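(* Let $(M,g)$ be a simply-connected Riemannian symmetric space (of finite or infinite dimension) and let $p$ be a point of $M$. If $M$ has fixed-sign curvature operator (i.e. its curvature operator is nonpositive or is nonnegative), then there exists a real L$^*$-algebra $L$ with an orthogonal decomposition of Hilbert spaces $L=\mathfrak{k}\oplus\mathfrak{p}$ such that: (i) the subspace $\mathfrak{k}$ is an L$^*$-subalgebra of $L$ and $\mathfrak{p}$ is isometric to the tangent space $T_pM$; (ii) the Lie algebra generated by $\mathfrak{p}$ is dense in $L$ and is isomorphic to a subalgebra of the Lie algebra of Killing fields on $M$.
   Context: Conventions. A Riemannian manifold is a connected smooth manifold modeled on a real Hilbert space (of finite or infinite dimension) endowed with a smooth Riemannian metric $g$. A Riemannian symmetric space is a Riemannian manifold such that for each point $p\in M$ there is an (involutive) isometry $\sigma_p$ of $M$ with $\sigma_p(p)=p$ and $d_p\sigma_p=-\mathrm{Id}$. A Killing field is a smooth vector field whose flow consists of isometries. Curvature operator. $R$ is the Riemann 4-tensor with the sign convention that the sectional curvature of orthonormal $u,v$ is $-R(u,v,u,v)$. Fix $p\in M$ (the isometry group is transitive, so the choice is irrelevant). On the algebraic exterior square $\wedge^2 T_pM$, identified with the finite rank skew-symmetric operators via $X\wedge Y\colon Z\mapsto g(X,Z)Y-g(Y,Z)X$, put $\langle A,B\rangle_g=\mathrm{trace}({}^tAB)$ for $A$ a bounded operator on $T_pM$ and $B\in\wedge^2T_pM$. The curvature operator is the linear map $C\colon\wedge^2T_pM\to \mathrm{L}(T_pM)$ (bounded operators), with values in skew-symmetric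 operators, such that $\langle C(X\wedge Y),Z\wedge T\rangle_g=-R(X,Y,Z,T)$. It is nonpositive (resp. nonnegative) if $\langle C(U),U\rangle_g\le 0$ (resp. $\ge0$) for all $U\in\wedge^2T_pM$; that is, $\sum_{i,j=1}^nR(X_i,Y_i,X_j,Y_j)\ge0$ (resp. $\le 0$) for all finite families $(X_i),(Y_i)$ in $T_pM$. L$^*$-algebras. An L$^*$-algebra is a (real or complex) Lie algebra $L$ with a structure of Hilbert space such that there is a map $x\mapsto x^*$ of $L$ to itself with $\langle[x,y],z\rangle=\langle y,[x^*,z]\rangle$ for all $x,y,z\in L$. An L$^*$-subalgebra is a closed, $*$-invariant Lie subalgebra. *)

(* Defs.v *)
From HB Require Import structures.
From mathcomp Require Import all_boot all_order all_algebra sesquilinear.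
From mathcomp Require Import all_classical all_reals all_analysis.

Set Implicit Arguments.
Unset Strict Implicit.
Unset Printing Implicit Defensive.

Import Order.TTheory GRing.Theory Num.Theory.
Import numFieldNormedType.Exports.

Local Open Scope classical_set_scope.
Local Open Scope ring_scope.

Record hilbertSpace (R : realType) := HilbertSpace {
  hilbert_sort :> completeNormedModType R;
  ip : {dot hilbert_sort for idfun};
  ip_norm : forall x : hilbert_sort, ip x x = `|x| ^+ 2
}.

Definition subspace_set (R : realType) (V : lmodType R) (A : set V) : Prop :=
  A 0 /\ forall (a : R) (x y : V), A x -> A y -> A (a *: x + y).

(* [class_C n U f] for all [n]: [f] and all its iterated tangent maps
   [(x, v) |-> df_x v], etc., are Frechet differentiable on the open set [U].
   On Banach spaces this is the same as being of class C^oo for the operator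
   norms; it avoids norms on spaces of multilinear maps. *)
Fixpoint class_C (R : realType) (n : nat) (E F : normedModType R)
    (U : set E) (f : E -> F) {struct n} : Prop :=
  if n is m.+1 then
    (forall x, U x -> differentiable f x) /\
    @class_C R m (E * E)%type F (U `*` setT) (fun z : E * E => 'd f (z.1) (z.2))
  else forall x, U x -> {for x, continuous f}.

Definition smooth_on (R : realType) (E F : normedModType R)
  (U : set E) (f : E -> F) : Prop := forall n, class_C n U f.

Record chart (R : realType) (H : hilbertSpace R) (M : topologicalType) := Chart {
  dom : set M;
  coord : M -> H;
  param : H -> M;
  dom_open : open dom;
  codom_open : open (coord @` dom);
  coord_continuous : forall q, dom q -> {for q, continuous coord};
  param_continuous : forall x, (coord @` dom) x -> {for x, continuous param};
  coordK : forall q, dom q -> param (coord q) = q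
}.

(* The atlas is indexed by the points of the manifold, [chart_at q] being a
   chart around [q]; every smooth structure has such an atlas.  The chart
   [chart_at q] is used to identify the tangent space at [q] with [H]: in all
   that follows, a vector of [H] "at q" stands for the tangent vector at [q]
   with these coordinates in [chart_at q]. *)
Record manifold (R : realType) (H : hilbertSpace R) := Manifold {
  manifold_sort :> topologicalType;
  chart_at : manifold_sort -> chart H manifold_sort;
  mem_chart_at : forall q, dom (chart_at q) q;
  transition_smooth : forall q r,
    smooth_on (coord (chart_at q) @` (dom (chart_at q) `&` dom (chart_at r)))
      (coord (chart_at r) \o param (chart_at q));
  manifold_hausdorff : hausdorff_space manifold_sort;
  manifold_connected : connected [set: manifold_sort]
}.

Section Manifolds.
Variables (R : realType) (H : hilbertSpace R) (M : manifold H).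
Implicit Types (p q r : M) (x : H).

Definition domain q : set M := dom (chart_at q).
Definition codomain q : set H := coord (chart_at q) @` domain q.
Definition to_chart q : M -> H := coord (chart_at q).
Definition of_chart q : H -> M := param (chart_at q).

Definition smooth_map (f : M -> M) : Prop :=
  continuous f /\
  forall q r, smooth_on (to_chart q @` (domain q `&` f @^-1` domain r))
                (to_chart r \o f \o of_chart q).

Definition tangent_map (f : M -> M) q : H -> H :=
  'd (to_chart (f q) \o f \o of_chart q) (to_chart q q).

(* From the coordinates of a tangent vector at [of_chart q x] in the chart
   attached to [q] to its coordinates in the chart attached to [of_chart q x]. *)
Definition tangent_of_chart q x : H -> H :=
  'd (to_chart (of_chart q x) \o of_chart q) x.

Definition tangent_to_chart q x : H -> H :=
  'd (to_chart q \o of_chart (of_chart q x))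
     (to_chart (of_chart q x) (of_chart q x)).

Definition vector_field := M -> H.

Definition field_in_chart (X : vector_field) q x : H :=
  tangent_to_chart q x (X (of_chart q x)).

Definition smooth_field (X : vector_field) : Prop :=
  forall q, smooth_on (codomain q) (field_in_chart X q).

Definition field_bracket (X Y : vector_field) : vector_field := fun q =>
  'd (field_in_chart Y q) (to_chart q q) (X q)
  - 'd (field_in_chart X q) (to_chart q q) (Y q).

(* The flow is global; [to_chart (Phi t q)] is the chart around [Phi t q] in which
   the tangent space at [Phi t q] is read. *)
Definition flow_of (X : vector_field) (Phi : R -> M -> M) : Prop :=
  [/\ Phi 0 = id,
      forall s t, Phi (s + t) = Phi s \o Phi t,
      forall q, continuous (Phi ^~ q : R^o -> M) &
      forall q (t : R^o),
        is_derive t 1 (fun s : R^o => to_chart (Phi t q) (Phi s q) : H)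
          (X (Phi t q))].

Definition form_in_chart (g : M -> {dot H for idfun}) q x (u v : H) : R :=
  g (of_chart q x) (tangent_of_chart q x u) (tangent_of_chart q x v).

(* [metric_strong]: each tangent space is a Hilbert space for the metric, which
   induces the topology of the manifold. *)
Record metric := Metric {
  metric_form :> M -> {dot H for idfun};
  metric_smooth : forall q,
    smooth_on (codomain q `*` (setT `*` setT))
      (fun z : H * (H * H) =>
         form_in_chart metric_form q z.1 z.2.1 z.2.2 : R^o);
  metric_strong : forall q, exists c C : R, 0 < c /\
    forall v : H, c * `|v| ^+ 2 <= metric_form q v v <= C * `|v| ^+ 2
}.

Variable g : metric.

Definition isometry (f : M -> M) : Prop :=
  (exists f' : M -> M,
     [/\ cancel f f', cancel f' f, smooth_map f & smooth_map f']) /\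
  forall q (u v : H), g (f q) (tangent_map f q u) (tangent_map f q v) = g q u v.

Definition symmetric_space : Prop :=
  forall q, exists s : M -> M,
    [/\ isometry s, involutive s, s q = q & forall v, tangent_map s q v = - v].

Definition killing_field (X : vector_field) : Prop :=
  smooth_field X /\
  exists2 Phi, flow_of X Phi & forall t, isometry (Phi t).

(* Coordinate expression, in the chart attached to [q], of the Levi-Civita
   connection on constant vector fields. *)
Definition christoffel q x (u v : H) : H :=
  xget 0 [set z : H | forall w : H,
    2 * form_in_chart g q x z w =
      'D_u (fun y => form_in_chart g q y v w : R^o) x
      + 'D_v (fun y => form_in_chart g q y u w : R^o) x
      - 'D_w (fun y => form_in_chart g q y u v : R^o) x].

(* [curvature q u v w] is R(u, v) w, with
   R(X, Y) = nabla_X nabla_Y - nabla_Y nabla_X - nabla_[X, Y]. *)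
Definition curvature q (u v w : H) : H :=
  let x := to_chart q q in
  'D_u (fun y => christoffel q y v w) x - 'D_v (fun y => christoffel q y u w) x
  + christoffel q x u (christoffel q x v w)
  - christoffel q x v (christoffel q x u w).

(* With this convention the sectional curvature of orthonormal [u], [v] is
   [- riemann q u v u v]. *)
Definition riemann q (X Y Z T : H) : R := g q (curvature q X Y Z) T.

Definition wedge q (X Y : H) : H -> H := fun Z => g q X Z *: Y - g q Y Z *: X.

Definition exterior_square q : set (H -> H) :=
  [set U | exists s : seq (H * H), U = \sum_(a <- s) wedge q a.1 a.2].

Definition bounded_operator (A : H -> H) : Prop := linear A /\ continuous A.

Definition skew_symmetric q (A : H -> H) : Prop :=
  forall u v, g q (A u) v = - g q u (A v).

Definition transpose q (A : H -> H) : H -> H :=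
  xget (fun=> 0) [set B : H -> H | forall u v, g q (A u) v = g q u (B v)].

(* Trace of a finite rank operator, written as a sum of operators
   [Z |-> <a, Z> b]. *)
Definition trace q (A : H -> H) : R :=
  xget 0 [set t : R | exists2 s : seq (H * H),
    A = (fun Z => \sum_(a <- s) g q a.1 Z *: a.2) &
    t = \sum_(a <- s) g q a.1 a.2].

Definition operator_pairing q (A B : H -> H) : R := trace q (transpose q A \o B).

Definition curvature_operator q (C : (H -> H) -> (H -> H)) : Prop :=
  [/\ forall (a : R) U V, exterior_square q U -> exterior_square q V ->
        C (a *: U + V) = a *: C U + C V,
      forall U, exterior_square q U ->
        bounded_operator (C U) /\ skew_symmetric q (C U) &
      forall X Y Z T : H,
        operator_pairing q (C (wedge q X Y)) (wedge q Z T) = - riemann q X Y Z T].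

Definition nonpositive_curvature_operator q : Prop :=
  exists2 C, curvature_operator q C &
    forall U, exterior_square q U -> operator_pairing q (C U) U <= 0.

Definition nonnegative_curvature_operator q : Prop :=
  exists2 C, curvature_operator q C &
    forall U, exterior_square q U -> 0 <= operator_pairing q (C U) U.

Definition fixed_sign_curvature_operator q : Prop :=
  nonpositive_curvature_operator q \/ nonnegative_curvature_operator q.

End Manifolds.

(* [h (s, t)]: [s] is the path parameter and [t] the homotopy parameter. *)
Definition simply_connected (R : realType) (T : topologicalType) : Prop :=
  (forall a b : T, exists c : R -> T,
     [/\ {within `[0, 1], continuous c}, c 0 = a & c 1 = b]) /\
  (forall c : R -> T, {within `[0, 1], continuous c} -> c 0 = c 1 ->
     exists h : R * R -> T,
       {within `[0, 1] `*` `[0, 1], continuous h} /\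
       forall t : R, 0 <= t <= 1 ->
         [/\ h (t, 0) = c t, h (t, 1) = c 0, h (0, t) = c 0 & h (1, t) = c 0]).

Record LstarAlgebra (R : realType) := LstarAlgebraPack {
  Lstar_space :> hilbertSpace R;
  bracket : {bilinear Lstar_space -> Lstar_space -> Lstar_space};
  bracketxx : forall x : Lstar_space, bracket x x = 0;
  jacobi : forall x y z : Lstar_space,
    bracket x (bracket y z) + bracket y (bracket z x)
    + bracket z (bracket x y) = 0;
  star : Lstar_space -> Lstar_space;
  bracket_star : forall x y z : Lstar_space,
    ip Lstar_space (bracket x y) z = ip Lstar_space y (bracket (star x) z)
}.

Section Lstar.
Variables (R : realType) (L : LstarAlgebra R).

Definition lie_subalgebra (A : set L) : Prop :=
  subspace_set A /\ forall x y, A x -> A y -> A (bracket L x y).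

Definition Lstar_subalgebra (A : set L) : Prop :=
  [/\ lie_subalgebra A, closed A & forall x, A x -> A (star x)].

Definition lie_generated (S : set L) : set L :=
  [set x | forall A, lie_subalgebra A -> S `<=` A -> A x].

Definition orthogonal_decomposition (A B : set L) : Prop :=
  [/\ subspace_set A /\ closed A, subspace_set B /\ closed B,
      forall x y, A x -> B y -> ip L x y = 0 &
      forall z, exists x y, [/\ A x, B y & z = x + y]].

Definition isometric_to_tangent (H : hilbertSpace R) (M : manifold H)
    (g : metric M) (q : M) (A : set L) : Prop :=
  exists J : L -> H,
    [/\ forall (a : R) x y, A x -> A y -> J (a *: x + y) = a *: J x + J y,
        forall x y, A x -> A y -> g q (J x) (J y) = ip L x y &
        J @` A = setT].

Definition isomorphic_to_killing_subalgebra (H : hilbertSpace R)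
    (M : manifold H) (g : metric M) (A : set L) : Prop :=
  exists phi : L -> vector_field M,
    [/\ forall (a : R) x y, A x -> A y ->
          phi (a *: x + y) = a *: phi x + phi y,
        forall x y, A x -> A y ->
          phi (bracket L x y) = field_bracket (phi x) (phi y),
        forall x y, A x -> A y -> phi x = phi y -> x = y &
        forall x, A x -> killing_field g (phi x)].

End Lstar.

(* Main.v *)
(* The symmetries of [M] give, for each [v] in [T_pM], a Killing field (a
   transvection) with value [v] and zero covariant derivative at [p].  A Killing
   field is determined by its value and its derivative at [p], and Killing fields
   form a Lie algebra: brackets of transvections realise the operators [R(u, v)],
   which gives the algebraic identities satisfied by the curvature of a symmetric
   space.  Let [s] be the sign of the curvature operator.  Then
   [s <R(u, v) w, z>] is a nonnegative form on [wedge^2 T_pM], and [k] is the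
   completion of the span of the [R(u, v)] for the norm it induces, made of
   operators [A] on [T_pM] such that [s <A u, v>] is bounded for this form.  Such
   operators are bounded skew derivations of [R], their commutators are again in
   [k], and [k + T_pM] with the bracket
   [(A, u), (B, v) |-> (AB - BA - R(u, v), A v - B u)] is the required algebra. *)
Require Import Defs.
From HB Require Import structures.
From mathcomp Require Import all_boot all_order all_algebra sesquilinear.
From mathcomp Require Import all_classical all_reals all_analysis.
From mathcomp Require Import ring lra zify.
Set Implicit Arguments.
Unset Strict Implicit.
Unset Printing Implicit Defensive.
Import Order.TTheory GRing.Theory Num.Theory.
Import numFieldNormedType.Exports.
Local Open Scope classical_set_scope.
Local Open Scope ring_scope.

(** Three obstacles shape the proof. The symmetries are given one point at a time, with no
    regularity in the point; smoothness of [(x, a) |-> s_p s_x a] is recovered from the fact that an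
    isometry is determined along geodesics by its 1-jet, and only after that can this family be
    differentiated into transvections. In infinite dimension there is no local compactness, so
    completeness of Killing fields rests on their constant speed along orbits and on the
    transitivity of the isometry group, which make the existence time depend on the speed alone;
    continuation arguments run by real induction. Finally, the curvature norm on [wedge^2 T_pM] may
    be much smaller than any natural one, and the action of [A] on it has no evident bound. The
    bound comes from skewness: the squared norms of the iterates form a log-convex sequence, so a
    crude exponential growth rate already controls the very first iterate. Elements of
    [wedge^2 T_pM] are represented by lists of pairs and operators are tested against lists, so no
    quotient and no abstract completion is formed. *)

Inductive lexp (K : Type) : Type :=
| LZero | LVar of nat | LAdd of lexp K & lexp K | LOpp of lexp K
| LScale of K & lexp K.

Fixpoint leval (K : pzRingType) (V : lmodType K) (env : seq V) (e : lexp K) : V :=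
  match e with
  | LZero => 0
  | LVar i => env`_i
  | LAdd a b => leval env a + leval env b
  | LOpp a => - leval env a
  | LScale c a => c *: leval env a
  end.

Fixpoint lcoef (K : pzRingType) (e : lexp K) (i : nat) : K :=
  match e with
  | LZero => 0
  | LVar j => if j == i then 1 else 0
  | LAdd a b => lcoef a i + lcoef b i
  | LOpp a => - lcoef a i
  | LScale c a => c * lcoef a i
  end.

Lemma leval_coef (K : pzRingType) (V : lmodType K) (env : seq V) (e : lexp K) :
  leval env e = \sum_(i < size env) lcoef e i *: env`_i.
Proof.
elim: e => [|j|a IHa b IHb|a IHa|c a IHa] /=.
- by rewrite big1// => i _; rewrite scale0r.
- have [js|js] := ltnP j (size env).
    rewrite (bigD1 (Ordinal js))//= eqxx scale1r big1 ?addr0// => i ij.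
    by rewrite ifN ?scale0r// eq_sym; apply: contraNneq ij => ij; apply/eqP/val_inj.
  rewrite nth_default// big1// => i _.
  by rewrite ifN ?scale0r// gtn_eqF// (leq_trans (ltn_ord i)).
- rewrite IHa IHb -big_split; apply: eq_bigr => i _; exact/esym/scalerDl.
- by rewrite IHa -sumrN; apply: eq_bigr => i _; rewrite scaleNr.
- by rewrite IHa scaler_sumr; apply: eq_bigr => i _; rewrite scalerA.
Qed.

Fixpoint all_below (n : nat) (P : nat -> Prop) : Prop :=
  if n is m.+1 then P m /\ all_below m P else True.

(** Both sides of a module identity are normalised to their scalar coefficients on a common list of
    atoms. The tactic [vring] reifies the two sides over that list and leaves one scalar identity
    per atom to [ring]. *)
Lemma leval_eq (K : pzRingType) (V : lmodType K) (env : seq V) (a b : lexp K) :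
  all_below (size env) (fun i => lcoef a i = lcoef b i) -> leval env a = leval env b.
Proof.
move=> ab; rewrite !leval_coef; apply: eq_bigr => i _; congr (_ *: _).
have : forall n, all_below n (fun i => lcoef a i = lcoef b i) ->
    forall i, (i < n)%N -> lcoef a i = lcoef b i.
  elim=> // n IH [an /IH{}IH] j; rewrite ltnS leq_eqVlt => /orP[/eqP->//|]; exact: IH.
by move=> /(_ _ ab); apply.
Qed.

Ltac lmem x l :=
  lazymatch l with
  | nil => constr:(false)
  | cons ?y ?t => lazymatch constr:((x, y)) with (?z, ?z) => constr:(true) | _ => lmem x t end
  end.
Ltac lindex x l :=
  lazymatch l with
  | cons ?y ?t => lazymatch constr:((x, y)) with
      (?z, ?z) => constr:(O) | _ => let i := lindex x t in constr:(S i) end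
  end.
Ltac latoms V e l :=
  lazymatch e with
  | (?a + ?b)%R => let l := latoms V a l in latoms V b l
  | (- ?a)%R => latoms V a l
  | (?c *: ?a)%R => latoms V a l
  | @GRing.zero _ => l
  | _ => let b := lmem e l in
         lazymatch b with true => l | false => constr:(@cons V e l) end
  end.
Ltac lreify K e l :=
  lazymatch e with
  | (?a + ?b)%R => let a := lreify K a l in let b := lreify K b l in constr:(@LAdd K a b)
  | (- ?a)%R => let a := lreify K a l in constr:(@LOpp K a)
  | (?c *: ?a)%R => let a := lreify K a l in constr:(@LScale K c a)
  | @GRing.zero _ => constr:(@LZero K)
  | _ => let i := lindex e l in constr:(@LVar K i)
  end.
Ltac vring K :=
  lazymatch goal with
  | |- @eq ?V ?a ?b =>
    let l := latoms V a (@nil V) in let l := latoms V b l in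
    let ea := lreify (K : Type) a l in let eb := lreify (K : Type) b l in
    refine (@leval_eq K _ l ea eb _);
    cbn -[GRing.add GRing.opp GRing.mul GRing.one GRing.zero];
    repeat split; try ring
  end.

(** * Differential calculus on normed spaces *)

Section Calculus.
Variable R : realType.
Implicit Types E F G : normedModType R.

Lemma cont_eps E F (f : E -> F) x :
  {for x, continuous f} <->
  forall e, 0 < e -> exists2 d, 0 < d & forall h, `|h| < d -> `|f (x + h) - f x| < e.
Proof.
split=> [/cvgrPdist_lt fc e e0|fc].
  have [d d0 dP] := (nbhs_ballP _ _).1 (fc e e0); exists d => // h hd.
  by rewrite distrC; apply: dP; rewrite -ball_normE /= opprD addNKr normrN.
apply/cvgrPdist_lt => e /fc[d d0 dP]; apply/nbhs_ballP; exists d => // y.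
rewrite -ball_normE /= distrC => yd.
by have := dP _ yd; rewrite [x + _]addrC subrK distrC.
Qed.

Lemma diff_eps E F (f : E -> F) x : differentiable f x ->
  forall e, 0 < e -> exists2 d, 0 < d &
    forall h, `|h| < d -> `|f (x + h) - f x - 'd f x h| <= e * `|h|.
Proof.
move=> /diff_locallyP [_ /eqaddoP fo] e e0.
have /nbhs_ballP[d /= d0 dP] := fo _ e0.
exists d => // h hd; have := dP h; rewrite -ball_normE /= sub0r normrN => /(_ hd).
by rewrite !fctE /= opprD addrA [h + x]addrC.
Qed.

(** The candidate differential is a bare function with a proof of linearity and a bound, so that it
    may come from a differential equation, from an inverse or from a Riesz representation. *)
Lemma eps_diff E F (f : E -> F) x (A : E -> F) :
  linear A -> (exists C, forall h, `|A h| <= C * `|h|) ->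
  (forall e, 0 < e -> exists2 d, 0 < d &
    forall h, `|h| < d -> `|f (x + h) - f x - A h| <= e * `|h|) ->
  differentiable f x /\ 'd f x = A :> (E -> F).
Proof.
move=> linA [C AC] fA.
pose A' : {linear E -> F} := HB.pack A (GRing.isLinear.Build _ _ _ _ _ linA).
have cA : continuous A'.
  apply/linear_bounded_continuous/linear_boundedP; exists C; split=> [|r Cr y].
    exact: num_real.
  by apply: le_trans (AC y) _; rewrite ler_wpM2r// ltW.
have fo : f \o shift x = cst (f x) + A' +o_ 0 id.
  apply/eqaddoP => e e0; have [d d0 dP] := fA _ e0.
  apply/nbhs_ballP; exists d => // h; rewrite -ball_normE /= sub0r normrN => /dP.
  by rewrite !fctE /= opprD addrA [h + x]addrC.
have dfA := diff_unique cA fo.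
by split; [apply/diff_locallyP; rewrite dfA|rewrite dfA].
Qed.

Lemma eps_isdiff E F (f : E -> F) x (A : E -> F) :
  linear A -> (exists C, forall h, `|A h| <= C * `|h|) ->
  (forall e, 0 < e -> exists2 d, 0 < d &
    forall h, `|h| < d -> `|f (x + h) - f x - A h| <= e * `|h|) ->
  is_diff x f A.
Proof. by move=> lA cA /(eps_diff lA cA)[df dfE]; apply: DiffDef. Qed.

Lemma diff_near E F (f g : E -> F) x :
  (\forall y \near x, f y = g y) -> differentiable f x ->
  differentiable g x /\ 'd g x = 'd f x :> (E -> F).
Proof.
move=> /nbhs_ballP[d /= d0 fg] df.
apply: (@eps_diff _ _ g x ('d f x)).
- exact: linearP.
- have /linear_bounded_continuous/linear_boundedP[C [_ CP]] := diff_continuous df.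
  by exists (C + 1) => h; apply: CP; rewrite ltrDl.
- move=> e e0; have [d' d'0 dP] := diff_eps df e0.
  exists (Num.min d d') => [|h]; first by rewrite lt_min d0.
  rewrite lt_min => /andP[hd hd']; rewrite -(fg x) -?fg ?dP//; try exact: ballxx.
  by rewrite -ball_normE /= opprD addNKr normrN.
Qed.

Lemma open_near E (U : set E) x : open U -> U x -> \forall y \near x, U y.
Proof. by move=> oU Ux; apply: open_nbhs_nbhs. Qed.

Lemma diff_open E F (f g : E -> F) (U : set E) x : open U -> U x ->
  (forall y, U y -> f y = g y) -> differentiable f x ->
  differentiable g x /\ 'd g x = 'd f x :> (E -> F).
Proof.
by move=> oU Ux fg; apply: diff_near; apply: filterS (open_near oU Ux).
Qed.

Lemma diff_bounded E F (f : E -> F) x : differentiable f x ->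
  exists2 C, 0 < C & forall h, `|'d f x h| <= C * `|h|.
Proof.
move=> /diff_continuous/linear_bounded_continuous/linear_boundedP[C [_ CP]].
exists (`|C| + 1); first by rewrite ltr_wpDl.
by move=> h; apply: CP; rewrite (le_lt_trans (ler_norm _)) // ltrDl.
Qed.

Lemma bounded_linear_cont E F (f : {linear E -> F}) C :
  (forall h, `|f h| <= C * `|h|) -> continuous f.
Proof.
move=> AC; apply/linear_bounded_continuous/linear_boundedP; exists C; split.
  exact: num_real.
by move=> r Cr y; apply: le_trans (AC y) _; rewrite ler_wpM2r// ltW.
Qed.

Lemma openP E (U : set E) :
  open U <-> forall x, U x -> exists2 d, 0 < d & forall h, `|h| < d -> U (x + h).
Proof.
split=> [oU x Ux|Ud].
  have /nbhs_ballP[d /= d0 dU] := open_near oU Ux.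
  exists d => // h hd; apply: dU.
  by rewrite -ball_normE /= opprD addNKr normrN.
rewrite openE => x /Ud[d d0 dU]; apply/nbhs_ballP; exists d => // y.
by rewrite -ball_normE /= distrC => /dU; rewrite addrC subrK.
Qed.

Lemma pair_norm_lt E F (z : E * F) d : (`|z| < d) = (`|z.1| < d) && (`|z.2| < d).
Proof. by rewrite -gt_max. Qed.

Lemma pair_norm_le E F (z : E * F) d : (`|z| <= d) = (`|z.1| <= d) && (`|z.2| <= d).
Proof. by rewrite -ge_max. Qed.

Lemma norm_fst E F (z : E * F) : `|z.1| <= `|z|.
Proof. by have := lexx `|z|; rewrite pair_norm_le => /andP[]. Qed.

Lemma norm_snd E F (z : E * F) : `|z.2| <= `|z|.
Proof. by have := lexx `|z|; rewrite pair_norm_le => /andP[]. Qed.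

Lemma openM E F (U : set E) (V : set F) : open U -> open V -> open (U `*` V).
Proof.
move=> /openP oU /openP oV; apply/openP => -[x y] [/= /oU[d d0 dU] /oV[e e0 eV]].
exists (Num.min d e) => [|h]; first by rewrite lt_min d0.
rewrite lt_min !pair_norm_lt => /andP[/andP[h1 _] /andP[_ h2]].
by split; [exact: dU|exact: eV].
Qed.

Lemma openMT E F (U : set E) : open U -> open (U `*` setT : set (E * F)).
Proof. by move=> oU; apply: openM => //; exact: openT. Qed.

Lemma class_C_ext n : forall E F (U : set E) (f g : E -> F), open U ->
  (forall y, U y -> f y = g y) -> class_C n U f -> class_C n U g.
Proof.
elim: n => [|n IH] E F U f g oU fg /=.
  move=> cf x Ux; apply/cont_eps => e e0.
  have /nbhs_ballP[d /= d0 dU] := open_near oU Ux.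
  have [d' d'0 dP] := (cont_eps f x).1 (cf x Ux) _ e0.
  exists (Num.min d d') => [|h]; first by rewrite lt_min d0.
  rewrite lt_min => /andP[hd hd']; rewrite -(fg x)// -fg ?dP//.
  by apply: dU; rewrite -ball_normE /= opprD addNKr normrN.
move=> [df cf]; split=> [x Ux|]; first exact: (diff_open oU Ux fg (df x Ux)).1.
apply: IH cf; first exact: openMT.
by move=> [x v] [/= Ux _]; rewrite (diff_open oU Ux fg (df x Ux)).2.
Qed.

Lemma class_C_sub n : forall E F (U V : set E) (f : E -> F), V `<=` U ->
  class_C n U f -> class_C n V f.
Proof.
elim: n => [|n IH] E F U V f VU /=; first by move=> cf x /VU/cf.
move=> [df cf]; split=> [x /VU/df//|].
by apply: IH cf => -[x v] [/= /VU Ux _]; split.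
Qed.

Lemma class_C_local n : forall E F (U : set E) (f : E -> F),
  (forall x, U x -> exists V, [/\ open V, V x & class_C n V f]) -> class_C n U f.
Proof.
elim: n => [|n IH] E F U f /= cf; first by move=> x /cf[V [_ Vx]]; apply.
split=> [x /cf[V [_ Vx []]]|]; first by move=> + _; apply.
apply: IH => -[x v] [/= Ux _]; have [V [oV Vx [_ cV]]] := cf x Ux.
by exists (V `*` setT); split=> //; exact: openMT.
Qed.

Lemma class_C_pred n : forall E F (U : set E) (f : E -> F),
  class_C n.+1 U f -> class_C n U f.
Proof.
elim: n => [|n IH] E F U f [df cf] /=.
  by move=> x Ux; apply: differentiable_continuous; exact: df.
by split=> //; apply: IH.
Qed.

Lemma class_C_le n m E F (U : set E) (f : E -> F) : (m <= n)%N ->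
  class_C n U f -> class_C m U f.
Proof.
move=> /subnK <-; elim: (n - m)%N => // k IH; rewrite addSn.
by move=> /class_C_pred/IH.
Qed.

Lemma class_C_cont n E F (U : set E) (f : E -> F) x : class_C n U f -> U x ->
  {for x, continuous f}.
Proof. by move=> /(class_C_le (leq0n n)); apply. Qed.

(** The tangent map of a continuous linear [f] is [(x, v) |-> f v], again continuous and linear,
    which closes the induction. *)
Lemma class_C_linear n : forall E F (U : set E) (f : {linear E -> F}),
  continuous f -> class_C n U f.
Proof.
elim: n => [|n IH] E F U f cf /=; first by move=> x _; apply: cf.
split=> [x _|]; first exact: linear_differentiable.
have l2 : linear (fun z : E * E => f z.2) by move=> a x y; rewrite linearP.
pose f2 : {linear (E * E)%type -> F} :=
  HB.pack (fun z : E * E => f z.2) (GRing.isLinear.Build _ _ _ _ _ l2).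
have cf2 : continuous f2.
  by move=> z; apply: (@continuous_comp _ _ _ snd f); [exact: cvg_snd|exact: cf].
rewrite (_ : (fun z => _) = f2); first exact: IH.
by apply/funext => z; rewrite diff_lin.
Qed.

Lemma class_C_id n E (U : set E) : class_C n U id.
Proof.
apply: (@class_C_linear n E E U (idfun : {linear E -> E})).
by move=> x; exact: cvg_id.
Qed.

Lemma class_C_fst n E F (U : set (E * F)) : class_C n U fst.
Proof. by apply: (@class_C_linear n _ _ U fst) => z; exact: cvg_fst. Qed.

Lemma class_C_snd n E F (U : set (E * F)) : class_C n U snd.
Proof. by apply: (@class_C_linear n _ _ U snd) => z; exact: cvg_snd. Qed.

Lemma class_C_cst n : forall E F (U : set E) (c : F), class_C n U (fun=> c).
Proof.
elim: n => [|n IH] E F U c /=; first by move=> x _; exact: cst_continuous.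
split=> [x _|]; first exact: differentiable_cst.
rewrite (_ : (fun z => _) = fun=> 0); first exact: IH.
by apply/funext => z; rewrite (@diff_cst _ E F c).
Qed.

Lemma class_C_add n : forall E F (U : set E) (f g : E -> F), open U ->
  class_C n U f -> class_C n U g -> class_C n U (fun x => f x + g x).
Proof.
elim: n => [|n IH] E F U f g oU /=.
  by move=> cf cg x Ux; apply: cvgD; [exact: cf|exact: cg].
move=> [df cf] [dg cg]; split=> [x Ux|].
  by apply: differentiableD; [exact: df|exact: dg].
have oU' : open (U `*` setT : set (E * E)) by exact: openMT.
apply: class_C_ext (IH _ _ _ _ _ oU' cf cg) => // z [/= Uz _].
by rewrite (@diffD _ _ _ f g)//; [exact: df|exact: dg].
Qed.

Lemma class_C_pair n : forall E F G (U : set E) (f : E -> F) (g : E -> G), open U ->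
  class_C n U f -> class_C n U g -> class_C n U (fun x => (f x, g x)).
Proof.
elim: n => [|n IH] E F G U f g oU /=.
  by move=> cf cg x Ux; apply: cvg_pair; [exact: cf|exact: cg].
move=> [df cf] [dg cg]; split=> [x Ux|].
  by apply: differentiable_pair; [exact: df|exact: dg].
have oU' : open (U `*` setT : set (E * E)) by exact: openMT.
apply: class_C_ext (IH _ _ _ _ _ _ oU' cf cg) => // z [/= Uz _].
by rewrite (@diff_pair _ _ _ _ f g)//; [exact: df|exact: dg].
Qed.

Lemma class_CS n E F (U : set E) (f : E -> F) : class_C n.+1 U f ->
  (forall x, U x -> differentiable f x) /\
  class_C n (U `*` setT) (fun z : E * E => 'd f (z.1) (z.2)).
Proof. by []. Qed.

(** The tangent map of [g \o f] is the tangent map of [g] after [(x, v) |-> (f x, df_x v)]: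
    functoriality of the tangent takes the place of a formula for higher derivatives of a
    composite. *)
Lemma class_C_comp n : forall E F G (U : set E) (V : set F) (f : E -> F) (g : F -> G),
  open U -> (forall x, U x -> V (f x)) ->
  class_C n U f -> class_C n V g -> class_C n U (fun x => g (f x)).
Proof.
elim: n => [|n IH] E F G U V f g oU UV.
  by move=> cf cg x Ux; apply: (@continuous_comp _ _ _ f g); [exact: cf|exact/cg/UV].
move=> cf1 cg1; have [df cf] := class_CS cf1; have [dg cg] := class_CS cg1; split=> [x Ux|].
  by apply: (@differentiable_comp _ _ _ _ f g); [exact: df|exact/dg/UV].
have oU' : open (U `*` setT : set (E * E)) by exact: openMT.
have cpair : class_C n (U `*` setT : set (E * E)) (fun z : E * E => (f z.1, 'd f (z.1) (z.2))).
  apply: class_C_pair => //.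
  apply: (IH _ _ _ _ U fst f) => //; first by move=> z [].
    exact: class_C_fst.
  exact: class_C_pred.
apply: class_C_ext (IH _ _ _ _ (V `*` setT) _ _ oU' _ cpair cg) => //.
  move=> z [/= Uz _].
  by rewrite (@diff_comp _ _ _ _ f g)//; [exact: df|exact/dg/UV].
by move=> z [/= Uz _]; split=> //; exact: UV.
Qed.

Lemma class_C_clinear n E F G (U : set E) (f : E -> F) (l : {linear F -> G}) :
  open U -> continuous l -> class_C n U f -> class_C n U (fun x => l (f x)).
Proof.
move=> oU cl cf; apply: (@class_C_comp n _ _ _ U setT f l) => //.
exact: class_C_linear.
Qed.

Lemma class_C_scale n E F (U : set E) (f : E -> F) (c : R) :
  open U -> class_C n U f -> class_C n U (fun x => c *: f x).
Proof.
move=> oU cf; apply: (@class_C_clinear n _ _ _ U f (c \*: idfun)) => //.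
apply: (@bounded_linear_cont _ _ _ `|c|) => h /=.
by rewrite normrZ.
Qed.

Lemma class_C_opp n E F (U : set E) (f : E -> F) :
  open U -> class_C n U f -> class_C n U (fun x => - f x).
Proof.
move=> oU /(class_C_scale (-1) oU).
by apply: class_C_ext => // y _; rewrite scaleN1r.
Qed.

Lemma class_C_sub_ n E F (U : set E) (f g : E -> F) : open U ->
  class_C n U f -> class_C n U g -> class_C n U (fun x => f x - g x).
Proof. by move=> oU cf cg; apply: class_C_add => //; exact: class_C_opp. Qed.

Definition real_step (P : R -> Prop) (a b t : R) :=
  (forall s, a <= s <= t -> P s) -> exists2 d, 0 < d & forall s, t < s < t + d -> s <= b -> P s.

(** At the supremum [m] of the times up to which [P] holds, the limit hypothesis gives [P m], and
    the step hypothesis would go beyond [m] if [m < b]. The mean value inequality, Gronwall's lemma,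
    smoothness of flows, transport of geodesics and continuation of integral curves are all
    instances. *)
Lemma real_ind (P : R -> Prop) (a b : R) : P a ->
  (forall t, a <= t < b -> real_step P a b t) ->
  (forall t, a < t <= b -> (forall s, a <= s < t -> P s) -> P t) ->
  forall t, a <= t <= b -> P t.
Proof.
move=> Pa Pstep Plim t0 /andP[at0 t0b].
pose S := [set t | a <= t <= b /\ forall s, a <= s <= t -> P s].
have Sa : S a.
  split; first by rewrite lexx (le_trans at0).
  by move=> s; rewrite -eq_le => /eqP <-.
have hS : has_sup S.
  by split; [exists a|exists b => x [/andP[]]].
pose m := sup S.
have am : a <= m by apply: ub_le_sup => //; case: hS.
have mb : m <= b by apply: ge_sup => [|x [/andP[]]//]; exists a.
have below s : a <= s < m -> P s.
  move=> /andP[as_ sm]; have [x [_ Px] sx] := sup_gt (proj1 hS) sm.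
  by apply: Px; rewrite as_ ltW.
have Pm : P m.
  have [->//|] := eqVneq m a; rewrite neq_lt ltNge am/= => am'.
  by apply: Plim => //; rewrite am' mb.
have Sm s : a <= s <= m -> P s.
  move=> /andP[as_]; rewrite le_eqVlt => /orP[/eqP->//|sm].
  by apply: below; rewrite as_.
have [t0m|mt0] := leP t0 m; first by apply: Sm; rewrite at0.
have mb' : m < b by exact: lt_le_trans mt0 t0b.
have [|d d0 dP] := Pstep m _ Sm; first by rewrite am.
pose s := Num.min b (m + d / 2).
have ms : m < s by rewrite lt_min mb' ltrDl divr_gt0.
have : S s.
  split; first by rewrite (le_trans am (ltW ms)) ge_min lexx.
  move=> r /andP[ar rs]; have [rm|mr] := leP r m; first by apply: Sm; rewrite ar.
  apply: dP; last by apply: (le_trans rs); rewrite ge_min lexx.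
  rewrite mr (le_lt_trans rs)// gt_min; apply/orP; right.
  by rewrite ltrD2l ltr_pdivrMr// ltr_pMr// ltr1n.
by move=> /(ub_le_sup (proj2 hS)); rewrite leNgt ms.
Qed.

Lemma derive_eps E (c : R -> E) t v :
  is_derive (t : R^o) 1 (c : R^o -> E) v <->
  forall e, 0 < e -> exists2 d, 0 < d &
    forall h, `|h| < d -> `|c (t + h) - c t - h *: v| <= e * `|h|.
Proof.
split=> [[cd <-]|cv].
  have /derivable1_diffP cdiff := cd.
  move=> e /(diff_eps cdiff)[d d0 dP]; exists d => // h /dP.
  by rewrite -deriveE // -[h in 'D_h _ _]mulr1 (deriveE (h * 1) cdiff) linearZ /= -deriveE.
have linA : linear (fun h : R^o => h *: v).
  by move=> a x y; rewrite scalerDl scalerA.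
have bndA : exists C, forall h : R^o, `|h *: v| <= C * `|h|.
  by exists `|v| => h; rewrite normrZ mulrC.
have [df dfE] := eps_diff linA bndA cv.
apply: DeriveDef; first exact/derivable1_diffP/df.
by rewrite deriveE// dfE scale1r.
Qed.

Lemma derive_cont E (c : R -> E) (t : R) v :
  is_derive (t : R^o) 1 (c : R^o -> E) v ->
  forall e, 0 < e -> exists2 d, 0 < d & forall s, `|s - t| < d -> `|c s - c t| < e.
Proof.
move=> [/derivable1_diffP/differentiable_continuous/cont_eps cc _] e /cc[d d0 dP].
by exists d => // s /dP; rewrite [t + _]addrC subrK.
Qed.

Lemma derive_comp E F (f : E -> F) (c : R -> E) t v :
  is_derive (t : R^o) 1 (c : R^o -> E) v -> differentiable f (c t) ->
  is_derive (t : R^o) 1 (f \o c : R^o -> F) ('d f (c t) v).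
Proof.
move=> [cd <-] df; have /derivable1_diffP cdiff := cd.
have fcd : differentiable (f \o (c : R^o -> E)) (t : R^o) by exact: differentiable_comp.
apply: DeriveDef; first exact/derivable1_diffP.
by rewrite (deriveE _ fcd) (deriveE _ cdiff) diff_comp.
Qed.

(** Real induction on the inequality with slope [M + e]: the slack [e] absorbs the differentiability
    error at each time. No integral and no linear functional is involved, so any normed space is
    allowed as target. *)
Lemma mean_value_right E (c : R -> E) (c' : R -> E) (a b M : R) : a <= b ->
  (forall t, a <= t <= b -> is_derive (t : R^o) 1 (c : R^o -> E) (c' t)) ->
  (forall t, a <= t <= b -> `|c' t| <= M) -> `|c b - c a| <= M * (b - a).
Proof.
move=> ab dc cM; apply/ler_addgt0Pr => e0 e00.
(* The slack accumulated over [[a, b]] is [e (b - a) <= e0]; the added 1 covers [a = b]. *)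
pose e := e0 / (b - a + 1).
have e_gt0 : 0 < e by rewrite divr_gt0// ltr_wpDl// subr_ge0.
suff: forall t, a <= t <= b -> `|c t - c a| <= (M + e) * (t - a).
  move=> /(_ b); rewrite ab lexx => /(_ isT) /le_trans; apply.
  rewrite mulrDl lerD2l /e mulrAC ler_pdivrMr; last by rewrite ltr_wpDl// subr_ge0.
  by rewrite ler_pM2l// lerDl.
apply: real_ind; first by rewrite !subrr normr0 mulr0.
- move=> t /andP[at_ tb] Pt.
  have [|d d0 dP] := (derive_eps c t (c' t)).1 _ e e_gt0.
    by apply: dc; rewrite at_ ltW.
  exists d => // s /andP[ts sd] sb; have {}dP := dP (s - t).
  rewrite (_ : c s - c a = (c t - c a) + ((c s - c t - (s - t) *: c' t) + (s - t) *: c' t));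
    last by vring R.
  have st0 : 0 <= s - t by rewrite subr_ge0 ltW.
  have -> : (M + e) * (s - a) = (M + e) * (t - a) + (e * (s - t) + (s - t) * M) by ring.
  apply: le_trans (ler_normD _ _) _; apply: lerD; first by apply: Pt; rewrite at_ lexx.
  apply: le_trans (ler_normD _ _) _; apply: lerD.
    move: dP; rewrite [t + _]addrC subrK ger0_norm//; apply.
    by rewrite ltrBlDl.
  by rewrite normrZ ger0_norm// ler_wpM2l// cM// at_ ltW.
- move=> t /andP[at_ tb] Pt.
  apply/ler_addgt0Pr => e1 e10.
  have [|d d0 dP] := @derive_cont _ c t (c' t) _ e1 e10.
    by apply: dc; rewrite ltW.
  pose s := Num.max a (t - d / 2).
  have st : s < t by rewrite gt_max at_ ltrBlDr ltrDl divr_gt0.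
  have as_ : a <= s by rewrite le_max lexx.
  have tsd : `|s - t| < d.
    rewrite distrC ger0_norm ?subr_ge0 ?(ltW st)// ltrBlDl -ltrBlDr lt_max; apply/orP; right.
    by rewrite ltrD2l ltrN2 ltr_pdivrMr// ltr_pMr// ltr1n.
  rewrite (_ : c t - c a = (c s - c a) + (c t - c s)); last by vring R.
  apply: le_trans (ler_normD _ _) _; apply: lerD; last by rewrite distrC ltW// dP.
  apply: le_trans (Pt s _) _; first by rewrite as_.
  rewrite ler_wpM2l ?lerB ?(ltW st)// addr_ge0 ?(ltW e_gt0)//.
  by apply: le_trans (cM a _); rewrite ?lexx ?ab.
Qed.

(* Convexity of balls makes the segment argument available. *)
Lemma mean_value_ball E F (f : E -> F) (x0 : E) (r M : R) x y :
  (forall z, `|z - x0| < r -> differentiable f z) ->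
  (forall z v, `|z - x0| < r -> `|'d f z v| <= M * `|v|) ->
  `|x - x0| < r -> `|y - x0| < r -> `|f y - f x| <= M * `|y - x|.
Proof.
move=> df dM xr yr.
pose c (t : R) : E := x + t *: (y - x).
have cr t : 0 <= t <= 1 -> `|c t - x0| < r.
  move=> /andP[t0 t1].
  rewrite (_ : c t - x0 = (1 - t) *: (x - x0) + t *: (y - x0)); last by rewrite /c; vring R.
  apply: le_lt_trans (ler_normD _ _) _; rewrite !normrZ !ger0_norm ?subr_ge0//.
  have [->|t0'] := eqVneq t 0; first by rewrite subr0 mul0r addr0 mul1r.
  have {}t0 : 0 < t by rewrite lt_neqAle eq_sym t0'.
  have -> : r = (1 - t) * r + t * r by ring.
  by apply: ler_ltD; [rewrite ler_wpM2l ?subr_ge0// ltW|rewrite ltr_pM2l].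
have dcv t : is_derive (t : R^o) 1 (c : R^o -> E) (y - x).
  apply/derive_eps => e e0; exists 1 => // h _.
  rewrite (_ : c (t + h) - c t - h *: (y - x) = 0).
    by rewrite normr0 mulr_ge0// ltW.
  by rewrite /c; vring R.
have := @mean_value_right _ (f \o c) (fun t => 'd f (c t) (y - x)) 0 1 (M * `|y - x|).
rewrite ler01 subr0 mulr1 /= => /(_ isT).
have -> : c 0 = x by rewrite /c scale0r addr0.
have -> : c 1 = y by rewrite /c scale1r addrC subrK.
apply.
  by move=> t /cr ct; apply: derive_comp => //; exact: df.
by move=> t /cr ct; exact: dM.
Qed.

Lemma dD E F (f : E -> F) x u v : 'd f x (u + v) = 'd f x u + 'd f x v.
Proof. exact: linearD. Qed.

Lemma dZ E F (f : E -> F) x a u : 'd f x (a *: u) = a *: 'd f x u.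
Proof. exact: linearZ. Qed.

Lemma d0 E F (f : E -> F) x : 'd f x 0 = 0.
Proof. exact: linear0. Qed.

Lemma dN E F (f : E -> F) x u : 'd f x (- u) = - 'd f x u.
Proof. exact: linearN. Qed.

Lemma dB E F (f : E -> F) x u v : 'd f x (u - v) = 'd f x u - 'd f x v.
Proof. exact: linearB. Qed.

Lemma is_derive_affine E (x u : E) (t : R) :
  is_derive (t : R^o) 1 (fun s : R^o => x + (s : R) *: u) u.
Proof.
apply/(@derive_eps _ (fun s : R => x + s *: u)) => e e0; exists 1 => // h _.
rewrite (_ : x + (t + h) *: u - (x + t *: u) - h *: u = 0).
  by rewrite normr0 mulr_ge0// ltW.
vring R.
Qed.

Lemma increment_difference E F (A : E -> F) (L : {linear E -> F}) x u w (s t k N : R) :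
  `|s *: w| <= N -> `|0 : E| <= N ->
  (forall v, `|v| <= N ->
     `|A (x + v + t *: u) - A x - L (t *: u + v)| <= k * `|t *: u + v|) ->
  `|A (x + s *: w + t *: u) - A (x + 0 + t *: u) - s *: L w| <=
    k * `|t *: u + s *: w| + k * `|t *: u + 0|.
Proof.
move=> sw zw b; apply: le_trans (lerD (b _ sw) (b _ zw)).
apply: le_trans (ler_normB _ _); rewrite addr0 [L (_ + _)]linearD [L (s *: _)]linearZ /=.
rewrite addr0.
set a1 := A _; set a2 := A _; set a3 := A _; set l1 := L _; set l2 := L _.
have -> // : a1 - a2 - s *: l1 = a1 - a3 - (l2 + s *: l1) - (a2 - a3 - l2).
by vring R.
Qed.

(** The difference of [f] along the parallel lines [x + s w + t u] and [x + t u], minus [t s D], has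
    a derivative in [t] of size [e s], read off the expansion of [y |-> df_y u] at the single point
    [x]. The mean value inequality on [[0, s]] then gives [e s^2]. *)
Lemma second_difference E F (f : E -> F) (U : set E) x u w : open U -> U x ->
  (forall y, U y -> differentiable f y) ->
  differentiable (fun y => 'd f y u) x ->
  forall e, 0 < e -> exists2 d, 0 < d & forall s : R, 0 < s < d ->
    `|f (x + s *: u + s *: w) - f (x + s *: u) - (f (x + s *: w) - f x)
      - (s * s) *: 'd (fun y => 'd f y u) x w| <= e * (s * s).
Proof.
(* For [0 <= t <= s] the two increments fed to the expansion, [t u + s w] and [t u], have total
   length at most [s N]. *)
move=> oU Ux df d2f e e0; pose N := 2 * `|u| + `|w| + 1.
have N0 : 0 < N by rewrite ltr_wpDl// addr_ge0// mulr_ge0.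
have eN : 0 < e / N by rewrite divr_gt0.
have [d d0 dP] := diff_eps d2f eN.
have [d' d'0 dU] := (openP U).1 oU x Ux.
exists (Num.min d d' / N) => [|s /andP[s0]]; first by rewrite divr_gt0// lt_min d0.
rewrite ltr_pdivlMr// => sN; set D := 'd _ x w.
have small t v : 0 <= t <= s -> `|v| <= s * `|w| -> `|t *: u + v| < Num.min d d'.
  move=> /andP[t0 ts] vw; apply: le_lt_trans sN; apply: le_trans (ler_normD _ _) _.
  rewrite normrZ ger0_norm// /N !mulrDr -addrA lerD//.
    by rewrite ler_pM// ler_peMl// ler1n.
  by rewrite ler_wpDr// mulr1 ltW.
have sw : `|s *: w| <= s * `|w| by rewrite normrZ gtr0_norm.
have zw : `|0 : E| <= s * `|w| by rewrite normr0 mulr_ge0// ltW.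
have dc t v : 0 <= t <= s -> `|v| <= s * `|w| ->
    is_derive (t : R^o) 1 (fun s : R^o => f (x + v + (s : R) *: u) : F) ('d f (x + v + t *: u) u).
  move=> ts vw; apply: (@derive_comp _ _ f (fun s : R => x + v + s *: u)).
    exact: is_derive_affine.
  apply: df; rewrite -addrA [v + _]addrC; apply: dU.
  by apply: lt_le_trans (small _ _ ts vw) _; rewrite ge_min lexx orbT.
pose c (t : R) := f (x + s *: w + t *: u) - f (x + 0 + t *: u) - t *: (s *: D).
pose c' (t : R) := 'd f (x + s *: w + t *: u) u - 'd f (x + 0 + t *: u) u - s *: D.
have cP t : 0 <= t <= s -> is_derive (t : R^o) 1 (c : R^o -> F) (c' t).
  move=> ts; have c1 := dc t _ ts sw; have c2 := dc t _ ts zw.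
  have c3 := is_derive_affine 0 (s *: D) t.
  have := @is_deriveB _ _ _ _ _ _ _ _ _ (@is_deriveB _ _ _ _ _ _ _ _ _ c1 c2) c3.
  rewrite (_ : _ - _ = c)//.
  by apply/funext => r; rewrite /c !fctE add0r.
have c'P t : 0 <= t <= s -> `|c' t| <= e * s.
  move=> ts; have /andP[t0 _] := ts.
  have b v : `|v| <= s * `|w| ->
      `|'d f (x + v + t *: u) u - 'd f x u - 'd (fun y => 'd f y u) x (t *: u + v)| <=
      e / N * `|t *: u + v|.
    move=> vw; have -> : x + v + t *: u = x + (t *: u + v) by vring R.
    apply: dP.
    by apply: lt_le_trans (small _ _ ts vw) _; rewrite ge_min lexx.
  apply: (le_trans (@increment_difference E F (fun y => 'd f y u)
    ('d (fun y => 'd f y u) x) x u w s t (e / N) (s * `|w|) sw zw b)).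
  rewrite addr0 -mulrDr mulrAC ler_pdivrMr// -mulrA ler_wpM2l ?(ltW e0)//.
  apply: le_trans (lerD (ler_normD _ _) (lexx _)) _; rewrite !normrZ !ger0_norm ?(ltW s0)//.
  have /andP[_ tss] := ts; rewrite /N.
  have tu : t * `|u| <= s * `|u| by rewrite ler_wpM2r.
  have := ltW s0; lra.
have := @mean_value_right _ c c' 0 s (e * s) (ltW s0) cP c'P.
rewrite subr0 -mulrA => /(le_trans _); apply.
rewrite /c !scale0r !addr0 subr0 [x + s *: w + _]addrAC.
set a1 := f _; set a2 := f _; set a3 := f _; set a4 := f _.
have -> // : a1 - a2 - (a3 - a4) - (s * s) *: D = a1 - a2 - s *: (s *: D) - (a3 - a4).
by vring R.
Qed.

(** The second difference is symmetric in [u] and [w]. Its two expansions at the same small [s]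
    leave [s^2 |D1 - D2| <= e s^2]. *)
Lemma schwarz E F (f : E -> F) (U : set E) x u w : open U -> U x ->
  (forall y, U y -> differentiable f y) ->
  differentiable (fun y => 'd f y u) x -> differentiable (fun y => 'd f y w) x ->
  'd (fun y => 'd f y u) x w = 'd (fun y => 'd f y w) x u.
Proof.
move=> oU Ux df du dw; apply/eqP; rewrite -subr_eq0 -normr_le0.
apply/ler_addgt0Pr => e e0; have e2 : 0 < e / 2 by rewrite divr_gt0.
have [d1 d10 P1] := second_difference w oU Ux df du e2.
have [d2 d20 P2] := second_difference u oU Ux df dw e2.
pose s := Num.min d1 d2 / 2.
have s0 : 0 < s by rewrite divr_gt0// lt_min d10.
have s1 : 0 < s < d1.
  by rewrite s0 ltr_pdivrMr// (@le_lt_trans _ _ d1) ?ge_min ?lexx// ltr_pMr// ltr1n.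
have s2 : 0 < s < d2.
  by rewrite s0 ltr_pdivrMr// (@le_lt_trans _ _ d2) ?ge_min ?lexx ?orbT// ltr_pMr// ltr1n.
clearbody s; move: (P1 s s1) (P2 s s2); rewrite [x + s *: w + _]addrAC.
set a1 := f _; set a2 := f _; set a3 := f _; set a4 := f _.
set D1 := 'd _ x w; set D2 := 'd _ x u => Q1 Q2.
have := lerD Q1 Q2; move/(le_trans (ler_normB _ _)).
have -> : a1 - a2 - (a3 - a4) - (s * s) *: D1 - (a1 - a3 - (a2 - a4) - (s * s) *: D2) =
  (s * s) *: - (D1 - D2) by vring R.
rewrite -mulrDl -splitr normrZ normrN ger0_norm ?mulr_ge0 ?(ltW s0)//.
by rewrite mulrC ler_pM2r ?mulr_gt0// => /le_trans; apply; rewrite ler_wpDl.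
Qed.

Lemma differentiable_id E (x : E) : differentiable (id : E -> E) x.
Proof. exact: (@ex_diff _ _ _ _ _ _ _ (is_diff_id x)). Qed.

Lemma diff_idE E (x h : E) : 'd (id : E -> E) x h = h.
Proof. by have [_ ->] := is_diff_id x. Qed.

Lemma diff_cstE E F (c : F) (x h : E) : 'd (fun=> c) x h = 0.
Proof. by rewrite (@diff_cst _ E F c). Qed.

Lemma class_C2_diff E F (f : E -> F) (U : set E) x v : open U -> U x ->
  class_C 2 U f -> differentiable (fun y => 'd f y v) x.
Proof.
move=> oU Ux [_ [+ _]] => /(_ (x, v)) df.
apply: (@differentiable_comp _ _ _ _ (fun y : E => (y, v))
          (fun z : E * E => 'd f (z.1) (z.2))); last exact: df.
by apply: differentiable_pair; [exact: differentiable_id|exact: differentiable_cst].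
Qed.

(* ['d ('d f) (x, v)] splits into the second derivative and [df_x]. *)
Lemma class_C2_tangent E F (f : E -> F) (U : set E) x v h k : open U -> U x ->
  class_C 2 U f ->
  'd (fun z : E * E => 'd f (z.1) (z.2)) (x, v) (h, k) =
  'd (fun y => 'd f y v) x h + 'd f x k.
Proof.
move=> oU Ux cf; have [_ [/(_ (x, v)) df _]] := cf.
set g := (fun z : E * E => 'd f (z.1) (z.2)).
have {df} dg : differentiable g (x, v) by exact: df.
have -> : (h, k) = (h, 0) + (0, k) by congr pair; rewrite ?addr0 ?add0r.
rewrite dD; congr (_ + _).
  have dp : differentiable (fun y : E => (y, v)) x.
    by apply: differentiable_pair; [exact: differentiable_id|exact: differentiable_cst].
  have := @diff_comp _ _ _ _ (fun y : E => (y, v)) g x dp dg.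
  move=> /(congr1 (fun l => l h)) /= ->; congr ('d g _ _).
  rewrite (@diff_pair _ _ _ _ id (fun=> v)); last 2 first.
  - exact: differentiable_id.
  - exact: differentiable_cst.
  by rewrite diff_idE diff_cstE.
have dp : differentiable (fun w : E => (x, w)) v.
  by apply: differentiable_pair; [exact: differentiable_cst|exact: differentiable_id].
have e1 : 'd (fun w : E => (x, w)) v k = (0, k).
  rewrite (@diff_pair _ _ _ _ (fun=> x) id); last 2 first.
  - exact: differentiable_cst.
  - exact: differentiable_id.
  by rewrite diff_idE diff_cstE.
have := @diff_comp _ _ _ _ (fun w : E => (x, w)) g v dp dg.
move=> /(congr1 (fun l => l k)) /=; rewrite e1 => <-.
have -> : g \o (fun w : E => (x, w)) = 'd f x by [].
by rewrite diff_lin//; apply: diff_continuous; have [+ _] := class_CS cf; apply.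
Qed.

Lemma schwarz2 E F (f : E -> F) (U : set E) x u w : open U -> U x ->
  class_C 2 U f ->
  'd (fun y => 'd f y u) x w = 'd (fun y => 'd f y w) x u.
Proof.
move=> oU Ux cf; apply: (schwarz oU Ux).
- by have [] := class_CS cf.
- exact: class_C2_diff cf.
- exact: class_C2_diff cf.
Qed.
End Calculus.

(** * Ordinary differential equations and flows *)

Section Flows.
Variable R : realType.
Implicit Types E F G : normedModType R.

(** Completeness tested on geometric sequences only. In this form it passes to the products [E * E]
    where tangent flows live, and its explicit rate is what the estimates consume. *)
Definition geo_complete E := forall (u : nat -> E) C,
  (forall n, `|u n.+1 - u n| <= C * 2^-1 ^+ n) ->
  exists l, forall n, `|u n - l| <= 2 * C * 2^-1 ^+ n.

Lemma le_of_eq (a b : R) : a = b -> a <= b.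
Proof. by move=> ->. Qed.

Lemma le_geo (a b K : R) : (forall n, a <= b + K * 2^-1 ^+ n) -> a <= b.
Proof.
move=> ab; apply/ler_addgt0Pr => e e0.
have K1 : 0 < `|K| + 1 by rewrite ltr_wpDl.
have [n nP] : exists n, (2^-1 : R) ^+ n < e / (`|K| + 1).
  have q1 : `|2^-1 : R| < 1 by rewrite ger0_norm ?invr_ge0// invf_lt1// ltr1n.
  have eK : 0 < e / (`|K| + 1) by rewrite divr_gt0.
  have /cvgrPdist_lt/(_ _ eK)[n _ /(_ n (leqnn n))] := cvg_geometric 1 q1.
  by rewrite sub0r normrN /= mul1r => nP; exists n; apply: le_lt_trans nP; exact: ler_norm.
apply: le_trans (ab n) _; rewrite lerD2l.
apply: le_trans (_ : (`|K| + 1) * 2^-1 ^+ n <= _).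
  by rewrite ler_wpM2r ?exprn_ge0// (le_trans (ler_norm _))// lerDl.
by rewrite mulrC -ler_pdivlMr// ltW.
Qed.

Lemma geo_le (E : normedModType R) (u : nat -> E) C :
  (forall n, `|u n.+1 - u n| <= C * 2^-1 ^+ n) ->
  forall n k, `|u n - u (n + k)%N| <= 2 * C * 2^-1 ^+ n.
Proof.
move=> uC n k.
have C0 : 0 <= C by have := uC 0%N; rewrite expr0 mulr1; exact: le_trans.
suff : `|u n - u (n + k)%N| <= 2 * C * (2^-1 ^+ n - 2^-1 ^+ (n + k)).
  move/le_trans; apply; rewrite ler_wpM2l ?mulr_ge0// lerBlDr lerDl.
  by rewrite exprn_ge0.
elim: k => [|k IH]; first by rewrite addn0 !subrr normr0 mulr0.
have -> : u n - u (n + k.+1)%N = (u n - u (n + k)%N) + (u (n + k)%N - u (n + k.+1)%N).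
  by vring R.
apply: le_trans (ler_normD _ _) _; apply: le_trans (lerD IH (_ : _ <= C * 2^-1 ^+ (n + k))) _.
  by rewrite distrC addnS.
rewrite addnS exprS; lra.
Qed.

Lemma complete_geo (E : completeNormedModType R) : geo_complete E.
Proof.
move=> u C uC; have uk := geo_le uC.
have : cvg (u @ \oo).
  apply: cauchy_cvg; apply: cauchy_exP => e e0.
  have [n nP] : exists n, 2 * C * 2^-1 ^+ n < e.
    apply: contrapT => /forallNP h; have : e <= 0; last by rewrite leNgt e0.
    by apply: (@le_geo _ _ (2 * C)) => n; rewrite add0r leNgt; exact/negP/h.
  exists (u n), n => // m /= nm; rewrite -ball_normE /=.
  by rewrite -(subnKC nm); exact: le_lt_trans nP.
move=> /cvg_ex[l /cvgrPdist_lt ul]; exists l => n.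
apply/ler_addgt0Pr => e /ul[N _ NP].
have := NP (maxn N n) (leq_maxl _ _) => /= h.
have -> : u n - l = (u n - u (maxn N n)) - (l - u (maxn N n)) by vring R.
apply: le_trans (ler_normB _ _) _; apply: lerD; last exact: ltW.
by rewrite -(subnKC (leq_maxr N n)).
Qed.

Lemma geo_complete_pair E F : geo_complete E -> geo_complete F ->
  geo_complete (E * F)%type.
Proof.
move=> cE cF u C uC.
have [|l1 P1] := cE (fun n => (u n).1) C.
  by move=> n; apply: le_trans (uC n); exact: (norm_fst (u n.+1 - u n)).
have [|l2 P2] := cF (fun n => (u n).2) C.
  by move=> n; apply: le_trans (uC n); exact: (norm_snd (u n.+1 - u n)).
by exists (l1, l2) => n; rewrite pair_norm_le P1 P2.
Qed.

(** * The Euler scheme on dyadic grids *)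

Section Euler.
Variables (E : normedModType R) (F : E -> E) (L M : R).
Hypotheses (cE : geo_complete E) (L0 : 0 <= L) (M0 : 0 <= M).
Hypotheses (FL : forall x y, `|F x - F y| <= L * `|x - y|) (FM : forall x, `|F x| <= M).

Definition euler_step (h : R) (x : E) := x + h *: F x.
Definition euler (h : R) (k : nat) (x : E) := iter k (euler_step h) x.

Lemma eulerD h k l x : euler h (k + l) x = euler h k (euler h l x).
Proof. exact: iterD. Qed.

Lemma euler_step_lip h x y : 0 <= h ->
  `|euler_step h x - euler_step h y| <= (1 + h * L) * `|x - y|.
Proof.
move=> h0; have -> : euler_step h x - euler_step h y = (x - y) + h *: (F x - F y).
  by rewrite /euler_step; vring R.
apply: le_trans (ler_normD _ _) _; rewrite mulrDl mul1r lerD2l normrZ ger0_norm//.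
by rewrite -mulrA ler_wpM2l.
Qed.

Lemma euler_near h k x : 0 <= h -> `|euler h k x - x| <= k%:R * h * M.
Proof.
move=> h0; elim: k => [|k IH]; first by rewrite subrr normr0 !mul0r.
rewrite /euler iterS -/(euler h k x) /euler_step.
rewrite addrAC; apply: le_trans (ler_normD _ _) _.
rewrite -natr1 !mulrDl mul1r lerD// normrZ ger0_norm// ler_wpM2l//.
Qed.

Lemma euler_tangent h k x : 0 <= h ->
  `|euler h k x - x - (k%:R * h) *: F x| <= (k%:R * h) ^+ 2 * (L * M).
Proof.
move=> h0; elim: k => [|k IH].
  by rewrite subrr !mul0r scale0r subr0 normr0 expr0n /= mul0r.
rewrite /euler iterS -/(euler h k x) {1}/euler_step.
set y := euler h k x in IH *.
have -> : y + h *: F y - x - (k.+1%:R * h) *: F x =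
    (y - x - (k%:R * h) *: F x) + h *: (F y - F x) by rewrite -natr1; vring R.
apply: le_trans (ler_normD _ _) _; apply: le_trans (lerD IH (_ : _ <= h * (L * (k%:R * h * M)))) _.
  rewrite normrZ ger0_norm// ler_wpM2l//; apply: le_trans (FL _ _) _.
  by rewrite ler_wpM2l// euler_near.
rewrite -natr1 -subr_ge0.
rewrite (_ : _ - _ = h ^+ 2 * (L * M) * (k%:R + 1)); last by ring.
by rewrite !mulr_ge0 ?exprn_ge0.
Qed.

(** From the same point, one step of size [h] and two of size [h / 2] differ by at most
    [h^2 L M / 4], and each further step amplifies a discrepancy by at most [1 + h L]. The bound is
    the sum of this geometric series. *)
Lemma euler_halving h k x : 0 <= h ->
  `|euler (h / 2) (k * 2) x - euler h k x| <= ((1 + h * L) ^+ k - 1) * (M * h / 4).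
Proof.
move=> h0; elim: k => [|k IH]; first by rewrite /= subrr normr0 expr0 subrr mul0r.
rewrite mulSn eulerD -[in euler h k.+1 x]add1n eulerD.
set y := euler (h / 2) _ x in IH *; set z := euler h k x in IH *.
rewrite -[euler h 1 z]/(euler_step h z).
have -> : euler (h / 2) 2 y - euler_step h z =
    (euler (h / 2) 2 y - euler_step h y) + (euler_step h y - euler_step h z) by vring R.
apply: le_trans (ler_normD _ _) _.
have h20 : 0 <= h / 2 by rewrite divr_ge0.
have e1 : `|euler (h / 2) 2 y - euler_step h y| <= h / 2 * (L * (h / 2 * M)).
  rewrite (_ : _ - _ = (h / 2) *: (F (y + (h / 2) *: F y) - F y)).
    rewrite normrZ ger0_norm// ler_wpM2l//; apply: le_trans (FL _ _) _.
    by rewrite ler_wpM2l// addrAC subrr add0r normrZ ger0_norm// ler_wpM2l.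
  rewrite /euler /= /euler_step; set a := F (_ + _); set b := F y.
  have -> : h *: b = (h / 2) *: b + (h / 2) *: b by rewrite -scalerDl -splitr.
  by vring R.
have e2 := euler_step_lip y z h0.
apply: le_trans (lerD e1 (le_trans e2 (ler_wpM2l _ IH))) _; first by rewrite addr_ge0 ?mulr_ge0.
by rewrite exprS; apply: le_of_eq; field.
Qed.

Definition euler_index (t : R) (n : nat) : nat := Num.truncn (t * 2 ^+ n).
Definition euler_approx (t : R) (x : E) (n : nat) : E :=
  euler (2^-1 ^+ n) (euler_index t n) x.

Lemma half_exp (n : nat) : (2 : R) ^+ n * 2^-1 ^+ n = 1.
Proof. by rewrite -exprMn divff// expr1n. Qed.

Lemma euler_indexP t n : 0 <= t ->
  (euler_index t n)%:R * 2^-1 ^+ n <= t < (euler_index t n)%:R * 2^-1 ^+ n + 2^-1 ^+ n.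
Proof.
move=> t0; have t20 : 0 <= t * 2 ^+ n by rewrite mulr_ge0// exprn_ge0.
have /andP[a b] := truncn_itv t20; rewrite -/(euler_index t n) in a b.
have h0 : 0 < (2^-1 : R) ^+ n by rewrite exprn_gt0// invr_gt0.
rewrite -(ler_pM2r h0) -mulrA half_exp mulr1 in a.
rewrite -(ltr_pM2r h0) -mulrA half_exp mulr1 -natr1 mulrDl mul1r in b.
by rewrite a.
Qed.

Lemma euler_index_le s t n : 0 <= s -> s <= t -> (euler_index s n <= euler_index t n)%N.
Proof. by move=> s0 st; rewrite le_truncn// ler_wpM2r// exprn_ge0. Qed.

Lemma euler_indexS t n : 0 <= t ->
  exists b : bool, euler_index t n.+1 = (b + euler_index t n * 2)%N.
Proof.
move=> t0; set k := euler_index t n; set m := euler_index t n.+1.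
have /andP[k1 k2] := euler_indexP n t0; have /andP[m1 m2] := euler_indexP n.+1 t0.
rewrite -/k -/m in k1 k2 m1 m2.
have h0 : 0 < (2^-1 : R) ^+ n by rewrite exprn_gt0// invr_gt0.
rewrite exprS in m1 m2; set h := 2^-1 ^+ n in k1 k2 m1 m2 h0.
have a : (m < k * 2 + 2)%N.
  rewrite -(ltr_nat R) natrD natrM.
  have : (m%:R * (2^-1 * h) : R) < (k%:R + 1) * h by rewrite mulrDl mul1r; exact: le_lt_trans m1 k2.
  by rewrite mulrA ltr_pM2r// => ?; lra.
have b : (k * 2 < m + 1)%N.
  rewrite -(ltr_nat R) natrD natrM.
  have : (k%:R * h : R) < (m%:R + 1) * (2^-1 * h) by rewrite mulrDl mul1r; exact: le_lt_trans k1 m2.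
  by rewrite mulrA ltr_pM2r// => ?; lra.
have [e|ne] := eqVneq m (k * 2)%N; first by exists false.
exists true; rewrite /= ; move: a b ne; clear; lia.
Qed.

Lemma euler_growth t n : 0 <= t ->
  (1 + 2^-1 ^+ n * L) ^+ euler_index t n <= expR (t * L).
Proof.
move=> t0; have /andP[k1 _] := euler_indexP n t0.
have h0 : 0 <= (2^-1 : R) ^+ n by rewrite exprn_ge0// invr_ge0.
apply: le_trans (_ : expR (2^-1 ^+ n * L) ^+ euler_index t n <= _).
  by rewrite lerXn2r ?nnegrE ?addr_ge0 ?mulr_ge0 ?expR_ge0 ?expR_ge1Dx.
by rewrite -expRM_natl ler_expR mulrA ler_wpM2r.
Qed.

(** The summand with [expR (t * L)] is the effect of halving the step, the amplification being
    bounded by [euler_growth]; the other one accounts for the possible extra half-step when [t]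
    falls in the right half of its dyadic interval. *)
Lemma euler_cauchy t x n : 0 <= t ->
  `|euler_approx t x n.+1 - euler_approx t x n| <= (M + expR (t * L) * M) * 2^-1 ^+ n.
Proof.
move=> t0; rewrite /euler_approx exprS mulrC; set h := 2^-1 ^+ n; set k := euler_index t n.
have h0 : 0 <= h by rewrite exprn_ge0// invr_ge0.
have h20 : 0 <= h / 2 by rewrite divr_ge0.
have [b ->] := euler_indexS n t0; rewrite -/k eulerD.
set y := euler (h / 2) (k * 2) x.
have -> : euler (h / 2) b y - euler h k x =
  (euler (h / 2) b y - y) + (y - euler h k x) by vring R.
apply: le_trans (ler_normD _ _) _; rewrite mulrDl; apply: lerD.
  apply: le_trans (euler_near _ _ h20) _; rewrite [leRHS]mulrC ler_wpM2r//.
  by case: (b) => /=; lra.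
apply: le_trans (euler_halving k x h0) _.
have Mh : 0 <= M * h by rewrite mulr_ge0.
have := euler_growth n t0; rewrite -/k -/h => g.
rewrite -[leRHS]mulrA; apply: ler_pM; rewrite ?divr_ge0//.
- by rewrite subr_ge0 exprn_ege1// lerDl mulr_ge0.
- by rewrite lerBlDr (le_trans g)// lerDl.
- by rewrite ler_pdivrMr// ler_peMr// ler1n.
Qed.

Definition euler_limit (t : R) (x : E) : E :=
  xget x [set l | forall n, `|euler_approx t x n - l| <=
    2 * (M + expR (t * L) * M) * 2^-1 ^+ n].

Lemma euler_limitP t x n : 0 <= t ->
  `|euler_approx t x n - euler_limit t x| <= 2 * (M + expR (t * L) * M) * 2^-1 ^+ n.
Proof.
move=> t0; have [l lP] := cE (fun n => euler_cauchy x n t0).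
by move: n; rewrite /euler_limit; case: xgetP => [y _ +|/(_ l)//]; exact.
Qed.

Lemma euler_limit0 x : euler_limit 0 x = x.
Proof.
apply/eqP; rewrite -subr_eq0 -normr_le0.
apply: (@le_geo _ _ (2 * (M + expR (0 * L) * M))) => n.
have := euler_limitP x n (lexx 0).
by rewrite /euler_approx /euler_index mul0r truncn0 /= distrC add0r.
Qed.

(** The polygon started near the limit at time [t] satisfies the estimate with [k h] in place of
    [s - t]. Every discretisation error is a constant times [2^-n], and [le_geo] removes them
    together. *)
Lemma euler_limit_tangent s t x : 0 <= t -> t <= s ->
  `|euler_limit s x - euler_limit t x - (s - t) *: F (euler_limit t x)| <=
  (s - t) ^+ 2 * (L * M).
Proof.
move=> t0 ts; have s0 := le_trans t0 ts.
pose Cs := 2 * (M + expR (s * L) * M); pose Ct := 2 * (M + expR (t * L) * M).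
have Cs0 : 0 <= Cs by rewrite mulr_ge0 ?addr_ge0 ?mulr_ge0 ?expR_ge0.
have Ct0 : 0 <= Ct by rewrite mulr_ge0 ?addr_ge0 ?mulr_ge0 ?expR_ge0.
apply: (@le_geo _ _ (Cs + Ct + M + (s - t) * L * Ct + (2 * (s - t) + 1) * (L * M))) => n.
have := euler_limitP x n s0; have := euler_limitP x n t0; rewrite -/Cs -/Ct.
rewrite /euler_approx; set h := 2^-1 ^+ n.
have h0 : 0 <= h by rewrite exprn_ge0// invr_ge0.
have h1 : h <= 1 by rewrite exprn_ile1// ?invr_ge0// invf_le1// ler1n.
have /andP[i1 i2] := euler_indexP n s0; have /andP[j1 j2] := euler_indexP n t0.
have ij := euler_index_le n t0 ts.
rewrite -(subnK ij) eulerD; rewrite -(subnK ij) natrD in i1 i2.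
set k := (_ - _)%N in i1 i2 *; set j := euler_index t n in i1 i2 j1 j2 *.
rewrite -/h in i1 i2 j1 j2.
set y := euler h j x; set z := euler h k y; move=> yP zP.
set a := euler_limit s x in zP *; set b := euler_limit t x in yP *.
have tz := euler_tangent k y h0; rewrite -/z in tz.
have kh1 : k%:R * h <= s - t + h by lra.
have kh2 : s - t - h <= k%:R * h by lra.
have kh0 : 0 <= k%:R * h by rewrite mulr_ge0.
have -> : a - b - (s - t) *: F b = (y - b) - (z - a) + (z - y - (k%:R * h) *: F y)
  + ((k%:R * h - (s - t)) *: F y + (s - t) *: (F y - F b)) by vring R.
apply: le_trans (ler_normD _ _) _.
apply: le_trans (lerD (le_trans (ler_normD _ _) (lerD (ler_normB _ _) (lexx _))) (ler_normD _ _)) _.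
rewrite !normrZ (ger0_norm (_ : 0 <= s - t)) ?subr_ge0//.
have n1 : `|k%:R * h - (s - t)| * `|F y| <= h * M.
  by apply: ler_pM => //; rewrite ler_norml; apply/andP; split; lra.
have n2 : (s - t) * `|F y - F b| <= (s - t) * (L * (Ct * h)).
  rewrite ler_wpM2l ?subr_ge0//; apply: le_trans (FL _ _) _.
  by rewrite ler_wpM2l.
have n3 : (k%:R * h) ^+ 2 * (L * M) <= ((s - t) ^+ 2 + (2 * (s - t) + 1) * h) * (L * M).
  rewrite ler_wpM2r ?mulr_ge0//.
  apply: le_trans (_ : (s - t + h) ^+ 2 <= _); first by rewrite lerXn2r ?nnegrE//; lra.
  have hh : h * h <= h by rewrite ler_piMl.
  by rewrite -subr_ge0 (_ : _ - _ = h - h * h) ?subr_ge0//; ring.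
apply: le_trans (lerD (lerD (lerD yP zP) (le_trans tz n3)) (lerD n1 n2)) _.
by apply: le_of_eq; ring.
Qed.

(** For [s < t] the forward estimate based at [s] is turned around: replacing [F] at the earlier
    point by [F] at the later one costs [L] times their distance, again a term of order
    [(s - t)^2]. *)
Lemma euler_limit_diff s t x : 0 <= t -> 0 <= s -> `|s - t| <= 1 ->
  `|euler_limit s x - euler_limit t x - (s - t) *: F (euler_limit t x)| <=
  (s - t) ^+ 2 * (2 * (L * M) + L * (L * M)).
Proof.
move=> t0 s0; have LM : 0 <= L * M by rewrite mulr_ge0.
have [ts _|st] := leP t s.
  apply: le_trans (euler_limit_tangent x t0 ts) _; rewrite ler_wpM2l ?sqr_ge0//.
  have : 0 <= L * (L * M) by rewrite mulr_ge0.
  lra.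
rewrite ltr0_norm ?subr_lt0// opprB => ts1; have {}st := ltW st.
have h := euler_limit_tangent x s0 st.
set a := euler_limit s x in h *; set b := euler_limit t x in h *.
have -> : a - b - (s - t) *: F b = (t - s) *: (F b - F a) - (b - a - (t - s) *: F a) by vring R.
apply: le_trans (ler_normB _ _) _.
apply: le_trans (lerD (_ : _ <= (t - s) * (L * ((t - s) * M + (t - s) * (L * M)))) h) _; last first.
  apply: le_of_eq; ring.
have ts0 : 0 <= t - s by rewrite subr_ge0.
rewrite normrZ ger0_norm// ler_wpM2l//; apply: le_trans (FL _ _) _; rewrite ler_wpM2l//.
have -> : b - a = (t - s) *: F a + (b - a - (t - s) *: F a) by vring R.
apply: le_trans (ler_normD _ _) _; apply: lerD.
  by rewrite normrZ ger0_norm// ler_wpM2l.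
apply: le_trans h _; rewrite expr2 -mulrA ler_wpM2l// ler_piMl//.
Qed.
End Euler.

Lemma sq_bound_derive E (c : R -> E) (t K r : R) v : 0 < r ->
  (forall s, `|s - t| < r -> `|c s - c t - (s - t) *: v| <= (s - t) ^+ 2 * K) ->
  is_derive (t : R^o) 1 (c : R^o -> E) v.
Proof.
move=> r0 cK; apply/derive_eps => e e0.
have K1 : 0 < `|K| + 1 by rewrite ltr_wpDl.
exists (Num.min r (e / (`|K| + 1))) => [|h].
  by rewrite lt_min r0 divr_gt0.
rewrite lt_min => /andP[h1 hK].
have := cK (t + h); rewrite [t + h - t]addrAC subrr add0r => /(_ h1)/le_trans; apply.
rewrite -[h ^+ 2]ger0_norm ?sqr_ge0// normrX expr2 mulrAC ler_wpM2r//.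
apply: le_trans (_ : `|h| * (`|K| + 1) <= _).
  by rewrite ler_wpM2l// (le_trans (ler_norm K))// lerDl.
by rewrite -ler_pdivlMr// ltW.
Qed.

Lemma derive_reflect E (c : R -> E) t v : is_derive (t : R^o) 1 (c : R^o -> E) v ->
  is_derive (- t : R^o) 1 ((fun s => c (- s)) : R^o -> E) (- v).
Proof.
move=> /derive_eps cv; apply/derive_eps => e /cv[d d0 dP].
exists d => // h hd; have := dP (- h); rewrite normrN => /(_ hd).
by rewrite opprD opprK scalerN scaleNr.
Qed.

(* The Euler scheme is run forward for [F] and for [- F]. *)
Theorem global_flow E (F : E -> E) (L M : R) : geo_complete E -> 0 <= L -> 0 <= M ->
  (forall x y, `|F x - F y| <= L * `|x - y|) -> (forall x, `|F x| <= M) ->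
  exists phi : R -> E -> E, (forall x, phi 0 x = x) /\
    forall x t, is_derive (t : R^o) 1 ((phi^~ x) : R^o -> E) (F (phi t x)).
Proof.
move=> cE L0 M0 FL FM; pose F' x := - F x.
have FL' x y : `|F' x - F' y| <= L * `|x - y|.
  have -> : F' x - F' y = - (F x - F y) by rewrite /F'; vring R.
  by rewrite normrN.
have FM' x : `|F' x| <= M by rewrite normrN.
pose f := euler_limit F L M; pose b := euler_limit F' L M.
have f0 x : f 0 x = x by apply: euler_limit0.
have b0 x : b 0 x = x by apply: euler_limit0.
exists (fun t x => if 0 <= t then f t x else b (- t) x); split=> [x|x t].
  by rewrite lexx.
pose K := 2 * (L * M) + L * (L * M).
have fP s r y : 0 <= r -> 0 <= s -> `|s - r| < 1 ->
    `|f s y - f r y - (s - r) *: F (f r y)| <= (s - r) ^+ 2 * K.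
  by move=> r0 s0 /ltW; exact: euler_limit_diff.
have bP s r y : r <= 0 -> s <= 0 -> `|s - r| < 1 ->
    `|b (- s) y - b (- r) y - (s - r) *: F (b (- r) y)| <= (s - r) ^+ 2 * K.
  move=> r0 s0 sr; have sr' : `|- s - - r| <= 1 by rewrite -opprD normrN ltW.
  have := @euler_limit_diff E F' L M cE L0 M0 FL' FM' (- s) (- r) y.
  rewrite !oppr_ge0 -!opprD sqrrN normrN => /(_ r0 s0 (ltW sr)).
  by rewrite scalerN scaleNr opprK.
case: (ltgtP 0 t) => [t0|t0|<-].
- apply: (@sq_bound_derive _ _ _ K (Num.min 1 t)) => [|s].
    by rewrite lt_min ltr01.
  rewrite lt_min => /andP[s1 st]; have s0 : 0 <= s.
    by move: st; rewrite ltr_norml => /andP[+ _]; rewrite ltrBrDr addNr => /ltW.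
  by rewrite s0 (ltW t0) fP// ltW.
- apply: (@sq_bound_derive _ _ _ K (Num.min 1 (- t))) => [|s].
    by rewrite lt_min ltr01 oppr_gt0.
  rewrite lt_min => /andP[s1 st]; have s0 : s < 0.
    by move: st; rewrite ltr_norml => /andP[_]; rewrite ltrBlDr addNr.
  by rewrite !(leNgt 0) s0 t0 /= bP// ltW.
- rewrite f0; apply: (@sq_bound_derive _ _ _ K 1) => // s.
  rewrite lexx f0; have [s0 s1|s0 s1] := leP 0 s.
    by have := fP s 0 x (lexx _) s0 s1; rewrite f0.
  by have := bP s 0 x (lexx _) (ltW s0) s1; rewrite oppr0 b0.
Qed.

Section Retraction.
Variables (E : normedModType R) (x0 : E) (r : R).
Hypothesis r0 : 0 < r.

(** Radial retraction onto a closed ball. Composed with it, a field that is Lipschitz near [x0]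
    becomes globally Lipschitz and bounded; the Lipschitz constant at most doubles, as the norm is
    arbitrary. *)
Definition retract (x : E) : E :=
  if `|x - x0| <= r then x else x0 + (r / `|x - x0|) *: (x - x0).

Lemma retract_id x : `|x - x0| <= r -> retract x = x.
Proof. by rewrite /retract => ->. Qed.

Lemma retract_in x : `|retract x - x0| <= r.
Proof.
rewrite /retract; case: ifPn => //; rewrite -ltNge => rx.
have x0' : 0 < `|x - x0| by exact: lt_trans rx.
by rewrite addrAC subrr add0r normrZ ger0_norm ?divr_ge0 ?(ltW r0)// divfK// gt_eqF.
Qed.

Lemma retract_lip x y : `|retract x - retract y| <= 2 * `|x - y|.
Proof.
have key (a b : E) : r < `|a| -> `|b| <= r -> `|(r / `|a|) *: a - b| <= 2 * `|a - b|.
  move=> ra br; have a0 : 0 < `|a| by exact: lt_trans ra.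
  have -> : (r / `|a|) *: a - b = (a - b) - (1 - r / `|a|) *: a by vring R.
  apply: le_trans (ler_normB _ _) _; rewrite mulrDl mul1r lerD2l normrZ.
  rewrite ger0_norm; last by rewrite subr_ge0 ler_pdivrMr// mul1r ltW.
  rewrite mulrBl mul1r divfK ?gt_eqF//.
  by apply: le_trans (lerB_dist _ _); rewrite lerB.
have key2 (a b : E) : r < `|a| -> r < `|b| ->
    `|(r / `|a|) *: a - (r / `|b|) *: b| <= 2 * `|a - b|.
  move=> ra rb; have a0 : 0 < `|a| by exact: lt_trans ra.
  have b0 : 0 < `|b| by exact: lt_trans rb.
  have -> : (r / `|a|) *: a - (r / `|b|) *: b =
    (r / `|a|) *: ((a - b) + (1 - `|a| / `|b|) *: b).
    rewrite scalerDr scalerA mulrBr mulr1 mulrA divfK ?gt_eqF//; vring R.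
  rewrite normrZ ger0_norm ?divr_ge0 ?(ltW r0)//.
  apply: le_trans (ler_piMl _ _) _ => //; first by rewrite ler_pdivrMr// mul1r ltW.
  apply: le_trans (ler_normD _ _) _; rewrite mulrDl mul1r lerD2l normrZ.
  rewrite -[X in _ * X]ger0_norm// -normrM mulrBl mul1r divfK ?gt_eqF//.
  by rewrite distrC; exact: ler_dist_dist.
have -> : x - y = (x - x0) - (y - x0) by vring R.
rewrite /retract; case: ifPn; case: ifPn; rewrite -?ltNge => xr yr.
- have <- : x - y = (x - x0) - (y - x0) by vring R.
  by rewrite ler_peMl// ler1n.
- rewrite distrC [`|x - x0 - _|]distrC.
  have -> : x0 + (r / `|y - x0|) *: (y - x0) - x = (r / `|y - x0|) *: (y - x0) - (x - x0) by vring R.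
  exact: key.
- have -> : x0 + (r / `|x - x0|) *: (x - x0) - y = (r / `|x - x0|) *: (x - x0) - (y - x0) by vring R.
  exact: key.
- set a := x - x0 in xr yr *; set b := y - x0 in xr yr *.
  have -> : x0 + (r / `|a|) *: a - (x0 + (r / `|b|) *: b) = (r / `|a|) *: a - (r / `|b|) *: b by vring R.
  exact: key2.
Qed.
End Retraction.

(** Continuity at [(x0, 0)] bounds [A x v] by 1 for all [x] near [x0] and all small [v]; homogeneity
    turns this into a bound on the operators [A x], uniform in [x]. Joint continuity on products
    thus does the work of operator norms. *)
Lemma linear_family_bound E F G (W : set E) (A : E -> F -> G) x0 : open W -> W x0 ->
  (forall x, W x -> linear (A x)) -> {for (x0, 0), continuous (fun z : E * F => A z.1 z.2)} ->
  exists2 r, 0 < r & exists2 C, 0 < C & forall x v, `|x - x0| < r -> W x /\ `|A x v| <= C * `|v|.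
Proof.
move=> /openP oW Wx0 lA /cont_eps/(_ 1 ltr01)[d d0 dP].
have [d' d'0 dW] := oW x0 Wx0.
exists (Num.min d d'); first by rewrite lt_min d0.
exists (2 / d) => [|x v]; first by rewrite divr_gt0.
rewrite lt_min => /andP[xd xd'].
have Wx : W x by have := dW _ xd'; rewrite [x0 + _]addrC subrK.
have A0 y : W y -> A y 0 = 0.
  move=> Wy; have := lA y Wy 1 0 0; rewrite scaler0 addr0 scale1r => /eqP.
  by rewrite -subr_eq subrr eq_sym => /eqP.
have AZ a w : A x (a *: w) = a *: A x w by rewrite -[a *: w]addr0 lA// A0// addr0.
split=> //.
have [->|v0] := eqVneq v 0; first by rewrite A0// !normr0 mulr0.
have nv : 0 < `|v| by rewrite normr_gt0.
pose a := d / 2 / `|v|; have a0 : 0 < a by rewrite !divr_gt0.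
have := dP (x - x0, a *: v); rewrite pair_norm_lt /= xd normrZ gtr0_norm// /a divfK ?gt_eqF//.
rewrite ltr_pdivrMr// ltr_pMr// ltr1n => /(_ isT).
rewrite add0r [x0 + _]addrC subrK [A x0 0]A0// subr0 AZ normrZ -/a gtr0_norm// => h.
rewrite -(ler_pM2l a0); apply: le_trans (ltW h) _.
have nd := lt0r_neq0 d0; have nn := lt0r_neq0 nv.
by rewrite /a; apply: le_of_eq; field; rewrite nd nn.
Qed.

Lemma class_C1_bound E F (U : set E) (f : E -> F) x0 : open U -> U x0 -> class_C 1 U f ->
  exists2 r, 0 < r & exists2 C, 0 < C & forall x v, `|x - x0| < r -> `|'d f x v| <= C * `|v|.
Proof.
move=> oU Ux0 [_ cf].
have [|x _||r r0 [C C0 CP]] := @linear_family_bound E E F setT (fun x => 'd f x) x0 openT.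
- by [].
- exact: linearP.
- by apply: (cf (x0, 0)); split.
by exists r => //; exists C => // x v xr; exact: (CP x v xr).2.
Qed.

Lemma class_C1_lip E F (U : set E) (f : E -> F) x0 : open U -> U x0 -> class_C 1 U f ->
  exists2 r, 0 < r & exists2 L, 0 < L &
    [/\ forall x, `|x - x0| < r -> U x,
        forall x v, `|x - x0| < r -> `|'d f x v| <= L * `|v| &
        forall x y, `|x - x0| < r -> `|y - x0| < r -> `|f x - f y| <= L * `|x - y|].
Proof.
move=> oU Ux0 cf; have [r1 r10 [L L0 LP]] := class_C1_bound oU Ux0 cf.
have [r2 r20 UP] := (openP U).1 oU x0 Ux0.
exists (Num.min r1 r2); first by rewrite lt_min r10.
have UP' x : `|x - x0| < Num.min r1 r2 -> U x.
  by rewrite lt_min => /andP[_ /UP]; rewrite addrC subrK.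
have LP' x v : `|x - x0| < Num.min r1 r2 -> `|'d f x v| <= L * `|v|.
  by rewrite lt_min => /andP[/LP].
exists L => //; split=> // x y xr yr.
apply: (@mean_value_ball _ E F f x0 (Num.min r1 r2) L) => // z /UP'.
by have [+ _] := class_CS cf; apply.
Qed.

(** On an interval so short that [L tau <= 1/2] the bound [B] improves itself: if [|y| <= B] up to
    time [t], the mean value inequality yields [|y t| <= B - e / 2], so the bound persists a little
    longer. The factor 2 stands for the usual exponential. *)
Lemma gronwall_right E (y w : R -> E) (tau L K : R) : 0 <= tau -> 0 <= L -> 0 <= K ->
  L * tau <= 2^-1 ->
  (forall t, 0 <= t <= tau -> is_derive (t : R^o) 1 (y : R^o -> E) (w t)) ->
  (forall t, 0 <= t <= tau -> `|w t| <= L * `|y t| + K) ->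
  forall t, 0 <= t <= tau -> `|y t| <= 2 * `|y 0| + 2 * K * tau.
Proof.
move=> tau0 L0 K0 Ltau dy wy t tI; apply/ler_addgt0Pr => e e0.
pose B := 2 * `|y 0| + 2 * K * tau + e.
move: t tI; rewrite -/B; apply: (@real_ind _ (fun t => `|y t| <= B)).
- by rewrite /B -addrA mulrDl mul1r -addrA lerDl !addr_ge0 ?mulr_ge0// ltW.
- move=> t /andP[t0 tt] Pt.
  have yt : `|y t| < B.
    have : `|y t - y 0| <= (L * B + K) * (t - 0).
      apply: (@mean_value_right _ E y w) => // s /andP[s0 st].
        by apply: dy; rewrite s0 (le_trans st (ltW tt)).
      apply: le_trans (wy s _) _; first by rewrite s0 (le_trans st (ltW tt)).
      by rewrite lerD2r ler_wpM2l// Pt// s0.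
    rewrite subr0 => h; have : `|y t| <= `|y 0| + (L * B + K) * t.
      by rewrite -lerBlDl (le_trans (lerB_dist _ _) h).
    have B0 : 0 <= B by rewrite /B !addr_ge0 ?mulr_ge0// ltW.
    have tt' := ltW tt.
    have h1 : L * B * t <= 2^-1 * B.
      rewrite mulrAC ler_wpM2r// (le_trans _ Ltau)// ler_wpM2l//.
    have h2 : K * t <= K * tau by rewrite ler_wpM2l.
    rewrite /B in h1 *; lra.
  have Byt : 0 < B - `|y t| by rewrite subr_gt0.
  have tI : 0 <= t <= tau by rewrite t0 ltW.
  have [d d0 dP] := derive_cont (dy t tI) Byt.
  exists d => // s /andP[ts sd] stau; have /dP : `|s - t| < d.
    by rewrite ger0_norm ?subr_ge0 ?(ltW ts)// ltrBlDl.
  by move/(le_lt_trans (lerB_dist _ _)); rewrite ltrBlDr subrK => /ltW.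
- move=> t /andP[t0 tt] Pt; apply/ler_addgt0Pr => e1 e10.
  have tI : 0 <= t <= tau by rewrite (ltW t0).
  have [d d0 dP] := derive_cont (dy t tI) e10.
  pose s := Num.max 0 (t - d / 2).
  have st : s < t by rewrite gt_max t0 ltrBlDr ltrDl divr_gt0.
  have s0 : 0 <= s by rewrite le_max lexx.
  have tsd : `|s - t| < d.
    rewrite distrC ger0_norm ?subr_ge0 ?(ltW st)// ltrBlDl -ltrBlDr lt_max; apply/orP; right.
    by rewrite ltrD2l ltrN2 ltr_pdivrMr// ltr_pMr// ltr1n.
  have := dP _ tsd; rewrite distrC => /(le_lt_trans (lerB_dist _ _)) h.
  by have := Pt s; rewrite s0 st => /(_ isT) h'; move: h; lra.
Qed.

Lemma gronwall E (y w : R -> E) (tau L K : R) : 0 <= L -> 0 <= K -> L * tau <= 2^-1 ->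
  (forall t, `|t| < tau -> is_derive (t : R^o) 1 (y : R^o -> E) (w t)) ->
  (forall t, `|t| < tau -> `|w t| <= L * `|y t| + K) ->
  forall t, `|t| < tau -> `|y t| <= 2 * `|y 0| + 2 * K * tau.
Proof.
move=> L0 K0 Ltau dy wy t ttau; have tau0 : 0 < tau by exact: le_lt_trans ttau.
have Lt : L * `|t| <= 2^-1 by rewrite (le_trans _ Ltau)// ler_wpM2l// ltW.
suff : `|y t| <= 2 * `|y 0| + 2 * K * `|t|.
  by move/le_trans; apply; rewrite lerD2l ler_wpM2l ?mulr_ge0// ltW.
have in_ s : 0 <= s <= `|t| -> `|s| < tau.
  by move=> /andP[s0 st]; rewrite ger0_norm// (le_lt_trans st).
have [t0|t0] := leP 0 t.
  have tI : 0 <= t <= `|t| by rewrite t0 ger0_norm /=.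
  by apply: (@gronwall_right E y w `|t| L K) tI => // s /in_; [exact: dy|exact: wy].
have tI : 0 <= - t <= `|t| by rewrite oppr_ge0 (ltW t0) ltr0_norm /=.
have := @gronwall_right E (fun s => y (- s)) (fun s => - w (- s)) `|t| L K (normr_ge0 _) L0 K0 Lt.
rewrite oppr0 => /(_ _ _ (- t) tI); rewrite opprK; apply => s /in_ sI.
  have sI' : `|- s| < tau by rewrite normrN.
  by have := derive_reflect (dy _ sI'); rewrite opprK.
by rewrite normrN; apply: wy; rewrite normrN.
Qed.

Lemma derive_near E (c c' : R -> E) (tau t : R) v : `|t| < tau ->
  (forall s, `|s| < tau -> c s = c' s) ->
  is_derive (t : R^o) 1 (c : R^o -> E) v -> is_derive (t : R^o) 1 (c' : R^o -> E) v.
Proof.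
move=> tt cc' /derive_eps cv; apply/derive_eps => e /cv[d d0 dP].
exists (Num.min d (tau - `|t|)) => [|h]; first by rewrite lt_min d0 subr_gt0.
rewrite lt_min => /andP[hd ht]; rewrite -!cc' ?dP//.
by rewrite (le_lt_trans (ler_normD _ _))// addrC -ltrBrDr.
Qed.

Lemma mean_value_abs E (c : R -> E) (c' : R -> E) (tau M : R) :
  (forall t, `|t| < tau -> is_derive (t : R^o) 1 (c : R^o -> E) (c' t)) ->
  (forall t, `|t| < tau -> `|c' t| <= M) ->
  forall t, `|t| < tau -> `|c t - c 0| <= M * `|t|.
Proof.
move=> dc cM t ttau.
have in_ s : 0 <= s <= `|t| -> `|s| < tau.
  by move=> /andP[s0 st]; rewrite ger0_norm// (le_lt_trans st).
have [t0|t0] := leP 0 t.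
  rewrite (ger0_norm t0) -[in leRHS](subr0 t).
  by apply: (@mean_value_right _ E c c') => // s sI; [apply: dc|apply: cM];
    apply: in_; rewrite (ger0_norm t0).
have := @mean_value_right _ E (fun s => c (- s)) (fun s => - c' (- s)) 0 (- t) M.
rewrite oppr0 opprK oppr_ge0 (ltW t0) addr0 -(ltr0_norm t0); apply => // s sI.
  have sI' : `|- s| < tau by rewrite normrN in_.
  by have := derive_reflect (dc _ sI'); rewrite opprK.
by rewrite normrN; apply: cM; rewrite normrN in_.
Qed.

Definition flows E (F : E -> E) (B : set E) (tau : R) (phi : R -> E -> E) (V : set E) :=
  forall x, B x -> phi 0 x = x /\
    forall t, `|t| < tau -> V (phi t x) /\
      is_derive (t : R^o) 1 ((phi^~ x) : R^o -> E) (F (phi t x)).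

Definition nball E (x0 : E) (r : R) : set E := [set x | `|x - x0| < r].

Lemma nball_open E (x0 : E) r : open (nball x0 r).
Proof.
apply/openP => x; rewrite /nball /= => xr; exists (r - `|x - x0|); first by rewrite subr_gt0.
move=> h hr; have -> : x + h - x0 = h + (x - x0) by vring R.
by apply: le_lt_trans (ler_normD _ _) _; rewrite -ltrBrDr.
Qed.

Lemma nball_center E (x0 : E) r : 0 < r -> nball x0 r x0.
Proof. by rewrite /nball /= subrr normr0. Qed.

(** The field composed with the retraction onto the ball of radius [r] has a global flow of speed at
    most [M]. An orbit starting within [r / 2] of the centre stays inside that ball for time
    [r / (2 (M + 1))], and there the retraction is the identity. *)
Lemma local_existence E (F : E -> E) (U : set E) x0 rho : geo_complete E -> open U -> U x0 ->
  class_C 1 U F -> 0 < rho ->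
  exists2 r, 0 < r & exists2 tau, 0 < tau &
    exists phi, flows F (nball x0 r) tau phi (nball x0 rho).
Proof.
move=> cE oU Ux0 cF rho0; have [r1 r10 [L L0 [_ _ LF]]] := class_C1_lip oU Ux0 cF.
pose r := Num.min rho r1 / 2.
have r0 : 0 < r by rewrite divr_gt0// lt_min rho0.
have rrho : r < rho.
  by rewrite ltr_pdivrMr// (@le_lt_trans _ _ rho) ?ge_min ?lexx// ltr_pMr// ltr1n.
have rr1 : r < r1.
  by rewrite ltr_pdivrMr// (@le_lt_trans _ _ r1) ?ge_min ?lexx ?orbT// ltr_pMr// ltr1n.
clearbody r.
pose F' x := F (retract x0 r x).
have ret1 x : `|retract x0 r x - x0| < r1 by apply: le_lt_trans rr1; exact: retract_in.
have FL' x y : `|F' x - F' y| <= 2 * L * `|x - y|.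
  apply: le_trans (LF _ _ (ret1 _) (ret1 _)) _.
  by rewrite [2 * L]mulrC -mulrA ler_wpM2l ?(ltW L0)//; exact: retract_lip.
pose M := `|F x0| + L * r.
have M0 : 0 <= M by rewrite addr_ge0// mulr_ge0// ltW.
have FM' x : `|F' x| <= M.
  rewrite /F' -[F _](subrK (F x0)) addrC; apply: le_trans (ler_normD _ _) _; rewrite lerD2l.
  apply: le_trans (LF _ _ (ret1 _) _) _; first by rewrite subrr normr0.
  by rewrite ler_wpM2l ?(ltW L0)// retract_in.
have [|phi [phi0 dphi]] := global_flow cE _ M0 FL' FM'; first by rewrite mulr_ge0// ltW.
have M1 : 0 < 2 * (M + 1) by rewrite mulr_gt0// ltr_wpDl.
exists (r / 2); first by rewrite divr_gt0.
exists (r / (2 * (M + 1))); first by rewrite divr_gt0.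
exists phi => x; rewrite /nball /= => xr; split=> [|t tt]; first exact: phi0.
have pr : `|phi t x - x0| < r.
  have := @mean_value_abs _ (phi^~ x) (fun t => F' (phi t x)) (`|t| + 1) M.
  move=> /(_ (fun t _ => dphi x t) (fun t _ => FM' _) t); rewrite ltrDl ltr01 => /(_ isT).
  rewrite phi0 => h.
  have -> : phi t x - x0 = (phi t x - x) + (x - x0) by vring R.
  apply: le_lt_trans (ler_normD _ _) _.
  rewrite [ltRHS](splitr r); apply: ler_ltD => //; apply: le_trans h _.
  have : (M + 1) * `|t| <= r / 2.
    move: tt; rewrite ltr_pdivlMr// => tt; rewrite ler_pdivlMr//; have := ltW tt; lra.
  apply: le_trans; rewrite ler_wpM2r// lerDl//.
split; first exact: lt_trans rrho.
by have := dphi x t; rewrite /F' retract_id// ltW.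
Qed.

(** The tangent map is of class C^1, hence Lipschitz near [(x0, 0)]; rescaling [v] to length [r / 2]
    makes the estimate homogeneous. *)
Lemma class_C2_lip E F (U : set E) (f : E -> F) x0 : open U -> U x0 -> class_C 2 U f ->
  exists2 r, 0 < r & exists2 K, 0 < K & forall x y v, `|x - x0| < r -> `|y - x0| < r ->
    `|'d f x v - 'd f y v| <= K * `|x - y| * `|v|.
Proof.
move=> oU Ux0 [_ cf]; have oU' : open (U `*` setT : set (E * E)) by exact: openMT.
have [//|r r0 [L L0 [_ _ LP]]] := @class_C1_lip (E * E)%type F _ _ (x0, 0) oU' _ cf.
exists r => //; exists (L * (2 / r)) => [|x y v xr yr]; first by rewrite mulr_gt0// divr_gt0.
have [->|v0] := eqVneq v 0; first by rewrite !d0 subr0 !normr0 mulr0.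
have nv : 0 < `|v| by rewrite normr_gt0.
pose a := r / 2 / `|v|; have a0 : 0 < a by rewrite !divr_gt0.
have av : `|a *: v| < r.
  rewrite normrZ gtr0_norm// /a divfK ?gt_eqF// ltr_pdivrMr// ltr_pMr// ltr1n //.
have := LP (x, a *: v) (y, a *: v); rewrite !pair_norm_lt /= !subr0 xr yr av.
move=> /(_ isT isT); rewrite !dZ -scalerBr normrZ gtr0_norm// => h.
rewrite -(ler_pM2l a0); apply: le_trans h _.
have -> : `|(x, a *: v) - (y, a *: v)| = `|x - y|.
  apply/eqP; rewrite eq_le pair_norm_le /= subrr normr0 normr_ge0 lexx /=.
  exact: (norm_fst ((x, a *: v) - (y, a *: v))).
have nr := lt0r_neq0 r0; have nn := lt0r_neq0 nv.
by rewrite /a; apply: le_of_eq; field; rewrite nr nn.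
Qed.

Lemma is_diff_sub_linear E F (f : E -> F) (l : {linear E -> F}) z :
  differentiable f z -> continuous l ->
  is_diff z (fun x => f x - l x) (fun v => 'd f z v - l v).
Proof.
move=> df cl; have dl : differentiable l z by exact: linear_differentiable.
have h2 : is_diff z l l by apply: DiffDef => //; exact: diff_lin.
exact: (is_diffB (differentiableP df) h2).
Qed.

Lemma class_C2_taylor E F (U : set E) (f : E -> F) x0 : open U -> U x0 -> class_C 2 U f ->
  exists2 r, 0 < r & exists2 K, 0 < K & forall x y, `|x - x0| < r -> `|y - x0| < r ->
    `|f y - f x - 'd f x (y - x)| <= K * `|y - x| * `|y - x|.
Proof.
move=> oU Ux0 cf; have [r1 r10 [K K0 KP]] := class_C2_lip oU Ux0 cf.
have [r2 r20 UP] := (openP U).1 oU x0 Ux0.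
pose r := Num.min r1 r2.
have r0 : 0 < r by rewrite lt_min r10.
have rr1 : r <= r1 by rewrite ge_min lexx.
have rr2 : r <= r2 by rewrite ge_min lexx orbT.
clearbody r.
have df z : `|z - x0| < r -> differentiable f z.
  have [+ _] := class_CS cf => df zr; apply: df.
  by have := UP (z - x0); rewrite [x0 + _]addrC subrK; apply; exact: lt_le_trans rr2.
exists (r / 8); first by rewrite divr_gt0.
exists (2 * K) => [|x y xr yr]; first by rewrite mulr_gt0.
have [->|xy] := eqVneq y x; first by rewrite !subrr d0 sub0r oppr0 !normr0 !mulr0.
have nxy : 0 < `|y - x| by rewrite normr_gt0 subr_eq0.
have yx : `|y - x| < r / 4.
  have -> : y - x = (y - x0) - (x - x0) by vring R.
  apply: le_lt_trans (ler_normB _ _) _; lra.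
have zr z : `|z - x| < 2 * `|y - x| -> `|z - x0| < r.
  have -> : z - x0 = (z - x) + (x - x0) by vring R.
  by move=> zx; apply: le_lt_trans (ler_normD _ _) _; lra.
have dfx : differentiable f x by apply: df; lra.
have KPx z v : `|z - x| < 2 * `|y - x| ->
    `|'d f z v - 'd f x v| <= K * (2 * `|y - x|) * `|v|.
  move=> zx; apply: le_trans (KP _ _ _ _ _) _.
  - exact: lt_le_trans (zr _ zx) rr1.
  - by lra.
  by rewrite ler_wpM2r// ler_wpM2l ?(ltW K0)// ltW.
move: KPx (diff_continuous dfx); move: ('d f x) => l lP cl.
have -> : f y - f x - l (y - x) = f y - l y - (f x - l x).
  rewrite linearB; vring R.
have -> : 2 * K * `|y - x| * `|y - x| = K * (2 * `|y - x|) * `|y - x| by ring.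
have dg z : `|z - x| < 2 * `|y - x| -> is_diff z (fun z => f z - l z) (fun v => 'd f z v - l v).
  by move=> /zr/df dfz; exact: is_diff_sub_linear.
apply: (@mean_value_ball _ E F (fun z => f z - l z) x (2 * `|y - x|) (K * (2 * `|y - x|)) x y).
- by move=> z /dg[].
- by move=> z v zx; have [_ ->] := dg z zx; exact: lP.
- by rewrite subrr normr0 mulr_gt0.
- by rewrite ltr_pMl// ltr1n.
Qed.

Lemma flow_unique E (F : E -> E) (x0 : E) (r L tau : R) (c1 c2 : R -> E) :
  0 <= L -> L * tau <= 2^-1 ->
  (forall x y, `|x - x0| < r -> `|y - x0| < r -> `|F x - F y| <= L * `|x - y|) ->
  (forall t, `|t| < tau -> `|c1 t - x0| < r /\ is_derive (t : R^o) 1 (c1 : R^o -> E) (F (c1 t))) ->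
  (forall t, `|t| < tau -> `|c2 t - x0| < r /\ is_derive (t : R^o) 1 (c2 : R^o -> E) (F (c2 t))) ->
  forall t, `|t| < tau -> `|c1 t - c2 t| <= 2 * `|c1 0 - c2 0|.
Proof.
move=> L0 Ltau FL P1 P2 t tt.
have h := @gronwall E (fun t => c1 t - c2 t) (fun t => F (c1 t) - F (c2 t)) tau L 0 L0 (lexx 0) Ltau.
apply: le_trans (h _ _ t tt) _ => [s st|s st|].
- by apply: is_deriveB; [exact: (P1 s st).2|exact: (P2 s st).2].
- by rewrite addr0; apply: FL; [exact: (P1 s st).1|exact: (P2 s st).1].
- by rewrite mulr0 mul0r addr0.
Qed.

Lemma linear_ode_unique E (A : R -> E -> E) (L tau : R) (y1 y2 : R -> E) :
  0 <= L -> L * tau <= 2^-1 ->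
  (forall t, `|t| < tau -> linear (A t)) ->
  (forall t v, `|t| < tau -> `|A t v| <= L * `|v|) ->
  (forall t, `|t| < tau -> is_derive (t : R^o) 1 (y1 : R^o -> E) (A t (y1 t))) ->
  (forall t, `|t| < tau -> is_derive (t : R^o) 1 (y2 : R^o -> E) (A t (y2 t))) ->
  y1 0 = y2 0 -> forall t, `|t| < tau -> y1 t = y2 t.
Proof.
move=> L0 Ltau lA AL P1 P2 y0 t tt; apply/eqP; rewrite -subr_eq0 -normr_le0.
have := @gronwall E (fun t => y1 t - y2 t) (fun t => A t (y1 t) - A t (y2 t)) tau L 0.
move=> /(_ L0 (lexx 0) Ltau) h; apply: le_trans (h _ _ t tt) _.
- by move=> s st; apply: is_deriveB; [exact: P1|exact: P2].
- move=> s st; rewrite addr0 -scaleN1r addrC -lA// scaleN1r addrC; exact: AL.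
- by rewrite y0 subrr normr0 !mulr0 add0r mul0r.
Qed.

Lemma is_derive_fst E F (c : R -> E * F) t v :
  is_derive (t : R^o) 1 (c : R^o -> (E * F)%type) v ->
  is_derive (t : R^o) 1 ((fun s => (c s).1) : R^o -> E) v.1.
Proof.
move=> /derive_eps cv; apply/derive_eps => e /cv[d d0 dP]; exists d => // h /dP.
by move/(le_trans (norm_fst _)).
Qed.

Lemma is_derive_snd E F (c : R -> E * F) t v :
  is_derive (t : R^o) 1 (c : R^o -> (E * F)%type) v ->
  is_derive (t : R^o) 1 ((fun s => (c s).2) : R^o -> F) v.2.
Proof.
move=> /derive_eps cv; apply/derive_eps => e /cv[d d0 dP]; exists d => // h /dP.
by move/(le_trans (norm_snd _)).
Qed.

Lemma is_derive_pair E F (c : R -> E) (c' : R -> F) t v w :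
  is_derive (t : R^o) 1 (c : R^o -> E) v -> is_derive (t : R^o) 1 (c' : R^o -> F) w ->
  is_derive (t : R^o) 1 ((fun s => (c s, c' s)) : R^o -> (E * F)%type) (v, w).
Proof.
move=> /derive_eps cv /derive_eps cw; apply/derive_eps => e e0.
have [d d0 dP] := cv e e0; have [d' d'0 dP'] := cw e e0.
exists (Num.min d d') => [|h]; first by rewrite lt_min d0.
by rewrite lt_min pair_norm_le => /andP[hd hd']; rewrite dP//= dP'.
Qed.

Lemma is_derive_scale E (c : R -> E) t v (a : R) :
  is_derive (t : R^o) 1 (c : R^o -> E) v ->
  is_derive (t : R^o) 1 ((fun s => a *: c s) : R^o -> E) (a *: v).
Proof. by move=> cv; exact: is_deriveZ. Qed.

Lemma is_derive_lin E (c1 c2 : R -> E) t v w (a : R) :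
  is_derive (t : R^o) 1 (c1 : R^o -> E) v -> is_derive (t : R^o) 1 (c2 : R^o -> E) w ->
  is_derive (t : R^o) 1 ((fun s => a *: c1 s + c2 s) : R^o -> E) (a *: v + w).
Proof. by move=> cv cw; apply: is_deriveD => //; exact: is_derive_scale. Qed.

Definition tangent_field E F (f : E -> F) (z : E * E) : F * F := (f z.1, 'd f (z.1) (z.2)).

Lemma tangent_field_smooth E F (U : set E) (f : E -> F) : open U -> smooth_on U f ->
  smooth_on (U `*` setT) (tangent_field f).
Proof.
move=> oU sf n; have oU' : open (U `*` setT : set (E * E)) by exact: openMT.
apply: class_C_pair => //; last by have [] := class_CS (sf n.+1).
apply: (@class_C_comp _ n _ _ _ _ U fst f) => //; first by move=> z [].
exact: class_C_fst.
Qed.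

(** * Derivative of a flow in the initial point *)

Section FlowDerivative.
Variables (E : normedModType R) (F : E -> E) (U : set E) (x0 : E).
Variables (rho tau L K : R) (B : set E) (phi : R -> E -> E).
Variables (s0 : R) (psi : R -> E * E -> E * E).
Hypotheses (L0 : 0 <= L) (K0 : 0 <= K) (Ltau : L * tau <= 2^-1) (s00 : 0 < s0).
Hypothesis FL : forall x y, `|x - x0| < rho -> `|y - x0| < rho -> `|F x - F y| <= L * `|x - y|.
Hypothesis dFL : forall x v, `|x - x0| < rho -> `|'d F x v| <= L * `|v|.
Hypothesis dFK : forall x y, `|x - x0| < rho -> `|y - x0| < rho ->
  `|F y - F x - 'd F x (y - x)| <= K * `|y - x| * `|y - x|.
Hypotheses (oB : open B) (phiP : flows F B tau phi (nball x0 rho)).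
Hypothesis psiP : flows (tangent_field F) (B `*` nball 0 s0) tau psi (nball x0 rho `*` setT).

Lemma phi_lip x y t : B x -> B y -> `|t| < tau -> `|phi t x - phi t y| <= 2 * `|x - y|.
Proof.
move=> Bx By tt; have [x1 x2] := phiP Bx; have [y1 y2] := phiP By.
rewrite -{2}x1 -{2}y1.
exact: (@flow_unique E F x0 rho L tau (phi^~ x) (phi^~ y) L0 Ltau FL x2 y2).
Qed.

Lemma psi_fst x v t : B x -> nball 0 s0 v -> `|t| < tau -> (psi t (x, v)).1 = phi t x.
Proof.
move=> Bx vs tt; have [x1 x2] := phiP Bx; have [|y1 y2] := @psiP (x, v); first by split.
have h := @flow_unique E F x0 rho L tau (fun t => (psi t (x, v)).1) (phi^~ x) L0 Ltau FL.
have {h} := h _ x2 t tt; rewrite y1 x1 subrr normr0 mulr0 => h.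
apply/eqP; rewrite -subr_eq0 -normr_le0; apply: h => s st.
have [[h1 _] h2] := y2 s st; split; first exact: h1.
exact: (is_derive_fst h2).
Qed.

(** The flow [psi] of the tangent field is available only for vectors shorter than [s0]. As its
    fibre part is linear, an arbitrary [v] is shrunk into that ball and the result expanded back. *)
Definition dflow_scale (v : E) : R := s0 / 2 / (1 + `|v|).

Lemma dflow_scaleP v : 0 < dflow_scale v /\ `|dflow_scale v *: v| < s0.
Proof.
have v1 : 0 < 1 + `|v| by rewrite ltr_pwDl.
have h : 0 < dflow_scale v by rewrite !divr_gt0.
split=> //; rewrite normrZ gtr0_norm// /dflow_scale mulrAC ltr_pdivrMr//.
have : 0 <= s0 * `|v| by rewrite mulr_ge0// ltW.
rewrite mulrDr mulr1 [s0 / 2 * _]mulrAC; move: (s0 * `|v|) (s00) => p; lra.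
Qed.

Definition dflow t x v : E := (dflow_scale v)^-1 *: (psi t (x, dflow_scale v *: v)).2.

Lemma dflow_ode x v : B x -> dflow 0 x v = v /\ forall t, `|t| < tau ->
  is_derive (t : R^o) 1 ((fun s => dflow s x v) : R^o -> E) ('d F (phi t x) (dflow t x v)).
Proof.
move=> Bx; have [a0 av] := dflow_scaleP v.
have vs : nball 0 s0 (dflow_scale v *: v) by rewrite /nball /= subr0.
have [|y1 y2] := @psiP (x, dflow_scale v *: v); first by split.
split; first by rewrite /dflow y1 /= scalerA mulVf ?scale1r// gt_eqF.
move=> t tt; have [_ h] := y2 t tt; rewrite /dflow dZ.
apply: is_derive_scale; rewrite -(psi_fst Bx vs tt).
exact: (is_derive_snd h).
Qed.

Lemma dflow_unique x v y : B x -> y 0 = v ->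
  (forall t, `|t| < tau -> is_derive (t : R^o) 1 (y : R^o -> E) ('d F (phi t x) (y t))) ->
  forall t, `|t| < tau -> y t = dflow t x v.
Proof.
move=> Bx y0 dy; have [d1 d2] := dflow_ode v Bx; have [x1 x2] := phiP Bx.
apply: (@linear_ode_unique E (fun t => 'd F (phi t x)) L tau) => //.
- by move=> t _; exact: linearP.
- by move=> t v' tt; apply: dFL; exact: (x2 t tt).1.
- by rewrite y0 d1.
Qed.

Lemma dflow_linear x t : B x -> `|t| < tau -> linear (dflow t x).
Proof.
move=> Bx tt a v w; have [v1 v2] := dflow_ode v Bx; have [w1 w2] := dflow_ode w Bx.
apply/esym; apply: (@dflow_unique x _ (fun t => a *: dflow t x v + dflow t x w)) => //.
  by rewrite v1 w1.
by move=> s st; rewrite dD dZ; apply: is_derive_lin; [exact: v2|exact: w2].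
Qed.

Lemma dflow_bound x t v : B x -> `|t| < tau -> `|dflow t x v| <= 2 * `|v|.
Proof.
move=> Bx tt; have [v1 v2] := dflow_ode v Bx; have [x1 x2] := phiP Bx.
have h := @gronwall E (fun t => dflow t x v) (fun t => 'd F (phi t x) (dflow t x v)) tau L 0.
apply: le_trans (h L0 (lexx 0) Ltau v2 _ t tt) _ => [s st|].
  by rewrite addr0; apply: dFL; exact: (x2 s st).1.
by rewrite v1 mulr0 mul0r addr0.
Qed.

(** The remainder [D s = phi_s (x + h) - phi_s x - dflow_s h] vanishes at time 0 and solves the
    linearised equation up to the Taylor error of [F], so Gronwall's lemma makes it of order
    [|h|^2]. *)
Lemma dflow_diff x t : B x -> `|t| < tau -> is_diff x (phi t) (dflow t x).
Proof.
move=> Bx tt; have tau0 : 0 < tau by exact: le_lt_trans tt.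
apply: eps_isdiff; first exact: dflow_linear.
  by exists 2 => h; exact: dflow_bound.
move=> e e0; have [d d_gt0 dB'] := (openP B).1 oB x Bx.
have C0 : 0 < 8 * K * tau + 1 by rewrite ltr_wpDl// !mulr_ge0// ltW.
exists (Num.min d (e / (8 * K * tau + 1))) => [|h].
  by rewrite lt_min d_gt0 divr_gt0.
rewrite lt_min => /andP[hd he]; have Bxh := dB' _ hd.
have [x1 x2] := phiP Bx; have [y1 y2] := phiP Bxh; have [v1 v2] := dflow_ode h Bx.
pose D s := phi s (x + h) - phi s x - dflow s x h.
pose D' s := F (phi s (x + h)) - F (phi s x) - 'd F (phi s x) (dflow s x h).
have := @gronwall E D D' tau L (K * (2 * `|h|) * (2 * `|h|)) L0 _ Ltau.
move=> /(_ _ _ _ t tt) h'; apply: le_trans (h' _ _ _) _.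
- by rewrite !mulr_ge0.
- move=> s st; apply: is_deriveB; last exact: v2.
  by apply: is_deriveB; [exact: (y2 s st).2|exact: (x2 s st).2].
- move=> s st; rewrite /D' /D; set l := 'd F (phi s x).
  have -> : F (phi s (x + h)) - F (phi s x) - l (dflow s x h) =
    l (phi s (x + h) - phi s x - dflow s x h) +
    (F (phi s (x + h)) - F (phi s x) - l (phi s (x + h) - phi s x)).
    by rewrite [l (_ - dflow _ _ _)]linearB; vring R.
  apply: le_trans (ler_normD _ _) _; apply: lerD.
    by apply: dFL; exact: (x2 s st).1.
  apply: le_trans (dFK (x2 s st).1 (y2 s st).1) _.
  have hh : `|phi s (x + h) - phi s x| <= 2 * `|h|.
    have -> : `|h| = `|x + h - x| by rewrite addrAC subrr add0r.
    exact: phi_lip.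
  by apply: ler_pM => //; [exact: mulr_ge0|apply: ler_wpM2l].
- have -> : D 0 = 0 by rewrite /D x1 y1 v1; vring R.
  rewrite normr0 mulr0 add0r.
  have -> : 2 * (K * (2 * `|h|) * (2 * `|h|)) * tau = 8 * K * tau * `|h| * `|h| by ring.
  rewrite ler_wpM2r//; move: he; rewrite ltr_pdivlMr// => he; apply: le_trans (ltW he).
  by rewrite [leRHS]mulrC ler_wpM2r// lerDl.
Qed.

(** The differential of [phi t] is the fibre component of the flow of the tangent field, so one more
    derivative of [phi] is one less of [psi]. *)
Lemma dflow_class n : (forall t, `|t| < tau -> class_C n (B `*` nball 0 s0) (psi t)) ->
  forall t, `|t| < tau -> class_C n.+1 B (phi t).
Proof.
move=> cpsi t tt; split=> [x Bx|]; first by have [] := dflow_diff Bx tt.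
apply: class_C_local => -[x v] [/= Bx _].
(* [dflow_scale] involves the norm, which need not be smooth. One constant scale serves all vectors
   within 1 of [v], and uniqueness of the linear equation shows that it computes the same
   differential. *)
pose s := s0 / 2 / (2 + `|v|).
have v2 : 0 < 2 + `|v| by rewrite ltr_pwDl.
have s_gt0 : 0 < s by rewrite !divr_gt0.
have sP w : `|w - v| < 1 -> `|s *: w| < s0.
  move=> wv; rewrite normrZ gtr0_norm// /s mulrAC ltr_pdivrMr//.
  have : `|w| < 1 + `|v|.
    by rewrite -[w](subrK v) (le_lt_trans (ler_normD _ _))// ltrD2r.
  have : 0 <= s0 * `|v| by rewrite mulr_ge0// ltW.
  have : `|w| < 1 + `|v| -> s0 * `|w| <= s0 * (1 + `|v|) by rewrite ler_pM2l// => /ltW.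
  rewrite !mulrDr mulr1 [s0 / 2 * _]mulrAC => + + h => /(_ h).
  move: (s0 * `|v|) (s0 * `|w|) (s00) => p q; lra.
exists (B `*` nball v 1); split.
- by apply: openM => //; exact: nball_open.
- by split=> //; exact: nball_center.
have oB' : open (B `*` nball v 1) by apply: openM => //; exact: nball_open.
have c1 : class_C n (B `*` nball v 1) (fun z : E * E => (z.1, s *: z.2)).
  apply: class_C_pair => //; first exact: class_C_fst.
  by apply: class_C_scale => //; exact: class_C_snd.
have c2 : class_C n (B `*` nball v 1) (fun z : E * E => psi t (z.1, s *: z.2)).
  apply: (@class_C_comp _ n _ _ _ _ (B `*` nball 0 s0) _ (psi t)) => //; last exact: cpsi.
  by move=> [y w] [/= By wv]; split=> //=; rewrite /nball /= subr0; exact: sP.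
have c3 : class_C n (B `*` nball v 1) (fun z : E * E => s^-1 *: (psi t (z.1, s *: z.2)).2).
  apply: class_C_scale => //.
  by apply: (@class_C_comp _ n _ _ _ _ setT _ snd) => //; exact: class_C_snd.
apply: class_C_ext c3 => // -[y w] [/= By wv].
have [_ ->] := dflow_diff By tt.
have ws : nball 0 s0 (s *: w) by rewrite /nball /= subr0; exact: sP.
have [|y1 y2] := @psiP (y, s *: w); first by split.
apply: (@dflow_unique y w (fun t => s^-1 *: (psi t (y, s *: w)).2)) => //.
  by rewrite y1 /= scalerA mulVf ?scale1r// gt_eqF.
move=> r rt; have [_ h] := y2 r rt; rewrite dZ.
apply: is_derive_scale; rewrite -(psi_fst By ws rt).
exact: (is_derive_snd h).
Qed.

Lemma dflow_derive x v t : B x -> `|t| < tau ->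
  is_derive (t : R^o) 1 ((fun s => 'd (phi s) x v) : R^o -> E) ('d F (phi t x) ('d (phi t) x v)).
Proof.
move=> Bx tt; have [_ dE] := dflow_ode v Bx.
have [_ e] := dflow_diff Bx tt; rewrite e.
apply: derive_near tt _ (dE t tt) => s st.
by have [_ ->] := dflow_diff Bx st.
Qed.
End FlowDerivative.

Lemma is_derive_shift_time E (c : R -> E) (a t : R) v :
  is_derive (a + t : R^o) 1 (c : R^o -> E) v ->
  is_derive (t : R^o) 1 ((fun s => c (a + s)) : R^o -> E) v.
Proof.
move=> /derive_eps cv; apply/derive_eps => e /cv[d d0 dP]; exists d => // h /dP.
by rewrite addrA.
Qed.

Lemma ode_unique_right E (F : E -> E) (U : set E) (T : R) (c1 c2 : R -> E) :
  open U -> class_C 1 U F ->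
  (forall t, 0 <= t <= T -> U (c1 t) /\ is_derive (t : R^o) 1 (c1 : R^o -> E) (F (c1 t))) ->
  (forall t, 0 <= t <= T -> U (c2 t) /\ is_derive (t : R^o) 1 (c2 : R^o -> E) (F (c2 t))) ->
  c1 0 = c2 0 -> forall t, 0 <= t <= T -> c1 t = c2 t.
Proof.
move=> oU cF P1 P2 c0; apply: real_ind => // t /andP[t0 tT] Pt; last first.
  apply/eqP; rewrite -subr_eq0 -normr_le0; apply/ler_addgt0Pr => e e0.
  have e2 : 0 < e / 2 by rewrite divr_gt0.
  have tI : 0 <= t <= T by rewrite (ltW t0).
  have [d1 d10 D1] := derive_cont (P1 t tI).2 e2.
  have [d2 d20 D2] := derive_cont (P2 t tI).2 e2.
  pose d := Num.min t (Num.min d1 d2) / 2.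
  have d_gt0 : 0 < d by rewrite divr_gt0// !lt_min t0 d10.
  have dt : d < t.
    by rewrite ltr_pdivrMr// (@le_lt_trans _ _ t) ?ge_min ?lexx// ltr_pMr// ltr1n.
  have dd1 : d < d1.
    by rewrite ltr_pdivrMr// (@le_lt_trans _ _ d1) ?ge_min ?lexx ?orbT// ltr_pMr// ltr1n.
  have dd2 : d < d2.
    by rewrite ltr_pdivrMr// (@le_lt_trans _ _ d2) ?ge_min ?lexx ?orbT// ltr_pMr// ltr1n.
  clearbody d.
  have td : `|t - d - t| = d by rewrite addrAC subrr add0r normrN gtr0_norm.
  have cc := Pt (t - d); rewrite subr_ge0 (ltW dt) ltrBlDr ltrDl d_gt0 in cc.
  have := D2 (t - d); have := D1 (t - d); rewrite td (cc isT) => /(_ dd1) h1 /(_ dd2) h2.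
  have -> : c1 t - c2 t = (c2 (t - d) - c2 t) - (c2 (t - d) - c1 t) by vring R.
  by rewrite (le_trans (ler_normB _ _))// add0r [e in _ <= e]splitr lerD// ltW.
have tI : 0 <= t <= T by rewrite t0 ltW.
have [r r0 [L L0 [_ _ LF]]] := class_C1_lip oU (P1 t tI).1 cF.
have ct : c1 t = c2 t by apply: Pt; rewrite t0 lexx.
have [d1 d10 D1] := derive_cont (P1 t tI).2 r0.
have [d2 d20 D2] := derive_cont (P2 t tI).2 r0.
pose d := Num.min (T - t) (Num.min (Num.min d1 d2) (2^-1 / L)).
have d_gt0 : 0 < d by rewrite /d !lt_min subr_gt0 tT d10 d20 divr_gt0// invr_gt0.
have dd1 : d <= d1 by rewrite /d !ge_min lexx !orbT.
have dd2 : d <= d2 by rewrite /d !ge_min lexx !orbT.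
have dT : d <= T - t by rewrite /d !ge_min lexx.
have dL : L * d <= 2^-1 by rewrite mulrC -ler_pdivlMr// /d !ge_min lexx !orbT.
clearbody d; exists (d / 1) => [|s /andP[ts sd] _]; first by rewrite divr1.
rewrite divr1 in sd.
apply/eqP; rewrite -subr_eq0 -normr_le0.
have h := @gronwall_right E (fun u => c1 (t + u) - c2 (t + u))
  (fun u => F (c1 (t + u)) - F (c2 (t + u))) (s - t) L 0 _ (ltW L0) (lexx 0).
have st0 : 0 <= s - t by rewrite subr_ge0 ltW.
have std : s - t < d by rewrite ltrBlDl.
have Ls : L * (s - t) <= 2^-1 by apply: le_trans dL; rewrite ler_wpM2l// ltW.
have {h} := h st0 Ls _ _ (s - t); rewrite st0 lexx addr0 ct subrr normr0 !mulr0 mul0r addr0.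
rewrite [t + _]addrC subrK; apply=> // u /andP[u0 us].
  have uI : 0 <= t + u <= T by rewrite addr_ge0//=; lra.
  by apply: is_deriveB; apply: is_derive_shift_time; [exact: (P1 _ uI).2|exact: (P2 _ uI).2].
have ud : `|t + u - t| < d.
  by rewrite addrAC subrr add0r ger0_norm// (le_lt_trans us).
rewrite addr0; apply: LF; first by apply: D1; exact: lt_le_trans dd1.
by rewrite ct; apply: D2; exact: lt_le_trans dd2.
Qed.

Lemma ode_unique E (F : E -> E) (U : set E) (T : R) (c1 c2 : R -> E) :
  open U -> class_C 1 U F ->
  (forall t, `|t| < T -> U (c1 t) /\ is_derive (t : R^o) 1 (c1 : R^o -> E) (F (c1 t))) ->
  (forall t, `|t| < T -> U (c2 t) /\ is_derive (t : R^o) 1 (c2 : R^o -> E) (F (c2 t))) ->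
  c1 0 = c2 0 -> forall t, `|t| < T -> c1 t = c2 t.
Proof.
move=> oU cF P1 P2 c0 t tT.
have in_ s : 0 <= s <= `|t| -> `|s| < T.
  by move=> /andP[s0 st]; rewrite ger0_norm// (le_lt_trans st).
have [t0|t0] := leP 0 t.
  apply: (@ode_unique_right E F U `|t| c1 c2) => //; last by rewrite t0 ger0_norm /=.
    by move=> s /in_/P1.
  by move=> s /in_/P2.
have refl (c : R -> E) : (forall t, `|t| < T -> U (c t) /\ is_derive (t : R^o) 1 (c : R^o -> E) (F (c t))) ->
    forall s, 0 <= s <= `|t| -> U (c (- s)) /\
      is_derive (s : R^o) 1 ((fun s => c (- s)) : R^o -> E) (- F (c (- s))).
  move=> P s /in_ sI; have sI' : `|- s| < T by rewrite normrN.
  have [Us ds] := P _ sI'; split=> //.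
  by have := derive_reflect ds; rewrite opprK.
have := @ode_unique_right E (fun x => - F x) U `|t| (fun s => c1 (- s)) (fun s => c2 (- s)) oU.
move=> /(_ (class_C_opp oU cF) (refl _ P1) (refl _ P2)).
rewrite oppr0 => /(_ c0 (- t)); rewrite opprK; apply.
by rewrite oppr_ge0 (ltW t0) ltr0_norm /=.
Qed.

Lemma flows_sub E (F : E -> E) (B B' : set E) (tau tau' : R) phi (V V' : set E) :
  B' `<=` B -> tau' <= tau -> V `<=` V' -> flows F B tau phi V -> flows F B' tau' phi V'.
Proof.
move=> BB tt VV P x /BB/P[x1 x2]; split=> // t tt'.
have [/VV Vx dx] := x2 t (lt_le_trans tt' tt); by split.
Qed.

Lemma flows_init E (F : E -> E) (B : set E) (tau : R) phi (V : set E) :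
  0 < tau -> flows F B tau phi V -> B `<=` V.
Proof.
move=> tau0 P x /P[x1 x2]; have := x2 0; rewrite normr0 => /(_ tau0)[].
by rewrite x1.
Qed.

(** Common constants for the field and its tangent field. The orbits of [psi] are also kept within
    [rho1] of [(x0, 0)], the radius that an induction on the tangent field will prescribe. *)
Lemma flow_setup E (F : E -> E) (U : set E) x0 (rho1 : R) :
  geo_complete E -> open U -> smooth_on U F -> U x0 -> 0 < rho1 ->
  exists2 rho, 0 < rho & exists2 tau0, 0 < tau0 & exists rho2 L K s0 psi,
    [/\ [/\ 0 <= L, 0 <= K, L * tau0 <= 2^-1, 0 < s0 & rho <= rho2],
      forall x y, `|x - x0| < rho2 -> `|y - x0| < rho2 -> `|F x - F y| <= L * `|x - y|,
      forall x v, `|x - x0| < rho2 -> `|'d F x v| <= L * `|v|,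
      forall x y, `|x - x0| < rho2 -> `|y - x0| < rho2 ->
        `|F y - F x - 'd F x (y - x)| <= K * `|y - x| * `|y - x| &
      forall B, B `<=` nball x0 rho ->
        flows (tangent_field F) (B `*` nball 0 s0) tau0 psi
           (nball x0 rho2 `*` setT `&` nball (x0, 0) rho1)].
Proof.
move=> cE oU sF Ux0 rho10.
have [r1 r10 [L L0 [_ dFL FL]]] := class_C1_lip oU Ux0 (sF 1%N).
have [r2 r20 [K K0 FK]] := class_C2_taylor oU Ux0 (sF 2%N).
have oU' : open (U `*` setT : set (E * E)) by exact: openMT.
pose rho2 := Num.min r1 r2.
have rho20 : 0 < rho2 by rewrite lt_min r10.
have rr1 : rho2 <= r1 by rewrite ge_min lexx.
have rr2 : rho2 <= r2 by rewrite ge_min lexx orbT.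
clearbody rho2.
have rho30 : 0 < Num.min rho2 rho1 by rewrite lt_min rho20.
have Ux0' : (U `*` setT) (x0, 0 : E) by split.
have [s0 s00 [tau tau0 [psi psiP]]] := local_existence (geo_complete_pair cE cE) oU' Ux0'
  (tangent_field_smooth oU sF 1%N) rho30.
exists (Num.min s0 rho2); first by rewrite lt_min s00.
exists (Num.min tau (2^-1 / L)); first by rewrite lt_min tau0 divr_gt0// invr_gt0.
exists rho2, L, K, s0, psi; split.
- by split; rewrite ?(ltW L0) ?(ltW K0)// ?ge_min ?lexx ?orbT// mulrC -ler_pdivlMr// ge_min lexx orbT.
- by move=> x y /lt_le_trans xr /lt_le_trans yr; apply: FL; [exact: xr|exact: yr].
- by move=> x v /lt_le_trans xr; apply: dFL; exact: xr.
- by move=> x y /lt_le_trans xr /lt_le_trans yr; apply: FK; [exact: xr|exact: yr].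
move=> B Bx0; apply: (@flows_sub _ _ _ _ _ _ _ _ _ _ _ _ psiP).
- move=> [x v] [/= /Bx0]; rewrite /nball /= subr0 pair_norm_lt /= subr0 => + ->.
  by rewrite lt_min => /andP[->].
- by rewrite ge_min lexx.
move=> [x v]; rewrite /nball /= pair_norm_lt /= !subr0 !lt_min => /andP[/andP[a b] /andP[_ c]].
by split=> //; rewrite pair_norm_lt /= subr0 b c.
Qed.

(** Induction over all spaces at once, from the tangent flow on [E * E] to the flow on [E]. Every
    flow close to [x0] is covered, because the induction hypothesis has to apply to a [psi] built
    elsewhere. The radius and the time depend on [n], a defect that [flow_smooth_right] repairs. *)
Lemma flow_class n : forall E (F : E -> E) (U : set E) x0,
  geo_complete E -> open U -> smooth_on U F -> U x0 ->
  exists2 rho, 0 < rho & exists2 tau0, 0 < tau0 &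
    forall tau B phi, open B -> tau <= tau0 -> flows F B tau phi (nball x0 rho) ->
      forall t, `|t| < tau -> class_C n B (phi t).
Proof.
elim: n => [|n IH] E F U x0 cE oU sF Ux0.
  have [rho rho0 [tau0 tau00 [rho2 [L [K [s0 [psi [[L0 K0 Ltau _ rr] FL _ _ _]]]]]]]] :=
    flow_setup cE oU sF Ux0 ltr01.
  exists rho => //; exists tau0 => // tau B phi oB tt P t ttau x Bx.
  have P' : flows F B tau phi (nball x0 rho2).
    by apply: flows_sub P => // y; rewrite /nball /= => /lt_le_trans; apply.
  have Ltau' : L * tau <= 2^-1 by rewrite (le_trans _ Ltau)// ler_wpM2l.
  apply/cont_eps => e e0; have [d d0 dB] := (openP B).1 oB x Bx.
  exists (Num.min d (e / 2)) => [|h]; first by rewrite lt_min d0 divr_gt0.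
  rewrite lt_min => /andP[hd he]; have Bxh := dB _ hd.
  apply: le_lt_trans (phi_lip L0 Ltau' FL P' Bxh Bx ttau) _.
  by rewrite addrAC subrr add0r mulrC -ltr_pdivlMr.
have oU' : open (U `*` setT : set (E * E)) by exact: openMT.
have Ux0' : (U `*` setT) (x0, 0 : E) by split.
have [rho1 rho10 [tau1 tau10 H1]] := IH _ _ _ _ (geo_complete_pair cE cE) oU'
  (tangent_field_smooth oU sF) Ux0'.
have [rho rho0 [tau0 tau00 [rho2 [L [K [s0 [psi [[L0 K0 Ltau s00 rr] FL dFL FK psiP]]]]]]]] :=
    flow_setup cE oU sF Ux0 rho10.
exists rho => //; exists (Num.min tau0 tau1) => [|tau B phi oB]; first by rewrite lt_min tau00.
rewrite le_min => /andP[tt0 tt1] P.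
have P' : flows F B tau phi (nball x0 rho2).
  by apply: flows_sub P => // y; rewrite /nball /= => /lt_le_trans; apply.
move=> t ttau; have tau_gt0 : 0 < tau by exact: le_lt_trans ttau.
have Ltau' : L * tau <= 2^-1 by rewrite (le_trans _ Ltau)// ler_wpM2l.
have psiB := psiP B (flows_init tau_gt0 P).
have psi2 : flows (tangent_field F) (B `*` nball 0 s0) tau psi (nball x0 rho2 `*` setT).
  by apply: flows_sub psiB => // z [].
have psi1 : flows (tangent_field F) (B `*` nball 0 s0) tau psi (nball (x0, 0) rho1).
  by apply: flows_sub psiB => // z [].
have oB' : open (B `*` nball (0 : E) s0) by apply: openM => //; exact: nball_open.
apply: (dflow_class L0 K0 Ltau' s00 FL dFL FK oB P' psi2) => //.
exact: H1 tt1 psi1.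
Qed.

Lemma open_nball E (U : set E) x : open U -> U x -> exists2 r, 0 < r & nball x r `<=` U.
Proof.
move=> /openP oU /oU[r r0 rU]; exists r => // y; rewrite /nball /=.
by move=> /rU; rewrite [x + _]addrC subrK.
Qed.

Lemma class_C_flow_box n E (F : E -> E) (U : set E) x0 :
  geo_complete E -> open U -> smooth_on U F -> U x0 ->
  exists2 r, 0 < r & exists2 tau, 0 < tau & exists sigma,
    flows F (nball x0 r) tau sigma U /\
    forall t, `|t| < tau -> class_C n (nball x0 r) (sigma t).
Proof.
move=> cE oU sF Ux0; have [rho rho0 [tau0 tau00 H]] := flow_class n cE oU sF Ux0.
have [r1 r10 r1U] := open_nball oU Ux0.
have m0 : 0 < Num.min rho r1 by rewrite lt_min rho0.
have [r r0 [tau tau_gt0 [sigma sP]]] := local_existence cE oU Ux0 (sF 1%N) m0.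
exists r => //; exists (Num.min tau tau0); first by rewrite lt_min tau_gt0.
exists sigma; split.
  apply: flows_sub sP => //; first by rewrite ge_min lexx.
  move=> y; rewrite /nball /= lt_min => /andP[_ yr]; exact: r1U.
apply: H; first exact: nball_open.
  by rewrite ge_min lexx orbT.
apply: flows_sub sP => //; first by rewrite ge_min lexx.
by move=> y; rewrite /nball /= lt_min => /andP[].
Qed.

(** The flow is fixed before [n], while flow boxes of class [n] shrink with [n]. Near [x], [phi t2]
    is the box flow for time [t2 - t1] after [phi t1], by uniqueness of solutions; real induction in
    time carries the class [n] along the whole orbit, on neighbourhoods that may shrink. *)
Lemma flow_smooth_right n E (F : E -> E) (U B : set E) (T : R) (phi : R -> E -> E) :
  geo_complete E -> open U -> smooth_on U F -> open B ->
  (forall x, B x -> phi 0 x = x /\ forall t, 0 <= t <= T -> U (phi t x) /\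
    is_derive (t : R^o) 1 ((phi^~ x) : R^o -> E) (F (phi t x))) ->
  forall t, 0 <= t <= T -> class_C n B (phi t).
Proof.
move=> cE oU sF oB P t tI; apply: class_C_local => x Bx.
suff: exists2 d, 0 < d & nball x d `<=` B /\ class_C n (nball x d) (phi t).
  move=> [d d0 [dB cd]]; exists (nball x d); split=> //; first exact: nball_open.
  exact: nball_center.
have [x1 x2] := P x Bx.
have key t0 : 0 <= t0 <= T -> exists2 r, 0 < r & exists2 tau, 0 < tau &
    forall t1 t2, 0 <= t1 -> t1 <= t2 -> t2 <= T -> t2 - t1 < tau ->
      `|phi t1 x - phi t0 x| < r ->
      (exists2 d, 0 < d & nball x d `<=` B /\ class_C n (nball x d) (phi t1)) ->
      exists2 d, 0 < d & nball x d `<=` B /\ class_C n (nball x d) (phi t2).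
  move=> t0I; have [r r0 [tau tau0 [sigma [sP sC]]]] := class_C_flow_box n cE oU sF (x2 t0 t0I).1.
  exists r => //; exists tau => // t1 t2 t10 t12 t2T t12tau px [d d0 [dB cd]].
  have /cont_eps pc := class_C_cont cd (nball_center x d0).
  have rp : 0 < r - `|phi t1 x - phi t0 x| by rewrite subr_gt0.
  have [d' d'0 dP] := pc _ rp.
  pose dd := Num.min d d'.
  have dd0 : 0 < dd by rewrite lt_min d0.
  have ddd : nball x dd `<=` nball x d.
    by move=> y; rewrite /nball /= lt_min => /andP[].
  have inr y : nball x dd y -> nball (phi t0 x) r (phi t1 y).
    rewrite /nball /= lt_min => /andP[_ /dP]; rewrite [x + _]addrC subrK => h.
    have -> : phi t1 y - phi t0 x = (phi t1 y - phi t1 x) + (phi t1 x - phi t0 x) by vring R.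
    by apply: le_lt_trans (ler_normD _ _) _; rewrite -ltrBrDr.
  exists dd => //; split; first by move=> y /ddd/dB.
  have t12' : `|t2 - t1| < tau by rewrite ger0_norm ?subr_ge0.
  have oN : open (nball x dd) by exact: nball_open.
  have c1 : class_C n (nball x dd) (fun y => sigma (t2 - t1) (phi t1 y)).
    apply: (@class_C_comp _ n _ _ _ _ (nball (phi t0 x) r) (phi t1)) => //.
      exact: class_C_sub cd.
    exact: sC.
  apply: class_C_ext c1 => // y yd; have [y1 y2] := P y (dB _ (ddd _ yd)).
  have [s1 s2] := sP _ (inr _ yd).
  have := @ode_unique_right E F U (t2 - t1) (fun s => sigma s (phi t1 y)) (fun s => phi (t1 + s) y).
  move=> /(_ oU (sF 1%N)) h; rewrite (h _ _ _ (t2 - t1)).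
  - by rewrite [t1 + _]addrC subrK.
  - move=> s /andP[s0 st]; apply: s2; rewrite ger0_norm//; exact: le_lt_trans t12tau.
  - move=> s /andP[s0 st]; have sI : 0 <= t1 + s <= T by lra.
    have [Us ds] := y2 _ sI; split=> //.
    exact: (@is_derive_shift_time E (phi^~ y)).
  - by rewrite s1 addr0.
  - by rewrite subr_ge0 t12 /=.
move: t tI; apply: (@real_ind _ (fun t => exists2 d, 0 < d & nball x d `<=` B /\ class_C n (nball x d) (phi t)) 0 T).
- have [d d0 dB] := open_nball oB Bx; exists d => //; split=> //.
  apply: class_C_ext (class_C_id _ _); first exact: nball_open.
  by move=> y /dB/P[-> _].
- move=> t0 /andP[t00 t0T] Pt; have t0I : 0 <= t0 <= T by rewrite t00 ltW.
  have [r r0 [tau tau0 H]] := key t0 t0I.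
  exists tau => // s /andP[ts st] sT; apply: (H t0) => //.
  + exact: ltW.
  + by rewrite ltrBlDl.
  + by rewrite subrr normr0.
  by apply: Pt; rewrite t00 lexx.
move=> t0 /andP[t00 t0T] Pt; have t0I : 0 <= t0 <= T by rewrite ltW.
have [r r0 [tau tau0 H]] := key t0 t0I.
have [d d0 dP] := derive_cont (x2 t0 t0I).2 r0.
pose e := Num.min t0 (Num.min d tau) / 2.
have e0 : 0 < e by rewrite divr_gt0// !lt_min t00 d0.
have et : e < t0.
  by rewrite ltr_pdivrMr// (@le_lt_trans _ _ t0) ?ge_min ?lexx// ltr_pMr// ltr1n.
have ed : e < d.
  by rewrite ltr_pdivrMr// (@le_lt_trans _ _ d) ?ge_min ?lexx ?orbT// ltr_pMr// ltr1n.
have etau : e < tau.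
  by rewrite ltr_pdivrMr// (@le_lt_trans _ _ tau) ?ge_min ?lexx ?orbT// ltr_pMr// ltr1n.
clearbody e; apply: (H (t0 - e)) => //.
- by rewrite subr_ge0 ltW.
- by rewrite lerBlDr lerDl ltW.
- by rewrite opprB addrC subrK.
- by apply: dP; rewrite addrAC subrr add0r normrN gtr0_norm.
by apply: Pt; rewrite subr_ge0 (ltW et) ltrBlDr ltrDl.
Qed.

Lemma flow_smooth n E (F : E -> E) (U B : set E) (tau : R) (phi : R -> E -> E) :
  geo_complete E -> open U -> smooth_on U F -> open B -> flows F B tau phi U ->
  forall t, `|t| < tau -> class_C n B (phi t).
Proof.
move=> cE oU sF oB P t ttau.
have in_ s : 0 <= s <= `|t| -> `|s| < tau.
  by move=> /andP[s0 st]; rewrite ger0_norm// (le_lt_trans st).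
have [t0|t0] := leP 0 t.
  apply: (@flow_smooth_right n E F U B `|t| phi) => //; last by rewrite t0 ger0_norm /=.
  by move=> x /P[x1 x2]; split=> // s /in_/x2.
have := @flow_smooth_right n E (fun x => - F x) U B `|t| (fun s => phi (- s)) cE oU.
move=> /(_ (fun m => class_C_opp oU (sF m)) oB _ (- t)); rewrite opprK; apply.
  move=> x /P[x1 x2]; rewrite oppr0; split=> // s /in_ st.
  have st' : `|- s| < tau by rewrite normrN.
  have [Us ds] := x2 _ st'; split=> //.
  by have := derive_reflect ds; rewrite opprK.
by rewrite oppr_ge0 (ltW t0) ltr0_norm /=.
Qed.

Theorem local_flow E (F : E -> E) (U : set E) x0 :
  geo_complete E -> open U -> smooth_on U F -> U x0 ->
  exists2 r, 0 < r & exists2 tau, 0 < tau & exists phi,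
    [/\ nball x0 r `<=` U, flows F (nball x0 r) tau phi U,
        forall t, `|t| < tau -> smooth_on (nball x0 r) (phi t) &
        forall x v t, nball x0 r x -> `|t| < tau ->
          is_derive (t : R^o) 1 ((fun s => 'd (phi s) x v) : R^o -> E)
            ('d F (phi t x) ('d (phi t) x v))].
Proof.
move=> cE oU sF Ux0.
have [rho rho0 [tau0 tau00 [rho2 [L [K [s0 [psi [[L0 K0 Ltau s00 rr] FL dFL FK psiP]]]]]]]] :=
    flow_setup cE oU sF Ux0 ltr01.
have [r1 r10 r1U] := open_nball oU Ux0.
have m0 : 0 < Num.min rho r1 by rewrite lt_min rho0.
have [r r0 [tau tau_gt0 [phi P]]] := local_existence cE oU Ux0 (sF 1%N) m0.
pose t0 := Num.min tau tau0.
have t00 : 0 < t0 by rewrite lt_min tau_gt0.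
have tt : t0 <= tau by rewrite ge_min lexx.
have tt0 : t0 <= tau0 by rewrite ge_min lexx orbT.
clearbody t0.
have PU : flows F (nball x0 r) t0 phi U.
  by apply: flows_sub P => // y; rewrite /nball /= lt_min => /andP[_ yr]; exact: r1U.
exists r => //; exists t0 => //; exists phi; split=> //.
- exact: flows_init PU.
- by move=> t tt1 n; apply: (flow_smooth n cE oU sF _ PU) => //; exact: nball_open.
have P2 : flows F (nball x0 r) t0 phi (nball x0 rho).
  by apply: flows_sub P => // y; rewrite /nball /= lt_min => /andP[].
have P3 : flows F (nball x0 r) t0 phi (nball x0 rho2).
  by apply: flows_sub P2 => // y; rewrite /nball /= => /lt_le_trans; apply.
have psi2 : flows (tangent_field F) (nball x0 r `*` nball 0 s0) t0 psi (nball x0 rho2 `*` setT).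
  by apply: flows_sub (psiP _ (flows_init t00 P2)) => // z [].
have Ltau' : L * t0 <= 2^-1 by rewrite (le_trans _ Ltau)// ler_wpM2l.
move=> x v t xr tt1.
exact: (dflow_derive L0 K0 Ltau' s00 FL dFL FK (@nball_open _ _ _) P3 psi2).
Qed.
End Flows.

(** * The inverse function theorem *)

Section Inverse.
Variable R : realType.
Implicit Types E F G : normedModType R.

Definition bounded_linear E F (A : E -> F) : Prop :=
  linear A /\ exists2 C, 0 < C & forall v, `|A v| <= C * `|v|.

Lemma blD E F (A : E -> F) u v : bounded_linear A -> A (u + v) = A u + A v.
Proof. by move=> [l _]; rewrite -{1}[u]scale1r l scale1r. Qed.

Lemma bl0 E F (A : E -> F) : bounded_linear A -> A 0 = 0.
Proof. by move=> [l _]; have := l 1 0 0; rewrite scaler0 addr0 scale1r => /eqP; rewrite -subr_eq subrr eq_sym => /eqP. Qed.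

Lemma blZ E F (A : E -> F) a u : bounded_linear A -> A (a *: u) = a *: A u.
Proof. by move=> bA; have [l _] := bA; rewrite -[a *: u]addr0 l bl0// addr0. Qed.

Lemma blN E F (A : E -> F) u : bounded_linear A -> A (- u) = - A u.
Proof. by move=> bA; rewrite -scaleN1r blZ// scaleN1r. Qed.

Lemma blB E F (A : E -> F) u v : bounded_linear A -> A (u - v) = A u - A v.
Proof. by move=> bA; rewrite blD// blN. Qed.

Lemma diff_bl E F (f : E -> F) x : differentiable f x -> bounded_linear ('d f x).
Proof.
move=> df; split; first exact: linearP.
by have [C C0 CP] := diff_bounded df; exists C.
Qed.

Lemma bl_comp E F G (A : E -> F) (B : F -> G) :
  bounded_linear A -> bounded_linear B -> bounded_linear (fun v => B (A v)).
Proof.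
move=> bA bB; have [_ [C C0 CP]] := bA; have [_ [D D0 DP]] := bB; split.
  by move=> a u v; rewrite blD// blZ// blD// blZ.
exists (D * C) => [|v]; first exact: mulr_gt0.
by apply: le_trans (DP _) _; rewrite -mulrA ler_wpM2l// ltW.
Qed.

Lemma bl_is_diff E F (A : E -> F) x : bounded_linear A -> is_diff x A A.
Proof.
move=> bA; have [lA [C C0 CP]] := bA; apply: eps_isdiff => //; first by exists C.
move=> e e0; exists 1 => // h _.
have -> : A (x + h) - A x - A h = 0 by rewrite (blD _ _ bA); vring R.
by rewrite normr0 mulr_ge0// ltW.
Qed.

Lemma class_C_bl n E F (U : set E) (A : E -> F) : bounded_linear A -> class_C n U A.
Proof.
move=> [lA [C C0 CP]].
pose A' : {linear E -> F} := HB.pack A (GRing.isLinear.Build _ _ _ _ _ lA).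
by apply: (@class_C_linear _ n E F U A'); exact: (@bounded_linear_cont _ _ _ A' C).
Qed.

Definition inverse_maps E F (A : E -> F) (B : F -> E) :=
  [/\ bounded_linear B, forall v, B (A v) = v & forall w, A (B w) = w].

Lemma inverse_diff E F (V : set F) (f : E -> F) (k : F -> E) y j : open V -> V y ->
  differentiable f (k y) -> (forall z, V z -> f (k z) = z) -> {for y, continuous k} ->
  inverse_maps ('d f (k y)) j -> is_diff y k j.
Proof.
move=> oV Vy df fk /cont_eps kc [bj jd dj]; have [lj [C C0 CP]] := bj.
apply: eps_isdiff => //; first by exists C.
move=> e e0.
(* The first bound gives [C e1 <= 1/2], hence [|D| <= 2 C |h|] for the increment [D] of [k]; the
   second then turns [C e1 |D|] into at most [e |h|]. *)
pose e1 := Num.min (2^-1 / C) (e / (2 * C * C)).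
have CC : 0 < 2 * C * C by rewrite !mulr_gt0.
have e10 : 0 < e1 by rewrite lt_min !divr_gt0// invr_gt0.
have [d1 d10 P1] := diff_eps df e10; have [d2 d20 P2] := kc _ d10.
have [d3 d30 P3] := (openP V).1 oV y Vy.
exists (Num.min d2 d3) => [|h]; first by rewrite lt_min d20.
rewrite lt_min => /andP[h2 h3]; have {}P1 := P1 _ (P2 _ h2).
set D := k (y + h) - k y in P1 *.
have fD : f (k y + D) = y + h by rewrite /D [k y + _]addrC subrK fk//; exact: P3.
rewrite fD fk// [y + h]addrC addrK in P1.
have jD : `|D - j h| <= C * (e1 * `|D|).
  rewrite distrC -{1}(jd D) -(blB _ _ bj); apply: le_trans (CP _) _.
  by rewrite ler_wpM2l// ltW.
have e1a : C * e1 <= 2^-1 by rewrite mulrC -ler_pdivlMr// ge_min lexx.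
have e1b : e1 <= e / (2 * C * C) by rewrite ge_min lexx orbT.
have Dh : `|D| <= 2 * C * `|h|.
  have : `|D| <= `|D - j h| + `|j h| by rewrite -{1}[D](subrK (j h)) ler_normD.
  have := CP h; have : C * (e1 * `|D|) <= 2^-1 * `|D| by rewrite mulrA ler_wpM2r.
  by move: jD; rewrite -[2 * C * _]mulrA; lra.
apply: le_trans jD _; rewrite mulrA.
apply: le_trans (ler_pM _ _ (ler_wpM2l (ltW C0) e1b) Dh) _; rewrite ?mulr_ge0 ?(ltW e10) ?(ltW C0)//.
by have nC := lt0r_neq0 C0; apply: le_of_eq; field.
Qed.

(** Resolvent identity: [z' - z = j y ((df_x - df_x') z' + h')]. As [df] is Lipschitz, the part of
    the right-hand side proportional to [|z' - z|] is at most half of the left and is absorbed. *)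
Lemma inverse_tangent_cont E F (f : E -> F) (k : F -> E) (U : set E) (V : set F)
    (j : F -> F -> E) y w : open U -> class_C 2 U f -> open V -> V y ->
  (forall z, V z -> U (k z)) -> {for y, continuous k} ->
  (forall z, V z -> inverse_maps ('d f (k z)) (j z)) ->
  {for (y, w), continuous (fun z : F * F => j z.1 z.2)}.
Proof.
move=> oU cf oV Vy kU /cont_eps kc jP; apply/cont_eps => e e0 /=.
have [bj jd dj] := jP y Vy; have [_ [C C0 CP]] := bj.
have [r r0 [K K0 KP]] := class_C2_lip oU (kU y Vy) cf.
pose z := j y w; pose N := 2 * C * (K * `|z| + 1).
have N0 : 0 < N by rewrite !mulr_gt0// ltr_wpDl// mulr_ge0// ltW.
pose d := Num.min (Num.min r (2^-1 / (C * K))) (e / N / 2).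
have CK : 0 < C * K by rewrite mulr_gt0.
have d_gt0 : 0 < d by rewrite !lt_min r0 !divr_gt0// invr_gt0.
have dr : d <= r by rewrite !ge_min lexx.
have dK : C * K * d <= 2^-1 by rewrite mulrC -ler_pdivlMr// !ge_min lexx orbT.
have dN : d * N < e.
  have : d <= e / N / 2 by rewrite !ge_min lexx !orbT.
  by rewrite mulrAC ler_pdivlMr// ler_pdivlMr//; have := mulr_gt0 d_gt0 N0; lra.
clearbody d; have [d1 d10 P1] := kc _ d_gt0.
have [d2 d20 P2] := (openP V).1 oV y Vy.
exists (Num.min d (Num.min d1 d2)) => [|[h h']]; first by rewrite !lt_min d_gt0 d10.
rewrite !lt_min !pair_norm_lt /= => /andP[/andP[_ hd]] /andP[/andP[h1 _] /andP[h2 _]].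
have Vh := P2 _ h2; have [bj' jd' dj'] := jP _ Vh.
set z' := j (y + h) (w + h'); rewrite -/z.
have xd := P1 _ h1; set x := k y in xd *; set x' := k (y + h) in xd *.
have ee : z' - z = j y (('d f x z' - 'd f x' z') + h').
  have -> : 'd f x z' - 'd f x' z' + h' = 'd f x z' - w by rewrite dj'; vring R.
  by rewrite blB// jd.
have bd : `|'d f x z' - 'd f x' z'| <= K * d * `|z'|.
  apply: le_trans (KP _ _ _ _ _) _.
  - by rewrite subrr normr0.
  - exact: lt_le_trans dr.
  - by rewrite ler_wpM2r// ler_wpM2l ?(ltW K0)// distrC ltW.
have zz : `|z' - z| <= C * (K * d * (`|z' - z| + `|z|) + d).
  rewrite {1}ee; apply: le_trans (CP _) _; rewrite ler_wpM2l ?(ltW C0)//.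
  apply: le_trans (ler_normD _ _) _; apply: lerD; last exact: ltW.
  apply: le_trans bd _; rewrite ler_wpM2l ?mulr_ge0 ?(ltW K0) ?(ltW d_gt0)//.
  by rewrite -{1}[z'](subrK z) ler_normD.
have : C * K * d * `|z' - z| <= 2^-1 * `|z' - z| by rewrite ler_wpM2r.
move: zz dN; rewrite /N; set a := `|z' - z|; set b := `|z|.
have -> : C * (K * d * (a + b) + d) = C * K * d * a + d * (C * (K * b + 1)) by ring.
have -> : d * (2 * C * (K * b + 1)) = 2 * (d * (C * (K * b + 1))) by ring.
lra.
Qed.

Lemma diff_tangent_field E F (f : E -> F) (U : set E) x v p : open U -> U x ->
  class_C 2 U f -> 'd (tangent_field f) (x, v) p =
    ('d f x p.1, 'd (fun y => 'd f y v) x p.1 + 'd f x p.2).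
Proof.
move=> oU Ux cf; have [df1 /class_CS[df2 _]] := class_CS cf.
have dfst : differentiable (fst : E * E -> E) (x, v).
  by apply: linear_differentiable => z; exact: cvg_fst.
have dfx : differentiable f (fst (x, v)) by exact: df1.
have df3 : differentiable (f \o (fst : E * E -> E)) (x, v) by exact: differentiable_comp.
have df4 : differentiable (fun z : E * E => 'd f (z.1) (z.2)) (x, v) by exact: df2.
have := @diff_pair _ _ _ _ (f \o (fst : E * E -> E)) _ (x, v) df3 df4.
move=> /(congr1 (fun l => l p)) /= ->; congr pair.
  rewrite (diff_comp dfst dfx) /=; congr ('d f x _).
  by rewrite (@diff_lin _ _ _ fst)// => z; exact: cvg_fst.
by case: p => p1 p2; exact: (class_C2_tangent _ _ _ oU Ux cf).
Qed.

(** The map [Tk] inverts the tangent map of [f], and its components are [k] and the differential of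
    [k]. The differential of the tangent map is block triangular with diagonal blocks [df], and [J]
    is its explicit inverse, so the induction hypothesis applies to [Tk] and contains the class of
    the differential of [k]. *)
Lemma class_C_inverse n : forall E F (f : E -> F) (k : F -> E) (U : set E) (V : set F)
    (j : F -> F -> E), open U -> smooth_on U f -> open V ->
  (forall z, V z -> U (k z) /\ f (k z) = z) -> (forall z, V z -> {for z, continuous k}) ->
  (forall z, V z -> inverse_maps ('d f (k z)) (j z)) -> class_C n V k.
Proof.
elim: n => [//|n IH] E F f k U V j oU sf oV kP kc jP.
have dk y : V y -> is_diff y k (j y).
  move=> Vy; apply: (inverse_diff oV Vy _ _ (kc y Vy) (jP y Vy)); last by move=> z /kP[].
  by have [+ _] := class_CS (sf 1%N); apply; exact: (kP y Vy).1.
split=> [y Vy|]; first by have [] := dk y Vy.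
pose Tk (z : F * F) := (k z.1, j z.1 z.2).
pose J (z : F * F) (p : F * F) :=
  (j z.1 p.1, j z.1 (p.2 - 'd (fun y => 'd f y (j z.1 z.2)) (k z.1) (j z.1 p.1))).
have oV' : open (V `*` setT : set (F * F)) by exact: openMT.
have cT : class_C n (V `*` setT) Tk.
  apply: (IH _ _ (tangent_field f) Tk (U `*` setT) _ J).
  - exact: openMT.
  - exact: tangent_field_smooth.
  - exact: oV'.
  - move=> [y w] [/= Vy _]; have [Uy fy] := kP y Vy; split; first by split.
    by rewrite /tangent_field /= fy; have [_ _ ->] := jP y Vy.
  - move=> [y w] [/= Vy _]; apply: cvg_pair.
      apply: (@continuous_comp _ _ _ fst k); first exact: cvg_fst.
      exact: kc.
    apply: (@inverse_tangent_cont E F f k U V j y w oU (sf 2%N) oV Vy) => //; last exact: kc.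
    by move=> z /kP[].
  move=> [y w] [/= Vy _]; have [bj jd dj] := jP y Vy; have [Uy _] := kP y Vy.
  rewrite /Tk /J /=; set x := k y in jd dj Uy *; set v := j y w.
  have d2 : differentiable (fun y => 'd f y v) x by exact: class_C2_diff (sf 2%N).
  have bD := diff_bl d2.
  have dT p := @diff_tangent_field E F f U x v p oU Uy (sf 2%N).
  split.
  - have [l1 [C C0 CP]] := bj; have [l2 [D D0 DP]] := bD; split.
      move=> a [p1 p2] [q1 q2]; rewrite /= l1; congr pair.
      rewrite l2 /=; set D1 := 'd _ x (j y p1); set D2 := 'd _ x (j y q1).
      have -> : a *: p2 + q2 - (a *: D1 + D2) = a *: (p2 - D1) + (q2 - D2) by vring R.
      exact: l1.
    exists (C + C * (1 + D * C)) => [|p].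
      by rewrite addr_gt0// mulr_gt0// addr_gt0// mulr_gt0.
    have h1 : `|j y p.1| <= C * `|p|.
      by apply: le_trans (CP _) _; rewrite ler_wpM2l ?(ltW C0)// norm_fst.
    rewrite pair_norm_le /= mulrDl; apply/andP; split.
      by rewrite (le_trans h1)// lerDl !mulr_ge0 ?addr_ge0 ?mulr_ge0// ltW.
    apply: le_trans (_ : C * (1 + D * C) * `|p| <= _); last by rewrite lerDr mulr_ge0// ltW.
    apply: le_trans (CP _) _; rewrite -mulrA ler_wpM2l ?(ltW C0)//.
    apply: le_trans (ler_normB _ _) _; rewrite mulrDl mul1r; apply: lerD; first exact: norm_snd.
    by apply: le_trans (DP _) _; rewrite -mulrA ler_wpM2l ?(ltW D0).
  - move=> [a b]; rewrite dT /= jd; congr pair.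
    by rewrite [_ + 'd f x b]addrC addrK jd.
  - move=> [a b]; rewrite dT /= !dj; congr pair.
    by rewrite addrC subrK.
apply: (class_C_ext oV' _ (@class_C_comp _ n _ _ _ _ setT _ snd oV' (fun _ _ => I) cT (class_C_snd _ _))).
by move=> [y w] [/= Vy _]; have [_ ->] := dk y Vy.
Qed.

(** Contraction is assumed inside the ball only: the iterates from the centre stay within
    [2 |g x0 - x0| (1 - 2^-n)] of it, hence never leave the ball. *)
Lemma fixed_point E (g : E -> E) x0 (r : R) : geo_complete E ->
  (forall x y, `|x - x0| < r -> `|y - x0| < r -> `|g x - g y| <= 2^-1 * `|x - y|) ->
  2 * `|g x0 - x0| < r -> exists2 x, `|x - x0| <= 2 * `|g x0 - x0| & g x = x.
Proof.
move=> cE gL gr; set D := `|g x0 - x0| in gr *.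
have D0 : 0 <= D by exact: normr_ge0.
pose u n := iter n g x0.
have q0 n : 0 <= (2^-1 : R) ^+ n by rewrite exprn_ge0.
have uP n : `|u n - x0| <= 2 * D * (1 - 2^-1 ^+ n) /\ `|u n.+1 - u n| <= D * 2^-1 ^+ n.
  elim: n => [|n [IH1 IH2]]; first by rewrite /u /= !subrr normr0 !mulr0 expr0 mulr1.
  have qn := q0 n.
  have a : `|u n.+1 - x0| <= 2 * D * (1 - 2^-1 ^+ n.+1).
    have -> : u n.+1 - x0 = (u n.+1 - u n) + (u n - x0) by vring R.
    apply: le_trans (ler_normD _ _) _; apply: le_trans (lerD IH2 IH1) _.
    by rewrite exprS; apply: le_of_eq; field.
  split=> //; apply: le_trans (gL _ _ _ _) _.
  - apply: le_lt_trans gr; apply: le_trans a _.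
    by rewrite ler_piMr ?mulr_ge0// lerBlDr lerDl.
  - apply: le_lt_trans gr; apply: le_trans IH1 _.
    by rewrite ler_piMr ?mulr_ge0// lerBlDr lerDl.
  by rewrite exprS mulrCA ler_wpM2l.
have [l lP] := cE u D (fun n => (uP n).2).
have l0 : `|l - x0| <= 2 * D by have := lP 0%N; rewrite expr0 mulr1 distrC.
exists l => //; apply/eqP; rewrite -subr_eq0 -normr_le0.
apply: (@le_geo _ _ _ (3 * D)) => n; rewrite add0r.
have -> : g l - l = (g l - g (u n)) + (u n.+1 - l) by rewrite /u /=; vring R.
apply: le_trans (ler_normD _ _) _; apply: le_trans (lerD (gL _ _ _ _) (lP _)) _.
- exact: le_lt_trans gr.
- apply: le_lt_trans gr; apply: le_trans (uP n).1 _.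
  by rewrite ler_piMr ?mulr_ge0// lerBlDr lerDl.
have := lP n; rewrite distrC exprS.
have : 0 <= D * 2^-1 ^+ n by rewrite mulr_ge0.
by move: (2^-1 ^+ n) => q; lra.
Qed.

(** The equation [A v = w] is the fixed point equation of [v |-> v - j (A v) + j w], which contracts
    by [1/2]: the Neumann series in the form of a fixed point. *)
Lemma near_inverse E F (A0 A : E -> F) (j : F -> E) : geo_complete E ->
  inverse_maps A0 j -> bounded_linear A ->
  (forall v, `|v - j (A v)| <= 2^-1 * `|v|) -> exists j', inverse_maps A j'.
Proof.
move=> cE [bj jd dj] bA Aj; have [_ [C C0 CP]] := bj.
have Ainj v w : A v = A w -> v = w.
  move=> vw; apply/eqP; rewrite -subr_eq0 -normr_le0.
  have := Aj (v - w); rewrite (blB _ _ bA) vw subrr (bl0 bj) subr0.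
  have := normr_ge0 (v - w); lra.
have jinj v w : j v = j w -> v = w by move=> /(congr1 A0); rewrite !dj.
have ex w : exists v, `|v| <= 2 * `|j w| /\ A v = w.
  pose g v := v - j (A v) + j w.
  have [||v v1 v2] := @fixed_point E g 0 (2 * `|j w| + 1) cE.
  - move=> x y _ _; have := Aj (x - y); rewrite (blB _ _ bA) (blB _ _ bj).
    by have -> : g x - g y = x - y - (j (A x) - j (A y)) by rewrite /g; vring R.
  - by rewrite /g (bl0 bA) (bl0 bj) !subr0 add0r ltrDl.
  exists v; split; first by move: v1; rewrite /g (bl0 bA) (bl0 bj) !subr0 add0r.
  apply: jinj; apply/eqP; rewrite -subr_eq0; apply/eqP.
  have -> : j (A v) - j w = v - g v by rewrite /g; vring R.
  by rewrite v2 subrr.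
have [j' jP] := choice ex; exists j'; split.
- split=> [a u v|]; last first.
    exists (2 * C) => [|v]; first by rewrite mulr_gt0.
    by apply: le_trans (jP v).1 _; rewrite -mulrA ler_wpM2l.
  by apply: Ainj; rewrite (blD _ _ bA) (blZ _ _ bA) !(jP _).2.
- by move=> v; apply: Ainj; rewrite (jP _).2.
- by move=> w; exact: (jP w).2.
Qed.

(** Newton's method with frozen derivative: [g x = x - j (f x)] contracts by [1/2] on a ball where
    [df] stays close to [df_x0]. Solving [f x = y] is finding a fixed point of [g + j y], and the
    same contraction bounds [|x - y|] by [2 C |f x - f y|], which gives injectivity and continuity
    of the inverse. *)
Theorem inverse_function E F (f : E -> F) (U : set E) x0 (j : F -> E) :
  geo_complete E -> open U -> smooth_on U f -> U x0 -> inverse_maps ('d f x0) j ->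
  exists2 r, 0 < r & exists2 rho, 0 < rho & exists k,
    [/\ nball x0 r `<=` U,
        forall y, nball (f x0) rho y -> nball x0 r (k y) /\ f (k y) = y,
        smooth_on (nball (f x0) rho) k &
        forall x, nball x0 r x -> nball (f x0) rho (f x) -> k (f x) = x].
Proof.
move=> cE oU sf Ux0 ij; have [bj jd dj] := ij; have [_ [C C0 CP]] := bj.
have [r1 r10 [K K0 KP]] := class_C2_lip oU Ux0 (sf 2%N).
have [r2 r20 r2U] := open_nball oU Ux0.
pose r := Num.min (Num.min r1 r2) (2^-1 / (C * K)).
have CK : 0 < C * K by rewrite mulr_gt0.
have r0 : 0 < r by rewrite !lt_min r10 r20 divr_gt0// invr_gt0.
have rr1 : r <= r1 by rewrite !ge_min lexx.
have rr2 : r <= r2 by rewrite !ge_min lexx orbT.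
have rCK : C * K * r <= 2^-1 by rewrite mulrC -ler_pdivlMr// !ge_min lexx !orbT.
clearbody r.
have rU : nball x0 r `<=` U by move=> x /lt_le_trans xr; apply: r2U; exact: xr.
have df x : nball x0 r x -> differentiable f x.
  by move=> /rU; have [+ _] := class_CS (sf 1%N); apply.
have near x v : nball x0 r x -> `|v - j ('d f x v)| <= 2^-1 * `|v|.
  move=> xr; rewrite -{1}(jd v) -(blB _ _ bj); apply: le_trans (CP _) _.
  apply: le_trans (ler_wpM2l (ltW C0) (KP _ _ _ _ _)) _.
  - by rewrite subrr normr0.
  - exact: lt_le_trans xr rr1.
  rewrite mulrA ler_wpM2r// mulrA; apply: le_trans rCK.
  by rewrite ler_wpM2l ?(ltW CK)// distrC ltW.
pose g x := x - j (f x).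
have dg x : nball x0 r x -> is_diff x g (fun v => v - j ('d f x v)).
  move=> /df dfx; have dj' := bl_is_diff (f x) bj.
  have h : is_diff x (j \o f) (j \o 'd f x).
    by apply: is_diff_comp dj'; exact: differentiableP.
  exact: (is_diffB (is_diff_id x) h).
have gL x y : nball x0 r x -> nball x0 r y -> `|g x - g y| <= 2^-1 * `|x - y|.
  move=> xr yr; apply: (@mean_value_ball _ E E g x0 r) => // z.
    by move=> /dg[].
  by move=> v zr; have [_ ->] := dg z zr; exact: near.
have jinj v w : j v = j w -> v = w by move=> /(congr1 ('d f x0)); rewrite !dj.
have gjx x y : nball x0 r x -> nball x0 r y -> `|x - y| <= 2 * C * `|f x - f y|.
  move=> xr yr; have := gL x y xr yr; have := CP (f x - f y).
  have -> : x - y = (g x - g y) + j (f x - f y) by rewrite (blB _ _ bj) /g; vring R.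
  by have := ler_normD (g x - g y) (j (f x - f y)); rewrite -mulrA; lra.
have finj x y : nball x0 r x -> nball x0 r y -> f x = f y -> x = y.
  move=> xr yr xy; have := gjx x y xr yr; rewrite xy subrr normr0 mulr0 normr_le0.
  by rewrite subr_eq0 => /eqP.
have x00 := nball_center x0 r0.
have ex y : exists x, nball (f x0) (r / (2 * C)) y -> nball x0 r x /\ f x = y.
  have [yr|yr] := pselect (nball (f x0) (r / (2 * C)) y); last by exists x0.
  pose h x := g x + j y.
  have hx0 : h x0 - x0 = j (y - f x0) by rewrite /h /g (blB _ _ bj); vring R.
  have hr : 2 * `|h x0 - x0| < r.
    rewrite hx0; apply: le_lt_trans (ler_wpM2l _ (CP _)) _ => //.
    move: yr; rewrite /nball /= ltr_pdivlMr ?mulr_gt0//.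
    by have -> : 2 * (C * `|y - f x0|) = `|y - f x0| * (2 * C) by ring.
  have [|x x1 x2] := @fixed_point E h x0 r cE _ hr.
    move=> a b ar br; have := gL a b ar br.
    by have -> : h a - h b = g a - g b by rewrite /h; vring R.
  exists x => _; split; first exact: le_lt_trans hr.
  apply: jinj; apply/eqP; rewrite -subr_eq0; apply/eqP.
  have -> : j (f x) - j y = x - h x by rewrite /h /g; vring R.
  by rewrite x2 subrr.
have [k kP] := choice ex.
have rho0 : 0 < r / (2 * C) by rewrite divr_gt0// mulr_gt0.
exists r => //; exists (r / (2 * C)) => //; exists k; split=> //.
- have oV := @nball_open _ _ (f x0) (r / (2 * C)).
  have ex' z : exists j' : F -> E, nball (f x0) (r / (2 * C)) z ->
      inverse_maps ('d f (k z)) j'.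
    have [zr|zr] := pselect (nball (f x0) (r / (2 * C)) z); last by exists j.
    have [kz _] := kP z zr.
    have [j' j'P] := near_inverse cE ij (diff_bl (df _ kz)) (fun v => near _ v kz).
    by exists j'.
  have [j' jP'] := choice ex'.
  move=> n; apply: (class_C_inverse n oU sf oV _ _ jP').
    by move=> z /kP[/rU]; split.
  move=> z zr; apply/cont_eps => e e0.
  have [d d0 dV] := (openP _).1 oV z zr.
  have C2 : 0 < 2 * C by rewrite mulr_gt0.
  exists (Num.min d (e / (2 * C))) => [|h]; first by rewrite lt_min d0 divr_gt0.
  rewrite lt_min => /andP[hd he]; have zh := dV _ hd.
  have [k1 k2] := kP _ zr; have [k3 k4] := kP _ zh.
  apply: le_lt_trans (gjx _ _ k3 k1) _; rewrite k2 k4 addrAC subrr add0r.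
  by rewrite mulrC -ltr_pdivlMr.
- by move=> x xr fxr; have [k1 k2] := kP _ fxr; apply: finj.
Qed.
End Inverse.

(** * Semidefinite forms and Riesz representation *)

Section Combination.
Variables (R : realType) (V : Type) (comb : V -> R -> V -> V) (b : V -> V -> R) (w0 : V).
Hypotheses (bC : forall u v, b u v = b v u) (b0 : forall u, 0 <= b u u)
  (bD : forall u t v w, b (comb u t v) w = b u w + t * b v w).

Lemma quadratic_disc (p q e : R) : 0 <= q -> (forall t, 0 <= t ^+ 2 * q + 2 * t * p + e) ->
  p ^+ 2 <= e * q.
Proof.
rewrite le_eqVlt => /orP[/eqP<-|q0] h.
  rewrite mulr0; have [->|p0] := eqVneq p 0; first by rewrite expr0n.
  have := h (- (e + 1) / (2 * p)); rewrite mulr0 add0r.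
  rewrite (_ : 2 * (- (e + 1) / (2 * p)) * p + e = -1); last by field.
  by rewrite oppr_ge0 leNgt ltr01.
have := h (- p / q); rewrite (_ : _ + _ + _ = e - p ^+ 2 / q); last first.
  by field; rewrite gt_eqF.
by rewrite subr_ge0 ler_pdivrMr.
Qed.

Let bDD u t v : b (comb u t v) (comb u t v) = b u u + 2 * t * b u v + t ^+ 2 * b v v.
Proof. by rewrite bD ![b _ (comb _ _ _)]bC !bD (bC v u); ring. Qed.

(** [comb u t v] plays the role of [u + t v] on a bare type. Lists of pairs standing for elements of
    [wedge^2] are thus covered, although they do not form a module. *)
Lemma comb_cauchy u v : b u v ^+ 2 <= b u u * b v v.
Proof.
apply: quadratic_disc => // t; have := b0 (comb u t v); rewrite bDD; congr (_ <= _); ring.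
Qed.

(* Near-minimisers of [b w w / 2 - l w] almost represent [l]. *)
Lemma comb_riesz (l : V -> R) (C : R) : (forall u t v, l (comb u t v) = l u + t * l v) ->
  (forall w, l w ^+ 2 <= C * b w w) ->
  forall e, 0 < e -> exists w, forall u, (b w u - l u) ^+ 2 <= e * b u u.
Proof.
move=> ll lC e e0; pose J w := b w w / 2 - l w.
have Jlow w : - (`|C| / 2) <= J w.
  have h : l w ^+ 2 <= `|C| * b w w.
    by apply: le_trans (lC w) _; rewrite ler_wpM2r ?b0// ler_norm.
  have : 2 * l w <= `|C| + b w w.
    rewrite leNgt; apply/negP => h2; have c0 := normr_ge0 C; have bw := b0 w.
    have s0 : 0 <= `|C| + b w w by rewrite addr_ge0.
    have : (`|C| + b w w) ^+ 2 < (2 * l w) ^+ 2 by rewrite ltrXn2r// nnegrE//; lra.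
    have := sqr_ge0 (`|C| - b w w).
    rewrite !expr2 in h *; nra.
  by rewrite /J; lra.
pose S := [set J w | w in [set: V]].
have hS : has_inf S.
  by split; [exists (J w0); exists w0|exists (- (`|C| / 2)) => _ [w _ <-]].
have e2 : 0 < e / 2 by rewrite divr_gt0.
have [_ [w _ <-] wP] := inf_adherent e2 hS.
exists w => u; apply: quadratic_disc; first exact: b0.
move=> t; have : inf S <= J (comb w t u).
  by apply: ge_inf; [case: hS|exists (comb w t u)].
move=> h; have {h} : J w - e / 2 < J (comb w t u).
  by move: wP; rewrite -ltrBlDr => /lt_le_trans; apply.
rewrite /J bDD ll => h.
have -> : t ^+ 2 * b u u + 2 * t * (b w u - l u) + e =
  2 * ((b w w + 2 * t * b w u + t ^+ 2 * b u u) / 2 - (l w + t * l u) -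
   (b w w / 2 - l w - e / 2)) by field.
by rewrite mulr_ge0// subr_ge0 ltW.
Qed.
End Combination.

Section Riesz.
Variable R : realType.
Implicit Types E F G : normedModType R.

Definition psd_form (V : lmodType R) (b : V -> V -> R) : Prop :=
  [/\ forall a x y z, b (a *: x + y) z = a * b x z + b y z,
      forall x y, b x y = b y x & forall x, 0 <= b x x].

Section Form.
Variables (V : lmodType R) (b : V -> V -> R).
Hypothesis fb : psd_form b.

Lemma psd0l z : b 0 z = 0.
Proof.
by have [l _ _] := fb; have := l (-1) 0 0 z; rewrite scaler0 addr0; lra.
Qed.

Lemma psdDl x y z : b (x + y) z = b x z + b y z.
Proof. by have [l _ _] := fb; have := l 1 x y z; rewrite scale1r mul1r. Qed.

Lemma psdZl a x z : b (a *: x) z = a * b x z.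
Proof. by have [l _ _] := fb; have := l a x 0 z; rewrite addr0 psd0l addr0. Qed.

Lemma psdC x y : b x y = b y x.
Proof. by have [_ s _] := fb; exact: s. Qed.

Lemma psdDr x y z : b z (x + y) = b z x + b z y.
Proof. by rewrite psdC psdDl (psdC x) (psdC y). Qed.

Lemma psdZr a x z : b z (a *: x) = a * b z x.
Proof. by rewrite psdC psdZl (psdC x). Qed.

Lemma psdNl x z : b (- x) z = - b x z.
Proof. by rewrite -scaleN1r psdZl mulN1r. Qed.

Lemma psdNr x z : b z (- x) = - b z x.
Proof. by rewrite psdC psdNl (psdC x). Qed.

Lemma psd_ge0 x : 0 <= b x x.
Proof. by have [_ _ p] := fb; exact: p. Qed.

Let combL u t v w : b (u + t *: v) w = b u w + t * b v w.
Proof. by rewrite psdDl psdZl. Qed.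

Lemma psd_cauchy x y : b x y ^+ 2 <= b x x * b y y.
Proof. exact: (comb_cauchy psdC psd_ge0 combL). Qed.

Lemma approx_riesz (l : V -> R) (C : R) :
  (forall a x y, l (a *: x + y) = a * l x + l y) ->
  (forall w, l w ^+ 2 <= C * b w w) ->
  forall e, 0 < e -> exists w, forall u, (b w u - l u) ^+ 2 <= e * b u u.
Proof.
move=> ll; apply: (comb_riesz (comb := fun x t y => x + t *: y) 0 psdC psd_ge0 combL).
by move=> u t v; rewrite addrC ll addrC.
Qed.
End Form.

(** Approximate representers at precision [2^-n] form a geometric sequence: their consecutive
    difference, tested on itself, is bounded below by coercivity. Completeness is that of the given
    norm, which the form is only required to be equivalent to. *)
Lemma riesz E (b : E -> E -> R) (l : E -> R) (c D K : R) : geo_complete E -> psd_form b ->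
  0 < c -> (forall v, c * `|v| ^+ 2 <= b v v) ->
  (forall v, b v v <= D * `|v| ^+ 2) ->
  (forall a x y, l (a *: x + y) = a * l x + l y) -> (forall v, `|l v| <= K * `|v|) ->
  exists z, forall u, b z u = l u.
Proof.
move=> cE fb c0 bc bD ll lK.
pose D1 := `|D| + 1; have D10 : 0 < D1 by rewrite ltr_wpDl.
have bD1 v : b v v <= D1 * `|v| ^+ 2.
  apply: le_trans (bD v) _; rewrite ler_wpM2r ?exprn_ge0//.
  by rewrite (le_trans (ler_norm _))// lerDl.
have lC w : l w ^+ 2 <= K ^+ 2 / c * b w w.
  have : l w ^+ 2 <= (K * `|w|) ^+ 2.
    rewrite -[l w ^+ 2]ger0_norm ?sqr_ge0// normrX lerXn2r ?nnegrE//.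
    by apply: le_trans (lK w).
  move/le_trans; apply; rewrite exprMn -mulrA ler_wpM2l ?sqr_ge0//.
  by rewrite mulrC ler_pdivlMr// mulrC.
have ap n : exists w, forall u, `|b w u - l u| <= 2^-1 ^+ n * `|u|.
  have q0 : 0 < (2^-1 : R) ^+ n by rewrite exprn_gt0// invr_gt0.
  have e0 : 0 < (2^-1 ^+ n) ^+ 2 / D1 by rewrite divr_gt0// exprn_gt0.
  have [w wP] := approx_riesz fb ll lC e0; exists w => u.
  rewrite -(@ler_pXn2r _ 2) ?nnegrE ?mulr_ge0 ?(ltW q0)//.
  rewrite -normrX ger0_norm ?sqr_ge0//; apply: le_trans (wP u) _.
  rewrite exprMn -mulrA ler_wpM2l ?exprn_ge0 ?(ltW q0)//.
  by rewrite mulrC ler_pdivrMr// mulrC.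
have [w wP] := choice ap.
have wC n : `|w n.+1 - w n| <= 2 / c * 2^-1 ^+ n.
  set u := w n.+1 - w n.
  have h : b u u <= 2 * 2^-1 ^+ n * `|u|.
    rewrite {1}/u (psdDl fb) (psdNl fb).
    have := wP n.+1 u; have := wP n u; rewrite exprS => h1 h2.
    have h3 : b (w n.+1) u - b (w n) u <= `|b (w n.+1) u - l u| + `|b (w n) u - l u|.
      apply: le_trans (ler_norm _) _; apply: le_trans (ler_normB _ _).
      by have -> : b (w n.+1) u - l u - (b (w n) u - l u) = b (w n.+1) u - b (w n) u by ring.
    apply: le_trans h3 _; apply: le_trans (lerD h2 h1) _.
    have q0 : 0 <= (2^-1 : R) ^+ n by rewrite exprn_ge0.
    have : 0 <= 2^-1 ^+ n * `|u| by rewrite mulr_ge0.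
    lra.
  have [u0|u0] := eqVneq u 0; first by rewrite u0 normr0 mulr_ge0 ?divr_ge0 ?exprn_ge0// ltW.
  have nu : 0 < `|u| by rewrite normr_gt0.
  have := le_trans (bc u) h; rewrite expr2 mulrA ler_pM2r// mulrC mulrAC.
  by rewrite -ler_pdivlMr// => /le_trans; apply; rewrite mulrAC.
have [z zP] := cE w _ wC; exists z => u.
have bzu x : `|b x u| <= D1 * (`|x| * `|u|).
  rewrite -(@ler_pXn2r _ 2) ?nnegrE ?mulr_ge0 ?(ltW D10)//.
  rewrite -normrX ger0_norm ?sqr_ge0//; apply: le_trans (psd_cauchy fb x u) _.
  apply: le_trans (ler_pM _ _ (bD1 x) (bD1 u)) _; rewrite ?psd_ge0//.
  by apply: le_of_eq; ring.
apply/eqP; rewrite -subr_eq0 -normr_le0.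
apply: (@le_geo _ _ _ ((D1 * (2 * (2 / c)) + 1) * `|u|)) => n; rewrite add0r.
have -> : b z u - l u = (b (w n) u - l u) - b (w n - z) u.
  by rewrite (psdDl fb) (psdNl fb); ring.
apply: le_trans (ler_normB _ _) _; apply: le_trans (lerD (wP n u) (bzu _)) _.
have h : D1 * (`|w n - z| * `|u|) <= D1 * (2 * (2 / c) * 2^-1 ^+ n * `|u|).
  by rewrite ler_wpM2l ?(ltW D10)// ler_wpM2r.
apply: le_trans (lerD (lexx _) h) _; apply: le_of_eq; ring.
Qed.

Lemma derive_inj E (c : R -> E) t v w : is_derive (t : R^o) 1 (c : R^o -> E) v ->
  is_derive (t : R^o) 1 (c : R^o -> E) w -> v = w.
Proof. by move=> [_ <-] [_ <-]. Qed.

Lemma derive_line E F (f : E -> F) z v : differentiable f z ->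
  is_derive (0 : R^o) 1 ((fun s : R => f (z + s *: v)) : R^o -> F) ('d f z v).
Proof.
move=> df; have := @derive_comp _ _ _ f (fun s : R => z + s *: v) 0 v (is_derive_affine z v 0).
by rewrite /= scale0r addr0; exact.
Qed.

Lemma diff_affine E F (f : E -> F) z v w : differentiable f z ->
  (forall s : R, f (z + s *: v) = f z + s *: w) -> 'd f z v = w.
Proof.
move=> /(derive_line v) h fw; apply: (derive_inj h).
rewrite (_ : (fun s : R => _) = fun s : R => f z + s *: w); last exact/funext.
exact: is_derive_affine.
Qed.
End Riesz.

Lemma dot_psd (R : realType) (V : lmodType R) (g : {dot V for idfun}) : psd_form g.
Proof.
split=> [a x y z|x y|x]; first by rewrite linearPl.
- by rewrite hermC expr0 mul1r.
- have [->|/neq0_dnorm_gt0/ltW] := eqVneq x 0; last by apply.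
  by rewrite linear0l.
Qed.

Lemma dot_eq0 (R : realType) (V : lmodType R) (g : {dot V for idfun}) x : g x x = 0 -> x = 0.
Proof.
have [->//|/neq0_dnorm_gt0 h e] := eqVneq x 0.
by have := h _ g; rewrite e ltxx.
Qed.

Section Projections.
Variables (R : realType) (D E F : normedModType R).

Lemma class_C_fstc n (U : set D) (f : D -> E * F) : open U -> class_C n U f ->
  class_C n U (fun x => (f x).1).
Proof.
move=> oU cf.
by apply: (@class_C_comp _ n _ _ _ U setT f fst) => //; exact: class_C_fst.
Qed.

Lemma class_C_sndc n (U : set D) (f : D -> E * F) : open U -> class_C n U f ->
  class_C n U (fun x => (f x).2).
Proof.
move=> oU cf.
by apply: (@class_C_comp _ n _ _ _ U setT f snd) => //; exact: class_C_snd.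
Qed.
End Projections.

Ltac smooth_proj := repeat first
  [ apply: class_C_pair | exact: class_C_id | exact: class_C_cst
  | exact: class_C_fst | exact: class_C_snd
  | apply: class_C_fstc | apply: class_C_sndc | exact: openT | done ].

(** * Smoothness of Riesz representers *)

Section Representer.
Variables (R : realType) (H : hilbertSpace R).
Implicit Types E F G : normedModType R.

Lemma ip_psd : psd_form (ip H).
Proof. exact: dot_psd. Qed.

Lemma ip_le x y : `|ip H x y| <= `|x| * `|y|.
Proof.
rewrite -(@ler_pXn2r _ 2) ?nnegrE ?mulr_ge0// -normrX ger0_norm ?sqr_ge0//.
by rewrite exprMn -!ip_norm; exact: psd_cauchy ip_psd x y.
Qed.

Lemma ip_dual z C : 0 <= C -> (forall w, `|ip H z w| <= C * `|w|) -> `|z| <= C.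
Proof.
move=> C0 zC; have [->|z0] := eqVneq z 0; first by rewrite normr0.
have nz : 0 < `|z| by rewrite normr_gt0.
have := zC z; rewrite ip_norm ger0_norm ?exprn_ge0//.
by rewrite expr2 ler_pM2r.
Qed.

Lemma ip_ext x y : (forall w, ip H x w = ip H y w) -> x = y.
Proof.
move=> xy; apply/eqP; rewrite -subr_eq0; apply/eqP/(@dot_eq0 _ _ (ip H)).
by rewrite (psdDl ip_psd) (psdNl ip_psd) xy subrr.
Qed.

Lemma ip_riesz (l : H -> R) K : (forall a x y, l (a *: x + y) = a * l x + l y) ->
  (forall v, `|l v| <= K * `|v|) -> exists z, forall u, ip H z u = l u.
Proof.
move=> ll lK; apply: (@riesz _ H (ip H) l 1 1 K (@complete_geo _ H) ip_psd) => //.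
  by move=> v; rewrite ip_norm mul1r.
by move=> v; rewrite ip_norm mul1r.
Qed.

Lemma diff_curry1 E F G (f : E * F -> G) y w : differentiable f (y, w) ->
  is_diff y (fun y => f (y, w)) (fun v => 'd f (y, w) (v, 0)).
Proof.
move=> df.
have dp : is_diff y (fun y : E => (y, w)) (fun v => (v, 0)).
  exact: (is_diff_pair (is_diff_id y) (is_diff_cst w y)).
have := @is_diff_comp _ _ _ _ _ _ f _ y dp (differentiableP df).
exact.
Qed.

Lemma diff_curry2 E F G (f : E * F -> G) y w : differentiable f (y, w) ->
  is_diff w (fun w => f (y, w)) (fun v => 'd f (y, w) (0, v)).
Proof.
move=> df.
have dp : is_diff w (fun w : F => (y, w)) (fun v => (0, v)).
  exact: (is_diff_pair (is_diff_cst y w) (is_diff_id w)).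
have := @is_diff_comp _ _ _ _ _ _ f _ w dp (differentiableP df).
exact.
Qed.

Lemma diff_unique_val E F (f : E -> F) x A B : is_diff x f A -> is_diff x f B -> A = B.
Proof. by move=> [_ <-] [_ <-]. Qed.

Lemma diff_linear_param E (F : E * H -> R^o) (W : set E) y a w w' h : open W -> W y ->
  (forall y, W y -> forall a w w', F (y, a *: w + w') = a * F (y, w) + F (y, w')) ->
  (forall y w, W y -> differentiable F (y, w)) ->
  'd F (y, a *: w + w') (h, 0) = a * 'd F (y, w) (h, 0) + 'd F (y, w') (h, 0).
Proof.
move=> oW Wy lF dF.
have d1 := diff_curry1 (dF y (a *: w + w') Wy).
have d2 := diff_curry1 (dF y w Wy); have d3 := diff_curry1 (dF y w' Wy).
have d4 := is_diffD (is_diffZ a d2) d3.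
have [|d5 d6] := @diff_open _ _ _ _ (fun y => F (y, a *: w + w')) W y oW Wy _ (@ex_diff _ _ _ _ _ _ _ d4).
  by move=> z Wz; rewrite lF.
move: d6; rewrite (@diff_val _ _ _ _ _ _ _ d1) (@diff_val _ _ _ _ _ _ _ d4).
by move=> /(congr1 (fun l => l h)).
Qed.

Section Smooth.
Variables (E : normedModType R) (W : set E) (F : E * H -> R^o) (f : E -> H).
Hypotheses (oW : open W) (fF : forall y w, W y -> ip H (f y) w = F (y, w)).

Lemma rep_linear y : W y -> forall a w w', F (y, a *: w + w') = a * F (y, w) + F (y, w').
Proof. by move=> Wy a w w'; rewrite -!fF// (psdDr ip_psd) (psdZr ip_psd). Qed.

(** The partial differential in [y] is regarded as a family of functionals of [w] with parameter
    [(y, h)] near [(x, 0)]. The uniform bound on this family, made homogeneous in [h], controls both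
    variables at once. *)
Lemma rep_d1_bound x : class_C 1 (W `*` setT) F -> class_C 2 (W `*` setT) F -> W x ->
  exists2 r, 0 < r & exists2 M, 0 < M & forall y w h, nball x r y ->
    W y /\ `|'d F (y, w) (h, 0)| <= M * (`|h| * `|w|).
Proof.
move=> cF1 cF Wx; have oW' : open (W `*` setT : set (E * H)) by exact: openMT.
have [dF cdF] := class_CS cF1.
pose A (p : E * E) (w : H) : R^o := 'd F (p.1, w) (p.2, 0).
have lA p : (W `*` setT) p -> linear (A p).
  move=> [/= Wp _] a w w'.
  by apply: (@diff_linear_param E F W p.1 a w w' p.2 oW Wp rep_linear) => y u Wy; exact: dF.
have oWE : open (W `*` setT : set (E * E)) by exact: openMT.
have [//||r r0 [C C0 CP]] := @linear_family_bound _ (E * E)%type H R^o (W `*` setT) A (x, 0) oWE _ lA.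
  pose L (z : (E * E) * H) : (E * H) * (E * H) := ((z.1.1, z.2), (z.1.2, 0)).
  have oD : open ((W `*` setT) `*` setT : set ((E * E) * H)) by exact: openMT.
  have cL : class_C 0 ((W `*` setT) `*` setT) L by rewrite /L; smooth_proj.
  apply: (@class_C_comp _ 0 _ _ _ _ _ L _ oD _ cL cdF); last by split.
  by move=> z [[/= Wz _] _]; split.
exists r => //; exists (C * (2 / r)); first by rewrite mulr_gt0// divr_gt0.
move=> y w h yr; have [|[/= Wy _] _] := CP (y, 0) w.
  by rewrite pair_norm_lt /= subrr normr0 r0 andbT.
split=> //.
have [->|h0] := eqVneq h 0.
  by rewrite (_ : (0, 0) = 0)// d0 !normr0 mul0r mulr0.
have nh : 0 < `|h| by rewrite normr_gt0.
pose a := r / 2 / `|h|; have a0 : 0 < a by rewrite !divr_gt0.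
have ah : `|a *: h| < r.
  rewrite normrZ gtr0_norm// /a divfK ?gt_eqF// ltr_pdivrMr// ltr_pMr// ltr1n //.
have [|_] := CP (y, a *: h) w; first by rewrite pair_norm_lt /= subr0 ah andbT.
have -> : A (y, a *: h) w = a *: 'd F (y, w) (h, 0).
  by rewrite /A -dZ; congr ('d F _ _); congr pair; rewrite scaler0.
rewrite normrZ gtr0_norm// => hh; rewrite -(ler_pM2l a0); apply: le_trans hh _.
have nr := lt0r_neq0 r0; have nn := lt0r_neq0 nh.
by rewrite /a; apply: le_of_eq; field; rewrite nr nn.
Qed.

Lemma rep_lip x : class_C 1 (W `*` setT) F -> class_C 2 (W `*` setT) F -> W x ->
  exists2 r, 0 < r & exists2 M, 0 < M & forall y y', nball x r y -> nball x r y' ->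
    W y /\ `|f y - f y'| <= M * `|y - y'|.
Proof.
move=> cF1 cF Wx; have [r r0 [M M0 MP]] := rep_d1_bound cF1 cF Wx.
have [dF _] := class_CS cF1.
exists r => //; exists M => // y y' yr y'r.
have [Wy _] := MP y 0 0 yr; have [Wy' _] := MP y' 0 0 y'r; split=> //.
apply: ip_dual => [|w]; first by rewrite mulr_ge0// ltW.
rewrite (psdDl ip_psd) (psdNl ip_psd) !fF// mulrAC -mulrA [`|w| * _]mulrC mulrA.
have -> : M * `|y - y'| * `|w| = (M * `|w|) * `|y - y'| by ring.
apply: (@mean_value_ball _ E R^o (fun y => F (y, w)) x r) => // z.
  move=> /MP-/(_ w 0)[Wz _].
  exact: (@ex_diff _ _ _ _ _ _ _ (diff_curry1 (dF (z, w) (conj Wz I)))).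
move=> v /MP-/(_ w v)[Wz]; have -> := @diff_val _ _ _ _ _ _ _ (diff_curry1 (dF (z, w) (conj Wz I))).
by have -> : M * `|w| * `|v| = M * (`|v| * `|w|) by ring.
Qed.
End Smooth.

Lemma linear_scale_bound E F (A : E -> F) (r M : R) : 0 < r -> bounded_linear A ->
  (forall v, `|v| < r -> `|A v| <= M) -> forall v, `|A v| <= 2 / r * M * `|v|.
Proof.
move=> r0 bA AM v; have [->|v0] := eqVneq v 0; first by rewrite bl0// !normr0 mulr0.
have nv : 0 < `|v| by rewrite normr_gt0.
pose a := r / 2 / `|v|; have a0 : 0 < a by rewrite !divr_gt0.
have := AM (a *: v); rewrite normrZ gtr0_norm// {1}/a divfK ?gt_eqF//.
rewrite ltr_pdivrMr// ltr_pMr// ltr1n => /(_ isT).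
rewrite blZ// normrZ gtr0_norm// => h; rewrite -(ler_pM2l a0); apply: le_trans h _.
have nr := lt0r_neq0 r0; have nn := lt0r_neq0 nv.
by rewrite /a; apply: le_of_eq; field; rewrite nr nn.
Qed.

(** Weak smoothness implies smoothness: [f] is known only through the scalar function [<f y, w>].
    The partial differential of [F] in [y] is linear and bounded in [w], hence has a representer
    [g], to which the same statement applies one order lower; [g] is then shown to be the tangent
    map of [f]. *)
Lemma representer_class n : forall E (W : set E) (F : E * H -> R^o) (f : E -> H),
  open W -> smooth_on (W `*` setT) F ->
  (forall y w, W y -> ip H (f y) w = F (y, w)) -> class_C n W f.
Proof.
elim: n => [|n IH] E W F f oW sF fF.
  move=> x Wx; have [r r0 [M M0 MP]] := rep_lip oW fF (sF 1%N) (sF 2%N) Wx.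
  apply/cont_eps => e e0; exists (Num.min r (e / M)) => [|h].
    by rewrite lt_min r0 divr_gt0.
  rewrite lt_min => /andP[hr he].
  have [||_] := MP (x + h) x; first by rewrite /nball /= addrAC subrr add0r.
    exact: nball_center.
  rewrite [x + h]addrC addrK => /le_lt_trans; apply.
  by rewrite mulrC -ltr_pdivlMr.
have [dF cdF] := class_CS (sF 1%N).
have lF := rep_linear fF.
pose F1 (p : (E * E) * H) : R^o := 'd F (p.1.1, p.2) (p.1.2, 0).
have oWE : open (W `*` setT : set (E * E)) by exact: openMT.
have oD : open ((W `*` setT) `*` setT : set ((E * E) * H)) by exact: openMT.
have sF1 : smooth_on ((W `*` setT) `*` setT) F1.
  move=> m; have [_ cd] := class_CS (sF m.+1).
  pose L (z : (E * E) * H) : (E * H) * (E * H) := ((z.1.1, z.2), (z.1.2, 0)).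
  have cL : class_C m ((W `*` setT) `*` setT) L by rewrite /L; smooth_proj.
  apply: (@class_C_comp _ m _ _ _ _ _ L _ oD _ cL cd).
  by move=> z [[/= Wz _] _]; split.
have exg p : exists z, W p.1 -> forall w, ip H z w = F1 (p, w).
  have [Wp|] := pselect (W p.1); last by exists 0.
  have [r r0 [M M0 MP]] := rep_d1_bound oW fF (sF 1%N) (sF 2%N) Wp.
  have [||z zP] := @ip_riesz (fun w => F1 (p, w)) (M * `|p.2|); last by exists z.
    move=> a w w'; apply: (@diff_linear_param E F W p.1 a w w' p.2 oW Wp lF) => y u Wy; exact: dF.
  by move=> w; rewrite -mulrA; exact: (MP p.1 w p.2 (nball_center _ r0)).2.
have [g gP] := choice exg.
have gF1 p w : (W `*` setT) p -> ip H (g p) w = F1 (p, w) by move=> [/gP].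
have cg := IH _ _ F1 g oWE sF1 gF1.
have bg y : W y -> bounded_linear (fun v => g (y, v)).
  move=> Wy; have [r r0 [M M0 MP]] := rep_d1_bound oW fF (sF 1%N) (sF 2%N) Wy; split.
    move=> a u v; apply: ip_ext => w.
    rewrite (psdDl ip_psd) (psdZl ip_psd) !gF1//; rewrite /F1 /=.
    have -> : (a *: u + v, 0) = a *: (u, 0) + (v, 0) :> E * H.
      by apply: injective_projections; rewrite /= ?scaler0 ?addr0.
    by rewrite dD dZ.
  exists M => // v; apply: ip_dual => [|w]; first by rewrite mulr_ge0// ltW.
  by rewrite gF1// -mulrA; exact: (MP y w v (nball_center _ r0)).2.
have df x : W x -> is_diff x f (fun v => g (x, v)).
  move=> Wx; have bgx := bg x Wx; have [l1 [C C0 CP]] := bgx.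
  have [//|r r0 [M M0 MP]] := @rep_lip _ (W `*` setT) F1 g oWE gF1 (x, 0) (sF1 1%N) (sF1 2%N).
  (* Lipschitz dependence of [g] near [(x, 0)], made homogeneous in [v]: the operators [g (y, .)]
     are norm continuous at [y = x], which is what Frechet differentiability of [f] requires. *)
  have gx y v : nball x r y -> `|g (y, v) - g (x, v)| <= 2 / r * M * `|y - x| * `|v|.
    move=> yr; have [|[Wy _] _] := MP (y, 0) (x, 0) _ (nball_center _ r0).
      by rewrite /nball /= pair_norm_lt /= subrr normr0 r0 andbT.
    rewrite -[2 / r * M * _]mulrA.
    apply: (@linear_scale_bound _ _ (fun v => g (y, v) - g (x, v)) r (M * `|y - x|) r0).
      have bgy := bg y Wy; have [ly [Cy Cy0 CyP]] := bgy; split.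
        by move=> a u v'; rewrite ly l1; vring R.
      exists (Cy + C) => [|u]; first exact: addr_gt0.
      by rewrite mulrDl (le_trans (ler_normB _ _))// lerD.
    move=> u ur; have [||_] := MP (y, u) (x, u).
    - by rewrite /nball /= pair_norm_lt /= subr0 ur andbT.
    - by rewrite /nball /= pair_norm_lt /= subrr normr0 r0 subr0 ur.
    move/le_trans; apply; rewrite ler_wpM2l ?(ltW M0)//.
    by rewrite pair_norm_le /= subrr normr0 normr_ge0 lexx.
  pose K := 2 / r * M; have K0 : 0 < K by rewrite mulr_gt0// divr_gt0.
  rewrite -/K in gx; clearbody K.
  apply: eps_isdiff => //; first by exists C.
  move=> e e0; exists (Num.min (r / 2) (e / (2 * K))) => [|h].
    by rewrite lt_min !divr_gt0// mulr_gt0.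
  rewrite lt_min => /andP[hr he].
  have [->|h0] := eqVneq h 0; first by rewrite addr0 (bl0 bgx) subrr subr0 !normr0 mulr0.
  have nh : 0 < `|h| by rewrite normr_gt0.
  have K2h : K * (2 * `|h|) <= e.
    by move: he; rewrite ltr_pdivlMr ?mulr_gt0// => he; apply: le_trans (ltW he); apply: le_of_eq; ring.
  apply: ip_dual => [|w]; first by rewrite mulr_ge0// ltW.
  have inr y : nball x (2 * `|h|) y -> nball x r y.
    by move=> /lt_trans; apply; move: hr; lra.
  have Winr y : nball x r y -> W y.
    move=> yr; have [|[Wy _] _] := MP (y, 0) (x, 0) _ (nball_center _ r0) => //.
    by rewrite /nball /= pair_norm_lt /= subrr normr0 r0 andbT.
  pose l (y : E) : R^o := 'd F (x, w) (y, 0).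
  have bl : bounded_linear l.
    have [_ [C1 C10 C1P]] := diff_bl (dF (x, w) (conj Wx I)); split.
      move=> a u v; rewrite /l -dZ -dD; congr ('d F _ _).
      by apply: injective_projections; rewrite /= ?scaler0 ?addr0.
    exists C1 => // v; apply: le_trans (C1P _) _; rewrite ler_wpM2l ?(ltW C10)//.
    by rewrite pair_norm_le /= normr0 normr_ge0 lexx.
  have de y : nball x (2 * `|h|) y ->
      is_diff y (fun y => F (y, w) - l y) (fun v => 'd F (y, w) (v, 0) - l v).
    move=> /inr/Winr Wy.
    exact: (is_diffB (diff_curry1 (dF (y, w) (conj Wy I))) (bl_is_diff y bl)).
  have -> : ip H (f (x + h) - f x - g (x, h)) w = (F (x + h, w) - l (x + h)) - (F (x, w) - l x).
    have xh : nball x (2 * `|h|) (x + h).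
      by rewrite /nball /= addrAC subrr add0r; move: nh; lra.
    rewrite !(psdDl ip_psd) !(psdNl ip_psd) !fF//; last exact/Winr/inr.
    rewrite gF1// (blD _ _ bl) /F1 /= -/(l h); ring.
  apply: (le_trans (@mean_value_ball _ E R^o (fun y => F (y, w) - l y) x (2 * `|h|)
     (e * `|w|) x (x + h) _ _ _ _)).
  - by move=> z /de[].
  - move=> z v zr; have [_ ->] := de z zr.
    have Wz := Winr _ (inr _ zr).
    have -> : 'd F (z, w) (v, 0) - l v = ip H (g (z, v) - g (x, v)) w.
      by rewrite (psdDl ip_psd) (psdNl ip_psd) !gF1.
    apply: le_trans (ip_le _ _) _.
    apply: le_trans (ler_wpM2r _ (gx z v (inr _ zr))) _ => //.
    have -> : e * `|w| * `|v| = e * `|v| * `|w| by ring.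
    rewrite ler_wpM2r// ler_wpM2r//; apply: le_trans K2h.
    by rewrite ler_wpM2l ?(ltW K0)// ltW.
  - by rewrite subrr normr0 mulr_gt0.
  - by rewrite addrAC subrr add0r; move: nh; lra.
  by rewrite addrAC subrr add0r; apply: le_of_eq; ring.
split=> [x Wx|]; first by have [] := df x Wx.
apply: class_C_ext cg => // -[x v] [/= Wx _].
by have [_ ->] := df x Wx.
Qed.
End Representer.

(** * Riemannian metrics and Christoffel symbols in a chart *)

Section LocalMetric.
Variables (R : realType) (H : hilbertSpace R).
Implicit Types E F : normedModType R.

Lemma is_diff_open E F (f g A : E -> F) (U : set E) x : open U -> U x ->
  (forall y, U y -> f y = g y) -> is_diff x f A -> is_diff x g A.
Proof.
move=> oU Ux fg dA; have [dg e] := diff_open oU Ux fg (@ex_diff _ _ _ _ _ _ _ dA).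
apply: DiffDef => //; exact: etrans e (@diff_val _ _ _ _ _ _ _ dA).
Qed.

Lemma is_diff_inj E F (f A B : E -> F) x u : is_diff x f A -> is_diff x f B -> A u = B u.
Proof. by move=> dA dB; rewrite (diff_unique_val dA dB). Qed.

Definition koszul (G : H -> H -> H -> R) (x u v w : H) : R :=
  'D_u (fun y => G y v w : R^o) x + 'D_v (fun y => G y u w : R^o) x
  - 'D_w (fun y => G y u v : R^o) x.

(** The body of [christoffel] with the metric abstracted; for [form_in_chart g q] the two are
    convertible. *)
Definition chris (G : H -> H -> H -> R) (x u v : H) : H :=
  xget 0 [set z : H | forall w : H, 2 * G x z w = koszul G x u v w].

Record local_metric (Om : set H) (G : H -> H -> H -> R) : Prop := LocalMetric {
  lm_open : open Om;
  lm_form : forall x, Om x -> psd_form (G x);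
  lm_coercive : forall x, Om x -> exists c D : R, 0 < c /\
    forall v, c * `|v| ^+ 2 <= G x v v <= D * `|v| ^+ 2;
  lm_smooth : smooth_on (Om `*` (setT `*` setT))
    (fun z : H * (H * H) => G z.1 z.2.1 z.2.2 : R^o) }.

Variables (Om : set H) (G : H -> H -> H -> R).
Hypothesis mG : local_metric Om G.
Let oOm : open Om := lm_open mG.
Let oOmT : open (Om `*` setT : set (H * H)). Proof. exact: openMT. Qed.
Let oOmTT : open (Om `*` setT : set (H * (H * H))). Proof. exact: openMT. Qed.

Lemma lm_bound x : Om x -> exists2 D, 0 < D & forall u v, `|G x u v| <= D * (`|u| * `|v|).
Proof.
move=> Ox; have fG := lm_form mG Ox; have [c [D [c0 cD]]] := lm_coercive mG Ox.
have D0 : 0 < `|D| + 1 by rewrite ltr_wpDl.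
exists (`|D| + 1) => // u v.
have GD w : G x w w <= (`|D| + 1) * `|w| ^+ 2.
  have /andP[_ h] := cD w; apply: le_trans h _; rewrite ler_wpM2r ?exprn_ge0//.
  by rewrite (le_trans (ler_norm _))// lerDl.
rewrite -(@ler_pXn2r _ 2) ?nnegrE ?mulr_ge0 ?(ltW D0)// -normrX ger0_norm ?sqr_ge0//.
apply: le_trans (psd_cauchy fG u v) _.
apply: le_trans (ler_pM _ _ (GD u) (GD v)) _; rewrite ?psd_ge0//.
by apply: le_of_eq; ring.
Qed.

Lemma lm_riesz x (l : H -> R) K : Om x -> (forall a u v, l (a *: u + v) = a * l u + l v) ->
  (forall v, `|l v| <= K * `|v|) -> exists z, forall u, G x z u = l u.
Proof.
move=> Ox ll lK; have [c [D [c0 cD]]] := lm_coercive mG Ox.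
apply: (@riesz _ H (G x) l c D K (@complete_geo _ H) (lm_form mG Ox)) => //.
  by move=> v; have /andP[] := cD v.
by move=> v; have /andP[] := cD v.
Qed.

Lemma lm_inj x z z' : Om x -> (forall u, G x z u = G x z' u) -> z = z'.
Proof.
move=> Ox zz; have fG := lm_form mG Ox; have [c [D [c0 cD]]] := lm_coercive mG Ox.
have /andP[h _] := cD (z - z'); move: h.
rewrite {1}(psdDl fG) (psdNl fG) zz subrr pmulr_rle0// => h.
by apply/eqP; rewrite -subr_eq0 -normr_eq0 -sqrf_eq0 eq_le h exprn_ge0.
Qed.

(** The metric at [p.1] lowered against the fixed inner product of [H]: the bounded operator
    representing [G x]. It turns statements on the varying form [G] into statements on vectors of
    [H]. *)
Definition flat (p : H * H) : H := xget 0 [set y | forall w, ip H y w = G p.1 p.2 w].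

Lemma flatP x z w : Om x -> ip H (flat (x, z)) w = G x z w.
Proof.
move=> Ox; have fG := lm_form mG Ox; have [D D0 DP] := lm_bound Ox.
have [||y yP] := @ip_riesz _ H (G x z) (D * `|z|).
- by move=> a u v; rewrite (psdDr fG) (psdZr fG).
- by move=> v; rewrite -mulrA.
by rewrite /flat; case: xgetP => [y' _ +|/(_ y)//]; exact.
Qed.

Lemma flat_smooth : smooth_on (Om `*` setT) flat.
Proof.
move=> n; pose F (p : (H * H) * H) : R^o := G p.1.1 p.1.2 p.2.
have oD : open ((Om `*` setT) `*` setT : set ((H * H) * H)) by exact: openMT.
apply: (@representer_class _ _ n _ _ F flat oOmT) => [m|[x z] w [/= Ox _]]; last exact: flatP.
pose L (p : (H * H) * H) : H * (H * H) := (p.1.1, (p.1.2, p.2)).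
have cL : class_C m ((Om `*` setT) `*` setT) L by rewrite /L; smooth_proj.
apply: (@class_C_comp _ m _ _ _ _ _ L _ oD _ cL (lm_smooth mG m)).
by move=> p [[/= Op _] _]; split.
Qed.

Lemma flat_diff x z : Om x -> differentiable flat (x, z).
Proof. by move=> Ox; have [+ _] := class_CS (flat_smooth 1%N); apply. Qed.

Lemma flat_linear x : Om x -> bounded_linear (fun z => flat (x, z)).
Proof.
move=> Ox; have fG := lm_form mG Ox; have [D D0 DP] := lm_bound Ox; split.
  move=> a u v; apply: ip_ext => w.
  by rewrite (psdDl (ip_psd H)) (psdZl (ip_psd H)) !flatP// (psdDl fG) (psdZl fG).
exists D => // v; apply: ip_dual => [|w]; first by rewrite mulr_ge0// ltW.
by rewrite flatP// -mulrA.
Qed.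

Lemma flat_diff2 x z h v : Om x ->
  'd flat (x, z) (h, v) = 'd flat (x, z) (h, 0) + flat (x, v).
Proof.
move=> Ox; have bl := flat_linear Ox.
have -> : (h, v) = (h, 0) + (0, v) by apply: injective_projections; rewrite /= ?addr0 ?add0r.
rewrite dD; congr (_ + _); apply: diff_affine; first exact: flat_diff.
move=> s; have -> : (x, z) + s *: (0, v) = (x, z + s *: v).
  by apply: injective_projections; rewrite /= ?scaler0 ?addr0.
by rewrite (blD _ _ bl) (blZ _ _ bl).
Qed.

Definition sharp (p : H * H) : H := xget 0 [set z | flat (p.1, z) = p.2].

Lemma sharpP x y : Om x -> flat (x, sharp (x, y)) = y.
Proof.
move=> Ox; have [||z zP] := @lm_riesz x (ip H y) `|y| Ox.
- by move=> a u v; rewrite (psdDr (ip_psd H)) (psdZr (ip_psd H)).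
- by move=> v; exact: ip_le.
have h : flat (x, z) = y by apply: ip_ext => w; rewrite flatP.
by rewrite /sharp; case: xgetP => [z' _ +|/(_ z)//]; exact.
Qed.

Lemma flat_inj x z z' : Om x -> flat (x, z) = flat (x, z') -> z = z'.
Proof. by move=> Ox zz; apply: (lm_inj Ox) => u; rewrite -!flatP// zz. Qed.

Lemma flatK x z : Om x -> sharp (x, flat (x, z)) = z.
Proof. by move=> Ox; apply: (flat_inj Ox); rewrite sharpP. Qed.

Lemma sharp_linear x : Om x -> bounded_linear (fun y => sharp (x, y)).
Proof.
move=> Ox; have bl := flat_linear Ox; split.
  by move=> a u v; apply: (flat_inj Ox); rewrite (blD _ _ bl) (blZ _ _ bl) !sharpP.
have [c [D [c0 cD]]] := lm_coercive mG Ox.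
exists c^-1 => [|y]; first by rewrite invr_gt0.
set z := sharp (x, y); have [->|z0] := eqVneq z 0; first by rewrite normr0 mulr_ge0// invr_ge0 ltW.
have nz : 0 < `|z| by rewrite normr_gt0.
have /andP[h _] := cD z; rewrite mulrC ler_pdivlMr// mulrC -(ler_pM2r nz) -mulrA -expr2.
apply: le_trans h _; rewrite -flatP// sharpP//.
by apply: le_trans (ler_norm _) _; exact: ip_le.
Qed.

(** The map [(x, z) |-> (x, flat (x, z))] has an invertible differential at every point, so the
    inverse function theorem applies to it; the second component of the local inverse is [sharp]. *)
Lemma sharp_smooth : smooth_on (Om `*` setT) sharp.
Proof.
move=> n; apply: class_C_local => -[x y] [/= Ox _].
pose f (p : H * H) := (p.1, flat p); pose z := sharp (x, y).
have sf : smooth_on (Om `*` setT) f.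
  by move=> m; apply: class_C_pair => //; [exact: class_C_fst|exact: flat_smooth].
pose j (p : H * H) := (p.1, sharp (x, p.2 - 'd flat (x, z) (p.1, 0))).
have bs := sharp_linear Ox; have bd := diff_bl (flat_diff z Ox).
have df p : 'd f (x, z) p = (p.1, 'd flat (x, z) p).
  have dfst : differentiable (fst : H * H -> H) (x, z).
    by apply: linear_differentiable => q; exact: cvg_fst.
  have := @diff_pair _ _ _ _ (fst : H * H -> H) flat (x, z) dfst (flat_diff z Ox).
  move=> /(congr1 (fun l => l p)) /= ->; congr pair.
  by rewrite (@diff_lin _ _ _ fst)// => q; exact: cvg_fst.
have ij : inverse_maps ('d f (x, z)) j.
  have bl1 : bounded_linear (fun p : H * H => p.2 - 'd flat (x, z) (p.1, 0)).
    have [ld [C C0 CP]] := bd; split.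
      move=> a [u1 u2] [v1 v2] /=.
      have -> : (a *: u1 + v1, 0) = a *: (u1, 0) + (v1, 0) :> H * H.
        by apply: injective_projections; rewrite /= ?scaler0 ?addr0.
      rewrite ld; set D1 := 'd _ _ _; set D2 := 'd _ _ _; vring R.
    exists (1 + C) => [|p]; first exact: addr_gt0.
    apply: le_trans (ler_normB _ _) _; rewrite mulrDl mul1r; apply: lerD; first exact: norm_snd.
    apply: le_trans (CP _) _; rewrite ler_wpM2l ?(ltW C0)// pair_norm_le /= normr0 normr_ge0 andbT.
    exact: norm_fst.
  have [l2 [C C0 CP]] := bl_comp bl1 bs.
  split.
  - split; first by move=> a u v; rewrite /j /= l2.
    exists (1 + C) => [|p]; first exact: addr_gt0.
    rewrite pair_norm_le /= mulrDl mul1r; apply/andP; split.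
      by apply: le_trans (norm_fst p) _; rewrite lerDl mulr_ge0// ltW.
    by apply: le_trans (CP p) _; rewrite lerDr.
  - move=> [h v]; rewrite df /j /= flat_diff2// [_ + flat _]addrC addrK.
    by rewrite flatK.
  - move=> [h w]; rewrite df /j /= flat_diff2// sharpP//.
    by rewrite addrC subrK.
have cHH : geo_complete (H * H)%type by apply: geo_complete_pair; exact: complete_geo.
have Oxz : (Om `*` setT) (x, z) by split.
have [r r0 [rho rho0 [k [rU kP sk _]]]] := inverse_function cHH oOmT sf Oxz ij.
have fz : f (x, z) = (x, y) by rewrite /f /= /z sharpP.
rewrite fz in kP sk.
exists (nball (x, y) rho); split; [exact: nball_open|exact: nball_center|].
have oN : open (nball (x, y) rho) by exact: nball_open.
apply: class_C_ext (class_C_sndc oN (sk n)) => // -[x' y'] xy'.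
have [/rU kO kf] := kP _ xy'.
have k1 : (k (x', y')).1 = x' by have := congr1 fst kf.
have k2 : flat (k (x', y')) = y' by have := congr1 snd kf.
have [Ox' _] := kO; rewrite /= k1 in Ox'.
apply: (flat_inj Ox'); rewrite sharpP// -[RHS]k2; congr flat.
exact: injective_projections.
Qed.

Let Gc (z : H * (H * H)) : R^o := G z.1 z.2.1 z.2.2.

Definition metric_d (x u v w : H) : R := 'd Gc (x, (v, w)) (u, 0).

Lemma Gc_diff x v : Om x -> differentiable Gc (x, v).
Proof. by move=> Ox; have [+ _] := class_CS (lm_smooth mG 1%N); apply. Qed.

Lemma metric_is_diff x v w : Om x ->
  is_diff x (fun y => G y v w : R^o) (fun u => metric_d x u v w).
Proof. by move=> Ox; exact: (diff_curry1 (Gc_diff (v, w) Ox)). Qed.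

Lemma metric_derive x u v w : Om x -> 'D_u (fun y => G y v w : R^o) x = metric_d x u v w.
Proof.
move=> Ox; have [d1 d2] := metric_is_diff v w Ox.
by rewrite deriveE// d2.
Qed.

Lemma koszulE x u v w : Om x ->
  koszul G x u v w = metric_d x u v w + metric_d x v u w - metric_d x w u v.
Proof. by move=> Ox; rewrite /koszul !metric_derive. Qed.

Lemma metric_d_flat x u v w : Om x -> metric_d x u v w = ip H ('d flat (x, v) (u, 0)) w.
Proof.
move=> Ox; have d1 := metric_is_diff v w Ox.
have bw : bounded_linear (fun y : H => ip H y w : R^o).
  split=> [a y z|]; first by rewrite (psdDl (ip_psd H)) (psdZl (ip_psd H)).
  exists (`|w| + 1) => [|y]; first by rewrite ltr_wpDl.
  apply: le_trans (ip_le _ _) _; rewrite mulrC ler_wpM2r// lerDl//.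
have d2 := diff_curry1 (flat_diff v Ox).
have d3 := @is_diff_comp _ _ _ _ _ _ _ _ x d2 (bl_is_diff _ bw).
by apply: (is_diff_inj u d1 (is_diff_open oOm Ox _ d3)) => y Oy /=; rewrite flatP.
Qed.

Lemma metric_dC x u v w : Om x -> metric_d x u v w = metric_d x u w v.
Proof.
move=> Ox; apply: (is_diff_inj u (metric_is_diff v w Ox) (is_diff_open oOm Ox _ (metric_is_diff w v Ox))).
by move=> y Oy; rewrite (psdC (lm_form mG Oy)).
Qed.

Lemma metric_d_lin1 x a u u' v w : metric_d x (a *: u + u') v w = a * metric_d x u v w + metric_d x u' v w.
Proof.
rewrite /metric_d.
have -> : (a *: u + u', 0) = a *: (u, 0) + (u', 0) :> H * (H * H).
  by apply: injective_projections; rewrite /= ?scaler0 ?addr0.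
by rewrite dD dZ.
Qed.

Lemma metric_d_lin3 x a u v w w' : Om x ->
  metric_d x u v (a *: w + w') = a * metric_d x u v w + metric_d x u v w'.
Proof. by move=> Ox; rewrite !metric_d_flat// (psdDr (ip_psd H)) (psdZr (ip_psd H)). Qed.

Lemma metric_d_lin2 x a u v v' w : Om x ->
  metric_d x u (a *: v + v') w = a * metric_d x u v w + metric_d x u v' w.
Proof. by move=> Ox; rewrite ![metric_d _ _ _ w]metric_dC// metric_d_lin3. Qed.

Lemma Gc_diffE x v w h h1 h2 : Om x ->
  'd Gc (x, (v, w)) (h, (h1, h2)) = metric_d x h v w + G x h1 w + G x v h2.
Proof.
move=> Ox; have fG := lm_form mG Ox.
have -> : (h, (h1, h2)) = (h, 0) + (0, (h1, 0)) + (0, (0, h2)) :> H * (H * H).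
  by apply: injective_projections; rewrite /= ?addr0 ?add0r//;
     apply: injective_projections; rewrite /= ?addr0 ?add0r.
rewrite !dD; congr (_ + _ + _); apply: diff_affine; try exact: Gc_diff.
  move=> s; have -> : (x, (v, w)) + s *: (0, (h1, 0)) = (x, (v + s *: h1, w)) :> H * (H * H).
    by apply: injective_projections; rewrite /= ?scaler0 ?addr0//;
      apply: injective_projections; rewrite /= ?scaler0 ?addr0.
  by rewrite /Gc /= (psdDl fG) (psdZl fG).
move=> s; have -> : (x, (v, w)) + s *: (0, (0, h2)) = (x, (v, w + s *: h2)) :> H * (H * H).
  by apply: injective_projections; rewrite /= ?scaler0 ?addr0//;
    apply: injective_projections; rewrite /= ?scaler0 ?addr0.
by rewrite /Gc /= (psdDr fG) (psdZr fG).
Qed.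

Lemma metric_diff_comp E (p s t : E -> H) (p' s' t' : E -> H) x : Om (p x) ->
  is_diff x p p' -> is_diff x s s' -> is_diff x t t' ->
  is_diff x (fun y => G (p y) (s y) (t y) : R^o)
    (fun a => metric_d (p x) (p' a) (s x) (t x) + G (p x) (s' a) (t x) + G (p x) (s x) (t' a)).
Proof.
move=> Ox dp ds dt.
have d1 := is_diff_pair dp (is_diff_pair ds dt).
have d2 := differentiableP (Gc_diff (s x, t x) Ox).
have d3 := @is_diff_comp _ _ _ _ (fun y => (p y, (s y, t y))) _ Gc _ x d1 d2.
apply: (is_diff_eq d3); apply/funext => a /=; exact: Gc_diffE.
Qed.

(** In the third Koszul term [w] is the direction of differentiation, so that this term is not a
    derivative of [flat] paired with [w]; it needs a representer of its own. *)
Definition koszul_rep (p : H * (H * H)) : H :=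
  xget 0 [set y | forall w, ip H y w = metric_d p.1 w p.2.1 p.2.2].

Lemma koszul_repP x u v w : Om x -> ip H (koszul_rep (x, (u, v))) w = metric_d x w u v.
Proof.
move=> Ox; have [_ [C C0 CP]] := diff_bl (Gc_diff (u, v) Ox).
have [||y yP] := @ip_riesz _ H (fun w => metric_d x w u v) C.
- by move=> a w1 w2; exact: metric_d_lin1.
- move=> w1; apply: le_trans (CP _) _; rewrite ler_wpM2l ?(ltW C0)//.
  by rewrite pair_norm_le /= normr0 normr_ge0 lexx.
by rewrite /koszul_rep; case: xgetP => [y' _ +|/(_ y)//]; exact.
Qed.

Let cflat1 m (L : H * (H * H) -> (H * H) * (H * H)) :
  class_C m (Om `*` setT) L -> (forall z, (Om `*` setT) z -> Om (L z).1.1) ->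
  class_C m (Om `*` setT) (fun z => 'd flat ((L z).1) ((L z).2)).
Proof.
move=> cL OL; have [_ cd] := class_CS (flat_smooth m.+1).
apply: (@class_C_comp _ m _ _ _ _ _ L _ oOmTT _ cL cd).
by move=> z Oz; split=> //; split=> //; exact: OL.
Qed.

Lemma koszul_rep_smooth : smooth_on (Om `*` setT) koszul_rep.
Proof.
move=> n.
pose F (p : (H * (H * H)) * H) : R^o := metric_d p.1.1 p.2 p.1.2.1 p.1.2.2.
apply: (@representer_class _ _ n _ _ F koszul_rep oOmTT) => [m|[x [u v]] w [/= Ox _]]; last first.
  exact: koszul_repP.
have oD : open ((Om `*` setT) `*` setT : set ((H * (H * H)) * H)) by exact: openMT.
pose L (p : (H * (H * H)) * H) : (H * (H * H)) * (H * (H * H)) := (p.1, (p.2, 0)).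
have cL : class_C m ((Om `*` setT) `*` setT) L by rewrite /L; smooth_proj.
have [_ cd] := class_CS (lm_smooth mG m.+1).
have hL p : ((Om `*` setT) `*` setT) p -> ((Om `*` (setT `*` setT)) `*` setT) (L p).
  by move=> [[/= Op _] _].
apply: (@class_C_ext _ m _ _ _ _ F oD _ (@class_C_comp _ m _ _ _ _ _ L _ oD hL cL cd)).
by move=> [[x [u v]] w] _.
Qed.

Let gam (p : H * (H * H)) : H :=
  sharp (p.1, 2^-1 *: ('d flat (p.1, p.2.2) (p.2.1, 0) + 'd flat (p.1, p.2.1) (p.2.2, 0)
    - koszul_rep p)).

Let gamP x u v w : Om x -> 2 * G x (gam (x, (u, v))) w = koszul G x u v w.
Proof.
move=> Ox; rewrite -flatP// /gam sharpP//= (psdZl (ip_psd H)) mulrA divff// mul1r.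
rewrite !(psdDl (ip_psd H)) (psdNl (ip_psd H)) koszul_repP// -!metric_d_flat//.
by rewrite koszulE.
Qed.

Lemma chrisP x u v w : Om x -> 2 * G x (chris G x u v) w = koszul G x u v w.
Proof.
move=> Ox; move: w; rewrite /chris; case: xgetP => [y _ //|/(_ (gam (x, (u, v)))) h].
by exfalso; apply: h => w; exact: gamP.
Qed.

Lemma chris_unique x u v z : Om x -> (forall w, 2 * G x z w = koszul G x u v w) ->
  chris G x u v = z.
Proof.
move=> Ox zP; apply: (lm_inj Ox) => w; apply: (@mulfI _ 2) => //.
by rewrite chrisP// zP.
Qed.

(** The auxiliary [gam] is the explicit solution of the Koszul equation, half the [sharp] of the
    represented Koszul terms. It proves at once that [chris] is not a default value and that it is
    smooth. *)
Lemma chris_smooth : smooth_on (Om `*` setT) (fun z : H * (H * H) => chris G z.1 z.2.1 z.2.2).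
Proof.
move=> n; apply: (@class_C_ext _ n _ _ _ gam) => // [[x [u v]] [/= Ox _]|].
  by apply/esym/chris_unique => // w; exact: gamP.
pose M (p : H * (H * H)) : H := 2^-1 *: ('d flat (p.1, p.2.2) (p.2.1, 0)
  + 'd flat (p.1, p.2.1) (p.2.2, 0) - koszul_rep p).
have cM : class_C n (Om `*` setT) M.
  apply: class_C_scale => //; apply: class_C_sub_ => //; last exact: koszul_rep_smooth.
  apply: class_C_add => //.
    apply: (@cflat1 n (fun p => ((p.1, p.2.2), (p.2.1, 0)))); first by smooth_proj.
    by move=> z [].
  apply: (@cflat1 n (fun p => ((p.1, p.2.1), (p.2.2, 0)))); first by smooth_proj.
  by move=> z [].
apply: (@class_C_comp _ n _ _ _ _ (Om `*` setT) (fun p => (p.1, M p)) sharp) => //.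
  by apply: class_C_pair => //; exact: class_C_fst.
exact: sharp_smooth.
Qed.

Opaque metric_d.

Lemma chrisC x u v : Om x -> chris G x u v = chris G x v u.
Proof.
move=> Ox; apply: (chris_unique Ox) => w.
rewrite (chrisP v u w Ox) (koszulE u v w Ox) (koszulE v u w Ox).
rewrite (metric_dC w u v Ox); ring.
Qed.

Lemma chris_lin2 x a u v v' : Om x ->
  chris G x u (a *: v + v') = a *: chris G x u v + chris G x u v'.
Proof.
move=> Ox; have fG := lm_form mG Ox; apply: (chris_unique Ox) => w.
rewrite (psdDl fG) (psdZl fG) mulrDr mulrCA (chrisP u v w Ox) (chrisP u v' w Ox).
rewrite (koszulE u _ w Ox) (koszulE u v' w Ox) (koszulE u (_ + _) w Ox).
rewrite (metric_d_lin1 x a v v' u w) (metric_d_lin2 a u v v' w Ox).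
have l3 := metric_d_lin3 a w u v v' Ox.
rewrite l3.
move: (metric_d x u v w) (metric_d x v u w) (metric_d x w u v) => a1 a2 a3.
move: (metric_d x u v' w) (metric_d x v' u w) (metric_d x w u v') => b1 b2 b3.
ring.
Qed.

Lemma chris_lin1 x a u u' v : Om x ->
  chris G x (a *: u + u') v = a *: chris G x u v + chris G x u' v.
Proof.
move=> Ox; rewrite (chrisC _ v Ox) (chris_lin2 _ _ _ _ Ox).
by rewrite (chrisC v u Ox) (chrisC v u' Ox).
Qed.
End LocalMetric.

(** * Second derivatives and Lie brackets *)

Section SecondOrder.
Variable R : realType.
Implicit Types E F : normedModType R.

Definition d2 E F (f : E -> F) (x a v : E) : F := 'd (fun y => 'd f y v) x a.

Lemma d2C E F (f : E -> F) (U : set E) x a v : open U -> U x -> class_C 2 U f ->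
  d2 f x a v = d2 f x v a.
Proof. by move=> oU Ux cf; exact: (schwarz2 v a oU Ux cf). Qed.

Lemma diff_field_apply E E' F (f : E -> F) (p : E' -> E) (s : E' -> E) p' s' (U : set E) x :
  open U -> U (p x) -> class_C 2 U f -> is_diff x p p' -> is_diff x s s' ->
  is_diff x (fun y => 'd f (p y) (s y)) (fun a => d2 f (p x) (p' a) (s x) + 'd f (p x) (s' a)).
Proof.
move=> oU Ux cf dp ds; have d1 := is_diff_pair dp ds.
have [_ [/(_ (p x, s x)) dT _]] := cf.
have dT' := differentiableP (dT (conj Ux I)).
have d3 := @is_diff_comp _ _ _ _ (fun y => (p y, s y)) _ _ _ x d1 dT'.
apply: (is_diff_eq d3); apply/funext => a /=.
exact: (class_C2_tangent _ _ _ oU Ux cf).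
Qed.

Definition lie E (X Y : E -> E) (x : E) : E := 'd Y x (X x) - 'd X x (Y x).

Lemma lie_diff E (X Y : E -> E) (U : set E) x : open U -> U x ->
  class_C 2 U X -> class_C 2 U Y ->
  is_diff x (lie X Y) (fun a => (d2 Y x a (X x) + 'd Y x ('d X x a))
                              - (d2 X x a (Y x) + 'd X x ('d Y x a))).
Proof.
move=> oU Ux cX cY.
have dX : is_diff x X ('d X x).
  by apply: differentiableP; have [+ _] := class_CS cX; apply.
have dY : is_diff x Y ('d Y x).
  by apply: differentiableP; have [+ _] := class_CS cY; apply.
have i : is_diff x (id : E -> E) id by exact: is_diff_id.
exact: (is_diffB (diff_field_apply oU Ux cY i dX) (diff_field_apply oU Ux cX i dY)).
Qed.

Lemma lie_smooth E (X Y : E -> E) (U : set E) : open U ->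
  smooth_on U X -> smooth_on U Y -> smooth_on U (lie X Y).
Proof.
move=> oU sX sY n.
have c (A B : E -> E) : smooth_on U A -> smooth_on U B -> class_C n U (fun x => 'd B x (A x)).
  move=> sA sB; have [_ cB] := class_CS (sB n.+1).
  apply: (@class_C_comp _ n _ _ _ _ _ (fun x => (x, A x)) _ oU _ _ cB) => //.
  by apply: class_C_pair => //; exact: class_C_id.
by apply: class_C_sub_ => //; apply: c.
Qed.

Lemma lie_jacobi E (X Y Z : E -> E) (U : set E) x : open U -> U x ->
  smooth_on U X -> smooth_on U Y -> smooth_on U Z ->
  lie X (lie Y Z) x + lie Y (lie Z X) x + lie Z (lie X Y) x = 0.
Proof.
move=> oU Ux sX sY sZ.
have dL A B : smooth_on U A -> smooth_on U B -> forall a, 'd (lie A B) x a =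
   (d2 B x a (A x) + 'd B x ('d A x a)) - (d2 A x a (B x) + 'd A x ('d B x a)).
  by move=> sA sB a; have [_ ->] := lie_diff oU Ux (sA 2%N) (sB 2%N).
have LL A B C : smooth_on U A -> smooth_on U B -> smooth_on U C -> lie A (lie B C) x =
    d2 C x (A x) (B x) + 'd C x ('d B x (A x)) - (d2 B x (A x) (C x) + 'd B x ('d C x (A x)))
    - ('d A x ('d C x (B x)) - 'd A x ('d B x (C x))).
  move=> sA sB sC.
  exact: (congr2 (fun a b => a - b) (dL B C sB sC (A x)) (dB A x ('d C x (B x)) ('d B x (C x)))).
rewrite (LL X Y Z sX sY sZ) (LL Y Z X sY sZ sX) (LL Z X Y sZ sX sY) {LL dL}.
have e1 := d2C (Y x) (X x) oU Ux (sZ 2%N); have e2 := d2C (Z x) (Y x) oU Ux (sX 2%N).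
have e3 := d2C (X x) (Z x) oU Ux (sY 2%N).
have alg (a1 a2 a3 a4 a5 a6 b1 b2 b3 b4 b5 b6 : E) : a1 = a2 -> a3 = a4 -> a5 = a6 ->
    a2 + b1 - (a5 + b2) - (b3 - b4) + (a4 + b3 - (a1 + b5) - (b6 - b2)) + (a6 + b6 - (a3 + b4) - (b1 - b5)) = 0.
  by move=> -> -> ->; vring R.
exact: (alg _ _ _ _ _ _ ('d Z x ('d Y x (X x))) ('d Y x ('d Z x (X x))) ('d X x ('d Z x (Y x)))
  ('d X x ('d Y x (Z x))) ('d Z x ('d X x (Y x))) ('d Y x ('d X x (Z x))) e1 e2 e3).
Qed.

(** Differentiating the two relations produces second derivatives of [f] on [(X x, Y x)] and on
    [(Y x, X x)]; by symmetry they cancel in the bracket. *)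
Lemma lie_related E E' (f : E -> E') (X Y : E -> E) (X' Y' : E' -> E') (U : set E) (U' : set E') x :
  open U -> U x -> (forall y, U y -> U' (f y)) -> open U' -> class_C 2 U f ->
  class_C 1 U X -> class_C 1 U Y -> class_C 1 U' X' -> class_C 1 U' Y' ->
  (forall y, U y -> X' (f y) = 'd f y (X y)) -> (forall y, U y -> Y' (f y) = 'd f y (Y y)) ->
  lie X' Y' (f x) = 'd f x (lie X Y x).
Proof.
move=> oU Ux UU' oU' cf cX cY cX' cY' rX rY.
have df : is_diff x f ('d f x).
  by apply: differentiableP; have [+ _] := class_CS cf; apply.
have key (A : E -> E) (A' : E' -> E') : class_C 1 U A -> class_C 1 U' A' ->
    (forall y, U y -> A' (f y) = 'd f y (A y)) ->
    forall u, 'd A' (f x) ('d f x u) = d2 f x u (A x) + 'd f x ('d A x u).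
  move=> cA cA' rA u.
  have dA : is_diff x A ('d A x).
    by apply: differentiableP; have [+ _] := class_CS cA; apply.
  have dA' : is_diff (f x) A' ('d A' (f x)).
    by apply: differentiableP; have [+ _] := class_CS cA'; apply; exact: UU'.
  have h1 := @is_diff_comp _ _ _ _ f _ A' _ x df dA'.
  have h2 := diff_field_apply oU Ux cf (is_diff_id x) dA.
  by apply: (is_diff_inj u h1 (is_diff_open oU Ux _ h2)) => y Uy /=; rewrite rA.
rewrite /lie rX// rY// (key Y Y')// (key X X')// dB.
rewrite (d2C (X x) _ oU Ux cf).
set a1 := d2 f x _ _; set a2 := 'd f x _; set a3 := 'd f x _; vring R.
Qed.
End SecondOrder.

Section BilinearIdentities.
Variables (R : realType) (V : lmodType R) (b : V -> V -> R).
Hypothesis fb : psd_form b.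

Lemma lie_chris_alg (u w C Cw Xu Xw dC dCw XC XCw Dau Daw Cau Caw CXa CXaw : V)
   (p q r1 r2 r3 m1 m2 : R) :
  p = q -> q = m1 + b dC w + b C 0 + (m2 + b 0 Cw + b u dCw) ->
  p + r1 + (r2 + b Dau w) + (r3 + b u Daw) = 0 ->
  m1 + b XC w + b C Xw = 0 -> m2 + b Xu Cw + b u XCw = 0 ->
  r1 = b CXa w + b u CXaw -> r2 = b Cau w + b Xu Cw -> r3 = b C Xw + b u Caw ->
  b (Dau + dC + CXa + Cau - XC) w + b u (Daw + dCw + CXaw + Caw - XCw) = 0.
Proof.
rewrite (psdC fb C 0) !(psd0l fb) !(psdDl fb, psdNl fb, psdDr fb, psdNr fb).
move: (b _ _) (b _ _) (b _ _) (b _ _) (b _ _) (b _ _) (b _ _) (b _ _) (b _ _) (b _ _) => *.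
lra.
Qed.

Lemma lie_killing_alg (u w Xu Xw Yu Yw XYu YXu XYw YXw X2u X2w Y2u Y2w X2u' X2w' Y2u' Y2w' : V)
   (z z1 z2 p p' m1 m2 m3 m4 : R) : z = z1 - z2 -> p = p' ->
  p + z2 + (m2 + b X2u w) + (m4 + b u X2w) = 0 ->
  p' + z1 + (m1 + b Y2u w) + (m3 + b u Y2w) = 0 ->
  m1 + b XYu w + b Yu Xw = 0 -> m2 + b YXu w + b Xu Yw = 0 ->
  m3 + b Xu Yw + b u XYw = 0 -> m4 + b Yu Xw + b u YXw = 0 ->
  X2u' = X2u -> X2w' = X2w -> Y2u' = Y2u -> Y2w' = Y2w ->
  z + b (Y2u' + YXu - (X2u' + XYu)) w + b u (Y2w' + YXw - (X2w' + XYw)) = 0.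
Proof.
move=> -> -> + + + + + + -> -> -> ->; rewrite !(psdDl fb, psdNl fb, psdDr fb, psdNr fb).
move: (b _ _) (b _ _) (b _ _) (b _ _) (b _ _) (b _ _) (b _ _) (b _ _) (b _ _) (b _ _) => *; lra.
Qed.
End BilinearIdentities.

(** * Isometries and Killing fields in a chart *)

Section LocalGeometry.
Variables (R : realType) (H : hilbertSpace R).

Lemma slice_class (Om : set H) (G : H -> H -> H -> R) u w n : local_metric Om G ->
  class_C n Om (fun y => G y u w : R^o).
Proof.
move=> mG; have oOm := lm_open mG.
apply: (@class_C_comp _ n _ _ _ Om _ (fun y : H => (y, (u, w)))
   (fun z : H * (H * H) => G z.1 z.2.1 z.2.2 : R^o) oOm _ _ (lm_smooth mG n)) => //.
by apply: class_C_pair => //; [exact: class_C_id|exact: class_C_cst].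
Qed.

Lemma slice_d (Om : set H) (G : H -> H -> H -> R) x a u w : local_metric Om G -> Om x ->
  'd (fun y => G y u w : R^o) x a = metric_d G x a u w.
Proof. by move=> mG Ox; have [_ ->] := metric_is_diff mG u w Ox. Qed.

Definition local_isometry (W : set H) (G : H -> H -> H -> R) (Om' : set H)
    (G' : H -> H -> H -> R) (f : H -> H) : Prop :=
  [/\ open W, smooth_on W f, forall x, W x -> Om' (f x),
      forall x u w, W x -> G' (f x) ('d f x u) ('d f x w) = G x u w &
      forall x, W x -> forall v, exists u, 'd f x u = v].

(** Naturality of the Levi-Civita connection. Differentiating the isometry condition expresses the
    Koszul terms of [G] through those of [G'] and second derivatives of [f]. The result is tested
    against the vectors [df w], which exhaust the space by the surjectivity clause of
    [local_isometry]. *)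
Lemma chris_isometry (W Om Om' : set H) (G G' : H -> H -> H -> R) (f : H -> H) x u v :
  local_metric Om G -> local_metric Om' G' -> W `<=` Om ->
  local_isometry W G Om' G' f -> W x ->
  chris G' (f x) ('d f x u) ('d f x v) + d2 f x u v = 'd f x (chris G x u v).
Proof.
move=> mG mG' WO [oW sf WO' fG sur] Wx; have Ox := WO _ Wx; have Ox' := WO' _ Wx.
have cf := sf 2%N; have fG' := lm_form mG' Ox'.
have df : is_diff x f ('d f x).
  by apply: differentiableP; have [+ _] := class_CS cf; apply.
have dd w : is_diff x (fun y => 'd f y w) (fun a => d2 f x a w).
  exact: differentiableP (class_C2_diff w oW Wx cf).
have E1 a b c : metric_d G x a b c = metric_d G' (f x) ('d f x a) ('d f x b) ('d f x c)
    + G' (f x) (d2 f x a b) ('d f x c) + G' (f x) ('d f x b) (d2 f x a c).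
  have h1 := metric_is_diff mG b c Ox.
  have h2 := metric_diff_comp mG' Ox' df (dd b) (dd c).
  by apply: (is_diff_inj a h1 (is_diff_open oW Wx _ h2)) => y Wy; rewrite fG.
apply/eqP; rewrite -subr_eq0; apply/eqP; apply: (lm_inj mG' Ox') => w'.
have [w <-] := sur x Wx w'.
have alg (Fu Fv Fw Duv Dvu Dvw Dwv Duw Dwu C C' : H) (m1 m2 m3 g : R) :
    2 * G' (f x) C Fw = m1 + m2 - m3 ->
    2 * g = (m1 + G' (f x) Duv Fw + G' (f x) Fv Duw) + (m2 + G' (f x) Dvu Fw + G' (f x) Fu Dvw)
      - (m3 + G' (f x) Dwu Fv + G' (f x) Fu Dwv) ->
    Dvu = Duv -> Dwv = Dvw -> Dwu = Duw -> G' (f x) C' Fw = g ->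
    G' (f x) (C + Duv - C') Fw = G' (f x) 0 Fw.
  move=> h1 h2 ? ? ? h3; subst Dvu Dwv Dwu; rewrite !(psdDl fG', psdNl fG', psd0l fG') h3.
  rewrite (psdC fG' Fv) in h2; lra.
have h1 := chrisP mG' ('d f x u) ('d f x v) ('d f x w) Ox'; rewrite (koszulE mG' _ _ _ Ox') in h1.
have h2 := chrisP mG u v w Ox; rewrite (koszulE mG _ _ _ Ox) in h2.
have e2 : metric_d G x u v w + metric_d G x v u w - metric_d G x w u v = _ :=
  congr2 (fun a b => a - b) (congr2 +%R (E1 u v w) (E1 v u w)) (E1 w u v).
exact: (alg _ _ _ _ _ _ _ _ _ _ _ _ _ _ _ h1 (etrans h2 e2) (d2C v u oW Wx cf) (d2C w v oW Wx cf)
  (d2C w u oW Wx cf) (fG x _ _ Wx)).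
Qed.

(** The coordinate expression of the vanishing of the Lie derivative of [G] along [X]. *)
Definition killing_eq (W : set H) (G : H -> H -> H -> R) (X : H -> H) : Prop :=
  forall x u w, W x -> metric_d G x (X x) u w + G x ('d X x u) w + G x u ('d X x w) = 0.

Section Killing.
Variables (W Om : set H) (G : H -> H -> H -> R).
Hypotheses (mG : local_metric Om G) (WO : W `<=` Om) (oW : open W).

Lemma killing_diff X x a u w : class_C 2 W X -> killing_eq W G X -> W x ->
  d2 (fun y => G y u w : R^o) x a (X x) + metric_d G x ('d X x a) u w
  + (metric_d G x a ('d X x u) w + G x (d2 X x a u) w)
  + (metric_d G x a u ('d X x w) + G x u (d2 X x a w)) = 0.
Proof.
move=> cX kX Wx; have Ox := WO Wx; have oO := lm_open mG.
have dX : is_diff x X ('d X x).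
  by apply: differentiableP; have [+ _] := class_CS cX; apply.
have dd b : is_diff x (fun y => 'd X y b) (fun a => d2 X x a b).
  exact: differentiableP (class_C2_diff b oW Wx cX).
have h1 := diff_field_apply oO Ox (slice_class u w 2 mG) (is_diff_id x) dX.
have h2 := metric_diff_comp mG Ox (is_diff_id x) (dd u) (is_diff_cst w x).
have h3 := metric_diff_comp mG Ox (is_diff_id x) (is_diff_cst u x) (dd w).
have h := is_diffD (is_diffD h1 h2) h3.
have h0 : is_diff x (fun=> 0 : R^o) (fun=> 0) := is_diff_cst 0 x.
have fG := lm_form mG Ox.
have e : (fun a => d2 (fun y => G y u w : R^o) x a (X x) + 'd (fun y => G y u w : R^o) x ('d X x a)
   + (metric_d G x a ('d X x u) w + G x (d2 X x a u) w + G x ('d X x u) 0)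
   + (metric_d G x a u ('d X x w) + G x 0 ('d X x w) + G x u (d2 X x a w))) a = 0.
  apply: (is_diff_inj a h (is_diff_open oW Wx _ h0)) => y Wy.
  by rewrite !fctE (slice_d _ _ _ mG (WO Wy)) kX.
have alg (Xu Xw D1 D2 : H) (p q q' r s : R) : q' = q ->
    p + q' + (r + G x D1 w + G x Xu 0) + (s + G x 0 Xw + G x u D2) = 0 ->
    p + q + (r + G x D1 w) + (s + G x u D2) = 0.
  by move=> ->; rewrite (psdC fG _ 0) !(psd0l fG) !addr0.
exact: (alg _ _ _ _ _ _ _ _ _ (slice_d ('d X x a) u w mG Ox) e).
Qed.

Lemma metric_compat x a u w : Om x ->
  metric_d G x a u w = G x (chris G x a u) w + G x u (chris G x a w).
Proof.
move=> Ox; have fG := lm_form mG Ox.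
have h1 := chrisP mG a u w Ox; have h2 := chrisP mG a w u Ox.
rewrite (koszulE mG _ _ _ Ox) in h1; rewrite (koszulE mG _ _ _ Ox) in h2.
rewrite (psdC fG u); move: h1 h2.
rewrite (metric_dC mG a w u Ox) (metric_dC mG w a u Ox) (metric_dC mG u a w Ox).
move: (G x _ _) (G x _ _) (metric_d G x a u w) (metric_d G x u w a) (metric_d G x w u a).
move=> *; lra.
Qed.

Lemma chris_slice_diff x u v : Om x ->
  is_diff x (fun y => chris G y u v) ('d (fun y => chris G y u v) x).
Proof.
move=> Ox; apply: differentiableP; have oO := lm_open mG.
have cl : class_C 1 Om (fun y : H => (y, (u, v))).
  by apply: class_C_pair => //; [exact: class_C_id|exact: class_C_cst].
have c := class_C_comp oO (V := Om `*` setT) _ cl (chris_smooth mG 1%N).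
by have [] := class_CS (c (fun y Oy => conj Oy I)) => + _; apply.
Qed.

Let lie_chris X x u v := d2 X x u v + 'd (fun y => chris G y u v) x (X x)
  + chris G x ('d X x u) v + chris G x u ('d X x v) - 'd X x (chris G x u v).

Let lie_chris_skew X x a u w : class_C 2 W X -> killing_eq W G X -> W x ->
  G x (lie_chris X x a u) w + G x u (lie_chris X x a w) = 0.
Proof.
move=> cX kX Wx; have Ox := WO Wx; have oO := lm_open mG; have fG := lm_form mG Ox.
have kd := killing_diff a u w cX kX Wx.
have dX : is_diff x X ('d X x).
  by apply: differentiableP; have [+ _] := class_CS cX; apply.
have h1 := metric_diff_comp mG Ox (is_diff_id x) (chris_slice_diff a u Ox) (is_diff_cst w x).
have h2 := metric_diff_comp mG Ox (is_diff_id x) (is_diff_cst u x) (chris_slice_diff a w Ox).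
have h3 : is_diff x (fun y => metric_d G y a u w : R^o) (fun b => d2 (fun y => G y u w : R^o) x b a).
  have h := differentiableP (class_C2_diff a oO Ox (slice_class u w 2 mG)).
  by apply: (is_diff_open oO Ox _ h) => y Oy; exact: (slice_d a u w mG Oy).
have e : d2 (fun y => G y u w : R^o) x (X x) a =
  metric_d G x (X x) (chris G x a u) w + G x ('d (fun y => chris G y a u) x (X x)) w
  + G x (chris G x a u) 0 + (metric_d G x (X x) u (chris G x a w) + G x 0 (chris G x a w)
  + G x u ('d (fun y => chris G y a w) x (X x))).
  apply: (is_diff_inj (X x) h3 (is_diff_open oO Ox _ (is_diffD h1 h2))) => y Oy.
  by rewrite fctE metric_compat.
exact: (lie_chris_alg fG
  (d2C a (X x) oO Ox (slice_class u w 2 mG)) e kd (kX x (chris G x a u) w Wx) (kX x u (chris G x a w) Wx)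
  (metric_compat ('d X x a) u w Ox) (metric_compat a ('d X x u) w Ox) (metric_compat a u ('d X x w) Ox)).
Qed.

Let lie_chrisC X x u v : class_C 2 W X -> W x -> lie_chris X x u v = lie_chris X x v u.
Proof.
move=> cX Wx; have Ox := WO Wx; rewrite /lie_chris.
have e : 'd (fun y => chris G y u v) x (X x) = 'd (fun y => chris G y v u) x (X x).
  apply: (is_diff_inj (X x) (chris_slice_diff u v Ox)
    (is_diff_open (lm_open mG) Ox _ (chris_slice_diff v u Ox))) => y Oy.
  by rewrite (chrisC mG v u Oy).
have alg (a a' b b' c c' d d' k k' : H) : a = a' -> b = b' -> c = d' -> d = c' -> k = k' ->
    a + b + c + d - k = a' + b' + c' + d' - k'.
  by move=> -> -> -> -> ->; vring R.
exact: (alg _ _ _ _ _ _ _ _ _ _ (d2C u v oW Wx cX) e (chrisC mG ('d X x u) v Ox)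
  (chrisC mG u ('d X x v) Ox) (congr1 _ (chrisC mG u v Ox))).
Qed.

(** [lie_chris] is the Lie derivative of the connection along [X]. It is symmetric in [u], [v]
    because the connection is torsion free, and skew in its last two slots after lowering because
    [X] is Killing and the connection metric. A tensor with these two symmetries is zero. *)
Lemma killing_chris X x u v : class_C 2 W X -> killing_eq W G X -> W x ->
  d2 X x u v + 'd (fun y => chris G y u v) x (X x) + chris G x ('d X x u) v
  + chris G x u ('d X x v) = 'd X x (chris G x u v).
Proof.
move=> cX kX Wx; have Ox := WO Wx; have fG := lm_form mG Ox.
apply/eqP; rewrite -subr_eq0; apply/eqP; apply: (lm_inj mG Ox) => w.
rewrite (psd0l fG) -/(lie_chris X x u v).
have alg (uv vu uw wu vw wv : H) : G x uv w + G x v uw = 0 -> G x wu v + G x u wv = 0 ->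
    G x vw u + G x w vu = 0 -> uv = vu -> uw = wu -> vw = wv -> G x uv w = 0.
  move=> + + + e1 e2 e3; rewrite -e1 -e2 -e3 (psdC fG v) (psdC fG u) (psdC fG w).
  by move: (G x _ _) (G x _ _) (G x _ _) => *; lra.
exact: (alg _ _ _ _ _ _ (lie_chris_skew u v w cX kX Wx) (lie_chris_skew w u v cX kX Wx)
  (lie_chris_skew v w u cX kX Wx) (lie_chrisC u v cX Wx) (lie_chrisC u w cX Wx) (lie_chrisC v w cX Wx)).
Qed.

(** Each Killing equation is differentiated along the other field and the results are subtracted:
    second derivatives of the metric and of the fields match by symmetry, and the products of first
    derivatives are eliminated with the Killing equations themselves. *)
Lemma lie_killing X Y : class_C 2 W X -> class_C 2 W Y -> killing_eq W G X ->
  killing_eq W G Y -> killing_eq W G (lie X Y).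
Proof.
move=> cX cY kX kY x u w Wx; have Ox := WO Wx; have oO := lm_open mG; have fG := lm_form mG Ox.
have e1 := killing_diff (Y x) u w cX kX Wx; have e2 := killing_diff (X x) u w cY kY Wx.
have [_ dL] := lie_diff oW Wx cX cY; rewrite dL.
have eZ : metric_d G x (lie X Y x) u w = metric_d G x ('d Y x (X x)) u w - metric_d G x ('d X x (Y x)) u w.
  by rewrite /lie addrC -scaleN1r (metric_d_lin1 G x (-1) ('d X x (Y x)) _ u w) mulN1r addrC.
exact: (lie_killing_alg fG eZ
  (d2C (Y x) (X x) oO Ox (slice_class u w 2 mG)) e1 e2 (kX x ('d Y x u) w Wx) (kY x ('d X x u) w Wx)
  (kX x u ('d Y x w) Wx) (kY x u ('d X x w) Wx)
  (d2C u (Y x) oW Wx cX) (d2C w (Y x) oW Wx cX) (d2C u (X x) oW Wx cY) (d2C w (X x) oW Wx cY)).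
Qed.
End Killing.
End LocalGeometry.

(** * Geodesics and the exponential map *)

Section Geodesics.
Variables (R : realType) (H : hilbertSpace R).
Implicit Types (G : H -> H -> H -> R) (Om : set H).

Definition spray G (z : H * H) : H * H := (z.2, - chris G z.1 z.2 z.2).

Section Spray.
Variables (Om : set H) (G : H -> H -> H -> R).
Hypothesis mG : local_metric Om G.
Let oOm : open Om := lm_open mG.
Let oOmT : open (Om `*` setT : set (H * H)). Proof. exact: openMT. Qed.

Lemma chris0r x u : Om x -> chris G x u 0 = 0.
Proof. by move=> Ox; have := chris_lin2 mG 1 u 0 0 Ox; rewrite scaler0 add0r scale1r -{1}[chris G x u 0]addr0 => /addrI/esym. Qed.

Lemma chris0l x u : Om x -> chris G x 0 u = 0.
Proof. by move=> Ox; rewrite (chrisC mG 0 u Ox) (chris0r u Ox). Qed.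

Lemma chrisNr x u v : Om x -> chris G x u (- v) = - chris G x u v.
Proof.
by move=> Ox; have := chris_lin2 mG (-1) u v 0 Ox; rewrite (chris0r u Ox) !scaleN1r !addr0.
Qed.

Lemma chrisNl x u v : Om x -> chris G x (- u) v = - chris G x u v.
Proof. by move=> Ox; rewrite (chrisC mG _ _ Ox) (chrisNr _ _ Ox) (chrisC mG v u Ox). Qed.

Let chr3 (z : H * (H * H)) : H := chris G z.1 z.2.1 z.2.2.

Let chr3_diff z : Om z.1 -> differentiable chr3 z.
Proof. by move=> Oz; have [+ _] := class_CS (chris_smooth mG 1%N); apply; split. Qed.

Lemma chris_diffE x v w h h1 h2 : Om x ->
  'd chr3 (x, (v, w)) (h, (h1, h2)) =
    'd (fun y => chris G y v w) x h + chris G x h1 w + chris G x v h2.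
Proof.
move=> Ox.
have dc : differentiable chr3 (x, (v, w)) by exact: chr3_diff.
have -> : (h, (h1, h2)) = (h, 0) + (0, (h1, 0)) + (0, (0, h2)) :> H * (H * H).
  by apply: injective_projections; rewrite /= ?addr0 ?add0r//;
     apply: injective_projections; rewrite /= ?addr0 ?add0r.
rewrite !dD; congr (_ + _ + _).
- by have [_ e] := diff_curry1 dc; exact: (esym (congr1 (fun l => l h) e)).
- apply: diff_affine => // s.
  have -> : (x, (v, w)) + s *: (0, (h1, 0)) = (x, (v + s *: h1, w)) :> H * (H * H).
    by apply: injective_projections; rewrite /= ?scaler0 ?addr0//;
      apply: injective_projections; rewrite /= ?scaler0 ?addr0.
  by rewrite /chr3 /= addrC (chris_lin1 mG _ _ _ _ Ox) addrC.
- apply: diff_affine => // s.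
  have -> : (x, (v, w)) + s *: (0, (0, h2)) = (x, (v, w + s *: h2)) :> H * (H * H).
    by apply: injective_projections; rewrite /= ?scaler0 ?addr0//;
      apply: injective_projections; rewrite /= ?scaler0 ?addr0.
  by rewrite /chr3 /= addrC (chris_lin2 mG _ _ _ _ Ox) addrC.
Qed.

Lemma spray_smooth : smooth_on (Om `*` setT) (spray G).
Proof.
move=> n; apply: class_C_pair => //; first exact: class_C_snd.
apply: class_C_opp => //.
have cl : class_C n (Om `*` setT) (fun z : H * H => (z.1, (z.2, z.2))) by smooth_proj.
exact: (@class_C_comp _ n _ _ _ _ (Om `*` setT) _ chr3 oOmT _ cl (chris_smooth mG n)).
Qed.

Lemma dspray x v a b : Om x -> 'd (spray G) (x, v) (a, b) =
  (b, - ('d (fun y => chris G y v v) x a + chris G x b v + chris G x v b)).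
Proof.
move=> Ox.
have i2 : is_diff (x, v) (snd : H * H -> H) snd.
  by apply: bl_is_diff; split=> //; exists 1 => // z; rewrite mul1r norm_snd.
have i1 : is_diff (x, v) (fst : H * H -> H) fst.
  by apply: bl_is_diff; split=> //; exists 1 => // z; rewrite mul1r norm_fst.
have i3 := is_diff_pair i1 (is_diff_pair i2 i2).
have i4 := @is_diff_comp _ _ _ _ (fun z : H * H => (z.1, (z.2, z.2))) _ chr3 _ (x, v) i3
  (differentiableP (@chr3_diff (x, (v, v)) Ox)).
have i5 := is_diff_pair i2 (is_diffN i4).
have [_ ->] := i5; congr pair; congr (- _); exact: chris_diffE.
Qed.

Lemma geodesic_reflect (c : R -> H * H) t : Om (c (- t)).1 ->
  is_derive (- t : R^o) 1 (c : R^o -> (H * H)%type) (spray G (c (- t))) ->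
  is_derive (t : R^o) 1 ((fun s => ((c (- s)).1, - (c (- s)).2)) : R^o -> (H * H)%type)
    (spray G ((c (- t)).1, - (c (- t)).2)).
Proof.
move=> Ox /derive_reflect; rewrite opprK => d.
have d1 := is_derive_fst d; have d2 := is_derive_scale (-1) (is_derive_snd d).
have -> : (fun s => ((c (- s)).1, - (c (- s)).2)) = (fun s => ((c (- s)).1, -1 *: (c (- s)).2)).
  by apply/funext => s; rewrite scaleN1r.
have -> : spray G ((c (- t)).1, - (c (- t)).2) =
   ((- spray G (c (- t))).1, -1 *: (- spray G (c (- t))).2).
  by rewrite /spray /= scaleN1r opprK (chrisNl _ _ Ox) (chrisNr _ _ Ox) opprK.
exact: is_derive_pair d1 d2.
Qed.

(** The complete lift of a Killing field to the tangent bundle commutes with the geodesic spray;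
    this is [killing_chris] on the diagonal [u = v]. *)
Lemma killing_spray X z : smooth_on Om X -> killing_eq Om G X -> Om z.1 ->
  'd (tangent_field X) z (spray G z) = 'd (spray G) z (tangent_field X z).
Proof.
case: z => x v sX kX Ox; apply: (etrans (diff_tangent_field v _ oOm Ox (sX 2%N))).
apply: (etrans _ (esym (dspray v _ _ Ox))); apply: (congr2 pair (erefl _)).
apply: (etrans (congr2 +%R (erefl _) (dN _ _ _))).
have alg (a b c d k : H) : a + b + c + d = k -> a - k = - (b + c + d) by move=> <-; vring R.
exact: (alg _ _ _ _ _ (killing_chris mG (@subset_refl _ Om) oOm v v (sX 2%N) kX Ox)).
Qed.

(* Along a geodesic the 1-jet of a Killing field solves the linearised geodesic equation. *)
Lemma killing_jet_zero X (c : R -> H * H) T : smooth_on Om X -> killing_eq Om G X ->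
  (forall t, `|t| < T -> Om (c t).1 /\ is_derive (t : R^o) 1 (c : R^o -> (H * H)%type) (spray G (c t))) ->
  X (c 0).1 = 0 -> (forall v, 'd X ((c 0).1) v = 0) -> forall t, `|t| < T -> X (c t).1 = 0.
Proof.
move=> sX kX cP X0 dX0 t tT.
have sT := tangent_field_smooth oOmT spray_smooth.
have oTT : open ((Om `*` setT) `*` setT : set ((H * H) * (H * H))) by exact: openMT.
pose c1 s := (c s, tangent_field X (c s)); pose c2 s := (c s, 0 : H * H).
have dTX z : Om z.1 -> differentiable (tangent_field X) z.
  by move=> Oz; have [+ _] := class_CS (tangent_field_smooth oOm sX 1%N); apply; split.
have e : c1 t = c2 t.
  apply: (ode_unique oTT (sT 1%N) _ _ _ tT) => [s sT'|s sT'|].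
  - have [Oc dc] := cP s sT'; split; first by split.
    apply: is_derive_pair => //.
    rewrite /= -killing_spray//; exact: derive_comp dc (dTX _ Oc).
  - have [Oc dc] := cP s sT'; split; first by split.
    apply: is_derive_pair => //=; rewrite d0; exact: is_derive_cst.
  - rewrite /c1 /c2 /tangent_field X0 dX0 //.
by have := congr1 (fun z => z.2.1) e.
Qed.
End Spray.

Section SprayIsometry.
Variables (W Om Om' : set H) (G G' : H -> H -> H -> R) (f : H -> H).
Hypotheses (mG : local_metric Om G) (mG' : local_metric Om' G') (WO : W `<=` Om).
Hypothesis If : local_isometry W G Om' G' f.

Lemma spray_isometry z : W z.1 ->
  'd (tangent_field f) z (spray G z) = spray G' (tangent_field f z).
Proof.
case: z => x v Wx; have [oW sf _ _ _] := If.
apply: (etrans (diff_tangent_field v _ oW Wx (sf 2%N))); apply: (congr2 pair (erefl _)).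
apply: (etrans (congr2 +%R (erefl _) (dN _ _ _))).
have alg (a b c : H) : a + b = c -> b + - c = - a by move=> <-; vring R.
exact: (alg _ _ _ (chris_isometry v v mG mG' WO If Wx)).
Qed.

Lemma geodesic_isometry (c : R -> H * H) t : W (c t).1 ->
  is_derive (t : R^o) 1 (c : R^o -> (H * H)%type) (spray G (c t)) ->
  is_derive (t : R^o) 1 ((fun s => tangent_field f (c s)) : R^o -> (H * H)%type)
     (spray G' (tangent_field f (c t))).
Proof.
move=> Wc dc; have [oW sf _ _ _] := If.
have dT : differentiable (tangent_field f) (c t).
  by have [+ _] := class_CS (tangent_field_smooth oW sf 1%N); apply; split.
by have := derive_comp dc dT; rewrite spray_isometry.
Qed.
End SprayIsometry.

Section Exponential.
Variables (Om : set H) (G : H -> H -> H -> R).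
Hypothesis mG : local_metric Om G.
Let oOm : open Om := lm_open mG.
Let oOmT : open (Om `*` setT : set (H * H)). Proof. exact: openMT. Qed.

Lemma nball_neg (z0 x v : H) r : nball (z0, 0) r (x, v) -> nball (z0, 0) r (x, - v).
Proof. by rewrite /nball /= !pair_norm_lt /= !subr0 normrN. Qed.

Lemma nball_pair (z0 x y : H) r : nball z0 r x -> nball z0 r y -> nball (z0, z0) r (x, y).
Proof. by move=> h1 h2; rewrite /nball /= pair_norm_lt /=; apply/andP. Qed.

(** [ell (x, y)] is the initial velocity of a geodesic that runs from [x] to [y] in time [tau / 2],
    with both ends free in one ball. The time [tau / 2] lies strictly inside the interval where the
    flow is controlled. *)
Record geodesic_chart (z0 : H) (r tau rho : R) (phi : R -> H * H -> H * H) (ell : H * H -> H)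
    : Prop := GeodesicChart {
  gc_r : 0 < r; gc_tau : 0 < tau; gc_rho : 0 < rho;
  gc_sub : nball (z0, 0 : H) r `<=` Om `*` setT;
  gc_flow : flows (spray G) (nball (z0, 0 : H) r) tau phi (Om `*` setT);
  gc_smooth : forall t, `|t| < tau -> smooth_on (nball (z0, 0 : H) r) (phi t);
  gc_log_smooth : smooth_on (nball (z0, z0) rho) ell;
  gc_dom : nball z0 rho `<=` Om;
  gc_log : forall x y, nball z0 rho x -> nball z0 rho y ->
    nball (z0, 0 : H) r (x, ell (x, y)) /\ (phi (tau / 2) (x, ell (x, y))).1 = y }.

Lemma spray_rest x : Om x -> spray G (x, 0) = 0.
Proof. by move=> Ox; rewrite /spray /= (chris0r mG _ Ox) oppr0. Qed.

(** Inverse function theorem at [(z0, 0)] for the map sending [(x, v)] to [x] and the point reached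
    at time [tau / 2]. *)
Lemma geodesic_chart_exists z0 : Om z0 ->
  exists r tau rho phi ell, geodesic_chart z0 r tau rho phi ell.
Proof.
move=> Oz; have cH : geo_complete H by exact: complete_geo.
have cHH : geo_complete (H * H)%type by exact: geo_complete_pair.
have [r r0 [tau tau0 [phi [rU fl sphi dphi]]]] :=
  local_flow (x0 := (z0, 0)) cHH oOmT (spray_smooth mG) (conj Oz I).
have z0r : nball (z0, 0 : H) r (z0, 0 : H) by exact: nball_center.
have rest t : `|t| < tau -> phi t (z0, 0) = (z0, 0).
  move=> tt; have [p0 pP] := fl _ z0r.
  apply: (ode_unique oOmT (spray_smooth mG 1%N) (T := tau) (c1 := fun s => phi s (z0, 0))
    (c2 := fun=> (z0, 0)) pP) => // s sT; split=> //.
  by rewrite spray_rest//; exact: is_derive_cst.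
pose S := 'd (spray G) (z0, 0 : H).
have SE (a b : H) : S (a, b) = (b, 0).
  rewrite /S (dspray mG _ _ _ Oz) (chris0r mG _ Oz) (chris0l mG _ Oz); congr pair.
  have i0 : is_diff z0 (fun y => chris G y 0 0) (fun=> 0 : H).
    apply: (is_diff_open oOm Oz _ (is_diff_cst 0 z0)) => y Oy.
    by rewrite (chris0r mG 0 Oy).
  by have [_ ->] := i0; rewrite !addr0 oppr0.
have dS : differentiable (spray G) (z0, 0 : H).
  by have [+ _] := class_CS (spray_smooth mG 1%N); apply; split.
(* Along the constant geodesic the linearised spray is [(a, b) |-> (b, 0)], so the linearised flow
   is explicit by uniqueness of solutions. *)
have dphi0 t a b : `|t| < tau -> 'd (phi t) (z0, 0) (a, b) = (a + t *: b, b).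
  move=> tt.
  apply: (ode_unique (@openT _) (@class_C_bl R 1 _ _ setT _ (diff_bl dS)) (T := tau)
    (c1 := fun s => 'd (phi s) (z0, 0) (a, b)) (c2 := fun s => (a + s *: b, b))) tt.
  - by move=> s sT; split=> //; have := dphi _ (a, b) s z0r sT; rewrite rest.
  - move=> s sT; split=> //; rewrite [X in is_derive _ _ _ X]SE.
    exact: is_derive_pair (is_derive_affine a b s) (is_derive_cst b s 1).
  - rewrite scale0r addr0.
    have i0 : is_diff (z0, 0 : H) (phi 0) id.
      apply: (is_diff_open (@nball_open _ _ _ r) z0r _ (is_diff_id _)) => y yr.
      by have [->] := fl _ yr.
    by have [_ ->] := i0.
have t2 : `|tau / 2| < tau by rewrite ger0_norm ?divr_ge0 ?(ltW tau0)//; lra.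
pose f (z : H * H) := (z.1, (phi (tau / 2) z).1).
have oB : open (nball (z0, 0 : H) r) by exact: nball_open.
have sf : smooth_on (nball (z0, 0) r) f.
  move=> n; apply: class_C_pair => //; first exact: class_C_fst.
  by apply: class_C_fstc => //; exact: sphi.
have df a b : 'd f (z0, 0) (a, b) = (a, a + (tau / 2) *: b).
  have i1 : is_diff (z0, 0) (fst : H * H -> H) fst.
    by apply: bl_is_diff; split=> //; exists 1 => // z; rewrite mul1r norm_fst.
  have i2 : is_diff (phi (tau / 2) (z0, 0)) (fst : H * H -> H) fst.
    by apply: bl_is_diff; split=> //; exists 1 => // z; rewrite mul1r norm_fst.
  have i3 : is_diff (z0, 0 : H) (phi (tau / 2)) ('d (phi (tau / 2)) (z0, 0)).
    by apply: differentiableP; have [+ _] := class_CS (sphi _ t2 1%N); apply.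
  have [_ ->] := is_diff_pair i1 (@is_diff_comp _ _ _ _ _ _ _ _ (z0, 0) i3 i2).
  by rewrite /= dphi0.
pose j (p : H * H) := (p.1, (2 / tau) *: (p.2 - p.1)).
have tau2 : 2 / tau * (tau / 2) = 1 by field; rewrite gt_eqF.
have ij : inverse_maps ('d f (z0, 0)) j.
  split.
  - split=> [a u v|]; first by apply: injective_projections => //=; rewrite scalerA; vring R.
    exists (1 + `|2 / tau| * 2) => [|p]; first by rewrite ltr_wpDr ?mulr_ge0.
    rewrite pair_norm_le /= mulrDl mul1r; apply/andP; split.
      by apply: le_trans (norm_fst p) _; rewrite lerDl !mulr_ge0.
    rewrite normrZ; apply: (@le_trans _ _ (`|2 / tau| * 2 * `|p|)); last by rewrite lerDr.
    rewrite -mulrA ler_wpM2l// mulr2n mulrDl mul1r.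
    by apply: le_trans (ler_normB _ _) _; apply: lerD; [exact: norm_snd|exact: norm_fst].
  - by move=> [a b]; rewrite df /j /= [_ + (tau / 2) *: b]addrC addrK scalerA tau2 scale1r.
  - by move=> [a b]; rewrite df /j /= scalerA mulrC tau2 scale1r addrC subrK.
have [r1 r10 [rho rho0 [k [r1r kP sk _]]]] := inverse_function cHH oB sf z0r ij.
have fz : f (z0, 0) = (z0, z0) by rewrite /f /= rest.
rewrite fz in kP sk.
pose ell p := (k p).2.
have key x y : nball z0 rho x -> nball z0 rho y -> nball (z0, 0) r (x, ell (x, y)) /\
    (phi (tau / 2) (x, ell (x, y))).1 = y.
  move=> xr yr; have [/r1r kr fk] := kP _ (nball_pair xr yr).
  have k1 : (k (x, y)).1 = x by have := congr1 fst fk.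
  have -> : (x, ell (x, y)) = k (x, y) by rewrite -{1}k1 /ell; case: (k _).
  by split=> //; have := congr1 snd fk.
exists r, tau, rho, phi, ell; split=> //.
- by move=> n; apply: class_C_sndc; [exact: nball_open|exact: sk].
- by move=> x xr; have [/rU[]] := key x x xr xr.
Qed.
End Exponential.
End Geodesics.

(** * Smooth maps on the manifold *)

Section Charts.
Variables (R : realType) (H : hilbertSpace R) (M : manifold H).
Implicit Types (q r : M) (E : normedModType R).

Lemma open_domain q : open (domain q : set M). Proof. exact: dom_open. Qed.
Lemma open_codomain q : open (codomain q). Proof. exact: codom_open. Qed.
Lemma domain_self q : domain q q. Proof. exact: mem_chart_at. Qed.

Lemma to_chartK q a : domain q a -> of_chart q (to_chart q a) = a.
Proof. exact: coordK. Qed.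

Lemma to_chart_codomain q a : domain q a -> codomain q (to_chart q a).
Proof. by move=> qa; exists a. Qed.

Lemma of_chartK q x : codomain q x -> domain q (of_chart q x) /\ to_chart q (of_chart q x) = x.
Proof. by case=> a qa <-; rewrite /of_chart (coordK qa). Qed.

Definition chart_pre q (U : set M) : set H := [set x | codomain q x /\ U (of_chart q x)].

Lemma chart_pre_image q U : to_chart q @` (domain q `&` U) = chart_pre q U.
Proof.
apply/seteqP; split=> x; first by move=> [a [qa Ua] <-]; split; [exists a|rewrite to_chartK].
by move=> [cx Ux]; have [d e] := of_chartK cx; exists (of_chart q x).
Qed.

Lemma open_preimage E (W : set E) (psi : E -> M) (U : set M) : open W ->
  (forall x, W x -> {for x, continuous psi}) -> open U -> open [set x | W x /\ U (psi x)].
Proof.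
move=> oW cW oU; rewrite openE => x [Wx Ux].
have h1 : \forall y \near x, W y by exact: open_near.
have h2 : nbhs x (psi @^-1` U) by apply: (cW x Wx); exact: open_nbhs_nbhs.
by rewrite /interior; near=> y; split; near: y.
Unshelve. all: by end_near. Qed.

Lemma of_chart_cont q x : codomain q x -> {for x, continuous (of_chart q)}.
Proof. exact: param_continuous. Qed.

Lemma open_chart_pre q U : open U -> open (chart_pre q U).
Proof. by move=> oU; apply: open_preimage => //; [exact: open_codomain|exact: of_chart_cont]. Qed.

Definition trans q r (x : H) : H := to_chart r (of_chart q x).

Lemma trans_smooth q r : smooth_on (chart_pre q (domain r)) (trans q r).
Proof. by rewrite -chart_pre_image; exact: transition_smooth. Qed.

(** Smooth maps from an open set of a normed space into [M], tested in all charts. Maps between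
    manifolds, families with parameters and flows are all handled by precomposing with such maps. *)
Definition par E (W : set E) (psi : E -> M) : Prop :=
  [/\ open W, forall x, W x -> {for x, continuous psi} &
      forall r, smooth_on [set x | W x /\ domain r (psi x)] (fun x => to_chart r (psi x))].

Lemma par_open E (W : set E) psi U : par W psi -> open U -> open [set x | W x /\ U (psi x)].
Proof. by move=> [oW cW _] oU; exact: open_preimage. Qed.

Lemma par_local E (W : set E) (psi : E -> M) : open W ->
  (forall x, W x -> exists V q phi, [/\ open V, V x, smooth_on V phi,
     (forall y, V y -> codomain q (phi y)) & forall y, V y -> psi y = of_chart q (phi y)]) ->
  par W psi.
Proof.
move=> oW loc; have cW x : W x -> {for x, continuous psi}.
  move=> Wx; have [V [q [phi [oV Vx sphi cphi e]]]] := loc x Wx.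
  have c1 : {for x, continuous phi} by exact: (class_C_cont (sphi 0%N) Vx).
  have c2 := @continuous_comp _ _ _ phi (of_chart q) x c1 (of_chart_cont (cphi x Vx)).
  rewrite /prop_for /continuous_at (e x Vx).
  apply: cvg_trans c2; apply: near_eq_cvg.
  have : \forall y \near x, V y by exact: open_near.
  by apply: filterS => y Vy; rewrite (e y Vy).
split=> // r n; apply: class_C_local => x [Wx dx].
have [V [q [phi [oV Vx sphi cphi e]]]] := loc x Wx.
have oWr := open_preimage oW cW (open_domain r).
exists (V `&` [set x | W x /\ domain r (psi x)]); split=> //; first exact: openI.
have oVW : open (V `&` [set x | W x /\ domain r (psi x)]) by exact: openI.
apply: (@class_C_ext _ n _ _ _ (fun y => trans q r (phi y))) => //.
  by move=> y [Vy _]; rewrite e.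
apply: (class_C_comp oVW _ _ (trans_smooth q r n)).
  by move=> y [Vy [Wy dy]]; split; [exact: cphi|rewrite -e].
by apply: class_C_sub (sphi n) => y [].
Qed.

Lemma par_chart q : par (codomain q) (of_chart q).
Proof.
apply: par_local (open_codomain q) _ => x cx; exists (codomain q), q, id; split=> //.
  exact: open_codomain.
by move=> n; exact: class_C_id.
Qed.

Lemma par_pre E E' (W : set E) (W' : set E') (psi : E -> M) (phi : E' -> E) : open W' ->
  smooth_on W' phi -> (forall x, W' x -> W (phi x)) -> par W psi -> par W' (psi \o phi).
Proof.
move=> oW' sphi WW [oW cW sW]; split=> // [x W'x|r n].
  apply: continuous_comp; last exact: cW (WW _ W'x).
  exact: (class_C_cont (sphi 0%N) W'x).
have oWr := open_preimage oW cW (open_domain r).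
have c' x : W' x -> {for x, continuous (psi \o phi)}.
  move=> W'x; apply: continuous_comp; last exact: cW (WW _ W'x).
  exact: (class_C_cont (sphi 0%N) W'x).
apply: (class_C_comp (open_preimage oW' c' (open_domain r)) _ _ (sW r n)).
  by move=> x [W'x dx]; split=> //; exact: WW.
by apply: class_C_sub (sphi n) => x [].
Qed.

Lemma par_sub E (W W' : set E) psi : open W' -> W' `<=` W -> par W psi -> par W' psi.
Proof. by move=> oW' WW; apply: (par_pre (phi := id) oW') => // n; exact: class_C_id. Qed.

Lemma par_of_smooth E (W : set E) q phi : open W -> smooth_on W phi ->
  (forall x, W x -> codomain q (phi x)) -> par W (of_chart q \o phi).
Proof. by move=> oW sphi Wq; exact: par_pre (par_chart q). Qed.

Lemma par_ext E (W : set E) psi psi' : (forall x, W x -> psi x = psi' x) -> par W psi -> par W psi'.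
Proof.
move=> e pW; have [oW cW sW] := pW; apply: par_local => // x Wx.
pose q := psi x.
exists [set y | W y /\ domain q (psi y)], q, (fun y => to_chart q (psi y)); split.
- exact: par_open pW (open_domain q).
- by split=> //; exact: domain_self.
- exact: sW.
- by move=> y [Wy dy]; exact: to_chart_codomain.
- by move=> y [Wy dy]; rewrite to_chartK// e.
Qed.

Lemma par_glue E (W : set E) psi : (forall x, W x -> exists V, V x /\ par V psi) -> open W ->
  par W psi.
Proof.
move=> loc oW; apply: par_local => // x Wx; have [V [Vx pV]] := loc x Wx; have [oV cV sV] := pV.
pose q := psi x.
exists [set y | V y /\ domain q (psi y)], q, (fun y => to_chart q (psi y)); split=> //.
- exact: par_open pV (open_domain q).
- by split=> //; exact: domain_self.
- by move=> y [Vy dy]; exact: to_chart_codomain.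
- by move=> y [Vy dy]; rewrite to_chartK.
Qed.

Definition smooth_in (U : set M) (f : M -> M) : Prop :=
  open U /\ forall q, par (chart_pre q U) (f \o of_chart q).

Lemma smooth_in_cont U f a : smooth_in U f -> U a -> {for a, continuous f}.
Proof.
move=> [oU pf] Ua; have [_ cf _] := pf a; pose x := to_chart a a.
have ax : of_chart a x = a by exact: to_chartK (domain_self a).
have Ux : chart_pre a U x by split; [exact: to_chart_codomain (domain_self a)|rewrite ax].
have c1 : {for a, continuous (to_chart a)} := @Defs.coord_continuous _ _ _ (chart_at a) a (domain_self a).
have c2 := @continuous_comp _ _ _ (to_chart a) (f \o of_chart a) a c1 (cf _ Ux).
have fe : f a = (f \o of_chart a) (to_chart a a) by rewrite /= ax.
rewrite /prop_for /continuous_at [X in _ --> X]fe.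
apply: cvg_trans c2; apply: near_eq_cvg.
have : nbhs a (domain a) by apply: open_nbhs_nbhs; split; [exact: open_domain|exact: domain_self].
by apply: filterS => b ab /=; rewrite to_chartK.
Qed.

Lemma smooth_mapP f : smooth_map f <-> smooth_in setT f.
Proof.
split=> [[cf sf]|sf].
  split=> [|q]; first exact: openT.
  have -> : chart_pre q setT = codomain q by apply/seteqP; split=> x; [case|].
  split=> [|x cx|r]; first exact: open_codomain.
    by apply: continuous_comp; [exact: of_chart_cont|exact: cf].
  by have := sf q r; rewrite chart_pre_image.
split=> [a|q r]; first exact: smooth_in_cont sf I.
rewrite chart_pre_image; have [_ /(_ q)[_ _ /(_ r)]] := sf.
have -> // : [set x | chart_pre q setT x /\ domain r ((f \o of_chart q) x)] = chart_pre q (f @^-1` domain r).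
by apply/seteqP; split=> x; [move=> [[]]|move=> []].
Qed.

Lemma par_comp E (W : set E) psi U f : smooth_in U f -> par W psi ->
  (forall x, W x -> U (psi x)) -> par W (f \o psi).
Proof.
move=> [oU pf] pW WU; have [oW cW sW] := pW; apply: par_glue => // x Wx.
pose q := psi x; exists [set y | W y /\ domain q (psi y)].
split; first by split=> //; exact: domain_self.
apply: (@par_ext _ _ (fun y => (f \o of_chart q) (to_chart q (psi y)))).
  by move=> y [Wy dy]; rewrite /= to_chartK.
apply: (par_pre _ (sW q) _ (pf q)); first exact: par_open pW (open_domain q).
move=> y [Wy dy]; split; first exact: to_chart_codomain.
by rewrite to_chartK//; exact: WU.
Qed.

Definition in_charts (f : M -> M) q r (x : H) : H := to_chart r (f (of_chart q x)).

Lemma par_diff E (W : set E) psi r x : par W psi -> W x -> domain r (psi x) ->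
  is_diff x (fun y => to_chart r (psi y)) ('d (fun y => to_chart r (psi y)) x).
Proof.
by move=> [_ _ sW] Wx dx; apply: differentiableP; have [+ _] := class_CS (sW r 1%N); apply.
Qed.

Lemma map_chain E (W : set E) psi U f q r x v : smooth_in U f -> par W psi -> W x ->
  U (psi x) -> domain q (psi x) -> domain r (f (psi x)) ->
  'd (fun y => to_chart r (f (psi y))) x v =
  'd (in_charts f q r) (to_chart q (psi x)) ('d (fun y => to_chart q (psi y)) x v).
Proof.
move=> sf pW Wx Ux qx rx; have d1 := par_diff pW Wx qx.
have [oU pf] := sf.
have cx : chart_pre q U (to_chart q (psi x)).
  by split; [exact: to_chart_codomain|rewrite to_chartK].
have rx' : domain r ((f \o of_chart q) (to_chart q (psi x))) by rewrite /= to_chartK.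
have d2 := par_diff (pf q) cx rx'.
have d3 := @is_diff_comp _ _ _ _ _ _ _ _ x d1 d2.
have [oW _ _] := pW.
have oWq := par_open pW (open_domain q).
have e y : W y /\ domain q (psi y) ->
    to_chart r ((f \o of_chart q) (to_chart q (psi y))) = to_chart r (f (psi y)).
  by move=> [Wy qy]; rewrite /= to_chartK.
by have [_ ->] := is_diff_open oWq (conj Wx qx) e d3.
Qed.

Lemma smooth_id : smooth_in setT (id : M -> M).
Proof.
split=> [|q]; first exact: openT.
have -> : chart_pre q setT = codomain q by apply/seteqP; split=> x; [case|].
exact: par_chart.
Qed.

Lemma par_change E (W : set E) psi q r x v : par W psi -> W x ->
  domain q (psi x) -> domain r (psi x) ->
  'd (fun y => to_chart r (psi y)) x v =
  'd (trans q r) (to_chart q (psi x)) ('d (fun y => to_chart q (psi y)) x v).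
Proof. by move=> pW Wx qx rx; exact: (map_chain v smooth_id pW Wx I qx rx). Qed.

Lemma trans_self q x v : codomain q x -> 'd (trans q q) x v = v.
Proof.
move=> cx; have [_ ->] : is_diff x (trans q q) id; last by [].
apply: (is_diff_open (open_codomain q) cx _ (is_diff_id x)) => y cy.
by rewrite /trans; have [_ ->] := of_chartK cy.
Qed.

Lemma trans_comp q r s x v : codomain q x -> domain r (of_chart q x) -> domain s (of_chart q x) ->
  'd (trans q s) x v = 'd (trans r s) (trans q r x) ('d (trans q r) x v).
Proof. by move=> cx rx sx; exact: par_change (par_chart q) cx rx sx. Qed.

Lemma trans_inv q r x v : codomain q x -> domain r (of_chart q x) ->
  'd (trans r q) (trans q r x) ('d (trans q r) x v) = v.
Proof. by move=> cx rx; rewrite -trans_comp//; [exact: trans_self|have [] := of_chartK cx]. Qed.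

Lemma transK q r x : codomain q x -> domain r (of_chart q x) ->
  [/\ codomain r (trans q r x), of_chart r (trans q r x) = of_chart q x & trans r q (trans q r x) = x].
Proof.
move=> cx rx; have e : of_chart r (trans q r x) = of_chart q x by rewrite /trans to_chartK.
by split=> //; [exact: to_chart_codomain|rewrite {1}/trans e; have [_ ->] := of_chartK cx].
Qed.

Lemma trans_diff q r x : codomain q x -> domain r (of_chart q x) -> differentiable (trans q r) x.
Proof. by move=> cx rx; have [+ _] := class_CS (trans_smooth q r 1%N); apply. Qed.
End Charts.

(** * Two topological propagation principles *)

Section Topology.
Variables (R : realType).

Lemma is_derive_continuous (E : normedModType R) (c : R -> E) t v :
  is_derive (t : R^o) 1 (c : R^o -> E) v -> {for t, continuous (c : R^o -> E)}.
Proof. by move=> d; apply: differentiable_continuous; apply/derivable1_diffP; exact: (@ex_derive _ _ _ _ _ _ _ d). Qed.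

Lemma left_limit_unique (T : topologicalType) (c1 c2 : R -> T) (a b : R) :
  hausdorff_space T -> a < b -> {for b, continuous (c1 : R^o -> T)} ->
  {for b, continuous (c2 : R^o -> T)} -> (forall t, a <= t < b -> c1 t = c2 t) -> c1 b = c2 b.
Proof.
move=> hT ab k1 k2 e; apply: hT => A B A1 B2.
have h1 : nbhs (b : R^o) (c1 @^-1` A) by exact: k1.
have h2 : nbhs (b : R^o) (c2 @^-1` B) by exact: k2.
have /nbhs_ballP[d /= d0 dP] : nbhs (b : R^o) ((c1 @^-1` A) `&` (c2 @^-1` B)) by exact: filterI.
pose t := Num.max a (b - d / 2).
have tb : t < b by rewrite /t gt_max ab ltrBlDr ltrDl divr_gt0.
have at_ : a <= t by rewrite /t le_max lexx.
have [] : ((c1 @^-1` A) `&` (c2 @^-1` B)) t.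
  apply: dP; rewrite /ball /= ger0_norm ?subr_ge0 ?(ltW tb)// ltrBlDl -ltrBlDr.
  by rewrite /t lt_max; apply/orP; right; lra.
by rewrite /preimage /= => At Bt; exists (c1 t); split=> //; rewrite e ?at_.
Qed.

(** The hypothesis makes both [P] and its complement open. A statement transferred between any two
    points of a small neighbourhood thereby spreads over the whole manifold. *)
Lemma connected_propagation (T : topologicalType) (P : set T) (a : T) :
  connected [set: T] -> P a ->
  (forall b, exists N, [/\ open N, N b & forall x y, N x -> N y -> P x -> P y]) ->
  forall b, P b.
Proof.
move=> cT Pa loc b.
have -> // : P = setT.
apply: cT; first by exists a.
  exists P; last by rewrite setTI.
  rewrite openE => x Px; have [N [oN Nx NP]] := loc x.
  by rewrite /interior; apply: filterS (open_nbhs_nbhs (conj oN Nx)) => y Ny; exact: NP Px.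
exists P; last by rewrite setTI.
rewrite -[P]setCK; apply: open_closedC; rewrite openE => x Px; have [N [oN Nx NP]] := loc x.
by rewrite /interior; apply: filterS (open_nbhs_nbhs (conj oN Nx)) => y Ny Py; apply: Px; exact: NP Py.
Qed.
End Topology.

(** * The metric and isometries across charts *)

Section Metric.
Variables (R : realType) (H : hilbertSpace R) (M : manifold H) (g : metric M).
Implicit Types (q r : M) (E : normedModType R).

Let form q := form_in_chart g q.

Lemma metric_psd a : psd_form (g a). Proof. exact: dot_psd. Qed.

Lemma form_change q r x u v : codomain q x -> domain r (of_chart q x) ->
  form r (trans q r x) ('d (trans q r) x u) ('d (trans q r) x v) = form q x u v.
Proof.
move=> cx rx; have [cr e _] := transK cx rx; set a := of_chart q x.
have aa : domain a (of_chart q x) by exact: domain_self.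
change (g (of_chart r (trans q r x)) ('d (trans r (of_chart r (trans q r x))) (trans q r x) ('d (trans q r) x u))
  ('d (trans r (of_chart r (trans q r x))) (trans q r x) ('d (trans q r) x v))
  = g a ('d (trans q a) x u) ('d (trans q a) x v)).
have alg b U V : b = a -> g b ('d (trans r b) (trans q r x) U) ('d (trans r b) (trans q r x) V) =
    g a ('d (trans r a) (trans q r x) U) ('d (trans r a) (trans q r x) V) by move=> ->.
exact: (etrans (alg _ _ _ e)
  (esym (congr2 (fun u v => g a u v) (trans_comp u cx rx aa) (trans_comp v cx rx aa)))).
Qed.

Lemma form_self a u v : form a (to_chart a a) u v = g a u v.
Proof.
have da := domain_self a; have e := to_chartK da; have ca := to_chart_codomain da.
change (g (of_chart a (to_chart a a)) ('d (trans a (of_chart a (to_chart a a))) (to_chart a a) u)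
  ('d (trans a (of_chart a (to_chart a a))) (to_chart a a) v) = g a u v).
have alg b : b = a -> g b ('d (trans a b) (to_chart a a) u) ('d (trans a b) (to_chart a a) v) =
    g a ('d (trans a a) (to_chart a a) u) ('d (trans a a) (to_chart a a) v) by move=> ->.
exact: (etrans (alg _ e) (congr2 (fun u v => g a u v) (trans_self u ca) (trans_self v ca))).
Qed.

Lemma form_metric q : local_metric (codomain q) (form q).
Proof.
split; [exact: open_codomain| | |exact: metric_smooth] => x cx;
  have aa : domain (of_chart q x) (of_chart q x) by exact: domain_self.
- have := metric_psd (of_chart q x); set L := 'd (trans q (of_chart q x)) x => fg.
  split=> [a u v w|u v|u].
  + change (g (of_chart q x) (L (a *: u + v)) (L w) = a * g (of_chart q x) (L u) (L w) + g (of_chart q x) (L v) (L w)).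
    by rewrite dD dZ (psdDl fg) (psdZl fg).
  + exact: (psdC fg (L u) (L v)).
  + exact: (psd_ge0 fg (L u)).
- have [c [D [c0 cD]]] := metric_strong g (of_chart q x).
  have [C1 C10 C1P] := diff_bounded (trans_diff cx aa).
  have [cr _ _] := transK cx aa.
  have bx : domain q (of_chart (of_chart q x) (trans q (of_chart q x) x)).
    by have [_ -> _] := transK cx aa; have [] := of_chartK cx.
  have [C2 C20 C2P] := diff_bounded (trans_diff cr bx).
  exists (c / C2 ^+ 2), (`|D| * C1 ^+ 2); split=> [|v]; first by rewrite divr_gt0 ?exprn_gt0.
  have /andP[h1 h2] := cD ('d (trans q (of_chart q x)) x v).
  apply/andP; split.
    apply: le_trans h1; rewrite -mulrA ler_wpM2l ?(ltW c0)// mulrC ler_pdivrMr ?exprn_gt0//.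
    rewrite -exprMn ler_pXn2r ?nnegrE ?mulr_ge0 ?(ltW C20)// mulrC.
    by have := C2P ('d (trans q (of_chart q x)) x v); rewrite trans_inv.
  apply: le_trans h2 _; apply: (@le_trans _ _ (`|D| * `|'d (trans q (of_chart q x)) x v| ^+ 2)).
    by rewrite ler_wpM2r ?exprn_ge0// ler_norm.
  rewrite -mulrA ler_wpM2l// -exprMn ler_pXn2r ?nnegrE ?mulr_ge0 ?(ltW C10)//.
Qed.

Definition preserves (f : M -> M) q r x : Prop := forall u v,
  form r (in_charts f q r x) ('d (in_charts f q r) x u) ('d (in_charts f q r) x v) = form q x u v.

Definition iso_in (U : set M) (f : M -> M) : Prop := smooth_in U f /\
  forall q r x, codomain q x -> U (of_chart q x) -> domain r (f (of_chart q x)) -> preserves f q r x.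

(** Transition maps are isometries of the local expressions of the metric, so preservation at a
    point may be checked in any one pair of charts. *)
Lemma preserves_change U f a q r q' r' : smooth_in U f -> U a -> domain q a -> domain q' a ->
  domain r (f a) -> domain r' (f a) -> preserves f q r (to_chart q a) -> preserves f q' r' (to_chart q' a).
Proof.
move=> sf Ua qa q'a ra r'a pf u v; have [oU pU] := sf.
have c1 := to_chart_codomain qa; have c2 := to_chart_codomain q'a.
have e1 := to_chartK qa; have e2 := to_chartK q'a.
have q2 : domain q (of_chart q' (to_chart q' a)) by rewrite e2.
have et : trans q' q (to_chart q' a) = to_chart q a by rewrite /trans e2.
have W1 : chart_pre q U (to_chart q a) by split; rewrite ?e1.
have dr : domain r (f (of_chart q (to_chart q a))) by rewrite e1.
have dr' : domain r' (f (of_chart q (to_chart q a))) by rewrite e1.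
have key w : 'd (in_charts f q' r') (to_chart q' a) w =
    'd (trans r r') (in_charts f q r (to_chart q a))
      ('d (in_charts f q r) (to_chart q a) ('d (trans q' q) (to_chart q' a) w)).
  have h1 := @map_chain _ _ _ _ (codomain q') (of_chart q') U f q r' (to_chart q' a) w sf (par_chart q') c2.
  rewrite e2 in h1; rewrite [LHS](h1 Ua qa r'a) {h1}.
  exact: (par_change _ (pU q) W1 dr dr').
have crf : codomain r (in_charts f q r (to_chart q a)).
  by rewrite /in_charts; exact: to_chart_codomain.
have drf : domain r' (of_chart r (in_charts f q r (to_chart q a))).
  by rewrite /in_charts to_chartK.
have -> : in_charts f q' r' (to_chart q' a) = trans r r' (in_charts f q r (to_chart q a)).
  by rewrite /trans /in_charts e2 e1 to_chartK.
rewrite (key u) (key v) (form_change _ _ crf drf) pf -(form_change u v c2 q2) et.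
by [].
Qed.

Lemma iso_in_at U f : smooth_in U f ->
  (forall a, U a -> exists q r, [/\ domain q a, domain r (f a) & preserves f q r (to_chart q a)]) ->
  iso_in U f.
Proof.
move=> sf loc; split=> // q r x cx Ux rx; have [dx e] := of_chartK cx.
have [q' [r' [q'a r'a p]]] := loc _ Ux.
by have := preserves_change sf Ux q'a dx r'a rx p; rewrite e.
Qed.

Lemma iso_in_tangent U f a u v : iso_in U f -> U a ->
  g (f a) (tangent_map f a u) (tangent_map f a v) = g a u v.
Proof.
move=> [sf pf] Ua; have da := domain_self a; have e := to_chartK da.
have := pf a (f a) (to_chart a a) (to_chart_codomain da).
rewrite e => /(_ Ua (domain_self _) u v); rewrite form_self => <-.
by rewrite /in_charts e form_self.
Qed.

Lemma iso_comp U V f h : iso_in U f -> iso_in V h -> (forall a, U a -> V (f a)) ->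
  iso_in U (h \o f).
Proof.
move=> [sf pf] [sh ph] UV; have [oU pU] := sf.
have shf : smooth_in U (h \o f).
  split=> // q; apply: (par_comp sh (pU q)) => x [cx Ux]; exact: UV.
apply: (iso_in_at shf) => a Ua; exists a, (h (f a)); split; [exact: domain_self|exact: domain_self|].
have da := domain_self a; have e := to_chartK da; have ca := to_chart_codomain da.
have dfa := domain_self (f a); have Wa : chart_pre a U (to_chart a a) by split; rewrite ?e.
move=> u v.
have h1 w := @map_chain _ _ _ _ (chart_pre a U) (f \o of_chart a) V h (f a) (h (f a)) (to_chart a a) w sh (pU a) Wa.
have key w : 'd (in_charts (h \o f) a (h (f a))) (to_chart a a) w =
   'd (in_charts h (f a) (h (f a))) (to_chart (f a) (f a)) ('d (in_charts f a (f a)) (to_chart a a) w).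
  by have := h1 w; rewrite /= e; apply=> //; [exact: UV|exact: domain_self].
have ec : in_charts (h \o f) a (h (f a)) (to_chart a a) = in_charts h (f a) (h (f a)) (to_chart (f a) (f a)).
  by rewrite /in_charts /= e to_chartK.
have alg (b : M) x x' U1 V1 U2 V2 : x = x' -> U1 = U2 -> V1 = V2 -> form b x U1 V1 = form b x' U2 V2.
  by move=> -> -> ->.
apply: (etrans (alg _ _ _ _ _ _ _ ec (key u) (key v))).
have efa := to_chartK dfa.
have h2 := ph (f a) (h (f a)) (to_chart (f a) (f a)) (to_chart_codomain dfa).
rewrite efa in h2; apply: (etrans (h2 (UV _ Ua) (domain_self _) _ _)).
have h3 := pf a (f a) (to_chart a a) ca; rewrite e in h3.
have ef : to_chart (f a) (f a) = in_charts f a (f a) (to_chart a a) by rewrite /in_charts e.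
exact: (etrans (alg _ _ _ _ _ _ _ ef (erefl _) (erefl _)) (h3 Ua dfa u v)).
Qed.

Lemma isometry_iso f : Defs.isometry g f -> iso_in setT f.
Proof.
move=> [[f' [_ _ sf _]] pf]; have sf' := (smooth_mapP f).1 sf.
apply: iso_in_at => // a _; exists a, (f a); split; [exact: domain_self|exact: domain_self|].
by move=> u v; rewrite /in_charts to_chartK ?form_self; [exact: pf|exact: domain_self].
Qed.

Lemma iso_isometry f f' : cancel f f' -> cancel f' f -> iso_in setT f -> iso_in setT f' -> Defs.isometry g f.
Proof.
move=> k k' i i'; split; first by exists f'; split=> //; apply/smooth_mapP; [case: i|case: i'].
by move=> q u v; exact: (iso_in_tangent u v i I).
Qed.

Lemma isometry_local f q r : Defs.isometry g f ->
  local_isometry (chart_pre q (f @^-1` domain r)) (form q) (codomain r) (form r) (in_charts f q r).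
Proof.
move=> If; have [[oT pT] pf] := isometry_iso If; have [[f' [k k' _ sf']] _] := If.
have sf1 := (smooth_mapP f).1 (let: conj (ex_intro f' (And4 _ _ s _)) _ := If in s).
have sf2 := (smooth_mapP f').1 sf'.
have eW : [set x | chart_pre q setT x /\ domain r ((f \o of_chart q) x)] = chart_pre q (f @^-1` domain r).
  by apply/seteqP; split=> x; [move=> [[]]|move=> []].
split.
- rewrite -eW; exact: par_open (pT q) (open_domain r).
- by have [_ _ /(_ r)] := pT q; rewrite -eW.
- by move=> x [cx rx]; exact: to_chart_codomain.
- by move=> x u w [cx rx]; exact: (pf q r x cx I rx).
- move=> x [cx rx] v; have [dx ex] := of_chartK cx.
  pose y := in_charts f q r x.
  have ey : of_chart r y = f (of_chart q x) by rewrite /y /in_charts to_chartK.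
  have cy : codomain r y by exact: to_chart_codomain.
  have efy : f' (of_chart r y) = of_chart q x by rewrite ey k.
  have pf' : par (chart_pre r setT) (f' \o of_chart r) by case: sf2.
  have Wy : chart_pre r setT y by split.
  exists ('d (in_charts f' r q) y v).
  have h1 := @map_chain _ _ _ _ _ (f' \o of_chart r) setT f q r y v sf1 pf' Wy I.
  rewrite /= efy in h1; have := h1 dx rx; rewrite ex => <-.
  rewrite -[RHS](trans_self v cy); congr ('d _ _ _).
  by apply/funext => z; rewrite k'.
Qed.
End Metric.

(** * Geodesics and Killing fields on the manifold *)

Section Transport.
Variables (R : realType) (H : hilbertSpace R) (M : manifold H) (g : metric M).
Implicit Types (q r : M).
Let form q := form_in_chart g q.

(* Closedness of the set of good times uses that [M] is Hausdorff. *)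
Lemma geodesic_transport f q r (c1 c2 : R -> H * H) T : Defs.isometry g f ->
  (forall t, 0 <= t <= T -> codomain q (c1 t).1 /\
    is_derive (t : R^o) 1 (c1 : R^o -> (H * H)%type) (spray (form q) (c1 t))) ->
  (forall t, 0 <= t <= T -> codomain r (c2 t).1 /\
    is_derive (t : R^o) 1 (c2 : R^o -> (H * H)%type) (spray (form r) (c2 t))) ->
  f (of_chart q (c1 0).1) = of_chart r (c2 0).1 ->
  tangent_field (in_charts f q r) (c1 0) = c2 0 ->
  forall t, 0 <= t <= T -> f (of_chart q (c1 t).1) = of_chart r (c2 t).1.
Proof.
move=> If c1P c2P e0 e1 t tT; have T0 : 0 <= T by case/andP: tT => /le_trans; apply.
have Il := isometry_local q r If; have [oW sf _ _ _] := Il.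
have mq := form_metric g q; have mr := form_metric g r.
have WO : chart_pre q (f @^-1` domain r) `<=` codomain q by move=> x [].
pose h := tangent_field (in_charts f q r).
have dh s : 0 <= s <= T -> domain r (f (of_chart q (c1 s).1)) ->
    is_derive (s : R^o) 1 ((fun s => h (c1 s)) : R^o -> (H * H)%type) (spray (form r) (h (c1 s))).
  move=> sT rs; have [cs ds] := c1P s sT.
  by apply: (geodesic_isometry mq mr WO Il) => //; split.
pose P s := domain r (f (of_chart q (c1 s).1)) /\ h (c1 s) = c2 s.
suff : P t.
  by case=> rt <-; rewrite /h /tangent_field /= /in_charts to_chartK.
move: t tT; apply: real_ind.
- by split=> //; rewrite e0; have [c _] := c2P 0 (introT andP (conj (lexx _) T0)); have [] := of_chartK c.
- move=> t /andP[t0 tT] Ps; have [rt et] := Ps t (introT andP (conj t0 (lexx _))).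
  have tT' : 0 <= t <= T by rewrite t0 ltW.
  have [ct dt] := c1P t tT'.
  have Wt : chart_pre q (f @^-1` domain r) (c1 t).1 by split.
  have [d d0 dW] := (openP _).1 oW _ Wt.
  have [e e0' eP] := derive_cont (is_derive_fst dt) d0.
  have We s : `|s - t| < e -> chart_pre q (f @^-1` domain r) (c1 s).1.
    by move=> /eP/dW; rewrite addrC subrK.
  exists e => // s /andP[ts se] sT.
  have st0 : 0 <= s - t by rewrite subr_ge0 ltW.
  have in1 u : 0 <= u <= s - t -> 0 <= t + u <= T /\ `|t + u - t| < e.
    move=> /andP[u0 us]; split; first by apply/andP; split; lra.
    by rewrite addrC addKr ger0_norm//; lra.
  have key := @ode_unique_right _ _ (spray (form r)) (codomain r `*` setT) (s - t)
    (fun u => h (c1 (t + u))) (fun u => c2 (t + u)) (openMT (lm_open mr)) (spray_smooth mr 1%N).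
  have es : t + (s - t) = s by rewrite addrC subrK.
  have [|Ws rs] := We s _; first by rewrite ger0_norm//; lra.
  split; first by (exact: rs || exact: Ws).
  rewrite -es; apply: key; rewrite ?addr0 ?st0 ?lexx//.
  + move=> u /in1[uT ue]; have [_ ru] := We _ ue; split.
      by split=> //; exact: to_chart_codomain.
    exact: is_derive_shift_time (dh _ uT ru).
  + move=> u /in1[uT ue]; have [cu du] := c2P _ uT; split; first exact: (conj cu I).
    exact: is_derive_shift_time du.
- move=> t /andP[t0 tT] Ps; have tT' : 0 <= t <= T by rewrite tT ltW.
  have [ct dt] := c1P t tT'; have [ct2 dt2] := c2P t tT'.
  have k1 : {for t, continuous ((fun s => f (of_chart q (c1 s).1)) : R^o -> M)}.
    apply: (@continuous_comp _ _ _ (fun s : R^o => of_chart q (c1 s).1) f).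
      apply: (@continuous_comp _ _ _ (fun s : R^o => (c1 s).1) (of_chart q)).
        exact: is_derive_continuous (is_derive_fst dt).
      exact: of_chart_cont.
    by have [[_ [_ _ [cf _] _]] _] := If; exact: cf.
  have k2 : {for t, continuous ((fun s => of_chart r (c2 s).1) : R^o -> M)}.
    apply: (@continuous_comp _ _ _ (fun s : R^o => (c2 s).1) (of_chart r)).
      exact: is_derive_continuous (is_derive_fst dt2).
    exact: of_chart_cont.
  have e : f (of_chart q (c1 t).1) = of_chart r (c2 t).1.
    apply: (left_limit_unique (@manifold_hausdorff _ _ M) t0 k1 k2) => s sT.
    by have [rs <-] := Ps s sT; rewrite /h /tangent_field /= /in_charts to_chartK.
  have rt : domain r (f (of_chart q (c1 t).1)) by rewrite e; have [] := of_chartK ct2.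
  split=> //; apply: (@left_limit_unique _ (H * H)%type (fun s => h (c1 s)) c2 0 t (@norm_hausdorff _ _) t0).
  + exact: is_derive_continuous (dh t tT' rt).
  + exact: is_derive_continuous dt2.
  + by move=> s sT; have [] := Ps s sT.
Qed.

Lemma open_chart_ball q z rho : open [set a | domain q a /\ nball z rho (to_chart q a)].
Proof.
rewrite openE => a [qa na]; rewrite /interior.
have h1 : \forall b \near a, domain q b by apply: open_nbhs_nbhs; split; [exact: open_domain|].
have h2 : nbhs a (to_chart q @^-1` nball z rho).
  apply: (@Defs.coord_continuous _ _ _ (chart_at q) a qa); apply: open_nbhs_nbhs; split=> //.
  exact: nball_open.
by near=> b; split; near: b.
Unshelve. all: by end_near. Qed.

Lemma field_change (X : vector_field M) q r x : codomain q x -> domain r (of_chart q x) ->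
  field_in_chart X r (trans q r x) = 'd (trans q r) x (field_in_chart X q x).
Proof.
move=> cx rx; have [_ e _] := transK cx rx; set a := of_chart q x.
have da := domain_self a; have ea := to_chartK da; have ca := to_chart_codomain da.
have [qa ex] := of_chartK cx.
have qa' : domain q (of_chart a (to_chart a a)) by rewrite ea.
have ra' : domain r (of_chart a (to_chart a a)) by rewrite ea.
have et : trans a q (to_chart a a) = x by rewrite /trans ea.
have alg b : b = a -> 'd (trans b r) (to_chart b b) (X b) = 'd (trans a r) (to_chart a a) (X a) by move=> ->.
have alg2 y : y = x -> 'd (trans q r) y ('d (trans a q) (to_chart a a) (X a)) =
   'd (trans q r) x ('d (trans a q) (to_chart a a) (X a)) by move=> ->.
exact: (etrans (alg _ e) (etrans (trans_comp (X a) ca qa' ra') (alg2 _ et))).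
Qed.

Lemma field_self (X : vector_field M) a : field_in_chart X a (to_chart a a) = X a.
Proof.
have da := domain_self a; have ea := to_chartK da.
have alg b : b = a -> 'd (trans b a) (to_chart b b) (X b) = 'd (trans a a) (to_chart a a) (X a) by move=> ->.
exact: (etrans (alg _ ea) (trans_self _ (to_chart_codomain da))).
Qed.

Lemma field_at (X : vector_field M) q a : domain q a ->
  field_in_chart X q (to_chart q a) = 'd (trans a q) (to_chart a a) (X a).
Proof.
move=> qa; have da := domain_self a; have ea := to_chartK da.
have := @field_change X a q (to_chart a a) (to_chart_codomain da).
by rewrite ea field_self /trans ea; apply.
Qed.

Lemma field_eq0 (X : vector_field M) q x : codomain q x ->
  field_in_chart X q x = 0 <-> X (of_chart q x) = 0.
Proof.
move=> cx; set a := of_chart q x; have [qa ex] := of_chartK cx.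
have da := domain_self a; have ea := to_chartK da.
have aq : domain q (of_chart a (to_chart a a)) by rewrite ea.
rewrite -{1}ex field_at//; split=> [|->]; last by rewrite d0.
by move=> /(congr1 ('d (trans q a) (trans a q (to_chart a a)))); rewrite trans_inv ?d0//; exact: to_chart_codomain.
Qed.

Lemma field_bracketE (X Y : vector_field M) q x : smooth_field X -> smooth_field Y -> codomain q x ->
  field_in_chart (field_bracket X Y) q x = lie (field_in_chart X q) (field_in_chart Y q) x.
Proof.
move=> sX sY cx; set a := of_chart q x; have [qa ex] := of_chartK cx.
have da := domain_self a; have ea := to_chartK da; have ca := to_chart_codomain da.
have aq : domain q (of_chart a (to_chart a a)) by rewrite ea.
have et : trans a q (to_chart a a) = x by rewrite /trans ea.
rewrite -{1}ex field_at//.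
have -> : field_bracket X Y a = lie (field_in_chart X a) (field_in_chart Y a) (to_chart a a).
  by rewrite /lie !field_self.
have oU : open (chart_pre a (domain q)) by apply: open_chart_pre; exact: open_domain.
have sub n Z : smooth_field Z -> class_C n (chart_pre a (domain q)) (field_in_chart Z a).
  by move=> sZ; apply: class_C_sub (sZ a n) => y [].
have := @lie_related _ _ _ (trans a q) (field_in_chart X a) (field_in_chart Y a)
  (field_in_chart X q) (field_in_chart Y q) (chart_pre a (domain q)) (codomain q) (to_chart a a)
  oU (conj ca aq) _ (@open_codomain _ _ _ q) (trans_smooth a q 2) (sub _ _ sX) (sub _ _ sY) (sX q _) (sY q _).
rewrite et => <- //.
- by move=> y [_]; exact: to_chart_codomain.
- by move=> y [cy qy]; exact: field_change.
- by move=> y [cy qy]; exact: field_change.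
Qed.

Lemma field_lin a (X Y : vector_field M) q x :
  field_in_chart (a *: X + Y) q x = a *: field_in_chart X q x + field_in_chart Y q x.
Proof. by rewrite /field_in_chart /tangent_to_chart fctE dD dZ. Qed.

(** Killing fields defined by the equation instead of a flow: in this form stability under linear
    combinations and brackets is local. The passage to [killing_field], which demands a global flow
    of isometries, is [inf_killing_field]. *)
Definition inf_killing (X : vector_field M) : Prop := smooth_field X /\
  forall q, killing_eq (codomain q) (form q) (field_in_chart X q).

Lemma smooth_field_lin a (X Y : vector_field M) : smooth_field X -> smooth_field Y ->
  smooth_field (a *: X + Y).
Proof.
move=> sX sY q n; have oc := @open_codomain _ _ _ q.
apply: (@class_C_ext _ n _ _ _ (fun x => a *: field_in_chart X q x + field_in_chart Y q x)) => //.
  by move=> x _; rewrite field_lin.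
by apply: class_C_add => //; [apply: class_C_scale => //; exact: sX|exact: sY].
Qed.

Lemma inf_killing_lin a X Y : inf_killing X -> inf_killing Y -> inf_killing (a *: X + Y).
Proof.
move=> [sX kX] [sY kY]; split=> [|q x u w cx]; first exact: smooth_field_lin.
have dX : is_diff x (field_in_chart X q) ('d (field_in_chart X q) x).
  by apply: differentiableP; have [+ _] := class_CS (sX q 1%N); apply.
have dY : is_diff x (field_in_chart Y q) ('d (field_in_chart Y q) x).
  by apply: differentiableP; have [+ _] := class_CS (sY q 1%N); apply.
have e y : codomain q y -> (a \*: field_in_chart X q + field_in_chart Y q) y = field_in_chart (a *: X + Y) q y.
  by move=> _; rewrite field_lin.
have [_ d] := is_diff_open (@open_codomain _ _ _ q) cx e (is_diffD (is_diffZ a dX) dY).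
have fG : psd_form (form q x) := lm_form (form_metric g q) cx.
have alg (m m1 m2 : R) (U V U1 V1 U2 V2 : H) : m = a * m1 + m2 -> U = a *: U1 + U2 -> V = a *: V1 + V2 ->
    m1 + form q x U1 w + form q x u V1 = 0 -> m2 + form q x U2 w + form q x u V2 = 0 ->
    m + form q x U w + form q x u V = 0.
  move=> -> -> -> h1 h2; rewrite (psdDl fG) (psdZl fG) (psdDr fG) (psdZr fG).
  by rewrite -[RHS](addr0 0) -{1}(mulr0 a) -{1}h1 -h2; ring.
apply: (alg _ _ _ _ _ _ _ _ _ _ (congr1 (fun l => l u) d) (congr1 (fun l => l w) d) (kX q x u w cx) (kY q x u w cx)).
by rewrite field_lin; exact: metric_d_lin1.
Qed.

Lemma inf_killing_bracket X Y : inf_killing X -> inf_killing Y -> inf_killing (field_bracket X Y).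
Proof.
move=> [sX kX] [sY kY]; split=> [q n|q].
  apply: (@class_C_ext _ n _ _ _ (lie (field_in_chart X q) (field_in_chart Y q))) => //.
  - exact: open_codomain.
  - by move=> x cx; rewrite field_bracketE.
  - by apply: lie_smooth => //; exact: open_codomain.
have := lie_killing (form_metric g q) (@subset_refl _ _) (@open_codomain _ _ _ q) (sX q _) (sY q _) (kX q) (kY q).
move=> kL x u w cx.
have e y : codomain q y -> lie (field_in_chart X q) (field_in_chart Y q) y = field_in_chart (field_bracket X Y) q y.
  by move=> cy; rewrite field_bracketE.
have dl := lie_smooth (@open_codomain _ _ _ q) (sX q) (sY q) 1.
have dL : is_diff x (lie (field_in_chart X q) (field_in_chart Y q)) ('d (lie (field_in_chart X q) (field_in_chart Y q)) x).
  by apply: differentiableP; have [+ _] := class_CS dl; apply.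
have [_ d] := is_diff_open (@open_codomain _ _ _ q) cx e dL.
have alg (Z1 Z2 U1 U2 V1 V2 : H) : Z1 = Z2 -> U1 = U2 -> V1 = V2 ->
  metric_d (form q) x Z2 u w + form q x U2 w + form q x u V2 = 0 ->
  metric_d (form q) x Z1 u w + form q x U1 w + form q x u V1 = 0 by move=> -> -> ->.
exact: (alg _ _ _ _ _ _ (esym (e x cx)) (congr1 (fun l => l u) d) (congr1 (fun l => l w) d) (kL x u w cx)).
Qed.

(** Inside a geodesic chart any two points are joined by a geodesic, along which the 1-jet of the
    field solves a linear equation; a zero jet at one point kills the field on the chart. The
    property propagated is vanishing on a neighbourhood, which contains the vanishing of the jet. *)
Lemma inf_killing_eq0 X p : inf_killing X -> X p = 0 ->
  (forall v, 'd (field_in_chart X p) (to_chart p p) v = 0) -> forall a, X a = 0.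
Proof.
move=> [sX kX] X0 dX0 a.
have local q : exists N, [/\ open N, N q, N `<=` domain q & forall x y, N x -> N y ->
    field_in_chart X q (to_chart q x) = 0 ->
    (forall v, 'd (field_in_chart X q) (to_chart q x) v = 0) -> X y = 0].
  have dq := domain_self q.
  have [r [tau [rho [phi [ell gc]]]]] := geodesic_chart_exists (form_metric g q) (to_chart_codomain dq).
  exists [set a | domain q a /\ nball (to_chart q q) rho (to_chart q a)]; split.
  - exact: open_chart_ball.
  - by split=> //; exact: nball_center (gc_rho gc).
  - by move=> x [].
  - move=> x y [qx nx] [qy ny] Xx dXx; have tau0 := gc_tau gc.
    have [rl el] := gc_log gc nx ny; have [f0 fP] := gc_flow gc rl.
    pose c t := phi t (to_chart q x, ell (to_chart q x, to_chart q y)).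
    have h := @killing_jet_zero _ _ _ _ (form_metric g q) _ c tau (sX q) (kX q).
    have t2 : `|tau / 2| < tau by rewrite ger0_norm ?divr_ge0 ?(ltW tau0)//; lra.
    rewrite -[y](to_chartK qy) -el; apply/(field_eq0 X); first by have [[]] := fP (tau / 2) t2.
    apply: h; rewrite /c ?f0//.
    by move=> t tt; have [[ct _] dt] := fP t tt.
pose P b := exists2 N : set M, open N /\ N b & forall y, N y -> X y = 0.
suff : P a by case=> N [_ Na]; exact.
apply: (@connected_propagation _ P p (@manifold_connected _ _ M)).
  have [N [oN Np Nd NP]] := local p; exists N => // y Ny.
  by apply: (NP p y Np Ny) => //; rewrite field_self.
move=> q; have [N [oN Nq Nd NP]] := local q; exists N; split=> // x y Nx Ny [V [oV Vx] V0].
exists N => // z Nz; have qx := Nd x Nx; have cx := to_chart_codomain qx; have ex := to_chartK qx.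
have Z w : codomain q w /\ V (of_chart q w) -> 0 = field_in_chart X q w.
  by move=> [cw Vw]; apply/esym/(field_eq0 X cw); exact: V0.
have cV : codomain q (to_chart q x) /\ V (of_chart q (to_chart q x)) by rewrite ex.
apply: (NP x z Nx Nz); first by rewrite -Z.
have [_ d] := is_diff_open (@open_chart_pre _ _ _ q V oV) cV Z (is_diff_cst (0 : H) (to_chart q x)).
by move=> v; rewrite d.
Qed.
End Transport.

Lemma open_preimage_diff (R : realType) (E F : normedModType R) (W : set E) (f : E -> F) (V : set F) :
  open W -> (forall x, W x -> {for x, continuous f}) -> open V -> open [set x | W x /\ V (f x)].
Proof.
move=> oW cf oV; rewrite openE => x [Wx Vx].
have h1 : \forall y \near x, W y by exact: open_near.
have h2 : nbhs x (f @^-1` V) by apply: (cf x Wx); exact: open_nbhs_nbhs.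
by rewrite /interior; near=> y; split; near: y.
Unshelve. all: by end_near. Qed.

(** * Geodesic symmetries and transitivity *)

Section Symmetries.
Variables (R : realType) (H : hilbertSpace R) (M : manifold H) (g : metric M).
Implicit Types (q r : M).
Let form q := form_in_chart g q.

Lemma isometry_comp f h : Defs.isometry g f -> Defs.isometry g h -> Defs.isometry g (h \o f).
Proof.
move=> If Ih; have i1 := isometry_iso If; have i2 := isometry_iso Ih.
have [[f' [kf kf' sf sf']] pf] := If; have [[h' [kh kh' sh sh']] ph] := Ih.
split; last by move=> a u v; apply: (iso_in_tangent u v (iso_comp i1 i2 _) I).
exists (f' \o h'); split.
- exact: can_comp.
- exact: can_comp.
- by apply/smooth_mapP; have [] := iso_comp i1 i2 (fun _ _ => I).
- apply/smooth_mapP; split=> [|q]; first exact: openT.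
  have [_ ph'] := (smooth_mapP h').1 sh'.
  by apply: (par_comp ((smooth_mapP f').1 sf') (ph' q)).
Qed.

Definition symmetry_at a (s : M -> M) : Prop :=
  [/\ Defs.isometry g s, involutive s, s a = a & forall v, tangent_map s a v = - v].

Lemma symmetry_diff a s q v : symmetry_at a s -> domain q a ->
  'd (in_charts s q q) (to_chart q a) v = - v.
Proof.
move=> [Is _ sa ds] qa; have [ss _] := isometry_iso Is; have [_ ps] := ss.
have da := domain_self a; have ea := to_chartK da; have ca := to_chart_codomain da.
have eq := to_chartK qa; have cq := to_chart_codomain qa.
have h1 := @map_chain _ _ _ _ (codomain q) (of_chart q) setT s a q (to_chart q a) v ss (par_chart q) cq.
rewrite eq sa in h1; rewrite [LHS](h1 I da qa).
have h2 w := @par_change _ _ _ _ (chart_pre a setT) (s \o of_chart a) a q (to_chart a a) w (ps a) (conj ca I).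
rewrite /= ea sa in h2; rewrite [LHS](h2 _ da qa).
have h3 := ds ('d (trans q a) (to_chart q a) v); rewrite /tangent_map sa in h3.
have h4 : 'd (trans a q) (to_chart a a) ('d (trans q a) (to_chart q a) v) = v.
  by have := trans_inv v cq (r := a); rewrite eq /trans eq; apply.
apply: (etrans (congr1 _ h3)).
by rewrite dN h4.
Qed.

(** The image of a geodesic through [a] and the same geodesic run backwards start with the same
    position and velocity, since the symmetry has differential [-1] at [a]. *)
Lemma symmetry_geodesic a s q (c : R -> H * H) T : symmetry_at a s -> domain q a ->
  (c 0).1 = to_chart q a ->
  (forall t, `|t| <= T -> codomain q (c t).1 /\
    is_derive (t : R^o) 1 (c : R^o -> (H * H)%type) (spray (form q) (c t))) ->
  forall t, 0 <= t <= T -> s (of_chart q (c t).1) = of_chart q (c (- t)).1.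
Proof.
move=> ss qa c0 cP t tT; have [Is _ sa _] := ss; have mq := form_metric g q.
have cP' u : 0 <= u <= T -> `|u| <= T /\ `|- u| <= T.
  by move=> /andP[u0 uT]; rewrite normrN ger0_norm.
apply: (@geodesic_transport _ _ _ g s q q c (fun t => ((c (- t)).1, - (c (- t)).2)) T Is) => //.
- by move=> u /cP'[u1 _]; exact: cP.
- move=> u /cP'[_ u2]; have [cu du] := cP _ u2; split; first exact: cu.
  exact: (geodesic_reflect mq cu du).
- by rewrite oppr0 c0 to_chartK.
- rewrite oppr0 /tangent_field c0 (symmetry_diff _ ss qa); congr pair.
  by rewrite /in_charts to_chartK// sa.
Qed.

Hypothesis symM : symmetric_space g.

Lemma symmetry_choice : exists s : M -> M -> M, forall a, symmetry_at a (s a).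
Proof. by have [s sP] := choice symM; exists s. Qed.

Lemma half_lt (tau : R) : 0 < tau -> `|tau / 2| < tau.
Proof. by move=> t0; rewrite ger0_norm ?divr_ge0 ?(ltW t0)//; lra. Qed.

(** Two points of one geodesic chart are exchanged by the symmetry at the midpoint of a geodesic
    joining them; connectedness does the rest. *)
Lemma isometry_transitive p a : exists2 f, Defs.isometry g f & f p = a.
Proof.
have [s sP] := symmetry_choice.
pose P b := exists2 f, Defs.isometry g f & f p = b.
apply: (@connected_propagation _ P p (@manifold_connected _ _ M)).
  exists id => //; apply: (@iso_isometry _ _ _ _ id id) => //; apply: (iso_in_at (@smooth_id _ _ M)) => b _;
  exists b, b; split; [exact: domain_self|exact: domain_self| |exact: domain_self|exact: domain_self|];
    move=> u v; have cb := to_chart_codomain (domain_self b);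
    have e : in_charts id b b = trans b b by [];
    by rewrite e !(trans_self _ cb) /trans to_chartK//; exact: domain_self.
move=> q; have dq := domain_self q.
have [r [tau [rho [phi [ell gc]]]]] := geodesic_chart_exists (form_metric g q) (to_chart_codomain dq).
exists [set a | domain q a /\ nball (to_chart q q) rho (to_chart q a)]; split.
- exact: open_chart_ball.
- by split=> //; exact: nball_center (gc_rho gc).
move=> x y [qx nx] [qy ny] [f If fx]; have tau0 := gc_tau gc; have h2 := half_lt tau0.
have [rl el] := gc_log gc nx ny; have [f0 fP] := gc_flow gc rl.
(* The travel time is [tau / 2], so the shift by [tau / 4] puts the midpoint at time 0. *)
pose c t := phi (tau / 4 + t) (to_chart q x, ell (to_chart q x, to_chart q y)).
have cP t : `|t| <= tau / 4 -> codomain q (c t).1 /\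
    is_derive (t : R^o) 1 (c : R^o -> (H * H)%type) (spray (form q) (c t)).
  rewrite ler_norml => /andP[t1 t2]; have [|[ct _] dt] := fP (tau / 4 + t) _.
    by rewrite ger0_norm; lra.
  by split=> //; exact: is_derive_shift_time dt.
have t4 : 0 <= tau / 4 by rewrite divr_ge0 ?(ltW tau0).
have [c0 _] := cP 0 (eq_ind_r (fun z => z <= _) t4 (normr0 _)).
have [dm em] := of_chartK c0; set m := of_chart q (c 0).1 in dm em.
have := @symmetry_geodesic m (s m) q c (tau / 4) (sP m) dm (esym em) cP (tau / 4).
rewrite t4 lexx /c subrr f0 /= => /(_ isT).
have -> : tau / 4 + tau / 4 = tau / 2 by field.
rewrite el !to_chartK// => sy.
have [Im sK _ _] := sP m.
by exists (s m \o f); [exact: isometry_comp If Im|rewrite /= fx -sy sK].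
Qed.
End Symmetries.

(** * Joint smoothness of the family of symmetries *)

Section Family.
Variables (R : realType) (H : hilbertSpace R) (M : manifold H) (g : metric M).
Implicit Types (q r : M).
Let form q := form_in_chart g q.
Variables (s : M -> M -> M) (p : M).
Hypothesis sP : forall a, symmetry_at g a (s a).

(** The product of the symmetries at [p] and at the point of coordinate [x]: a family of isometries
    through the identity at [x = x0]. The symmetries come from a choice point by point, so the
    smooth dependence on [x] has to be proved. *)
Definition sym_pair (x : H) (a : M) : M := s p (s (of_chart p x) a).

Let x0 := to_chart p p.
Let px0 : of_chart p x0 = p. Proof. exact: to_chartK (domain_self p). Qed.
Let cx0 : codomain p x0. Proof. exact: to_chart_codomain (domain_self p). Qed.

Lemma sym_pair_id a : sym_pair x0 a = a.
Proof. by rewrite /sym_pair px0; have [_ -> _ _] := sP p. Qed.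

Lemma sym_pair_isometry x : Defs.isometry g (sym_pair x).
Proof.
have [I1 _ _ _] := sP p; have [I2 _ _ _] := sP (of_chart p x); exact: (isometry_comp I2 I1).
Qed.

Definition sym_map q (z : H * H) : M := sym_pair z.1 (of_chart q z.2).

Definition smooth_near q y : Prop := exists W : set (H * H),
  [/\ W (x0, y), forall z, W z -> codomain q z.2 & par W (sym_map q)].

Lemma smooth_near_change q r a : domain q a -> domain r a ->
  smooth_near q (to_chart q a) -> smooth_near r (to_chart r a).
Proof.
move=> qa ra [W [Wa Wc pW]]; have [oW _ _] := pW.
pose V := setT `*` chart_pre r (domain q) : set (H * H).
pose f (z : H * H) := (z.1, trans r q z.2).
have oV : open V by apply: openM; [exact: openT|apply: open_chart_pre; exact: open_domain].
have sf : smooth_on V f.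
  move=> n; apply: class_C_pair => //; first exact: class_C_fst.
  have c2 : class_C n V (snd : H * H -> H) by exact: class_C_snd.
  by apply: (class_C_comp oV _ c2 (trans_smooth r q n)) => z [].
have er := to_chartK ra; have eq := to_chartK qa.
have oVW : open [set z | V z /\ W (f z)].
  by apply: open_preimage_diff => // z Vz; exact: (class_C_cont (sf 0%N) Vz).
exists [set z | V z /\ W (f z)]; split.
- split; first by split=> //; split; rewrite /= ?er//; exact: to_chart_codomain.
  by rewrite /f /= /trans er.
- by move=> z [[_ []]].
- have sf' : smooth_on [set z | V z /\ W (f z)] f by move=> n; apply: class_C_sub (sf n) => z [].
  have pc : par [set z | V z /\ W (f z)] (sym_map q \o f) by apply: (par_pre oVW sf' _ pW) => z [].
  apply: par_ext pc => z [[_ [cz qz]] _].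
  by have [_ e _] := transK cz qz; rewrite /sym_map /f /= e.
Qed.

(** For [x] and [y] near [p], the symmetry at [x] maps the endpoint of the geodesic with initial
    velocity [ell (x, y)] to the endpoint of the one with opposite velocity. The formula is smooth
    in both variables. *)
Lemma smooth_near_base : smooth_near p x0.
Proof.
have [r [tau [rho [phi [ell gc]]]]] := geodesic_chart_exists (form_metric g p) cx0.
have tau0 := gc_tau gc; have h2 := half_lt tau0.
pose f (z : H * H) : H := (phi (tau / 2) (z.1, - ell z)).1.
have nW z : nball (x0, x0) rho z -> nball x0 rho z.1 /\ nball x0 rho z.2.
  by rewrite /nball /= pair_norm_lt => /andP[].
have oW : open (nball (x0, x0) rho) by exact: nball_open.
exists (nball (x0, x0) rho); split; first exact: nball_center (gc_rho gc).
  by move=> z /nW[_ /(gc_dom gc)].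
have fP z : nball (x0, x0) rho z -> nball (x0, 0 : H) r (z.1, - ell z).
  case: z => x y /nW[nx ny]; exact: nball_neg (gc_log gc nx ny).1.
have sf : smooth_on (nball (x0, x0) rho) f.
  move=> n; apply: class_C_fstc => //.
  apply: (class_C_comp oW fP _ (gc_smooth gc h2 n)).
  by apply: class_C_pair => //; [exact: class_C_fst|apply: class_C_opp => //; exact: (gc_log_smooth gc)].
have cf z : nball (x0, x0) rho z -> codomain p (f z).
  by move=> /fP zr; have [_ /(_ _ h2)[[]]] := gc_flow gc zr.
have [I1 _ _ _] := sP p; have [sp _] := isometry_iso I1.
have pc := par_comp sp (par_of_smooth oW sf cf) (fun _ _ => I).
apply: par_ext pc => -[x y] zW; have [nx ny] := nW _ zW; rewrite /= /sym_map /sym_pair /=; congr (s p _).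
have [rl el] := gc_log gc nx ny; have [f0 flP] := gc_flow gc rl.
have [g0 glP] := gc_flow gc (fP _ zW).
have cx : codomain p x by exact: (gc_dom gc nx).
have [dx ex] := of_chartK cx; have sx := sP (of_chart p x); have [Ix _ fx _] := sx.
have hh u : 0 <= u <= tau / 2 -> `|u| < tau by move=> /andP[u0 u1]; rewrite ger0_norm//; lra.
have {}el : (phi (tau / 2) (x, ell (x, y))).1 = y := el.
rewrite -[in RHS]el; apply/esym.
apply: (@geodesic_transport _ _ _ g (s (of_chart p x)) p p (fun t => phi t (x, ell (x, y)))
   (fun t => phi t (x, - ell (x, y))) (tau / 2) Ix) => //.
- by move=> u /hh ut; have [[c _] d] := flP u ut.
- by move=> u /hh ut; have [[c _] d] := glP u ut.
- by rewrite f0 g0.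
- rewrite f0 g0 /tangent_field /=; congr pair; first by rewrite /in_charts fx ex.
  by have := symmetry_diff (ell (x, y)) sx dx; rewrite ex.
- by rewrite divr_ge0 ?(ltW tau0)/=.
Qed.

Lemma in_charts_sym_id q y v : codomain q y -> 'd (in_charts (sym_pair x0) q q) y v = v.
Proof.
move=> cy; have [_ ->] : is_diff y (in_charts (sym_pair x0) q q) id; last by [].
apply: (is_diff_open (@open_codomain _ _ _ q) cy _ (is_diff_id y)) => z cz.
by rewrite /in_charts sym_pair_id; have [_ ->] := of_chartK cz.
Qed.

Definition sym_chart q (z : H * H) : H := to_chart q (sym_map q z).

Lemma sym_chart_diff2 q W z v : par W (sym_map q) -> W z -> domain q (sym_map q z) ->
  'd (sym_chart q) z (0, v) = 'd (in_charts (sym_pair z.1) q q) (z.2) v.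
Proof.
case: z => x y pW Wz dz; have d := par_diff pW Wz dz.
have [_ e] := diff_curry2 (@ex_diff _ _ _ _ _ _ _ d).
exact: (esym (congr1 (fun l => l v) e)).
Qed.

(** Joint smoothness near [(x0, a)] gives a smooth 1-jet of [sym_pair x] at [a]. An isometry carries
    the geodesics from [a] to those with the image initial data, so the jet determines [sym_pair x]
    smoothly on the geodesic chart around, and connectedness propagates. *)
Lemma smooth_near_all q y : codomain q y -> smooth_near q y.
Proof.
pose P a := smooth_near a (to_chart a a).
suff PT a : P a.
  move=> cy; have [qy ey] := of_chartK cy; rewrite -ey.
  exact: (smooth_near_change (domain_self _) qy (PT _)).
move: a; apply: (@connected_propagation _ P p (@manifold_connected _ _ M)); first exact: smooth_near_base.
move=> {q y} q; have dq := domain_self q.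
have [r [tau [rho [phi [ell gc]]]]] := geodesic_chart_exists (form_metric g q) (to_chart_codomain dq).
set z0 := to_chart q q in gc.
exists [set a | domain q a /\ nball z0 rho (to_chart q a)]; split.
- exact: open_chart_ball.
- by split=> //; exact: nball_center (gc_rho gc).
move=> a b [qa na] [qb nb] Pa.
have tau0 := gc_tau gc; have h2 := half_lt tau0.
apply: (smooth_near_change qb (domain_self b)).
have [W [Wa Wc pW]] := smooth_near_change (domain_self a) qa Pa.
set y1 := to_chart q a in na Wa; set y2 := to_chart q b in nb.
have oW1 := par_open pW (@open_domain _ _ _ q).
have [_ _ /(_ q) sPhi] := pW.
set W1 := [set x | W x /\ domain q (sym_map q x)] in oW1 sPhi.
pose U0 : set (H * H) := [set z | W1 (z.1, y1) /\ nball z0 rho z.2].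
have oU0 : open U0.
  have -> : U0 = [set x | W1 (x, y1)] `*` nball z0 rho by apply/seteqP; split=> -[].
  apply: openM; last exact: nball_open.
  have := @open_preimage_diff R H (H * H)%type setT (fun x => (x, y1)) W1 (@openT _) _ oW1.
  rewrite (_ : [set x | setT x /\ W1 (x, y1)] = [set x | W1 (x, y1)]); last first.
    by apply/seteqP; split=> x; [case|].
  apply=> x _; apply: (@class_C_cont _ 0%N _ _ setT _ x) => //.
  by apply: class_C_pair; [exact: openT|exact: class_C_id|exact: class_C_cst].
(* For [z = (x, y)] this is the image under [sym_pair x] of the initial position and velocity of the
   geodesic from [a] to [y]; following it for time [tau / 2] gives the image of [y]. *)
pose K (z : H * H) : H * H := (sym_chart q (z.1, y1), 'd (sym_chart q) (z.1, y1) (0, ell (y1, z.2))).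
have sK : smooth_on U0 K.
  move=> n; have c1 : class_C n U0 (fun z : H * H => (z.1, y1)).
    by apply: class_C_pair => //; [exact: class_C_fst|exact: class_C_cst].
  apply: class_C_pair => //; first by apply: (class_C_comp oU0 _ c1 (sPhi n)) => z [].
  have [_ cd] := class_CS (sPhi n.+1).
  apply: (@class_C_comp _ n _ _ _ U0 (W1 `*` setT) (fun z : H * H => ((z.1, y1), (0 : H, ell (y1, z.2))))
     (fun z => 'd (sym_chart q) (z.1) (z.2)) oU0) => //.
    by move=> z [].
  apply: class_C_pair => //; apply: class_C_pair => //; first exact: class_C_cst.
  apply: (class_C_comp oU0 (V := nball (z0, z0) rho) _ _ (gc_log_smooth gc n)).
    by move=> z [_ nz]; exact: nball_pair.
  by apply: class_C_pair => //; [exact: class_C_cst|exact: class_C_snd].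
pose U := [set z | U0 z /\ nball (z0, 0 : H) r (K z)].
have oU : open U.
  apply: open_preimage_diff => //; last exact: nball_open.
  by move=> z Uz; exact: (class_C_cont (sK 0%N) Uz).
have ea : of_chart q y1 = a by exact: to_chartK.
have eb : of_chart q y2 = b by exact: to_chartK.
have U0b : U0 (x0, y2).
  by split=> //; split=> //; rewrite /sym_map /= ea sym_pair_id.
have Kb : K (x0, y2) = (y1, ell (y1, y2)).
  rewrite /K /= {1}/sym_chart /sym_map /= ea sym_pair_id; congr pair.
  rewrite (sym_chart_diff2 _ pW Wa) /=; last by rewrite /sym_map /= ea sym_pair_id.
  exact: in_charts_sym_id (to_chart_codomain qa).
exists U; split.
- by split=> //; rewrite Kb; have [] := gc_log gc na nb.
- by move=> z [[_ /(gc_dom gc)]].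
have sE : smooth_on U (fun z => (phi (tau / 2) (K z)).1).
  move=> n; apply: class_C_fstc => //.
  have cK : class_C n U K by apply: class_C_sub (sK n) => z [].
  by apply: (class_C_comp oU _ cK (gc_smooth gc h2 n)) => z [].
have cE z : U z -> codomain q (phi (tau / 2) (K z)).1.
  by move=> [_ kz]; have [_ /(_ _ h2)[[]]] := gc_flow gc kz.
apply: par_ext (par_of_smooth oU sE cE) => -[x y] [[[Wx dx] ny] kz].
have [rl el] := gc_log gc na ny; have [f0 flP] := gc_flow gc rl.
have [k0 klP] := gc_flow gc kz.
have hh u : 0 <= u <= tau / 2 -> `|u| < tau by move=> /andP[u0 u1]; rewrite ger0_norm//; lra.
have {}el : (phi (tau / 2) (y1, ell (y1, y))).1 = y := el.
rewrite /= /sym_map /= -[in RHS]el; apply/esym.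
apply: (@geodesic_transport _ _ _ g (sym_pair x) q q (fun t => phi t (y1, ell (y1, y)))
   (fun t => phi t (K (x, y))) (tau / 2) (sym_pair_isometry x)) => //.
- by move=> u /hh ut; have [[c _] d] := flP u ut.
- by move=> u /hh ut; have [[c _] d] := klP u ut.
- by rewrite f0 k0 /K /= /sym_chart to_chartK.
- rewrite f0 k0 /tangent_field /K /=; congr pair.
  exact: (esym (sym_chart_diff2 _ pW Wx dx)).
- by rewrite divr_ge0 ?(ltW tau0)/=.
Qed.
End Family.

(** * Transvections *)

Section Transvections.
Variables (R : realType) (H : hilbertSpace R) (M : manifold H) (g : metric M).
Implicit Types (q r : M).
Let form q := form_in_chart g q.
Variables (s : M -> M -> M) (p : M).
Hypothesis sP : forall a, symmetry_at g a (s a).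
Let x0 := to_chart p p.
Let px0 : of_chart p x0 = p. Proof. exact: to_chartK (domain_self p). Qed.
Let cx0 : codomain p x0. Proof. exact: to_chart_codomain (domain_self p). Qed.
Let Phi q := sym_chart s p q.
Let idp a : sym_pair s p x0 a = a. Proof. exact: (sym_pair_id p sP a). Qed.

Lemma sym_chart_near q y : codomain q y -> exists W : set (H * H),
  [/\ open W, W (x0, y), forall z, W z -> codomain q z.2 /\ domain q (sym_map s p q z),
      smooth_on W (Phi q) &
      forall z v, W z -> 'd (Phi q) z (0, v) = 'd (in_charts (sym_pair s p z.1) q q) (z.2) v].
Proof.
move=> cy; have [W [W0 Wc pW]] := smooth_near_all p sP cy; have [qy _] := of_chartK cy.
exists [set z | W z /\ domain q (sym_map s p q z)]; split.
- exact: par_open pW (@open_domain _ _ _ q).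
- by split=> //; rewrite /sym_map /= idp.
- by move=> z [/Wc].
- by have [_ _ /(_ q)] := pW.
- by move=> z v [Wz dz]; exact: sym_chart_diff2 v pW Wz dz.
Qed.

Lemma sym_chart_id q y : codomain q y -> Phi q (x0, y) = y.
Proof. by move=> cy; rewrite /Phi /sym_chart /sym_map /= idp; have [] := of_chartK cy. Qed.

(** Moving [x] from [x0] by a small [v] makes [s_p s_x] displace [p] by [-2 v] to first order; the
    factor normalises the value at [p] to [v]. *)
Definition transvection (v : H) : vector_field M := fun a =>
  (- 2^-1) *: 'd (Phi a) (x0, to_chart a a) (v, 0).

Lemma transvection_chart q y v : codomain q y ->
  field_in_chart (transvection v) q y = (- 2^-1) *: 'd (Phi q) (x0, y) (v, 0).
Proof.
move=> cy; have [qa ey] := of_chartK cy; set a := of_chart q y in qa ey.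
have da := domain_self a; have ea := to_chartK da; have ca := to_chart_codomain da.
rewrite -[in LHS]ey (field_at _ qa) [LHS]dZ; congr (_ *: _).
have [W [W0 Wc pW]] := smooth_near_all p sP ca; have [W' [W0' Wc' pW']] := smooth_near_all p sP cy.
have e1 : sym_map s p a (x0, to_chart a a) = a by rewrite /sym_map /= idp.
have e2 : sym_map s p q (x0, y) = a by rewrite /sym_map /= idp.
have h1 := @par_change _ _ _ _ W (sym_map s p a) a q (x0, to_chart a a) (v, 0) pW W0.
rewrite e1 in h1; rewrite -[LHS](h1 da qa).
have d1 := par_diff (r := q) pW W0; rewrite e1 in d1.
have d2 := par_diff (r := q) pW' W0'; rewrite e2 in d2.
have k1 := diff_curry1 (@ex_diff _ _ _ _ _ _ _ (d1 qa)).
have k2 := diff_curry1 (@ex_diff _ _ _ _ _ _ _ (d2 qa)).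
apply: (is_diff_inj v k1 (is_diff_open (@openT _) I _ k2)) => x _.
by rewrite /sym_map /= ea.
Qed.

Lemma transvection_smooth v : smooth_field (transvection v).
Proof.
move=> q n; apply: class_C_local => y cy.
have [W [oW W0 Wc sW _]] := sym_chart_near cy.
pose V := [set z | W (x0, z)].
have sl m (E : set H) : class_C m E (fun z : H => (x0, z)).
  apply: class_C_sub (_ : class_C m setT _) => //.
  by apply: class_C_pair; [exact: openT|exact: class_C_cst|exact: class_C_id].
have oV : open V.
  have -> : V = [set z | setT z /\ W (x0, z)] by apply/seteqP; split=> z; [|case].
  apply: (@open_preimage_diff R H (H * H)%type setT (fun z => (x0, z)) W (@openT _) _ oW).
  by move=> z _; exact: (@class_C_cont _ 0%N _ _ setT _ z (sl 0%N setT)).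
exists V; split=> //.
apply: (@class_C_ext _ n _ _ _ (fun z => (- 2^-1) *: 'd (Phi q) (x0, z) (v, 0))) => //.
  by move=> z Vz; rewrite transvection_chart//; have [] := Wc _ Vz.
apply: class_C_scale => //; have [_ cd] := class_CS (sW n.+1).
apply: (@class_C_comp _ n _ _ _ V (W `*` setT) (fun z : H => ((x0, z), (v, 0 : H)))
     (fun z => 'd (Phi q) (z.1) (z.2)) oV) => //.
by apply: class_C_pair => //; exact: class_C_cst.
Qed.

Lemma sym_chart_diff3 q y W u : open W -> W (x0, y) -> smooth_on W (Phi q) ->
  is_diff x0 (fun x => 'd (Phi q) (x, y) (0, u)) (fun a => d2 (Phi q) (x0, y) (a, 0) (0, u)).
Proof.
by move=> oW W0 sW; exact: (diff_curry1 (class_C2_diff (0, u) oW W0 (sW 2%N))).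
Qed.

Lemma transvection_diff q y v u W : codomain q y -> open W -> W (x0, y) -> smooth_on W (Phi q) ->
  'd (field_in_chart (transvection v) q) y u = (- 2^-1) *: d2 (Phi q) (x0, y) (v, 0) (0, u).
Proof.
move=> cy oW W0 sW.
have k := diff_curry2 (class_C2_diff (v, 0) oW W0 (sW 2%N)).
have e z : codomain q z -> (- 2^-1 \*: (fun z => 'd (Phi q) (x0, z) (v, 0))) z = field_in_chart (transvection v) q z.
  by move=> cz; rewrite transvection_chart.
have [_ d] := is_diff_open (@open_codomain _ _ _ q) cy e (is_diffZ (- 2^-1) k).
apply: (etrans (congr1 (fun l => l u) d)); rewrite [LHS]/=; congr (_ *: _).
exact: (d2C (0, u) (v, 0) oW W0 (sW 2%N)).
Qed.

(** Each [sym_pair x] preserves the metric and [sym_pair x0] is the identity; differentiating this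
    preservation in [x] at [x0] is the Killing equation up to the factor [- 1/2]. *)
Lemma transvection_killing v : inf_killing g (transvection v).
Proof.
split=> [|q y u w cy]; first exact: transvection_smooth.
have [W [oW W0 Wc sW dW]] := sym_chart_near cy.
have mq := form_metric g q.
have Pd : is_diff x0 (fun x => Phi q (x, y)) (fun a => 'd (Phi q) (x0, y) (a, 0)).
  by apply: diff_curry1; have [+ _] := class_CS (sW 1%N); apply.
have Oy : codomain q (Phi q (x0, y)) by rewrite sym_chart_id.
have h := metric_diff_comp (p := fun x => Phi q (x, y)) (x := x0) mq Oy Pd (sym_chart_diff3 u oW W0 sW) (sym_chart_diff3 w oW W0 sW).
pose V := [set x | W (x, y)].
have oV : open V.
  have -> : V = [set x | setT x /\ W (x, y)] by apply/seteqP; split=> z; [|case].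
  apply: (@open_preimage_diff R H (H * H)%type setT (fun z => (z, y)) W (@openT _) _ oW).
  move=> z _; apply: (@class_C_cont _ 0%N _ _ setT _ z) => //.
  by apply: class_C_pair; [exact: openT|exact: class_C_id|exact: class_C_cst].
have e x : V x -> form q y u w = form q (Phi q (x, y)) ('d (Phi q) (x, y) (0, u)) ('d (Phi q) (x, y) (0, w)).
  move=> Vx; rewrite !dW//=; have [_ pf] := isometry_iso (sym_pair_isometry p sP x).
  have [_ dd] := Wc _ Vx; exact: (esym (pf q q y cy I dd u w)).
have := is_diff_inj v h (is_diff_open oV W0 e (is_diff_cst (form q y u w : R^o) x0)).
have du : 'd (Phi q) (x0, y) (0, u) = u by rewrite dW//= (in_charts_sym_id p sP).
have dw : 'd (Phi q) (x0, y) (0, w) = w by rewrite dW//= (in_charts_sym_id p sP).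
have fG : psd_form (form q y) := lm_form mq cy.
have alg (P z0 X X' U U' V1 V1' u' w' : H) : P = y -> u' = u -> w' = w -> X' = (- 2^-1) *: X ->
    U' = (- 2^-1) *: U -> V1' = (- 2^-1) *: V1 ->
    metric_d (form q) P X u' w' + form q P U w' + form q P u' V1 = 0 ->
    metric_d (form q) y X' u w + form q y U' w + form q y u V1' = 0.
  move=> -> -> -> -> -> -> h0; rewrite (psdZl fG) (psdZr fG).
  have := metric_d_lin1 (form q) y (- 2^-1) X 0 u w; have := metric_d_lin1 (form q) y 1 0 0 u w.
  rewrite !scaler0 !addr0 mul1r -{1}[metric_d _ _ 0 _ _]addr0 => /addrI <- ->.
  by rewrite addr0 -!mulrDr h0 mulr0.
apply: (alg _ 0) => //; first exact: sym_chart_id.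
- exact: transvection_chart.
- exact: (transvection_diff v u cy oW W0 sW).
- exact: (transvection_diff v w cy oW W0 sW).
Qed.

Let sg := in_charts (s p) p p.

(** On the diagonal [s_x x = x] and the differential of [s_x] at [x] is [-1], so [Phi] and its
    partial differential in the second variable reduce to the single symmetry [s_p] and its
    differential. All jets of transvections at [p] are computed from these two identities. *)
Lemma transvection_base W : open W -> W (x0, x0) ->
  (forall z, W z -> codomain p z.2 /\ domain p (sym_map s p p z)) ->
  (forall z v, W z -> 'd (Phi p) z (0, v) = 'd (in_charts (sym_pair s p z.1) p p) (z.2) v) ->
  exists V : set H, [/\ open V, V x0, forall x, V x -> W (x, x) /\ domain p (s p (of_chart p x)),
    forall x, V x -> Phi p (x, x) = sg x &
    forall x v, V x -> 'd (Phi p) (x, x) (0, v) = - 'd sg x v].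
Proof.
move=> oW W0 Wc dW; have [I1 _ sp _] := sP p; have [sm _] := isometry_iso I1; have [_ ps] := sm.
pose V := [set x | W (x, x)].
have fixx x : s (of_chart p x) (of_chart p x) = of_chart p x by have [] := sP (of_chart p x).
have inV x : V x -> codomain p x /\ domain p (s p (of_chart p x)).
  by move=> /Wc[cx]; rewrite /sym_map /sym_pair /= fixx.
exists V; split=> //.
- have -> : V = [set x | setT x /\ W (x, x)] by apply/seteqP; split=> z; [|case].
  apply: (@open_preimage_diff R H (H * H)%type setT (fun z => (z, z)) W (@openT _) _ oW).
  move=> z _; apply: (@class_C_cont _ 0%N _ _ setT _ z) => //.
  by apply: class_C_pair; [exact: openT|exact: class_C_id|exact: class_C_id].
- by move=> x Vx; have [] := inV x Vx.
- by move=> x Vx; rewrite /Phi /sym_chart /sym_map /sym_pair /= fixx.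
- move=> x v Vx; have [cx dx] := inV x Vx; have [px ex] := of_chartK cx.
  rewrite dW//=; have [Ix _ _ _] := sP (of_chart p x); have [sx _] := isometry_iso Ix; have [_ psx] := sx.
  have h1 := @map_chain _ _ _ _ (chart_pre p setT) (s (of_chart p x) \o of_chart p) setT (s p) p p x v sm (psx p) (conj cx I) I.
  rewrite /= fixx in h1; rewrite [LHS](h1 px dx) ex -dN; congr ('d _ _ _).
  by have := symmetry_diff v (sP (of_chart p x)) px; rewrite ex.
Qed.

Lemma sg_fix : sg x0 = x0. Proof. by rewrite /sg /in_charts px0; have [_ _ -> _] := sP p. Qed.
Lemma sg_diff v : 'd sg x0 v = - v. Proof. exact: symmetry_diff (sP p) (domain_self p). Qed.

(** Differentiating [Phi (x, x) = s_p x] along [v] gives [dPhi (v, 0) + v = - v]. *)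
Lemma transvection_at v : transvection v p = v.
Proof.
have [W [oW W0 Wc sW dW]] := sym_chart_near cx0.
have [V [oV V0 Vc e1 e2]] := transvection_base oW W0 Wc dW.
have dPhi : is_diff (x0, x0) (Phi p) ('d (Phi p) (x0, x0)).
  by apply: differentiableP; have [+ _] := class_CS (sW 1%N); apply.
have k1 := @is_diff_comp _ _ _ _ _ _ _ _ x0 (is_diff_pair (is_diff_id x0) (is_diff_id x0)) dPhi.
have k2 : is_diff x0 sg ('d sg x0).
  have [I1 _ sp _] := sP p; have [[_ ps] _] := isometry_iso I1.
  have [] := @par_diff _ _ _ _ (chart_pre p setT) (s p \o of_chart p) p x0 (ps p) (conj cx0 I).
    by rewrite /= px0 sp; exact: domain_self.
  by move=> d _; exact: differentiableP.
have e := is_diff_inj v k2 (is_diff_open oV V0 e1 k1).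
rewrite /= sg_diff in e.
have e3 : 'd (Phi p) (x0, x0) (v, v) = 'd (Phi p) (x0, x0) (v, 0) + v.
  have ev := etrans (e2 x0 v V0) (etrans (congr1 -%R (sg_diff v)) (opprK v)).
  have pe : (v, v) = (v, 0) + (0, v) :> H * H.
    by apply: injective_projections; rewrite /= ?addr0 ?add0r.
  exact: (etrans (congr1 _ pe) (etrans (dD _ _ _ _) (congr1 (+%R _) ev))).
rewrite /transvection -/x0; have -> : 'd (Phi p) (x0, x0) (v, 0) = - (2 *: v).
  by apply: (addIr v); rewrite -e3 -e; vring R.
by rewrite scalerN scaleNr opprK scalerA mulVf// scale1r.
Qed.

Lemma sg_d2 u v : d2 sg x0 u v = - (2 *: chris (form p) x0 u v).
Proof.
have [I1 _ sp _] := sP p; have mp := form_metric g p.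
have Il := isometry_local p p I1.
have W0 : chart_pre p (s p @^-1` domain p) x0 by split=> //; rewrite /preimage /= px0 sp; exact: domain_self.
have h := chris_isometry u v mp mp (fun x (h : chart_pre p _ x) => h.1) Il W0.
have alg (y : H) (a b c du dv d : H) : y = x0 -> du = - u -> dv = - v -> d = - chris (form p) x0 u v ->
    chris (form p) y du dv + b = d -> b = - (2 *: chris (form p) x0 u v).
  move=> -> -> -> ->; rewrite (chrisNl mp _ _ cx0) (chrisNr mp _ _ cx0) opprK => h'.
  apply: (addrI (chris (form p) x0 u v)); apply: (etrans h').
  by move: (chris (form p) x0 u v) => c'; vring R.
exact: (alg _ 0 _ 0 _ _ _ sg_fix (sg_diff u) (sg_diff v) (sg_diff _) h).
Qed.

(** The covariant derivative of a transvection vanishes at [p]. By the diagonal identity its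
    derivative is half of a second derivative of [s_p] at its fixed point, and [sg_d2] computes the
    latter from the invariance of the connection under a map with differential [-1]. *)
Lemma transvection_d v w : 'd (field_in_chart (transvection v) p) x0 w = - chris (form p) x0 w v.
Proof.
have [W [oW W0 Wc sW dW]] := sym_chart_near cx0.
have [V [oV V0 Vc e1 e2]] := transvection_base oW W0 Wc dW.
rewrite (transvection_diff v w cx0 oW W0 sW).
have mp := form_metric g p.
have dd : is_diff (x0, x0) (fun z => 'd (Phi p) z (0, w)) (fun a => d2 (Phi p) (x0, x0) a (0, w)).
  exact: differentiableP (class_C2_diff (0, w) oW W0 (sW 2%N)).
have k1 := @is_diff_comp _ _ _ _ _ _ _ _ x0 (is_diff_pair (is_diff_id x0) (is_diff_id x0)) dd.
have [I1 _ sp _] := sP p; have [oS sS _ _ _] := isometry_local p p I1.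
have S0 : chart_pre p (s p @^-1` domain p) x0 by split=> //; rewrite /preimage /= px0 sp; exact: domain_self.
have k2 := is_diffN (differentiableP (class_C2_diff w oS S0 (sS 2%N))).
have e3 : d2 (Phi p) (x0, x0) (v, v) (0, w) = - d2 sg x0 v w.
  apply: (is_diff_inj v k1 (is_diff_open oV V0 _ k2)) => x Vx.
  by rewrite /= e2.
have e4 : d2 (Phi p) (x0, x0) (0, v) (0, w) = 0.
  have k3 := diff_curry2 (class_C2_diff (0, w) oW W0 (sW 2%N)).
  pose V2 := [set z | W (x0, z)].
  have oV2 : open V2.
    have -> : V2 = [set z | setT z /\ W (x0, z)] by apply/seteqP; split=> z; [|case].
    apply: (@open_preimage_diff R H (H * H)%type setT (fun z => (x0, z)) W (@openT _) _ oW).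
    move=> z _; apply: (@class_C_cont _ 0%N _ _ setT _ z) => //.
    by apply: class_C_pair; [exact: openT|exact: class_C_cst|exact: class_C_id].
  apply: (is_diff_inj v k3 (is_diff_open oV2 W0 _ (is_diff_cst w x0))) => z Vz.
  by rewrite dW//= (in_charts_sym_id p sP)//; have [] := Wc _ Vz.
have e5 : d2 (Phi p) (x0, x0) (v, 0) (0, w) = - d2 sg x0 v w.
  have pe : (v, v) = (v, 0) + (0, v) :> H * H.
    by apply: injective_projections; rewrite /= ?addr0 ?add0r.
  have h := etrans (esym e3) (etrans (congr1 (fun z => d2 (Phi p) (x0, x0) z (0, w)) pe) (dD _ _ _ _)).
  exact: (esym (etrans h (etrans (congr1 (+%R _) e4) (addr0 _)))).
rewrite e5 sg_d2 (chrisC mp w v cx0) opprK scalerA mulNr mulVf// scaleN1r.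
by [].
Qed.
End Transvections.

(** * Concatenation of curves *)

Section Gluing.
Variable R : realType.

Definition glue (T : Type) (t : R) (c1 c2 : R -> T) (s : R) : T := if s <= t then c1 s else c2 s.

Lemma derive_local (E : normedModType R) (c c' : R -> E) (t d : R) v : 0 < d ->
  (forall s, `|s - t| < d -> c s = c' s) ->
  is_derive (t : R^o) 1 (c : R^o -> E) v -> is_derive (t : R^o) 1 (c' : R^o -> E) v.
Proof.
move=> d0 e /derive_eps h; apply/derive_eps => eps eps0; have [d' d'0 dP] := h eps eps0.
exists (Num.min d d') => [|k]; first by rewrite lt_min d0.
rewrite lt_min => /andP[kd kd']; rewrite -!e ?subrr ?normr0 ?dP//.
by rewrite addrC addKr.
Qed.

Lemma derive_glue (E : normedModType R) (c1 c2 : R -> E) (t s : R) v :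
  (s <= t -> is_derive (s : R^o) 1 (c1 : R^o -> E) v) ->
  (t <= s -> is_derive (s : R^o) 1 (c2 : R^o -> E) v) ->
  c1 t = c2 t -> is_derive (s : R^o) 1 (glue t c1 c2 : R^o -> E) v.
Proof.
move=> d1 d2 e; have [st|ts|st] := ltgtP s t.
- have st0 : 0 < t - s by rewrite subr_gt0.
  apply: (derive_local st0 _ (d1 (ltW st))) => u; rewrite ltr_norml => /andP[_ h].
  by rewrite /glue ifT//; lra.
- have st0 : 0 < s - t by rewrite subr_gt0.
  apply: (derive_local st0 _ (d2 (ltW ts))) => u; rewrite ltr_norml => /andP[h _].
  by rewrite /glue ifF//; apply/negbTE; rewrite -ltNge; lra.
- have /derive_eps h1 := d1 (le_of_eq st).
  have /derive_eps h2 := d2 (le_of_eq (esym st)).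
  apply/derive_eps => eps eps0; have [r1 r10 rP1] := h1 eps eps0; have [r2 r20 rP2] := h2 eps eps0.
  exists (Num.min r1 r2) => [|k]; first by rewrite lt_min r10.
  rewrite lt_min => /andP[k1 k2]; have -> : glue t c1 c2 s = c1 s by rewrite /glue st lexx.
  rewrite /glue; case: ifP => _; first exact: rP1.
  have e' : c1 s = c2 s by rewrite st.
  rewrite e'; exact: rP2.
Qed.
End Gluing.

(** * Existence time for orbits of Killing fields *)

Section KillingTime.
Variables (R : realType) (H : hilbertSpace R) (Om : set H) (G : H -> H -> H -> R).
Hypothesis mG : local_metric Om G.
Let oOm : open Om := lm_open mG.

(** Coercivity of the metric is given point by point. Uniformity near [x0] follows from local bounds
    on [sharp] and [flat]: [|v| <= C1 |flat v|], and [|flat v|^2 <= C2 G v v] by the Cauchy-Schwarz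
    inequality for [G]. *)
Lemma uniform_coercive x0 : Om x0 -> exists2 rho, 0 < rho & exists2 K, 0 < K &
  forall x, nball x0 rho x -> Om x /\ forall v, `|v| ^+ 2 <= K * G x v v.
Proof.
move=> Ox0.
have cts (f : H * H -> H) : smooth_on (Om `*` setT) f -> {for (x0, 0), continuous (fun z : H * H => f (z.1, z.2))}.
  move=> sf; have c := class_C_cont (sf 0%N) (conj Ox0 I : (Om `*` setT) (x0, 0 : H)).
  have e : (fun z : H * H => f (z.1, z.2)) = f by apply/funext => -[].
  by rewrite e.
have [r1 r10 [C1 C10 P1]] := linear_family_bound oOm Ox0 (A := fun x y => sharp G (x, y))
   (fun x Ox => (sharp_linear mG Ox).1) (cts _ (sharp_smooth mG)).
have [r2 r20 [C2 C20 P2]] := linear_family_bound oOm Ox0 (A := fun x y => flat G (x, y))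
   (fun x Ox => (flat_linear mG Ox).1) (cts _ (flat_smooth mG)).
exists (Num.min r1 r2); first by rewrite lt_min r10.
exists (C1 ^+ 2 * C2); first by rewrite mulr_gt0 ?exprn_gt0.
move=> x; rewrite /nball /= lt_min => /andP[x1 x2]; have [Ox _] := P1 x 0 x1; split=> // v.
have fG := lm_form mG Ox; set y := flat G (x, v).
have vy : `|v| <= C1 * `|y| by rewrite -[in leLHS](flatK mG v Ox); have [_] := P1 x y x1.
have ub : G x y y <= C2 * `|y| ^+ 2.
  rewrite -(flatP mG y y Ox); apply: le_trans (ler_norm _) _; apply: le_trans (ip_le _ _) _.
  by rewrite expr2 mulrA ler_wpM2r//; have [_] := P2 x y x2.
have yy : `|y| ^+ 2 <= C2 * G x v v.
  have [->|y0] := eqVneq y 0; first by rewrite normr0 expr0n mulr_ge0 ?(ltW C20) ?psd_ge0.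
  have yp : 0 < `|y| ^+ 2 by rewrite exprn_gt0 ?normr_gt0.
  have h : `|y| ^+ 2 = G x v y by rewrite -(flatP mG v y Ox) -/y ip_norm.
  rewrite -(ler_pM2r yp) -{1}expr2 {1}h -mulrA [G x v v * _]mulrC mulrA mulrC.
  apply: le_trans (psd_cauchy fG v y) _; rewrite ler_wpM2l ?psd_ge0//.
rewrite -mulrA; apply: le_trans (_ : (C1 * `|y|) ^+ 2 <= _).
  by rewrite ler_pXn2r ?nnegrE ?mulr_ge0 ?(ltW C10).
by rewrite exprMn ler_wpM2l// exprn_ge0 ?ltW.
Qed.

(** This is the Killing equation with both arguments equal to [Z]. *)
Lemma killing_speed Z (c : R -> H) t : smooth_on Om Z -> killing_eq Om G Z ->
  Om (c t) -> is_derive (t : R^o) 1 (c : R^o -> H) (Z (c t)) ->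
  is_derive (t : R^o) 1 ((fun s => G (c s) (Z (c s)) (Z (c s))) : R^o -> R^o) 0.
Proof.
move=> sZ kZ Oc dc.
have dZ0 : differentiable Z (c t) by have [+ _] := class_CS (sZ 1%N); apply.
have d1 := is_derive_pair dc (is_derive_pair (derive_comp dc dZ0) (derive_comp dc dZ0)).
have dG := Gc_diff mG (Z (c t), Z (c t)) Oc.
have := derive_comp d1 dG.
by rewrite [X in is_derive _ _ _ X](Gc_diffE mG _ _ _ _ _ Oc) (kZ _ _ _ Oc).
Qed.

(** The existence time depends on [Z] through its speed at [x0] alone. The speed is constant along
    the orbit, so the coordinate velocity is at most [L], and the orbit cannot leave the ball while
    [L T < rho]. No lower bound on local existence times is known along the way, so the solution is
    continued by real induction, completeness supplying the point from which to restart. *)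
Lemma killing_existence_right x0 : Om x0 -> exists2 N : R, 0 < N & forall Z c0 T,
  smooth_on Om Z -> killing_eq Om G Z -> G x0 (Z x0) (Z x0) <= c0 ^+ 2 -> 0 <= c0 -> 0 <= T ->
  N * c0 * T < 1 ->
  exists2 c : R -> H, c 0 = x0 & forall t, 0 <= t <= T ->
    Om (c t) /\ is_derive (t : R^o) 1 (c : R^o -> H) (Z (c t)).
Proof.
move=> Ox0; have [rho rho0 [K K0 KP]] := uniform_coercive Ox0.
exists ((K + 1) / rho) => [|Z c0 T sZ kZ hc c00 T0 small]; first by rewrite divr_gt0// ltr_wpDl// ltW.
pose B := nball x0 rho; have oB : open B by exact: nball_open.
have sZB : smooth_on B Z by move=> n; apply: class_C_sub (sZ n) => x /KP[].
(* This bounds the velocity because [K <= (K + 1)^2], which spares a square root. *)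
pose L := (K + 1) * c0; have L0 : 0 <= L by rewrite mulr_ge0// addr_ge0// ltW.
have LT : L * T < rho.
  by move: small; rewrite [_ / rho]mulrC -!mulrA ltr_pdivrMl// mulr1 mulrA.
pose sol (c : R -> H) t := c 0 = x0 /\ forall s, 0 <= s <= t ->
   B (c s) /\ is_derive (s : R^o) 1 (c : R^o -> H) (Z (c s)).
have cH : geo_complete H by exact: complete_geo.
have speed c t s : sol c t -> 0 <= s <= t -> `|Z (c s)| <= L.
  move=> [cx cP] /andP[s0 st].
  have cst : G (c s) (Z (c s)) (Z (c s)) = G x0 (Z x0) (Z x0).
    have := @mean_value_right R R^o (fun u => G (c u) (Z (c u)) (Z (c u)) : R^o) (fun=> 0) 0 s 0 s0.
    rewrite cx mul0r => h; apply/eqP; rewrite -subr_eq0 -normr_le0; apply: h => u /andP[u0 us].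
      have [Bu du] := cP u (introT andP (conj u0 (le_trans us st))).
      by apply: killing_speed => //; have [] := KP _ Bu.
    by rewrite normr0.
  have [Bs _] := cP s (introT andP (conj s0 st)); have [_ /(_ (Z (c s)))] := KP _ Bs.
  rewrite cst => h; rewrite -(@ler_pXn2r _ 2) ?nnegrE//; apply: le_trans h _.
  apply: le_trans (ler_wpM2l (ltW K0) hc) _; rewrite /L exprMn ler_wpM2r ?exprn_ge0//.
  have := sqr_ge0 K; rewrite sqrrD; move: K0; nra.
have lip c t s1 s2 : sol c t -> 0 <= s1 -> s1 <= s2 -> s2 <= t -> `|c s2 - c s1| <= L * (s2 - s1).
  move=> sc s10 s12 s2t; apply: (mean_value_right (c' := fun s => Z (c s)) s12) => s /andP[h1 h2].
    by have [_ cP] := sc; have [] := cP s (introT andP (conj (le_trans s10 h1) (le_trans h2 s2t))).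
  by apply: (speed c t) => //; rewrite (le_trans s10 h1) (le_trans h2 s2t).
have uni c c' t s : sol c t -> sol c' t -> 0 <= s <= t -> c s = c' s.
  by move=> [e1 p1] [e2 p2]; apply: (ode_unique_right oB (sZB 1%N) p1 p2); rewrite e1 e2.
have step l : B l -> exists2 r, 0 < r & exists2 tau, 0 < tau & forall c s t, sol c s -> 0 <= s ->
    s <= t -> `|c s - l| < r -> t - s < tau -> exists c', sol c' t.
  move=> Bl; have [r r0 [tau tau0 [phi [rB fl _ _]]]] := local_flow cH oB sZB Bl.
  exists r => //; exists tau => // c s t [cx cP] s0 st cl tst.
  have [f0 fP] := fl (c s) cl.
  exists (glue s c (fun u => phi (- s + u) (c s))); split; first by rewrite /glue s0.
  move=> u /andP[u0 ut].
  have [us|su] := leP u s.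
    have [Bu du] := cP u (introT andP (conj u0 us)); rewrite /glue us; split=> //.
    apply: derive_glue => // [su|]; last by rewrite addrC subrr f0.
    have us' : u = s by apply/eqP; rewrite eq_le us su.
    have := fP 0; rewrite normr0 => /(_ tau0)[_]; rewrite f0 us' => d.
    have d' : is_derive (- s + s : R^o) 1 (phi^~ (c s) : R^o -> H) (Z (c s)) by rewrite addrC subrr.
    exact: is_derive_shift_time d'.
  have h : `|- s + u| < tau by rewrite ger0_norm; lra.
  have [Bu du] := fP _ h.
  have -> : glue s c (fun u => phi (- s + u) (c s)) u = phi (- s + u) (c s).
    by rewrite /glue ifF//; apply/negbTE; rewrite -ltNge.
  split=> //; apply: derive_glue => // [us|_|]; [|exact: is_derive_shift_time|by rewrite addrC subrr f0].
  by exfalso; move: us; rewrite leNgt su.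
have init : exists c, sol c 0.
  have Bx : B x0 by exact: nball_center.
  have [r r0 [tau tau0 [phi [rB fl _ _]]]] := local_flow cH oB sZB Bx.
  have [f0 fP] := fl x0 (nball_center _ r0); exists (phi^~ x0); split=> // s.
  by rewrite -eq_le => /eqP <-; apply: fP; rewrite normr0.
suff [c [cx cP]] : exists c, sol c T.
  by exists c => // t /cP[Bt dt]; split=> //; have [] := KP _ Bt.
have Tin : 0 <= T <= T by rewrite T0 lexx.
move: T Tin {T0 small} LT; suff key T : 0 <= T -> L * T < rho -> forall t, 0 <= t <= T -> exists c, sol c t.
  by move=> T /andP[T0 _] LT; apply: (key T T0 LT); rewrite T0 lexx.
move=> T0 LT; apply: real_ind => //.
- move=> t /andP[t0 tT] Pt; have [c sc] := Pt t (introT andP (conj t0 (lexx t))).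
  have Bt : B (c t) by have [_ cP] := sc; have [] := cP t (introT andP (conj t0 (lexx t))).
  have [r r0 [tau tau0 st]] := step _ Bt.
  exists tau => // s /andP[ts st'] sT; apply: (st c t s sc t0 (ltW ts)); rewrite ?subrr ?normr0//; lra.
- move=> t /andP[t0 tT] Pt.
  (* Solutions are known up to every time before [t]. Their endpoints at the times [sn n] form a
     geometric sequence, since the velocity is bounded; its limit lies in the ball, and the flow box
     there reaches past [t] from some [sn n]. *)
  pose sn n := t - t * 2^-1 ^+ n.
  have hn n : 0 < (2^-1 : R) ^+ n <= 1 by rewrite exprn_gt0 ?invr_gt0//= exprn_ile1// ?invr_ge0// invf_le1// ler1n.
  have snP n : 0 <= sn n < t.
    have /andP[a1 a2] := hn n; rewrite /sn subr_ge0 ler_piMr ?(ltW t0)//= ltrBlDr ltrDl mulr_gt0//.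
  have snS n : sn n <= sn n.+1.
    have /andP[a1 a2] := hn n; rewrite /sn lerD2l lerN2 ler_pM2l// exprS ler_piMl ?(ltW a1)//.
    by rewrite invf_le1// ler1n.
  have [c cP] := choice (fun n => Pt (sn n) (snP n)).
  have restr n m : (n <= m)%N -> sol (c m) (sn n) /\ sn n <= sn m.
    move=> nm; have le : sn n <= sn m.
      elim: m nm => [|m IH]; first by rewrite leqn0 => /eqP ->.
      by rewrite leq_eqVlt => /orP[/eqP-> //|]; rewrite ltnS => /IH h; exact: le_trans h (snS m).
    split=> //; have [e h] := cP m; split=> // s /andP[s0 s1]; apply: h; rewrite s0 (le_trans s1)//.
  pose u n := c n (sn n).
  have uS n : `|u n.+1 - u n| <= (L * t) * 2^-1 ^+ n.
    have [r1 le1] := restr n n.+1 (leqnSn n).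
    have -> : u n = c n.+1 (sn n).
      by apply: (uni _ _ (sn n) (sn n) (cP n) r1); rewrite lexx; have /andP[->] := snP n.
    have /andP[a1 _] := snP n.
    apply: le_trans (lip _ _ _ _ (cP n.+1) a1 le1 (lexx _)) _.
    rewrite -mulrA ler_wpM2l//; have /andP[b1 b2] := hn n; have /andP[b3 b4] := hn n.+1.
    have h : 0 <= t * 2^-1 ^+ n.+1 by rewrite mulr_ge0 ?(ltW t0) ?(ltW b3).
    by rewrite /sn; move: (t * 2^-1 ^+ n) (t * 2^-1 ^+ n.+1) h => *; lra.
  have [l lP] := cH _ _ uS.
  have Bl : B l.
    rewrite /B /nball /=; apply: le_lt_trans (_ : L * t < _); last first.
      by apply: le_lt_trans LT; rewrite ler_wpM2l.
    apply: (@le_geo _ _ _ (2 * (L * t))) => n.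
    rewrite -(subrKA (u n)); apply: le_trans (ler_normD _ _) _.
    rewrite addrC; apply: lerD; last by rewrite distrC; exact: lP.
    have [e _] := cP n; rewrite -e; have /andP[a1 a2] := snP n.
    by apply: le_trans (lip _ _ _ _ (cP n) (lexx 0) a1 (lexx _)) _; rewrite subr0 ler_wpM2l// ltW.
  have [r r0 [tau tau0 st]] := step _ Bl.
  have [n nP] : exists n : nat, (2 * (L * t) + t) * 2^-1 ^+ n < Num.min r tau.
    apply: contrapT => nn.
    have : Num.min r tau <= 0; last by apply/negP; rewrite -ltNge lt_min r0.
    apply: (@le_geo _ _ _ (2 * (L * t) + t)) => n; rewrite add0r leNgt; apply/negP => h; apply: nn; by exists n.
  have /andP[b1 b2] := hn n; have Lt0 : 0 <= 2 * (L * t) by rewrite mulr_ge0// mulr_ge0// ltW.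
  have /andP[a1 a2] := snP n.
  move: nP; rewrite mulrDl lt_min => /andP[n1 n2].
  have p1 : 0 <= 2 * (L * t) * 2^-1 ^+ n by rewrite mulr_ge0 ?(ltW b1).
  have p2 : 0 <= t * 2^-1 ^+ n by rewrite mulr_ge0 ?(ltW b1) ?(ltW t0).
  apply: (st (c n) (sn n) t (cP n) a1 (ltW a2)).
    by apply: le_lt_trans (lP n) _; lra.
  by rewrite /sn; lra.
Qed.
End KillingTime.

(** The isometry condition and the relation between [X] and [Z], once differentiated, both produce
    second derivatives of [f]; by symmetry these agree, and the Killing equation of [X] on the
    vectors [df u], [df w] becomes that of [Z]. *)
Lemma killing_related (R : realType) (H : hilbertSpace R) (W Om Om' : set H) (G G' : H -> H -> H -> R)
    (f Z X : H -> H) : local_metric Om G -> local_metric Om' G' -> W `<=` Om ->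
  local_isometry W G Om' G' f -> smooth_on W Z -> smooth_on Om' X ->
  (forall y, W y -> X (f y) = 'd f y (Z y)) -> killing_eq Om' G' X -> killing_eq W G Z.
Proof.
move=> mG mG' WO [oW sf WO' fG _] sZ sX rel kX x u w Wx; have Ox := WO _ Wx; have Ox' := WO' _ Wx.
have cf := sf 2%N; have fG' := lm_form mG' Ox'.
have df : is_diff x f ('d f x).
  by apply: differentiableP; have [+ _] := class_CS cf; apply.
have dZ : is_diff x Z ('d Z x).
  by apply: differentiableP; have [+ _] := class_CS (sZ 1%N); apply.
have dX : is_diff (f x) X ('d X (f x)).
  by apply: differentiableP; have [+ _] := class_CS (sX 1%N); apply.
have dd w' : is_diff x (fun y => 'd f y w') (fun a => d2 f x a w').
  exact: differentiableP (class_C2_diff w' oW Wx cf).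
have E1 a b c : metric_d G x a b c = metric_d G' (f x) ('d f x a) ('d f x b) ('d f x c)
    + G' (f x) (d2 f x a b) ('d f x c) + G' (f x) ('d f x b) (d2 f x a c).
  have h1 := metric_is_diff mG b c Ox.
  have h2 := metric_diff_comp mG' Ox' df (dd b) (dd c).
  by apply: (is_diff_inj a h1 (is_diff_open oW Wx _ h2)) => y Wy; rewrite fG.
have E2 b : 'd X (f x) ('d f x b) = d2 f x b (Z x) + 'd f x ('d Z x b).
  have h1 := @is_diff_comp _ _ _ _ f _ X _ x df dX.
  have h2 := diff_field_apply oW Wx cf (is_diff_id x) dZ.
  by apply: (is_diff_inj b h1 (is_diff_open oW Wx _ h2)) => y Wy; rewrite /= rel.
have alg (m m' g1 g2 : R) (Fu Fw Xu Xw D1 D1' D2 D2' Zu Zw : H) :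
    m = m' + G' (f x) D1' Fw + G' (f x) Fu D2' -> Xu = D1 + Zu -> Xw = D2 + Zw ->
    D1' = D1 -> D2' = D2 -> G' (f x) Zu Fw = g1 -> G' (f x) Fu Zw = g2 ->
    m' + G' (f x) Xu Fw + G' (f x) Fu Xw = 0 -> m + g1 + g2 = 0.
  move=> -> -> -> -> -> <- <-; rewrite (psdDl fG') (psdDr fG') => <-; ring.
have kk := kX (f x) ('d f x u) ('d f x w) Ox'; rewrite rel// in kk.
exact: (alg _ _ _ _ _ _ _ _ _ _ _ _ _ _ (E1 (Z x) u w) (E2 u) (E2 w) (d2C (Z x) u oW Wx cf)
   (d2C (Z x) w oW Wx cf) (fG x _ _ Wx) (fG x _ _ Wx) kk).
Qed.

(** * Pulling back Killing fields; integral curves *)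

Section Curves.
Variables (R : realType) (H : hilbertSpace R) (M : manifold H) (g : metric M).
Implicit Types (q r : M) (X : vector_field M).
Let form q := form_in_chart g q.

Lemma inverse_chain f f' q r y v : smooth_in setT f -> smooth_in setT f' -> cancel f' f ->
  codomain r y -> domain q (f' (of_chart r y)) ->
  'd (in_charts f q r) (in_charts f' r q y) ('d (in_charts f' r q) y v) = v.
Proof.
move=> sf sf' k cy qy; have [_ pf'] := sf'; have [ry ey] := of_chartK cy.
have h1 := @map_chain _ _ _ _ _ (f' \o of_chart r) setT f q r y v sf (pf' r) (conj cy I) I.
rewrite /= k in h1; rewrite -[LHS](h1 qy ry) -[RHS](trans_self v cy).
by apply: (congr1 (fun h => 'd h y v)); apply/funext => z; rewrite k.
Qed.

Section Push.
Variables (f f' : M -> M).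
Hypotheses (If : Defs.isometry g f) (If' : Defs.isometry g f') (k : cancel f f') (k' : cancel f' f).
Let sf : smooth_in setT f := (isometry_iso If).1.
Let sf' : smooth_in setT f' := (isometry_iso If').1.

Definition pull_back X : vector_field M := fun a =>
  'd (in_charts f' (f a) a) (to_chart (f a) (f a)) (X (f a)).

Lemma pull_back_chart X q r x : codomain q x -> domain r (f (of_chart q x)) ->
  field_in_chart (pull_back X) q x =
    'd (in_charts f' r q) (in_charts f q r x) (field_in_chart X r (in_charts f q r x)).
Proof.
move=> cx rx; have [qa ea] := of_chartK cx; set a := of_chart q x in qa ea rx *; set b := f a in rx *.
have db := domain_self b; have eb := to_chartK db; have cb := to_chart_codomain db.
have da := domain_self a.
have [_ pf'] := sf'.
have fb : f' b = a by rewrite /b k.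
rewrite -[in LHS]ea (field_at _ qa).
have h1 := @par_change _ _ _ _ (chart_pre b setT) (f' \o of_chart b) a q (to_chart b b) (X b) (pf' b) (conj cb I).
rewrite /= eb fb in h1; rewrite -[LHS](h1 da qa).
have h2 := @map_chain _ _ _ _ (codomain b) (of_chart b) setT f' r q (to_chart b b) (X b) sf' (par_chart b) cb.
rewrite eb fb in h2; rewrite [LHS](h2 I rx qa).
have -> : in_charts f q r x = to_chart r b by [].
exact: (congr1 _ (esym (field_at X rx))).
Qed.

Lemma pull_back_related X q r x : codomain q x -> domain r (f (of_chart q x)) ->
  field_in_chart X r (in_charts f q r x) = 'd (in_charts f q r) x (field_in_chart (pull_back X) q x).
Proof.
move=> cx rx; rewrite (pull_back_chart X cx rx); have [qx ex] := of_chartK cx.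
have e1 : of_chart r (in_charts f q r x) = f (of_chart q x) by exact: to_chartK.
have e2 : in_charts f' r q (in_charts f q r x) = x by rewrite {1}/in_charts e1 k ex.
have := @inverse_chain f f' q r (in_charts f q r x) (field_in_chart X r (in_charts f q r x)) sf sf' k'.
by rewrite e1 k e2 => ->//; exact: to_chart_codomain.
Qed.

Lemma pull_back_smooth X : smooth_field X -> smooth_field (pull_back X).
Proof.
move=> sX q n; apply: class_C_local => x cx; pose r := f (of_chart q x).
have [oW sfq inr _ _] := isometry_local q r If; have [_ sfq' inr' _ _] := isometry_local r q If'.
exists (chart_pre q (f @^-1` domain r)); split=> //; first by split=> //; exact: domain_self.
apply: (@class_C_ext _ n _ _ _ (fun y => 'd (in_charts f' r q) (in_charts f q r y)
  (field_in_chart X r (in_charts f q r y)))) => //.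
  by move=> y [cy ry]; rewrite (pull_back_chart X cy ry).
have [_ cd] := class_CS (sfq' n.+1).
apply: (@class_C_comp _ n _ _ _ _ _ (fun y => (in_charts f q r y, field_in_chart X r (in_charts f q r y)))
   (fun z => 'd (in_charts f' r q) (z.1) (z.2)) oW _ _ cd).
  move=> y [cy ry]; split=> //; split; first exact: inr.
  by rewrite /preimage /= /in_charts to_chartK// k; have [] := of_chartK cy.
apply: class_C_pair => //; apply: (class_C_comp oW inr (sfq n) (sX r n)).
Qed.

Lemma pull_back_killing X : inf_killing g X -> inf_killing g (pull_back X).
Proof.
move=> [sX kX]; have sp := pull_back_smooth sX; split; first exact: sp.
move=> q x u w cx; pose r := f (of_chart q x).
have Il := isometry_local q r If.
have sub : chart_pre q (f @^-1` domain r) `<=` codomain q by move=> y [].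
apply: (killing_related (form_metric g q) (form_metric g r) sub Il _ (sX r) _ (kX r)).
- by move=> n; apply: class_C_sub (sp q n).
- by move=> y [cy ry]; exact: pull_back_related.
- by split=> //; exact: domain_self.
Qed.
End Push.

Definition icurve X (c : R -> M) (t : R) : Prop := {for t, continuous (c : R^o -> M)} /\
  is_derive (t : R^o) 1 ((fun s => to_chart (c t) (c s)) : R^o -> H) (X (c t)).

Lemma cont_domain (c : R -> M) (t : R) (U : set M) : {for t, continuous (c : R^o -> M)} -> open U -> U (c t) ->
  exists2 d, 0 < d & forall s, `|s - t| < d -> U (c s).
Proof.
move=> cc oU Ut.
have /nbhs_ballP[d /= d0 dP] : nbhs (t : R^o) (c @^-1` U) by apply: cc; exact: open_nbhs_nbhs.
by exists d => // s sd; apply: dP; rewrite /ball /= distrC.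
Qed.

Lemma derive_change (c : R -> M) (t : R) q r v : {for t, continuous (c : R^o -> M)} ->
  domain r (c t) -> domain q (c t) ->
  is_derive (t : R^o) 1 ((fun s => to_chart r (c s)) : R^o -> H) v ->
  is_derive (t : R^o) 1 ((fun s => to_chart q (c s)) : R^o -> H) ('d (trans r q) (to_chart r (c t)) v).
Proof.
move=> cc rt qt dc; have [d d0 dP] := cont_domain cc (@open_domain _ _ _ r) rt.
have er := to_chartK rt.
have dt : differentiable (trans r q) (to_chart r (c t)).
  by apply: trans_diff; [exact: to_chart_codomain|rewrite er].
apply: (derive_local d0 _ (derive_comp dc dt)) => s /dP rs.
by rewrite /= /trans to_chartK.
Qed.

Lemma icurve_chart X c t q : domain q (c t) -> icurve X c t ->
  is_derive (t : R^o) 1 ((fun s => to_chart q (c s)) : R^o -> H) (field_in_chart X q (to_chart q (c t))).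
Proof. by move=> qt [cc dc]; rewrite field_at//; exact: (derive_change cc (domain_self _) qt dc). Qed.

Lemma icurve_intro X c t q : {for t, continuous (c : R^o -> M)} -> domain q (c t) ->
  is_derive (t : R^o) 1 ((fun s => to_chart q (c s)) : R^o -> H) (field_in_chart X q (to_chart q (c t))) ->
  icurve X c t.
Proof.
move=> cc qt dc; split=> //; have et := to_chartK qt.
have := derive_change cc qt (domain_self _) dc.
rewrite -field_change ?et//; [|exact: to_chart_codomain|exact: domain_self].
by rewrite /trans et field_self.
Qed.

Lemma icurve_of_chart X (ga : R -> H) t q : codomain q (ga t) ->
  is_derive (t : R^o) 1 (ga : R^o -> H) (field_in_chart X q (ga t)) -> icurve X (fun s => of_chart q (ga s)) t.
Proof.
move=> ct dg; have [qt et] := of_chartK ct.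
have cg := is_derive_continuous dg.
apply: (icurve_intro (q := q)) => //.
  by apply: (@continuous_comp _ _ _ (ga : R^o -> H) (of_chart q)) => //; exact: of_chart_cont.
have [d d0 dP] := (openP _).1 (@open_codomain _ _ _ q) _ ct.
have [e e0 eP] := derive_cont dg d0.
rewrite et; apply: (derive_local e0 _ dg) => s /eP h.
by have := dP _ h; rewrite addrC subrK => cs; have [_ ->] := of_chartK cs.
Qed.

Lemma icurve_ext X c c' t d : 0 < d -> (forall s, `|s - t| < d -> c s = c' s) ->
  icurve X c t -> icurve X c' t.
Proof.
move=> d0 e [cc dc]; have et : c t = c' t by apply: e; rewrite subrr normr0.
split; last by rewrite -et; apply: (derive_local d0 _ dc) => s /e ->.
rewrite /prop_for /continuous_at -et; apply: cvg_trans cc; apply: near_eq_cvg.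
apply/nbhs_ballP; exists d => //= s; rewrite /ball /= distrC => sd; exact: e.
Qed.

Lemma icurve_shift X c (a t : R) : icurve X c (a + t) -> icurve X (fun s => c (a + s)) t.
Proof.
move=> [cc dc]; split; last exact: is_derive_shift_time dc.
apply: (@continuous_comp _ _ _ (fun s : R^o => a + s : R^o) c) => //.
have := is_derive_affine (a : R^o) (1 : R^o) t.
have -> : (fun s : R^o => (a : R^o) + (s : R) *: (1 : R^o)) = (fun s => a + s).
  by apply/funext => s; rewrite [_ *: _]mulr1.
by move=> /is_derive_continuous.
Qed.

Lemma icurve_opp X c t : icurve X c (- t) -> icurve (fun a => - X a) (fun s => c (- s)) t.
Proof.
move=> [cc dc]; split; last by have := derive_reflect dc; rewrite opprK.
apply: (@continuous_comp _ _ _ (fun s : R^o => - s : R^o) c) => //.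
have := is_derive_affine (0 : R^o) (-1 : R^o) t.
have -> : (fun s : R^o => (0 : R^o) + (s : R) *: (-1 : R^o)) = (fun s => - s).
  by apply/funext => s; rewrite add0r [_ *: _]mulrN1.
by move=> /is_derive_continuous.
Qed.

Lemma icurve_glue X c1 c2 (t s : R) : (s <= t -> icurve X c1 s) -> (t <= s -> icurve X c2 s) ->
  c1 t = c2 t -> icurve X (glue t c1 c2) s.
Proof.
move=> h1 h2 e; have [st|ts|st] := ltgtP s t.
- have st0 : 0 < t - s by rewrite subr_gt0.
  apply: (icurve_ext st0 _ (h1 (ltW st))) => u; rewrite ltr_norml => /andP[_ h].
  by rewrite /glue ifT//; lra.
- have st0 : 0 < s - t by rewrite subr_gt0.
  apply: (icurve_ext st0 _ (h2 (ltW ts))) => u; rewrite ltr_norml => /andP[h _].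
  by rewrite /glue ifF//; apply/negbTE; rewrite -ltNge; lra.
have [k1 d1] := h1 (le_of_eq st); have [k2 d2] := h2 (le_of_eq (esym st)).
have ee : c1 s = c2 s by rewrite st.
have es : glue t c1 c2 s = c1 s by rewrite /glue st lexx.
split.
  rewrite /prop_for /continuous_at es => U Ut.
  have n1 : nbhs (s : R^o) (c1 @^-1` U) by exact: k1.
  have n2 : nbhs (s : R^o) (c2 @^-1` U) by apply: k2; rewrite -ee.
  have : nbhs (s : R^o) ((c1 @^-1` U) `&` (c2 @^-1` U)) by exact: filterI.
  apply: filterS => u [U1 U2]; rewrite /preimage /= /glue; by case: ifP.
have -> : (fun u => to_chart (glue t c1 c2 s) (glue t c1 c2 u)) =
    glue t (fun u => to_chart (c1 s) (c1 u)) (fun u => to_chart (c1 s) (c2 u)).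
  by apply/funext => u; rewrite es /glue; case: ifP.
rewrite es; rewrite -ee in d2.
exact: (derive_glue (fun _ => d1) (fun _ => d2) (congr1 (to_chart (c1 s)) e)).
Qed.

Lemma icurve_unique_right X c1 c2 T : smooth_field X ->
  (forall t, 0 <= t <= T -> icurve X c1 t) -> (forall t, 0 <= t <= T -> icurve X c2 t) ->
  c1 0 = c2 0 -> forall t, 0 <= t <= T -> c1 t = c2 t.
Proof.
move=> sX h1 h2 e0; apply: real_ind => //.
- move=> t /andP[t0 tT] Pt; have et := Pt t (introT andP (conj t0 (lexx t))).
  have tI : 0 <= t <= T by rewrite t0 ltW.
  pose q := c1 t; have q1 : domain q (c1 t) by exact: domain_self.
  have q2 : domain q (c2 t) by rewrite -et.
  have [d1 d10 P1] := cont_domain (h1 t tI).1 (@open_domain _ _ _ q) q1.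
  have [d2 d20 P2] := cont_domain (h2 t tI).1 (@open_domain _ _ _ q) q2.
  exists (Num.min d1 d2) => [|s /andP[ts st] sT]; first by rewrite lt_min d10.
  have min1 u : 0 <= u <= s - t -> [/\ 0 <= t + u <= T, `|t + u - t| < d1 & `|t + u - t| < d2].
    move=> /andP[u0 us]; have : `|t + u - t| < Num.min d1 d2.
      by rewrite addrC addKr ger0_norm//; lra.
    by rewrite lt_min => /andP[-> ->]; split=> //; apply/andP; split; lra.
  have es : t + (s - t) = s by rewrite addrC subrK.
  have st0 : 0 <= s - t <= s - t by rewrite lexx andbT subr_ge0 ltW.
  have e : to_chart q (c1 (t + (s - t))) = to_chart q (c2 (t + (s - t))).
    apply: (@ode_unique_right _ _ (field_in_chart X q) (codomain q) (s - t)
      (fun u => to_chart q (c1 (t + u))) (fun u => to_chart q (c2 (t + u)))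
      (@open_codomain _ _ _ q) (sX q 1%N) _ _ _ _ st0); last by rewrite addr0 et.
    + move=> u /min1[uT /P1 qu _]; split; first exact: to_chart_codomain.
      exact: is_derive_shift_time (icurve_chart qu (h1 _ uT)).
    + move=> u /min1[uT _ /P2 qu]; split; first exact: to_chart_codomain.
      exact: is_derive_shift_time (icurve_chart qu (h2 _ uT)).
  have [_ a1 a2] := min1 _ st0; rewrite es in a1 a2 e.
  by rewrite -[c1 s](to_chartK (P1 _ a1)) e to_chartK//; exact: P2.
- move=> t /andP[t0 tT] Pt; have tI : 0 <= t <= T by rewrite tT ltW.
  exact: (left_limit_unique (@manifold_hausdorff _ _ M) t0 (h1 t tI).1 (h2 t tI).1).
Qed.

Lemma icurve_speed X c T : inf_killing g X -> (forall t, 0 <= t <= T -> icurve X c t) ->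
  forall t, 0 <= t <= T -> g (c t) (X (c t)) (X (c t)) = g (c 0) (X (c 0)) (X (c 0)).
Proof.
move=> [sX kX] h t /andP[t0 tT].
pose sp s : R^o := g (c s) (X (c s)) (X (c s)).
have := @mean_value_right R R^o sp (fun=> 0) 0 t 0 t0.
rewrite mul0r => hm; apply/eqP; rewrite -subr_eq0 -normr_le0; apply: hm => [u /andP[u0 ut]|]; last first.
  by move=> _ _; rewrite normr0.
have hu := h u (introT andP (conj u0 (le_trans ut tT))).
pose q := c u; have qu : domain q (c u) by exact: domain_self.
have [d d0 dP] := cont_domain hu.1 (@open_domain _ _ _ q) qu.
have cu := to_chart_codomain qu.
have := killing_speed (form_metric g q) (c := fun s => to_chart q (c s)) (sX q) (kX q) cu (icurve_chart qu hu).
apply: (derive_local d0) => s /dP qs; rewrite /sp.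
have cs : codomain q (to_chart q (c s)) by exact: to_chart_codomain.
have es := to_chartK qs.
have ds : domain (c s) (of_chart q (to_chart q (c s))) by rewrite es; exact: domain_self.
rewrite -(form_change g _ _ cs ds) -(field_change X cs ds) /trans es field_self.
exact: form_self.
Qed.
End Curves.

(** * Completeness of Killing fields *)

Section Completeness.
Variables (R : realType) (H : hilbertSpace R) (M : manifold H) (g : metric M).
Implicit Types (q r : M) (X : vector_field M).
Let form q := form_in_chart g q.

Lemma isometry_inv f f' : Defs.isometry g f -> cancel f f' -> cancel f' f -> Defs.isometry g f'.
Proof.
move=> If k k'; have [sf pf] := isometry_iso If.
have sf' : smooth_in setT f'.
  have [[h [kh kh' _ sh]] _] := If.
  have -> : f' = h by apply/funext => a; rewrite -[a in RHS]k' kh.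
  exact/smooth_mapP.
apply: (iso_isometry k' k _ (isometry_iso If)); split; first exact: sf'.
move=> r q y cy _ qy u v; have [ry ey] := of_chartK cy.
have e1 : of_chart q (in_charts f' r q y) = f' (of_chart r y) by exact: to_chartK.
have h := pf q r (in_charts f' r q y) (to_chart_codomain qy) I; rewrite e1 k' in h.
have e2 : in_charts f q r (in_charts f' r q y) = y by rewrite {1}/in_charts e1 k'.
have alg (z U V U' V' : H) : z = y -> U = u -> V = v -> form r z U V = form r y u v by move=> -> -> ->.
apply: (etrans (esym (h ry _ _))).
exact: (alg _ _ _ 0 0 e2 (inverse_chain u sf sf' k' cy qy) (inverse_chain v sf sf' k' cy qy)).
Qed.

Hypothesis symM : symmetric_space g.

(** Any point [a] is the image of [p] under an isometry. The pulled back field is Killing with the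
    same speed at [p] as the original at [a], so the constant found at [p] serves everywhere. *)
Lemma uniform_time (p : M) : exists2 N : R, 0 < N & forall X c0 T a, inf_killing g X -> 0 <= c0 -> 0 <= T ->
  N * c0 * T < 1 -> g a (X a) (X a) <= c0 ^+ 2 ->
  exists2 c, c 0 = a & forall t, 0 <= t <= T -> icurve X c t.
Proof.
pose x0 := to_chart p p; have dp := domain_self p; have ep := to_chartK dp.
have cx0 : codomain p x0 := to_chart_codomain dp.
have [N N0 NP] := killing_existence_right (form_metric g p) cx0.
exists N => // X c0 T a kX c00 T0 small sp.
have [f If fp] := isometry_transitive symM p a.
have [[f' [k k' _ _]] _] := If; have If' := isometry_inv If k k'.
have [sZ kZ] := pull_back_killing If If' k k' kX.
have rp : domain a (f (of_chart p x0)) by rewrite ep fp; exact: domain_self.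
have [|c c0E cP] := NP _ c0 T (sZ p) (kZ p) _ c00 T0 small.
  have [_ pf] := isometry_iso If.
  have := pf p a x0 cx0 I rp (field_in_chart (pull_back f f' X) p x0) (field_in_chart (pull_back f f' X) p x0).
  rewrite -(pull_back_related If If' k k' X cx0 rp).
  have -> : in_charts f p a x0 = to_chart a a by rewrite /in_charts ep fp.
  by rewrite field_self => <-; rewrite form_self.
exists (fun t => f (of_chart p (c t))); first by rewrite c0E ep.
move=> t /cP[ct dt]; pose r := f (of_chart p (c t)).
have rt : domain r (f (of_chart p (c t))) by exact: domain_self.
apply: (icurve_intro (q := r)) => //.
  apply: (@continuous_comp _ _ _ (fun s : R^o => of_chart p (c s)) f).
    apply: (@continuous_comp _ _ _ (c : R^o -> H) (of_chart p)).
      exact: is_derive_continuous dt.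
    exact: of_chart_cont.
  by have [[_ [_ _ [cf _] _]] _] := If; exact: cf.
have [oW sfr _ _ _] := isometry_local p r If.
have df : differentiable (in_charts f p r) (c t).
  by have [+ _] := class_CS (sfr 1%N); apply; split.
have := derive_comp dt df; rewrite -(pull_back_related If If' k k' X ct rt).
by [].
Qed.

(** The speed at the end of a piece equals the speed at its beginning, so each restart lasts the
    same time [de], and finitely many pieces cover [[0, T]]. *)
Lemma icurve_forward X a T : inf_killing g X -> 0 <= T ->
  exists2 c, c 0 = a & forall t, 0 <= t <= T -> icurve X c t.
Proof.
move=> kX T0; have [N N0 NP] := uniform_time a.
(* A bound for the speed with no square root: a nonnegative [z] satisfies [z <= (z + 1)^2]. *)
pose c0 := g a (X a) (X a) + 1.
have gp : 0 <= g a (X a) (X a) by exact: psd_ge0 (metric_psd g a) _.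
have c00 : 0 < c0 by rewrite ltr_wpDl.
pose de := (2 * (N * c0))^-1; have Nc : 0 < N * c0 by rewrite mulr_gt0.
have de0 : 0 < de by rewrite invr_gt0 mulr_gt0.
have small : N * c0 * de < 1.
  by rewrite /de invfM mulrCA divff ?gt_eqF// mulr1 invf_lt1// ltr1n.
have key n : forall b, g b (X b) (X b) <= c0 ^+ 2 ->
    exists2 c, c 0 = b & forall t, 0 <= t <= n%:R * de -> icurve X c t.
  elim: n => [|n IH] b hb.
    have [|c cb cP] := NP X c0 0 b kX (ltW c00) (lexx 0) _ hb; first by rewrite mulr0.
    by rewrite mul0r; exists c.
  have [c cb cP] := NP X c0 de b kX (ltW c00) (ltW de0) small hb.
  have [|c' cb' cP'] := IH (c de).
    have dd : 0 <= de <= de by rewrite (ltW de0) lexx.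
    by have := icurve_speed kX cP dd; rewrite cb => ->.
  have e : - de + de = 0 by rewrite addrC subrr.
  exists (glue de c (fun s => c' (- de + s))); first by rewrite /glue ltW// cb.
  move=> t /andP[t0 tn]; apply: icurve_glue => [td|dt|]; last by rewrite e.
    by apply: cP; rewrite t0 td.
  apply: icurve_shift; apply: cP'; move: tn; rewrite -natr1 mulrDl mul1r => tn.
  by apply/andP; split; lra.
have [n nP] : exists n : nat, T <= n%:R * de.
  exists (Num.bound (T / de)); rewrite -ler_pdivrMr//; apply/ltW/archi_boundP.
  by rewrite divr_ge0// ltW.
have [|c cb cP] := key n a; first by rewrite /c0; move: gp; move: (g a _ _) => z; nra.
by exists c => // t /andP[t0 tT]; apply: cP; rewrite t0 (le_trans tT nP).
Qed.

Definition opp_field X : vector_field M := fun a => - X a.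

Lemma opp_field_killing X : inf_killing g X -> inf_killing g (opp_field X).
Proof.
move=> kX; have -> : opp_field X = -2 *: X + X; last exact: inf_killing_lin.
apply/funext => a; have alg (x : H) : - x = - 2 *: x + x by rewrite scaleNr scaler_nat mulr2n opprD subrK.
exact: alg.
Qed.

Lemma icurve_unique X c1 c2 T : inf_killing g X ->
  (forall t, `|t| <= T -> icurve X c1 t) -> (forall t, `|t| <= T -> icurve X c2 t) ->
  c1 0 = c2 0 -> forall t, `|t| <= T -> c1 t = c2 t.
Proof.
move=> kX h1 h2 e0 t; rewrite ler_norml => /andP[t1 t2].
have [t0|t0] := leP 0 t.
  have hh s : 0 <= s <= T -> `|s| <= T by move=> /andP[s0 sT]; rewrite ger0_norm.
  apply: (icurve_unique_right kX.1 (T := T)) => //.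
  - by move=> s /hh; exact: h1.
  - by move=> s /hh; exact: h2.
  - by rewrite t0.
have hh s : 0 <= s <= T -> `|- s| <= T by move=> /andP[s0 sT]; rewrite normrN ger0_norm.
rewrite -[t]opprK.
apply: (icurve_unique_right (c1 := fun s => c1 (- s)) (c2 := fun s => c2 (- s)) (opp_field_killing kX).1 (T := T)).
- by move=> s /hh; move=> /h1; exact: icurve_opp.
- by move=> s /hh; move=> /h2; exact: icurve_opp.
- by rewrite oppr0.
- by apply/andP; split; lra.
Qed.

Lemma icurve_both X a T : inf_killing g X -> 0 <= T ->
  exists2 c, c 0 = a & forall t, `|t| <= T -> icurve X c t.
Proof.
move=> kX T0; have [c1 e1 P1] := icurve_forward a kX T0.
have [c2 e2 P2] := icurve_forward a (opp_field_killing kX) T0.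
exists (glue 0 (fun s => c2 (- s)) c1); first by rewrite /glue lexx oppr0.
move=> t; rewrite ler_norml => /andP[t1 t2].
apply: icurve_glue => [t0|t0|]; last by rewrite oppr0 e1 e2.
  have := P2 (- t); rewrite oppr_ge0 t0 lerNl t1 => /(_ isT) h.
  have hX : (fun b => - opp_field X b) = X by apply/funext => b; rewrite /opp_field opprK.
  by rewrite -hX; exact: icurve_opp.
by apply: P1; rewrite t0.
Qed.

Lemma icurve_global X a : inf_killing g X -> exists2 c, c 0 = a & forall t, icurve X c t.
Proof.
move=> kX.
have ex (T : R) : exists c, c 0 = a /\ forall t, `|t| <= `|T| -> icurve X c t.
  by have [c e cP] := icurve_both a kX (normr_ge0 T); exists c.
have [D DP] := choice ex.
have uni T1 T2 t : `|t| <= `|T1| -> `|t| <= `|T2| -> D T1 t = D T2 t.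
  move=> h1 h2; have [e1 P1] := DP T1; have [e2 P2] := DP T2.
  apply: (icurve_unique kX (T := `|t|)) => //; last by rewrite e1 e2.
    by move=> s st; apply: P1; exact: le_trans st h1.
  by move=> s st; apply: P2; exact: le_trans st h2.
have n1 (t : R) : `|(`|t| + 1)| = `|t| + 1 by rewrite ger0_norm// addr_ge0.
(* Within distance 1 of [t] this agrees, by uniqueness, with the single solution [D (|t| + 2)],
   which makes it an integral curve at [t]. *)
exists (fun t => D (`|t| + 1) t); first exact: (DP (`|0 : R| + 1)).1.
move=> t; have [_ P] := DP (`|t| + 2).
have n2 : `|(`|t| + 2)| = `|t| + 2 by rewrite ger0_norm// addr_ge0.
have : icurve X (D (`|t| + 2)) t by apply: P; rewrite n2 lerDl.
apply: (@icurve_ext _ _ _ _ _ _ _ 1) => // s st; apply: uni; rewrite ?n1 ?n2.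
  have : `|s| <= `|s - t| + `|t| by rewrite -{1}(subrK t s) ler_normD.
  by move: st; move: (`|s - t|) (`|s|) (`|t|) => *; lra.
by rewrite lerDl.
Qed.

Lemma iso_in_sub U V f : open V -> V `<=` U -> iso_in g U f -> iso_in g V f.
Proof.
move=> oV VU [[oU pU] pf]; split; last by move=> q r x cx Vx; exact: pf (VU _ Vx).
split=> // q; apply: par_sub (pU q); first exact: open_chart_pre.
by move=> x [cx Vx]; split=> //; exact: VU.
Qed.

Lemma iso_in_glue f : (forall b, exists N, N b /\ iso_in g N f) -> iso_in g setT f.
Proof.
move=> loc; split; last first.
  by move=> q r x cx _; have [N [Nx [_ pf]]] := loc (of_chart q x); exact: pf.
split=> [|q]; first exact: openT.
apply: par_glue; last by apply: open_chart_pre; exact: openT.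
move=> x [cx _]; have [N [Nx [[_ pN] _]]] := loc (of_chart q x).
by exists (chart_pre q N).
Qed.

Section Flow.
Variables (X : vector_field M) (Phi : R -> M -> M).
Hypotheses (kX : inf_killing g X) (Phi0 : forall a, Phi 0 a = a).
Hypothesis PhiP : forall a t, icurve X (Phi^~ a) t.

Lemma flow_group s t a : Phi (s + t) a = Phi s (Phi t a).
Proof.
rewrite addrC; apply: (@icurve_unique X (fun u => Phi (t + u) a) (fun u => Phi u (Phi t a)) `|s| kX) => //.
- by move=> u _; apply: (icurve_shift (c := Phi^~ a)).
- by rewrite Phi0 addr0.
Qed.

(** Locally the global flow is the flow box of [local_flow], hence smooth. The metric evaluated on
    two transported vectors [d(phi_s) u], [d(phi_s) v] has zero derivative in [s], by the equation
    of variations and the Killing equation. *)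
Lemma flow_near b : exists N tau, [/\ 0 < tau, N b & forall t, `|t| < tau -> iso_in g N (Phi t)].
Proof.
have [sX keq] := kX; pose q := b; have qb : domain q b by exact: domain_self.
have cb := to_chart_codomain qb; have oc := @open_codomain _ _ _ q.
have [r r0 [tau tau0 [phi [rU fl sphi dphi]]]] := local_flow (@complete_geo _ H) oc (sX q) cb.
pose N := [set a | domain q a /\ nball (to_chart q b) r (to_chart q a)].
have oN : open N by exact: open_chart_ball.
have ob : open (nball (to_chart q b) r) by exact: nball_open.
have e y t : nball (to_chart q b) r y -> `|t| < tau -> Phi t (of_chart q y) = of_chart q (phi t y).
  move=> ry tt; have [f0 fP] := fl y ry.
  apply: (@icurve_unique X (Phi^~ (of_chart q y)) (fun s => of_chart q (phi s y)) `|t| kX) => //.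
    by move=> s st; have [cs ds] := fP s (le_lt_trans st tt); exact: icurve_of_chart.
  by rewrite Phi0 f0.
exists N, tau; split=> // [|t tt]; first by split=> //; exact: nball_center.
have cphi y : nball (to_chart q b) r y -> codomain q (phi t y).
  by move=> ry; have [_ /(_ t tt)[]] := fl y ry.
have sPhi : smooth_in N (Phi t).
  split=> // q'; have oW : open (chart_pre q' N) by exact: open_chart_pre.
  have cW x : chart_pre q' N x -> nball (to_chart q b) r (trans q' q x) by move=> [_ []].
  have sW : smooth_on (chart_pre q' N) (fun x => phi t (trans q' q x)).
    move=> n; apply: (class_C_comp oW cW _ (sphi t tt n)).
    by apply: class_C_sub (trans_smooth q' q n) => x [cx []].
  apply: par_ext (par_of_smooth oW sW (fun x h => cphi _ (cW x h))) => x xN.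
  rewrite /= -e//; last exact: cW.
  by have [cx [dx _]] := xN; have [_ ->] := transK cx dx.
apply: iso_in_at => // a [qa ra]; pose y := to_chart q a.
have eq : Phi t a = of_chart q (phi t y) by rewrite -e// to_chartK.
exists q, q; split=> //; first by rewrite eq; have [] := of_chartK (cphi _ ra).
have ei x : nball (to_chart q b) r x -> in_charts (Phi t) q q x = phi t x.
  by move=> rx; rewrite /in_charts e//; have [_ ->] := of_chartK (cphi _ rx).
have dt s : `|s| < tau -> is_diff y (phi s) ('d (phi s) y).
  by move=> ss; apply: differentiableP; have [+ _] := class_CS (sphi s ss 1%N); apply.
have ei' x : nball (to_chart q b) r x -> phi t x = in_charts (Phi t) q q x by move=> /ei ->.
have [_ de] := is_diff_open ob ra ei' (dt t tt).
move=> u v; pose E s : R^o := form q (phi s y) ('d (phi s) y u) ('d (phi s) y v).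
have mq := form_metric g q; have [f0 fP] := fl y ra.
have dE s : `|s| < tau -> is_derive (s : R^o) 1 (E : R^o -> R^o) 0.
  move=> ss; have [cs ds] := fP s ss.
  have d1 := is_derive_pair ds (is_derive_pair (dphi y u s ra ss) (dphi y v s ra ss)).
  have dG := Gc_diff mq ('d (phi s) y u, 'd (phi s) y v) cs.
  have h := derive_comp d1 dG.
  have z : 'd (fun z : H * (H * H) => form q z.1 z.2.1 z.2.2 : R^o) (phi s y, ('d (phi s) y u, 'd (phi s) y v))
     (field_in_chart X q (phi s y), ('d (field_in_chart X q) (phi s y) ('d (phi s) y u),
      'd (field_in_chart X q) (phi s y) ('d (phi s) y v))) = 0.
    exact: (etrans (Gc_diffE mq _ _ _ _ _ cs) (keq q _ _ _ cs)).
  by rewrite -z; exact: h.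
have E0 : E 0 = form q y u v.
  have t00 : `|0 : R| < tau by rewrite normr0.
  have i0 : is_diff y (phi 0) id.
    by apply: (is_diff_open ob ra _ (is_diff_id y)) => x rx; have [->] := fl x rx.
  have [_ ee] := i0.
  have alg (z U V : H) : z = y -> U = u -> V = v -> form q z U V = form q y u v by move=> -> -> ->.
  exact: (alg _ _ _ f0 (congr1 (fun l => l u) ee) (congr1 (fun l => l v) ee)).
have := @mean_value_abs R R^o E (fun=> 0) tau 0 dE.
move=> /(_ (fun s _ => eq_ind_r (fun z => z <= 0) (lexx 0) (normr0 _)) t tt).
rewrite mul0r normr_le0 subr_eq0 E0 => /eqP Et; apply: (etrans _ Et).
have alg (z z' U V U' V' : H) : z = z' -> U = U' -> V = V' -> form q z U V = form q z' U' V' by move=> -> -> ->.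
exact: (alg _ _ _ _ _ _ (ei _ ra) (congr1 (fun l => l u) de) (congr1 (fun l => l v) de)).
Qed.

(** The orbit of [b] up to time [T] is followed by real induction: near [b], the flow for time [t]
    is a short flow, isometric near the current point of the orbit, after the flow for a time
    already treated. *)
Lemma flow_iso_near b T : 0 <= T -> exists N, N b /\ iso_in g N (Phi T).
Proof.
move=> T0; have TT : 0 <= T <= T by rewrite T0 lexx.
have cPhi t := (PhiP b t).1.
have jump s t N N' tau : N b -> iso_in g N (Phi s) -> N' (Phi s b) ->
    (forall u, `|u| < tau -> iso_in g N' (Phi u)) -> 0 < tau -> `|t - s| < tau -> exists N, N b /\ iso_in g N (Phi t).
  move=> Nb iN N's iN' tau0 ts; have [sN _] := iN; have [oN _] := sN.
  have oN' : open N' by have [[]] := iN' _ ts.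
  pose V := [set a | N a /\ N' (Phi s a)].
  have oV : open V.
    rewrite openE => a [Na N'a]; rewrite /interior.
    have h1 : nbhs a N by exact: open_nbhs_nbhs.
    have h2 : nbhs a (Phi s @^-1` N') by apply: (smooth_in_cont sN Na); exact: open_nbhs_nbhs.
    have h3 : nbhs a (N `&` (Phi s @^-1` N')) by exact: filterI.
    by apply: filterS h3 => c [].
  exists V; split=> //.
  have -> : Phi t = Phi (t - s) \o Phi s by apply/funext => a; rewrite /= -flow_group subrK.
  apply: (iso_comp (iso_in_sub oV _ iN) (iN' _ ts)); first by move=> a [].
  by move=> a [].
pose P t := exists N, N b /\ iso_in g N (Phi t).
apply: (@real_ind _ P 0 T _ _ _ T TT).
- have [N [tau [tau0 Nb NP]]] := flow_near b; exists N; split=> //; apply: NP; by rewrite normr0.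
- move=> t /andP[t0 tT] Pt; have [N [Nb iN]] := Pt t (introT andP (conj t0 (lexx t))).
  have [N' [tau [tau0 N'b NP]]] := flow_near (Phi t b).
  exists tau => // s /andP[ts st] sT; apply: (jump t s N N' tau) => //.
  by rewrite ger0_norm; lra.
- move=> t /andP[t0 tT] Pt; have [N' [tau [tau0 N'b NP]]] := flow_near (Phi t b).
  have oN' : open N' by have [[]] := NP 0 (eq_ind_r (fun z => z < _) tau0 (normr0 _)).
  have [d d0 dP] := cont_domain (cPhi t) oN' N'b.
  pose e := Num.min (Num.min d tau) t / 2.
  have m0 : 0 < Num.min (Num.min d tau) t by rewrite !lt_min d0 tau0.
  have e0 : 0 < e by rewrite divr_gt0.
  have em : e < Num.min (Num.min d tau) t by rewrite /e; lra.
  move: em; rewrite !lt_min => /andP[/andP[ed et] ett].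
  have [N [Nb iN]] := Pt (t - e) (introT andP (conj (ltW (etrans (subr_gt0 _ _) ett)) (etrans (gtrBl _ _) e0))).
  apply: (jump (t - e) t N N' tau) => //.
    by apply: dP; rewrite addrAC subrr add0r normrN ger0_norm// ltW.
  by rewrite opprB addrC subrK ger0_norm// ltW.
Qed.

Lemma flow_iso T : 0 <= T -> iso_in g setT (Phi T).
Proof. by move=> T0; apply: iso_in_glue => b; exact: flow_iso_near. Qed.
End Flow.

Theorem inf_killing_field X : inf_killing g X -> killing_field g X.
Proof.
move=> kX; split; first exact: kX.1.
have ex a : exists c, c 0 = a /\ forall t, icurve X c t.
  by have [c e cP] := icurve_global a kX; exists c.
have [C CP] := choice ex; pose Phi t a := C a t.
have Phi0 a : Phi 0 a = a by have [] := CP a.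
have PhiP a t : icurve X (Phi^~ a) t by have [] := CP a.
have grp := flow_group kX Phi0 PhiP.
exists Phi.
  split; first by apply/funext => a; exact: Phi0.
  - by move=> s t; apply/funext => a; exact: grp.
  - by move=> a t; have [] := PhiP a t.
  - by move=> a t; have [] := PhiP a t.
have Psi0 a : Phi (- 0) a = a by rewrite oppr0.
have PsiP a t : icurve (opp_field X) (fun s => Phi (- s) a) t.
  by apply: (icurve_opp (c := Phi^~ a)).
have iso t : iso_in g setT (Phi t).
  have [t0|t0] := leP 0 t; first exact: flow_iso kX Phi0 PhiP t t0.
  have := @flow_iso (opp_field X) (fun s => Phi (- s)) (opp_field_killing kX) Psi0 PsiP (- t).
  by rewrite opprK; apply; rewrite oppr_ge0 ltW.
move=> t; apply: (@iso_isometry _ _ _ _ (Phi t) (Phi (- t))) => // a.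
  by rewrite -grp addrC subrr Phi0.
by rewrite -grp subrr Phi0.
Qed.
End Completeness.

(** * Hilbert spaces from complete definite forms *)

Record pre_hilbert (R : realType) := PreHilbert {
  ph_space :> lmodType R;
  ph_form : ph_space -> ph_space -> R;
  ph_psd : psd_form ph_form;
  ph_definite : forall x, ph_form x x = 0 -> x = 0;
  ph_complete : forall u : nat -> ph_space,
    (forall n, ph_form (u n.+1 - u n) (u n.+1 - u n) <= (2^-1 ^+ n) ^+ 2) ->
    exists l, forall e, 0 < e -> exists N, forall n, (N <= n)%N -> ph_form (u n - l) (u n - l) <= e ^+ 2 }.

Definition hilb (R : realType) (D : pre_hilbert R) : Type := ph_space D.
HB.instance Definition _ (R : realType) (D : pre_hilbert R) := GRing.Lmodule.copy (hilb D) (ph_space D).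

Section Hilbertization.
Variables (R : realType) (D : pre_hilbert R).
Implicit Types x y : hilb D.

Definition hilb_form x y : R := @ph_form R D x y.
Definition hilb_norm x : R := Num.sqrt (hilb_form x x).

Let fb : psd_form hilb_form := @ph_psd R D.

Lemma hilb_normE x : hilb_norm x ^+ 2 = hilb_form x x.
Proof. by rewrite sqr_sqrtr// psd_ge0. Qed.

Lemma hilb_norm_ge0 x : 0 <= hilb_norm x. Proof. exact: sqrtr_ge0. Qed.

Lemma hilb_cauchy x y : hilb_form x y <= hilb_norm x * hilb_norm y.
Proof.
apply: le_trans (ler_norm _) _; rewrite -(@ler_pXn2r _ 2) ?nnegrE ?mulr_ge0 ?hilb_norm_ge0//.
by rewrite -normrX ger0_norm ?sqr_ge0// exprMn !hilb_normE; exact: psd_cauchy.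
Qed.

Lemma hilb_normD x y : hilb_norm (x + y) <= hilb_norm x + hilb_norm y.
Proof.
rewrite -(@ler_pXn2r _ 2) ?nnegrE ?addr_ge0 ?hilb_norm_ge0// hilb_normE.
rewrite (psdDl fb) !(psdDr fb) (psdC fb y x) sqrrD !hilb_normE.
by have := hilb_cauchy x y; rewrite mulr2n; lra.
Qed.

Lemma hilb_normZ a x : hilb_norm (a *: x) = `|a| * hilb_norm x.
Proof. by rewrite /hilb_norm (psdZl fb) (psdZr fb) mulrA -expr2 sqrtrM ?sqr_ge0// sqrtr_sqr. Qed.

Lemma hilb_norm_eq0 x : hilb_norm x = 0 -> x = 0.
Proof.
move=> /eqP; rewrite sqrtr_eq0 => h; apply: (@ph_definite R D); apply/eqP; rewrite eq_le h.
exact: (psd_ge0 fb).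
Qed.
End Hilbertization.

HB.instance Definition _ (R : realType) (D : pre_hilbert R) :=
  @Lmodule_isNormed.Build R (hilb D) (@hilb_norm R D) (@hilb_normD R D) (@hilb_normZ R D) (@hilb_norm_eq0 R D).

Section HilbertComplete.
Variables (R : realType) (D : pre_hilbert R).

(** Centres of balls of radius [2^-n / 4] belonging to the filter are at consecutive distance at
    most [2^-n], the situation in which [ph_complete] provides a limit. *)
Lemma hilb_cauchy_cvg (F : set_system (hilb D)) : ProperFilter F -> cauchy F -> cvg F.
Proof.
move=> PF cF.
have e0 n : 0 < (4^-1 * 2^-1 ^+ n : R) by rewrite mulr_gt0 ?exprn_gt0 ?invr_gt0.
have ex n : exists x : hilb D, F (ball x (4^-1 * 2^-1 ^+ n)).
  by have /cauchyP /(_ _ (e0 n))[x Fx] := cF; exists x.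
have [u uP] := choice ex.
have h n : `|u n.+1 - u n| <= 2^-1 ^+ n.
  have [z [z1 z2]] := filter_ex (filterI (uP n.+1) (uP n)).
  move: z1 z2; rewrite -!ball_normE /ball_ /= => z1 z2.
  rewrite -(subrKA z); apply: le_trans (ler_normD _ _) _; rewrite [`|z - _|]distrC.
  move: (ltW z1) (ltW z2); rewrite exprS.
  have : 0 < (2^-1 ^+ n : R) by rewrite exprn_gt0 ?invr_gt0.
  by move: (2^-1 ^+ n) => a; lra.
have [n|l lP] := @ph_complete R D u.
  have := h n; rewrite -(@ler_pXn2r _ 2) ?nnegrE ?exprn_ge0 ?invr_ge0//; apply: le_trans.
  exact: (le_of_eq (esym (hilb_normE (u n.+1 - u n)))).
apply/cvg_ex; exists (l : hilb D); apply/cvgrPdist_lt => e ep.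
have ep2 : 0 < e / 2 by rewrite divr_gt0.
have [N NP] := lP _ ep2.
have [m mP] : exists m : nat, 2^-1 ^+ m <= e.
  apply: contrapT => nm.
  have : e <= 0; last by rewrite leNgt ep.
  apply: (@le_geo _ _ _ 1) => n; rewrite add0r mul1r leNgt; apply/negP => hn.
  by apply: nm; exists n; exact: ltW.
pose n := maxn N m.
have : `|(u n : hilb D) - l| <= e / 2.
  rewrite -(@ler_pXn2r _ 2) ?nnegrE ?(ltW ep2)//.
  apply: le_trans (NP n (leq_maxl _ _)); exact: (le_of_eq (hilb_normE ((u n : hilb D) - l))).
move=> un; apply: filterS (uP n) => z; rewrite -ball_normE /ball_ /= => z1.
rewrite -(subrKA (u n)); apply: le_lt_trans (ler_normD _ _) _; rewrite distrC.
have : (2^-1 : R) ^+ n <= 2^-1 ^+ m by rewrite ler_wiXn2l ?invr_ge0 ?invf_le1 ?ler1n ?leq_maxr.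
by move: z1 un mP; move: (2^-1 ^+ n) (2^-1 ^+ m) => *; lra.
Qed.
End HilbertComplete.

HB.instance Definition _ (R : realType) (D : pre_hilbert R) :=
  Uniform_isComplete.Build (hilb D) (@hilb_cauchy_cvg R D).

Section HilbertDot.
Variables (R : realType) (D : pre_hilbert R).
Let fb : psd_form (@hilb_form R D) := @ph_psd R D.

Lemma hilb_morphl y : zmod_morphism (fun x : hilb D => hilb_form x y).
Proof. by move=> x z; rewrite (psdDl fb) (psdNl fb). Qed.
Lemma hilb_morphr x : zmod_morphism (fun y : hilb D => hilb_form x y).
Proof. by move=> y z; rewrite (psdDr fb) (psdNr fb). Qed.
Lemma hilb_scall y : scalable_for *%R (fun x : hilb D => hilb_form x y).
Proof. by move=> a x; rewrite (psdZl fb). Qed.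
Lemma hilb_scalr x : scalable_for (idfun \; *%R) (fun y : hilb D => hilb_form x y).
Proof. by move=> a y; rewrite (psdZr fb). Qed.

HB.instance Definition _ := @isBilinear.Build R (hilb D) (hilb D) R *%R (idfun \; *%R) (@hilb_form R D)
  hilb_morphl hilb_morphr hilb_scall hilb_scalr.

Lemma hilb_hermitian (x y : hilb D) : hilb_form x y = (-1) ^+ false * idfun (hilb_form y x).
Proof. by rewrite expr0 mul1r (psdC fb). Qed.

HB.instance Definition _ := @isHermitianSesquilinear.Build R (hilb D) false idfun (@hilb_form R D) hilb_hermitian.

Lemma hilb_pos (x : hilb D) : x != 0 -> 0 < hilb_form x x.
Proof.
move=> x0; rewrite lt_neqAle (psd_ge0 fb) andbT eq_sym; apply: contraNneq x0 => h.
by apply/eqP; exact: (@ph_definite R D).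
Qed.

HB.instance Definition _ := @isDotProduct.Build R (hilb D) (@hilb_form R D) hilb_pos.

Definition hilbert_of : hilbertSpace R :=
  @HilbertSpace R (hilb D) (@hilb_form R D) (fun x => esym (hilb_normE x)).
End HilbertDot.

(** * Algebraic curvature tensors of fixed sign *)

Record curv_data (R : realType) := CurvData {
  cv_space :> hilbertSpace R;
  cv_form : cv_space -> cv_space -> R;
  cv_curv : cv_space -> cv_space -> cv_space -> cv_space;
  cv_sign : R;
  cv_psd : psd_form cv_form;
  cv_coercive : exists c C : R, 0 < c /\ forall v, c * `|v| ^+ 2 <= cv_form v v <= C * `|v| ^+ 2;
  cv_sign2 : cv_sign * cv_sign = 1;
  cv_lin1 : forall a u v w x, cv_curv (a *: u + v) w x = a *: cv_curv u w x + cv_curv v w x;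
  cv_lin3 : forall u v a x y, cv_curv u v (a *: x + y) = a *: cv_curv u v x + cv_curv u v y;
  cv_anti : forall u v w, cv_curv u v w = - cv_curv v u w;
  cv_skew : forall u v x y, cv_form (cv_curv u v x) y = - cv_form x (cv_curv u v y);
  cv_bianchi : forall u v w, cv_curv u v w + cv_curv v w u + cv_curv w u v = 0;
  cv_deriv : forall u v w z x, cv_curv u v (cv_curv w z x) - cv_curv w z (cv_curv u v x) =
    cv_curv (cv_curv u v w) z x + cv_curv w (cv_curv u v z) x;
  cv_bound : exists2 K : R, 0 < K & forall u v,
    cv_sign * cv_form (cv_curv u v u) v <= K * (cv_form u u * cv_form v v);
  cv_pos : forall U : seq (cv_space * cv_space),
    0 <= cv_sign * \sum_(a <- U) \sum_(b <- U) cv_form (cv_curv a.1 a.2 b.1) b.2 }.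

Section CurvatureAlgebra.
Variables (R : realType) (D : curv_data R).
Let H : hilbertSpace R := D.
Let gam : H -> H -> R := @cv_form R D.
Let Rm : H -> H -> H -> H := @cv_curv R D.
Let sg : R := cv_sign D.
Let fg : psd_form gam := @cv_psd R D.
Implicit Types (U V : seq (H * H)) (A B : H -> H).

Lemma Rm_lin1 a u v w x : Rm (a *: u + v) w x = a *: Rm u w x + Rm v w x.
Proof. exact: cv_lin1. Qed.
Lemma Rm_lin3 u v a x y : Rm u v (a *: x + y) = a *: Rm u v x + Rm u v y.
Proof. exact: cv_lin3. Qed.
Lemma Rm_anti u v w : Rm u v w = - Rm v u w.
Proof. exact: cv_anti. Qed.
Lemma Rm_skew u v x y : gam (Rm u v x) y = - gam x (Rm u v y).
Proof. exact: cv_skew. Qed.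
Lemma Rm0l w x : Rm 0 w x = 0.
Proof. by have := Rm_lin1 (-1) 0 0 w x; rewrite scaler0 add0r scaleN1r addNr. Qed.
Lemma RmZl t u w x : Rm (t *: u) w x = t *: Rm u w x.
Proof. by have := Rm_lin1 t u 0 w x; rewrite Rm0l !addr0. Qed.
Lemma RmZm t u w x : Rm u (t *: w) x = t *: Rm u w x.
Proof. by rewrite Rm_anti RmZl [in RHS]Rm_anti scalerN. Qed.
Lemma RmDl u v w x : Rm (u + v) w x = Rm u w x + Rm v w x.
Proof. by have := Rm_lin1 1 u v w x; rewrite !scale1r. Qed.
Lemma RmDm u v w x : Rm u (v + w) x = Rm u v x + Rm u w x.
Proof. by rewrite Rm_anti RmDl opprD -!Rm_anti. Qed.

Lemma sg_norm : `|sg| = 1.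
Proof.
have h : `|sg| ^+ 2 = 1 by rewrite -normrX expr2 cv_sign2 normr1.
by apply/eqP; rewrite -sqrp_eq1// h.
Qed.

Lemma gam_eq0 v : (forall w, gam v w = 0) -> v = 0.
Proof.
move=> h; have [c [C [c0 cC]]] := cv_coercive D; have /andP[] := cC v.
rewrite -/(gam v v) h pmulr_rle0// => h1 _; apply/eqP; rewrite -normr_eq0 -sqrf_eq0.
by rewrite eq_le h1 sqr_ge0.
Qed.

Lemma gam_ext v v' : (forall w, gam v w = gam v' w) -> v = v'.
Proof.
move=> h; apply/eqP; rewrite -subr_eq0; apply/eqP/gam_eq0 => w.
by rewrite (psdDl fg) (psdNl fg) h subrr.
Qed.

Definition gn v : R := Num.sqrt (gam v v).

Lemma gn_ge0 v : 0 <= gn v. Proof. exact: sqrtr_ge0. Qed.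

Lemma gnE v : gn v ^+ 2 = gam v v. Proof. by rewrite sqr_sqrtr// psd_ge0. Qed.

Lemma gam_le u v : `|gam u v| <= gn u * gn v.
Proof.
rewrite -(@ler_pXn2r _ 2) ?nnegrE ?mulr_ge0 ?gn_ge0// -normrX ger0_norm ?sqr_ge0//.
by rewrite exprMn !gnE; exact: psd_cauchy.
Qed.

Lemma Rm_pair u v w z : gam (Rm u v w) z = gam (Rm w z u) v.
Proof.
have an a b c d : gam (Rm a b c) d = - gam (Rm b a c) d by rewrite Rm_anti (psdNl fg).
have sk a b c d : gam (Rm a b c) d = - gam (Rm a b d) c by rewrite Rm_skew (psdC fg c).
have bi a b c d : gam (Rm a b c) d + gam (Rm b c a) d + gam (Rm c a b) d = 0.
  by rewrite -!(psdDl fg) [Rm a b c + _ + _](cv_bianchi a b c) (psd0l fg).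
have b1 := bi u v w z.
have b2 : gam (Rm v w u) z + gam (Rm w z u) v + gam (Rm v z w) u = 0.
  have := bi v w z u; rewrite (sk v w z u) (sk w z v u) (an z v w u); lra.
have b3 : gam (Rm w z u) v + gam (Rm u z v) w + gam (Rm w u v) z = 0.
  have := bi w z u v; rewrite (an z u w v) (sk u z w v) (an u w z v) (sk w u z v); lra.
have b4 : gam (Rm u z v) w + gam (Rm u v w) z + gam (Rm v z w) u = 0.
  have := bi z u v w; rewrite (an z u v w) (sk u v z w) (sk v z u w); lra.
lra.
Qed.

(** A list [U] stands for the sum of the [a.1 wedge a.2] in the algebraic exterior square. Up to
    constant factors, [ev A U] is the pairing of [A] with it, [rr U] its image under the curvature
    operator, and [bb] the form of the curvature operator with the sign that makes it
    nonnegative. *)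
Definition ev A U : R := sg * \sum_(a <- U) gam (A a.1) a.2.
Definition rr U : H -> H := fun w => \sum_(a <- U) Rm a.1 a.2 w.
Definition bb U V : R := ev (rr U) V.
Definition smul (t : R) U : seq (H * H) := [seq (t *: a.1, a.2) | a <- U].
Definition comb U t V := U ++ smul t V.

Lemma ev_nil A : ev A [::] = 0. Proof. by rewrite /ev big_nil mulr0. Qed.
Lemma ev_cat A U V : ev A (U ++ V) = ev A U + ev A V.
Proof. by rewrite /ev big_cat mulrDr. Qed.
Lemma ev_cons A a U : ev A (a :: U) = sg * gam (A a.1) a.2 + ev A U.
Proof. by rewrite /ev big_cons mulrDr. Qed.

Lemma ev_lin t A B U : ev (t *: A + B) U = t * ev A U + ev B U.
Proof.
elim: U => [|a U IH]; first by rewrite !ev_nil mulr0 addr0.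
rewrite !ev_cons IH; have -> : gam ((t *: A + B) a.1) a.2 = t * gam (A a.1) a.2 + gam (B a.1) a.2.
  by rewrite -(psdZl fg) -(psdDl fg).
ring.
Qed.

Lemma gam_suml (I : Type) (s : seq I) (F : I -> H) z : gam (\sum_(i <- s) F i) z = \sum_(i <- s) gam (F i) z.
Proof. by elim: s => [|i s IH]; rewrite ?big_nil ?(psd0l fg)// !big_cons (psdDl fg) IH. Qed.

Lemma rr_comb U t V w : rr (comb U t V) w = rr U w + t *: rr V w.
Proof.
by rewrite /rr big_cat big_map scaler_sumr; congr (_ + _); apply: eq_bigr => i _; exact: RmZl.
Qed.

Lemma bbE U V : bb U V = sg * \sum_(a <- U) \sum_(b <- V) gam (Rm a.1 a.2 b.1) b.2.
Proof.
rewrite /bb /ev; congr (_ * _); rewrite exchange_big /=; apply: eq_bigr => b _; exact: gam_suml.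
Qed.

Lemma bbC U V : bb U V = bb V U.
Proof.
rewrite !bbE exchange_big /=; congr (_ * _); apply: eq_bigr => a _; apply: eq_bigr => b _.
exact: Rm_pair.
Qed.

Lemma bb_ge0 U : 0 <= bb U U. Proof. by rewrite bbE; exact: cv_pos. Qed.

Lemma bb_comb U t V W : bb (comb U t V) W = bb U W + t * bb V W.
Proof.
rewrite /bb addrC -ev_lin; congr ev; apply/funext => w; rewrite rr_comb addrC.
by [].
Qed.

Definition nn U : R := Num.sqrt (bb U U).
Lemma nn_ge0 U : 0 <= nn U. Proof. exact: sqrtr_ge0. Qed.
Lemma nnE U : nn U ^+ 2 = bb U U. Proof. by rewrite sqr_sqrtr// bb_ge0. Qed.

Lemma bb_le U V : `|bb U V| <= nn U * nn V.
Proof.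
rewrite -(@ler_pXn2r _ 2) ?nnegrE ?mulr_ge0 ?nn_ge0// -normrX ger0_norm ?sqr_ge0//.
by rewrite [X in _ <= X]exprMn !nnE; exact: (comb_cauchy bbC bb_ge0 bb_comb).
Qed.

(* [kb A c]: the functional defined by [A] is bounded by [c]; the operators for
   which this holds form the completion of the span of the [R(u, v)]. *)
Definition kb A (c : R) : Prop := 0 <= c /\ forall U, `|ev A U| <= c * nn U.

Lemma kb_lin t A B c d : kb A c -> kb B d -> kb (t *: A + B) (`|t| * c + d).
Proof.
move=> [c0 h1] [d0 h2]; split=> [|U]; first by rewrite addr_ge0 ?mulr_ge0.
rewrite ev_lin; apply: le_trans (ler_normD _ _) _; rewrite mulrDl normrM -mulrA.
by apply: lerD => //; rewrite ler_wpM2l.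
Qed.

Lemma kb_sub A B c d : kb A c -> kb B d -> kb (A - B) (c + d).
Proof.
move=> h1 h2; have := kb_lin (-1) h2 h1; rewrite normrN1 mul1r [d + c]addrC.
by have -> : -1 *: B + A = A - B by rewrite scaleN1r addrC.
Qed.

Lemma kb0 : kb 0 0.
Proof.
split=> // U; have -> : ev 0 U = 0; last by rewrite normr0 mul0r.
by rewrite /ev big1 ?mulr0// => a _; rewrite (psd0l fg).
Qed.

Lemma kb_rr U : kb (rr U) (nn U).
Proof. by split=> [|V]; [exact: nn_ge0|exact: bb_le]. Qed.

Lemma kb_rr_nn U c : kb (rr U) c -> nn U <= c.
Proof.
move=> [c0 h]; have [n0|n0] := eqVneq (nn U) 0; first by rewrite n0.
have n1 : 0 < nn U by rewrite lt_neqAle eq_sym n0 nn_ge0.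
rewrite -(ler_pM2r n1) -expr2 nnE; exact: le_trans (ler_norm _) (h U).
Qed.

(** A list whose curvature operator is zero has zero norm, so every bounded functional kills it.
    Since [R] respects the relations of the exterior square, lists expressing bilinearity or
    antisymmetry are of this kind; this is how [kb_linear] and [kb_skew] obtain linearity and
    skewness of [A], which [kb] does not assume. *)
Lemma kb_zero A c U : kb A c -> (forall w, rr U w = 0) -> ev A U = 0.
Proof.
move=> [c0 h] r0; apply/eqP; rewrite -normr_le0; apply: le_trans (h U) _.
have -> : nn U = 0; last by rewrite mulr0.
apply/eqP; rewrite sqrtr_eq0; have -> : bb U U = 0; last by [].
by rewrite /bb /ev big1 ?mulr0// => a _; rewrite r0 (psd0l fg).
Qed.

Lemma sg_neq0 : sg != 0.
Proof. by apply/eqP => h; have := cv_sign2 D; rewrite -/sg h mul0r => /eqP; rewrite eq_sym oner_eq0. Qed.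

Lemma kb_linear A c : kb A c -> linear A.
Proof.
move=> kA a u v; apply: gam_ext => w.
have z x : rr [:: (a *: u + v, w); (u, - a *: w); (v, - w)] x = 0.
  rewrite /rr !big_cons big_nil /= addr0 RmZm -(scaleN1r w) RmZm Rm_lin1.
  by move: (Rm u w x) (Rm v w x) => r1 r2; vring R.
have := kb_zero kA z; rewrite !ev_cons ev_nil /= addr0 -!mulrDr => /eqP.
rewrite mulf_eq0 (negbTE sg_neq0) /= (psdZr fg) (psdNr fg) => /eqP h.
by rewrite (psdDl fg) (psdZl fg); lra.
Qed.

Lemma kb_skew A c u v : kb A c -> gam (A u) v = - gam u (A v).
Proof.
move=> kA; have z x : rr [:: (u, v); (v, u)] x = 0.
  by rewrite /rr !big_cons big_nil /= addr0 [X in _ + X]Rm_anti subrr.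
have := kb_zero kA z; rewrite !ev_cons ev_nil /= addr0 -mulrDr => /eqP.
by rewrite mulf_eq0 (negbTE sg_neq0) /= (psdC fg u) => /eqP h; lra.
Qed.

(** The square of [kappa] bounds the absolute sectional curvature. The curvature norm of [u wedge v]
    is at most [kappa |u| |v|], hence the operators of [k] are bounded on [T_pM]. *)
Definition kappa : R := xget 0 [set k : R | 0 <= k /\ forall u v,
  sg * gam (Rm u v u) v <= k ^+ 2 * (gam u u * gam v v)].

Lemma kappaP : 0 <= kappa /\ forall u v, nn [:: (u, v)] <= kappa * (gn u * gn v).
Proof.
have [k0 kP] : 0 <= kappa /\ forall u v, sg * gam (Rm u v u) v <= kappa ^+ 2 * (gam u u * gam v v).
  rewrite /kappa; case: xgetP => [k _ //|h]; exfalso.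
  have [K K0 KP] := cv_bound D; apply: (h (Num.sqrt K)); split; first exact: sqrtr_ge0.
  by move=> u v; rewrite sqr_sqrtr ?(ltW K0)//; exact: KP.
split=> // u v; rewrite -(@ler_pXn2r _ 2) ?nnegrE ?nn_ge0 ?mulr_ge0 ?gn_ge0//.
rewrite nnE !exprMn !gnE /bb ev_cons ev_nil addr0 /rr big_cons big_nil addr0 /=; exact: kP.
Qed.

Lemma kb_gam A c u v : kb A c -> `|gam (A u) v| <= c * kappa * (gn u * gn v).
Proof.
move=> [c0 h]; have [k0 kP] := kappaP.
have := h [:: (u, v)]; rewrite ev_cons ev_nil addr0 /= normrM sg_norm mul1r => h1.
by apply: le_trans h1 _; rewrite -mulrA ler_wpM2l.
Qed.

Lemma kb_bound A c v : kb A c -> gn (A v) <= c * kappa * gn v.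
Proof.
move=> kA; have [k0 _] := kappaP; have [c0 _] := kA.
have [n0|n0] := eqVneq (gn (A v)) 0; first by rewrite n0 !mulr_ge0 ?gn_ge0.
have n1 : 0 < gn (A v) by rewrite lt_neqAle eq_sym n0 gn_ge0.
rewrite -(ler_pM2r n1) -expr2 gnE; apply: le_trans (ler_norm _) _.
by apply: le_trans (kb_gam v (A v) kA) _; rewrite mulrA.
Qed.

Lemma ev_smul A c t U : kb A c -> ev A (smul t U) = t * ev A U.
Proof.
move=> kA; have lA := kb_linear kA.
have AZ x : A (t *: x) = t *: A x.
  have A0 : A 0 = 0.
    by have := lA 1 0 0; rewrite scaler0 addr0 scale1r -{1}[A 0]addr0 => /addrI.
  by have := lA t x 0; rewrite A0 !addr0.
elim: U => [|a U IH]; first by rewrite !ev_nil mulr0.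
by rewrite /= !ev_cons IH /= AZ (psdZl fg); ring.
Qed.

(** Approximate Riesz representation of the functional of [A] for the semidefinite form [bb] on
    lists. Being dense, the operators [rr U] transmit to [k] every identity that is continuous for
    the curvature norm. *)
Lemma kb_approx A c e : kb A c -> 0 < e -> exists U, kb (A - rr U) e.
Proof.
move=> kA e0; have [c0 h] := kA; have e2 : 0 < e ^+ 2 by rewrite exprn_gt0.
have l1 U t V : ev A (comb U t V) = ev A U + t * ev A V by rewrite ev_cat (ev_smul _ _ kA).
have l2 U : ev A U ^+ 2 <= c ^+ 2 * bb U U.
  rewrite -nnE -exprMn -[ev A U ^+ 2]ger0_norm ?sqr_ge0// normrX ler_pXn2r ?nnegrE ?mulr_ge0 ?nn_ge0//.
have [U UP] := comb_riesz [::] bbC bb_ge0 bb_comb l1 l2 e2.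
exists U; split=> [|V]; first exact: ltW.
rewrite -(@ler_pXn2r _ 2) ?nnegrE ?mulr_ge0 ?nn_ge0 ?(ltW e0)// -normrX ger0_norm ?sqr_ge0//.
rewrite [X in _ <= X]exprMn nnE; apply: le_trans (UP V); apply: le_of_eq.
have -> : A - rr U = -1 *: rr U + A by rewrite scaleN1r addrC.
by rewrite ev_lin /bb; ring.
Qed.

Lemma gam_sum_le A c U : kb A c -> `|ev A U| <= c * kappa * \sum_(a <- U) gn a.1 * gn a.2.
Proof.
move=> kA; elim: U => [|a U IH]; first by rewrite ev_nil normr0 big_nil mulr0.
rewrite ev_cons big_cons mulrDr; apply: le_trans (ler_normD _ _) _; apply: lerD => //.
by rewrite normrM sg_norm mul1r; exact: kb_gam.
Qed.

Lemma le_small (x K : R) : 0 <= K -> (forall e, 0 < e -> x <= e * K) -> x <= 0.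
Proof.
move=> K0 h; rewrite leNgt; apply/negP => x0.
have K1 : 0 < K + 1 by rewrite ltr_wpDl.
have := h (x / (2 * (K + 1))); rewrite divr_gt0 ?mulr_gt0// => /(_ isT).
rewrite leNgt => /negP; apply; rewrite -mulrA gtr_pMr// mulrC ltr_pdivrMr ?mulr_gt0// mul1r.
by lra.
Qed.

Lemma eq_small (x K : R) : 0 <= K -> (forall e, 0 < e -> `|x| <= e * K) -> x = 0.
Proof. by move=> K0 h; apply/eqP; rewrite -normr_le0; exact: le_small h. Qed.

(** The derivation of the exterior square induced by [A]:
    [u wedge v |-> A u wedge v + u wedge A v]. *)
Definition act A U : seq (H * H) := [seq (A a.1, a.2) | a <- U] ++ [seq (a.1, A a.2) | a <- U].

Definition comm A B : H -> H := fun x => A (B x) - B (A x).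

Lemma ev_act A B c U : kb A c -> ev B (act A U) = ev (comm B A) U.
Proof.
move=> kA; rewrite /act ev_cat; elim: U => [|a U IH]; first by rewrite !ev_nil addr0.
rewrite /= !ev_cons -IH /=.
have -> : gam (comm B A a.1) a.2 = gam (B (A a.1)) a.2 + gam (B a.1) (A a.2).
  have -> : gam (B a.1) (A a.2) = - gam (A (B a.1)) a.2 by rewrite (kb_skew _ _ kA) opprK.
  by rewrite -(psdNl fg) -(psdDl fg).
ring.
Qed.

Lemma rr1 x y w : rr [:: (x, y)] w = Rm x y w.
Proof. by rewrite /rr big_cons big_nil addr0. Qed.

Lemma Rm_le x y z t : `|gam (Rm x y z) t| <= kappa ^+ 2 * (gn x * gn y * (gn z * gn t)).
Proof.
have h : bb [:: (x, y)] [:: (z, t)] = sg * gam (Rm x y z) t.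
  by rewrite /bb ev_cons ev_nil addr0 rr1.
have := bb_le [:: (x, y)] [:: (z, t)]; rewrite h normrM sg_norm mul1r => /le_trans; apply.
have [k0 kP] := kappaP; rewrite expr2.
have -> : kappa * kappa * (gn x * gn y * (gn z * gn t)) = (kappa * (gn x * gn y)) * (kappa * (gn z * gn t)) by ring.
by apply: ler_pM; rewrite ?nn_ge0.
Qed.

Let der A w z v t : R := gam (A (Rm w z v)) t - gam (Rm w z (A v)) t - gam (Rm (A w) z v) t - gam (Rm w (A z) v) t.

Let der_rr U w z v t : der (rr U) w z v t = 0.
Proof.
rewrite /der; elim: U => [|a U IH].
  have z0 x : rr [::] x = 0 by rewrite /rr big_nil.
  rewrite !z0 Rm0l (Rm_anti w 0) Rm0l oppr0.
  have -> : Rm w z 0 = 0 by have := Rm_lin3 w z (-1) 0 0; rewrite scaler0 add0r scaleN1r addNr.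
  by rewrite !(psd0l fg) !subr0.
have rc x : rr (a :: U) x = Rm a.1 a.2 x + rr U x by rewrite /rr big_cons.
rewrite !rc RmDl RmDm; have := Rm_lin3 w z 1 (Rm a.1 a.2 v) (rr U v); rewrite !scale1r => ->.
have := cv_deriv a.1 a.2 w z v; rewrite -!/(Rm _ _ _) => /(congr1 (fun x => gam x t)).
rewrite !(psdDl fg) (psdNl fg) => e; move: IH e.
move: (gam _ _) (gam _ _) (gam _ _) (gam _ _) (gam _ _) (gam _ _) (gam _ _) (gam _ _) => *.
lra.
Qed.

Let der_bound A c w z v t : kb A c ->
  `|der A w z v t| <= c * (4 * (kappa ^+ 3 * (gn w * gn z * gn v * gn t))).
Proof.
move=> kA; have [k0 _] := kappaP; have [c0 _] := kA.
have skA x y : gam (A x) y = - gam x (A y) by exact: kb_skew kA.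
have g0 x := gn_ge0 x; have gA x := kb_bound x kA.
have t1 : `|gam (A (Rm w z v)) t| <= c * kappa ^+ 3 * (gn w * gn z * gn v * gn t).
  rewrite skA normrN; apply: le_trans (Rm_le _ _ _ _) _.
  have -> : c * kappa ^+ 3 * (gn w * gn z * gn v * gn t) =
    kappa ^+ 2 * (gn w * gn z * (gn v * (c * kappa * gn t))) by ring.
  by rewrite ler_wpM2l ?exprn_ge0// ler_wpM2l ?mulr_ge0// ler_wpM2l.
have t2 : `|gam (Rm w z (A v)) t| <= c * kappa ^+ 3 * (gn w * gn z * gn v * gn t).
  apply: le_trans (Rm_le _ _ _ _) _.
  have -> : c * kappa ^+ 3 * (gn w * gn z * gn v * gn t) =
    kappa ^+ 2 * (gn w * gn z * ((c * kappa * gn v) * gn t)) by ring.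
  by rewrite ler_wpM2l ?exprn_ge0// ler_wpM2l ?mulr_ge0// ler_wpM2r.
have t3 : `|gam (Rm (A w) z v) t| <= c * kappa ^+ 3 * (gn w * gn z * gn v * gn t).
  apply: le_trans (Rm_le _ _ _ _) _.
  have -> : c * kappa ^+ 3 * (gn w * gn z * gn v * gn t) =
    kappa ^+ 2 * ((c * kappa * gn w) * gn z * (gn v * gn t)) by ring.
  by rewrite ler_wpM2l ?exprn_ge0// ler_wpM2r ?mulr_ge0// ler_wpM2r.
have t4 : `|gam (Rm w (A z) v) t| <= c * kappa ^+ 3 * (gn w * gn z * gn v * gn t).
  apply: le_trans (Rm_le _ _ _ _) _.
  have -> : c * kappa ^+ 3 * (gn w * gn z * gn v * gn t) =
    kappa ^+ 2 * (gn w * (c * kappa * gn z) * (gn v * gn t)) by ring.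
  by rewrite ler_wpM2l ?exprn_ge0// ler_wpM2r ?mulr_ge0// ler_wpM2l.
rewrite /der; move: t1 t2 t3 t4.
move: (gam _ _) (gam _ _) (gam _ _) (gam _ _) => a1 a2 a3 a4 t1 t2 t3 t4.
have -> : c * (4 * (kappa ^+ 3 * (gn w * gn z * gn v * gn t))) = 4 * (c * kappa ^+ 3 * (gn w * gn z * gn v * gn t)) by ring.
move: t1 t2 t3 t4; move: (c * kappa ^+ 3 * _) => m; rewrite !ler_norml => /andP[? ?] /andP[? ?] /andP[? ?] /andP[? ?].
by apply/andP; split; lra.
Qed.

(** The defect [der] vanishes on every [rr U], as curvature operators are derivations of [R], and it
    is at most a constant times the curvature norm of its operator. Approximating [A] within [e] by
    some [rr U] makes the defect of [A] as small as desired. *)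
Lemma kb_deriv A c w z v : kb A c ->
  A (Rm w z v) - Rm w z (A v) = Rm (A w) z v + Rm w (A z) v.
Proof.
move=> kA; apply: gam_ext => t; apply/eqP; rewrite -subr_eq0; apply/eqP.
rewrite !(psdDl fg) (psdNl fg) opprD addrA -/(der A w z v t).
have [k0 _] := kappaP.
apply: (@eq_small _ (4 * (kappa ^+ 3 * (gn w * gn z * gn v * gn t)))) => [|e e0].
  by rewrite !mulr_ge0 ?exprn_ge0 ?gn_ge0.
have [U kU] := kb_approx kA e0.
have -> : der A w z v t = der (A - rr U) w z v t; last exact: der_bound.
have RB x y : gam ((A - rr U) x) y = gam (A x) y - gam (rr U x) y by rewrite -(psdNl fg) -(psdDl fg).
have R1 : gam (Rm w z ((A - rr U) v)) t = gam (Rm w z (A v)) t - gam (Rm w z (rr U v)) t.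
  have := Rm_lin3 w z (-1) (rr U v) (A v); rewrite !scaleN1r => h.
  by rewrite -(psdNl fg) -(psdDl fg) [Rm w z (A v) + _]addrC -h addrC.
have R2 : gam (Rm ((A - rr U) w) z v) t = gam (Rm (A w) z v) t - gam (Rm (rr U w) z v) t.
  have := Rm_lin1 (-1) (rr U w) (A w) z v; rewrite !scaleN1r => h.
  by rewrite -(psdNl fg) -(psdDl fg) [Rm (A w) z v + _]addrC -h addrC.
have R3 : gam (Rm w ((A - rr U) z) v) t = gam (Rm w (A z) v) t - gam (Rm w (rr U z) v) t.
  have h : Rm w (A z - rr U z) v = Rm w (A z) v - Rm w (rr U z) v.
    by rewrite RmDm -scaleN1r RmZm scaleN1r.
  by rewrite -(psdNl fg) -(psdDl fg) -h.
have := der_rr U w z v t; rewrite /der RB R1 R2 R3.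
by move: (gam _ _) (gam _ _) (gam _ _) (gam _ _) (gam _ _) (gam _ _) (gam _ _) (gam _ _) => *; lra.
Qed.

Lemma rr_act A c U w : kb A c -> rr (act A U) w = A (rr U w) - rr U (A w).
Proof.
move=> kA; have lA := kb_linear kA.
have AD x y : A (x + y) = A x + A y by have := lA 1 x y; rewrite !scale1r.
have A0 : A 0 = 0 by have := AD 0 0; rewrite addr0 -{1}[A 0]addr0 => /addrI.
rewrite /act /rr big_cat /= !big_map; elim: U => [|a U IH].
  by rewrite !big_nil A0 subr0 addr0.
rewrite !big_cons AD opprD /= .
have := kb_deriv a.1 a.2 w kA => e.
have -> : A (Rm a.1 a.2 w) = Rm (A a.1) a.2 w + Rm a.1 (A a.2) w + Rm a.1 a.2 (A w) by rewrite -e subrK.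
move: IH; move: (A (\sum_(j <- U) Rm j.1 j.2 w)) (\sum_(j <- U) Rm j.1 j.2 (A w)) => s1 s2 IH.
have -> : s1 = \sum_(j <- U) Rm (A j.1) j.2 w + \sum_(j <- U) Rm j.1 (A j.2) w + s2 by rewrite IH subrK.
move: (\sum_(j <- U) _) (\sum_(j <- U) _) (Rm _ _ _) (Rm _ _ _) (Rm _ _ _) => *; vring R.
Qed.

Lemma bb_act A c U V : kb A c -> bb (act A U) V = - bb U (act A V).
Proof.
move=> kA; rewrite /bb (ev_act _ _ kA).
have -> : rr (act A U) = -1 *: comm (rr U) A + 0.
  by apply/funext => w; rewrite (rr_act _ _ kA) scaleN1r addr0 opprB.
rewrite ev_lin mulN1r; have [_ h0] := kb0; have := h0 V; rewrite mul0r normr_le0 => /eqP ->.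
by rewrite addr0.
Qed.

(** The ratios [m (n+1) / m n] do not decrease, so a first ratio [rho (1 + d)] with [d > 0] would
    force growth faster than [rho^n]. Bernoulli's lower bound [1 + n d] is enough to outgrow the
    constant [C]. *)
Lemma log_convex (m : nat -> R) (C rho : R) : 0 <= rho -> (forall n, 0 <= m n) ->
  (forall n, m n.+1 ^+ 2 <= m n * m n.+2) -> (forall n, m n <= C * rho ^+ n) -> m 1%N <= rho * m 0%N.
Proof.
move=> rho0 m0 lc gr; have [z0|z0] := eqVneq (m 0%N) 0.
  have := lc 0%N; rewrite z0 mul0r mulr0 => h.
  have : m 1%N ^+ 2 == 0 by rewrite eq_le h sqr_ge0.
  by rewrite sqrf_eq0 => /eqP ->.
have p0 : 0 < m 0%N by rewrite lt_neqAle eq_sym z0 m0.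
rewrite leNgt; apply/negP => lt; have m1 : 0 < m 1%N by apply: le_lt_trans lt; rewrite mulr_ge0.
have ratio n : 0 < m n /\ m 1%N * m n <= m 0%N * m n.+1.
  elim: n => [|n [pn IH]]; first by split=> //; rewrite mulrC.
  have pn1 : 0 < m n.+1.
    by rewrite -(pmulr_rgt0 _ p0); apply: lt_le_trans IH; rewrite mulr_gt0.
  split=> //; rewrite -(ler_pM2r pn).
  have h1 : m 1%N * m n.+1 * m n <= m 0%N * m n.+1 ^+ 2.
    have := ler_wpM2r (ltW pn1) IH; rewrite expr2 mulrA; apply: le_trans.
    by apply: le_of_eq; ring.
  apply: le_trans h1 (le_trans (ler_wpM2l (ltW p0) (lc n)) _); apply: le_of_eq; ring.
have r0 : 0 < rho.
  rewrite lt_neqAle rho0 andbT eq_sym; apply/eqP => z.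
  by have := gr 1%N; rewrite z expr1 mulr0 leNgt m1.
pose d := m 1%N / (rho * m 0%N) - 1.
have rm : 0 < rho * m 0%N by rewrite mulr_gt0.
have d0 : 0 < d by rewrite subr_gt0 ltr_pdivlMr// mul1r.
have e1 : m 1%N = rho * (1 + d) * m 0%N by rewrite /d; field; rewrite !gt_eqF.
have low n : m 0%N * (1 + n%:R * d) * rho ^+ n <= m n.
  elim: n => [|n IH]; first by rewrite mul0r addr0 mulr1 expr0 mulr1.
  have [pn h] := ratio n; rewrite -(ler_pM2l p0); apply: le_trans h; rewrite e1.
  apply: le_trans (_ : rho * (1 + d) * m 0%N * (m 0%N * (1 + n%:R * d) * rho ^+ n) <= _); last first.
    by apply: ler_wpM2l => //; rewrite mulr_ge0 ?(ltW p0)// mulr_ge0 ?rho0// addr_ge0 ?(ltW d0).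
  rewrite -subr_ge0 exprS -natr1.
  have -> : rho * (1 + d) * m 0%N * (m 0%N * (1 + n%:R * d) * rho ^+ n) -
    m 0%N * (m 0%N * (1 + (n%:R + 1) * d) * (rho * rho ^+ n)) =
    rho * rho ^+ n * m 0%N ^+ 2 * (n%:R * d ^+ 2) by ring.
  by rewrite !mulr_ge0 ?exprn_ge0 ?rho0 ?(ltW d0) ?(ltW p0).
have up n : n%:R * (m 0%N * d) <= C.
  have rn : 0 < rho ^+ n by rewrite exprn_gt0.
  have := le_trans (low n) (gr n); rewrite ler_pM2r//; apply: le_trans.
  have -> : m 0%N * (1 + n%:R * d) = m 0%N + n%:R * (m 0%N * d) by ring.
  by rewrite lerDr ltW.
have md : 0 < m 0%N * d by rewrite mulr_gt0.
have C0 : 0 <= C by have := up 0%N; rewrite mul0r.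
have := up (Num.bound (C / (m 0%N * d))); rewrite leNgt => /negP; apply.
by rewrite -ltr_pdivrMr//; apply: archi_boundP; rewrite divr_ge0// ltW.
Qed.

Definition mass U : R := \sum_(a <- U) gn a.1 * gn a.2.

Lemma mass_act A c U : kb A c -> mass (act A U) <= 2 * (c * kappa) * mass U.
Proof.
move=> kA; rewrite /mass /act big_cat /= !big_map -big_split /= mulr_sumr; apply: ler_sum => a _.
have h1 := kb_bound a.1 kA; have h2 := kb_bound a.2 kA; have g1 := gn_ge0 a.1; have g2 := gn_ge0 a.2.
have -> : 2 * (c * kappa) * (gn a.1 * gn a.2) = c * kappa * gn a.1 * gn a.2 + gn a.1 * (c * kappa * gn a.2) by ring.
by apply: lerD; [exact: ler_wpM2r|exact: ler_wpM2l].
Qed.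

(** [act A] is visibly bounded only for [mass], which may be far larger than the curvature norm. It
    is however skew for [bb], so the squared norms [m n] of its iterates are log-convex by the
    Cauchy-Schwarz inequality. The mass estimate gives [m n <= C a^(2n)] with a constant depending
    on [U], and log-convexity eliminates this constant: [m 1 <= a^2 m 0]. *)
Lemma nn_act A c U : kb A c -> nn (act A U) <= 2 * (c * kappa) * nn U.
Proof.
move=> kA; have [k0 _] := kappaP; have [c0 _] := kA; pose a := 2 * (c * kappa).
have a0 : 0 <= a by rewrite !mulr_ge0.
pose T n := iter n (act A) U; pose m n := bb (T n) (T n).
have flip n k : bb (T n) (T k.+1) = - bb (T n.+1) (T k) by rewrite /= (bb_act _ _ kA) opprK.
have mE n : m n = bb (T 0%N) (T (n + n)%N) \/ m n = - bb (T 0%N) (T (n + n)%N).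
  have e k : forall i, bb (T k) (T i) = (-1) ^+ k * bb (T 0%N) (T (i + k)%N).
    elim: k => [|k IH] i; first by rewrite expr0 mul1r addn0.
    have -> : bb (T k.+1) (T i) = - bb (T k) (T i.+1) by rewrite flip opprK.
    by rewrite IH exprS addnS addSn mulN1r mulNr.
  rewrite /m e -signr_odd; case: (odd n); [right; rewrite expr1 mulN1r|left; rewrite expr0 mul1r]; by [].
have massT n : mass (T n) <= a ^+ n * mass U.
  elim: n => [|n IH]; first by rewrite expr0 mul1r.
  by apply: le_trans (mass_act _ kA) _; rewrite -/a exprS -(mulrA a) ler_wpM2l.
have key : m 1%N <= a ^+ 2 * m 0%N.
  apply: (@log_convex m (nn U * kappa * mass U)) => [|n|n|n]; first by rewrite exprn_ge0.
  - exact: bb_ge0.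
  - have -> : m n.+1 = - bb (T n) (T n.+2) by rewrite flip opprK.
    rewrite sqrrN; exact: (comb_cauchy bbC bb_ge0 bb_comb).
  (* By skewness [m n] is, up to sign, the pairing of [U] itself with the iterate of order [2n];
     pairing with [U] is bounded for the mass, and the mass of the iterate grows at rate [a]. *)
  - apply: le_trans (_ : `|bb (T 0%N) (T (n + n)%N)| <= _).
      by case: (mE n) => ->; [exact: ler_norm|rewrite -normrN; exact: ler_norm].
    apply: le_trans (gam_sum_le _ (kb_rr U)) _; rewrite -/(mass _) -!mulrA ler_wpM2l ?nn_ge0// ler_wpM2l//.
    by apply: le_trans (massT _) _; rewrite mulrC -exprM mul2n addnn.
rewrite -(@ler_pXn2r _ 2) ?nnegrE ?mulr_ge0 ?nn_ge0// nnE [X in _ <= X]exprMn nnE; exact: key.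
Qed.

(** Evaluating a commutator on [U] is evaluating [B] on [act A U] up to sign, so the bound is dual
    to [nn_act]. *)
Lemma kb_comm A B c d : kb A c -> kb B d -> kb (comm A B) (2 * (c * kappa) * d).
Proof.
move=> kA kB; have [k0 _] := kappaP; have [c0 _] := kA; have [d0 hB] := kB.
split=> [|U]; first by rewrite !mulr_ge0.
have -> : ev (comm A B) U = - ev B (act A U).
  rewrite (ev_act _ _ kA); have -> : comm A B = -1 *: comm B A + 0.
    by apply/funext => x; rewrite scaleN1r addr0 -[LHS]opprB.
  have [_ h0] := kb0; have := h0 U; rewrite mul0r normr_le0 => /eqP h.
  by rewrite ev_lin h mulN1r addr0.
rewrite normrN; apply: le_trans (hB _) _; apply: le_trans (ler_wpM2l d0 (nn_act U kA)) _.
by apply: le_of_eq; ring.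
Qed.

Definition Kset A : Prop := exists c, kb A c.

(* The value of the inner product is pinned down by approximating the first factor. *)
Definition kip A B : R := xget 0 [set t : R | forall U c d, kb (A - rr U) c -> kb B d ->
  `|ev B U - t| <= d * c].

Lemma kb_diff A U V c d : kb (A - rr U) c -> kb (A - rr V) d -> nn (U ++ smul (-1) V) <= c + d.
Proof.
move=> h1 h2; apply: kb_rr_nn; have := kb_sub h2 h1; rewrite [d + c]addrC.
congr kb; apply/funext => w; rewrite rr_comb scaleN1r.
have alg (a u v : H) : a - v - (a - u) = u - v by vring R.
exact: alg.
Qed.

(** Lists approximating [A] within [c] and [e] differ by a list of curvature norm at most [c + e].
    The evaluations of [B] on better and better approximations therefore converge to a value
    independent of the approximations. *)
Lemma kipP A B U c d : Kset A -> Kset B -> kb (A - rr U) c -> kb B d -> `|ev B U - kip A B| <= d * c.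
Proof.
move=> [cA kA] [d0 kB] kU kBd; move: U c d kU kBd.
suff [t tP] : exists t : R, forall U c d, kb (A - rr U) c -> kb B d -> `|ev B U - t| <= d * c.
  by rewrite /kip; case: xgetP => [t' _ //|/(_ t)/(_ tP)].
have hn n : 0 < (2^-1 : R) ^+ n by rewrite exprn_gt0 ?invr_gt0.
have [u uP] := choice (fun n => kb_approx kA (hn n)).
have close U V c e d : kb (A - rr U) c -> kb (A - rr V) e -> kb B d -> `|ev B U - ev B V| <= d * (c + e).
  move=> kU kV kBd; have -> : ev B U - ev B V = ev B (U ++ smul (-1) V).
    by rewrite ev_cat (ev_smul _ _ kBd) mulN1r.
  by have [d0' h] := kBd; apply: le_trans (h _) _; rewrite ler_wpM2l//; exact: kb_diff kU kV.
have hs n : `|(ev B (u n.+1) : R^o) - ev B (u n)| <= d0 * 2 * 2^-1 ^+ n.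
  apply: le_trans (close _ _ _ _ _ (uP n.+1) (uP n) kB) _; rewrite -mulrA; apply: ler_wpM2l; first exact: kB.1.
  by have := hn n; rewrite exprS; lra.
have [l lP] := @complete_geo _ R^o (fun n => ev B (u n)) _ hs.
exists l => U c d kU kBd; apply: (@le_geo _ _ _ (d + 2 * (d0 * 2))) => n.
have -> : ev B U - l = (ev B U - ev B (u n)) + (ev B (u n) - l) by ring.
apply: le_trans (ler_normD _ _) _; have h1 := close _ _ _ _ _ kU (uP n) kBd; have h2 := lP n.
apply: le_trans (lerD h1 h2) _; apply: le_of_eq; ring.
Qed.

Lemma Kset_rr U : Kset (rr U). Proof. by exists (nn U); exact: kb_rr. Qed.

Lemma kip_rr U B : Kset B -> kip (rr U) B = ev B U.
Proof.
move=> KB; have [d kB] := KB; have k0 : kb (rr U - rr U) 0 by rewrite subrr; exact: kb0.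
have := kipP (Kset_rr U) KB k0 kB; rewrite mulr0 normr_le0 subr_eq0 => /eqP ->.
by [].
Qed.

Lemma Kset_lin t A B : Kset A -> Kset B -> Kset (t *: A + B).
Proof. by move=> [c kA] [d kB]; exists (`|t| * c + d); exact: kb_lin. Qed.

(** With [e <= 1] an error such as [e (a + e)] is dominated by [e (a + 1)], which is linear in
    [e]. *)
Lemma le_small1 (x K : R) : 0 <= K -> (forall e, 0 < e <= 1 -> x <= e * K) -> x <= 0.
Proof.
move=> K0 h; apply: (le_small K0) => e e0; have [e1|e1] := leP e 1; first by apply: h; rewrite e0.
by apply: le_trans (h 1 _) _; rewrite ?ltr01 ?lexx// ler_wpM2r// ltW.
Qed.

Lemma eq_small1 (x K : R) : 0 <= K -> (forall e, 0 < e <= 1 -> `|x| <= e * K) -> x = 0.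
Proof. by move=> K0 h; apply/eqP; rewrite -normr_le0; exact: le_small1 h. Qed.

Lemma kip_linr t A B B' : Kset A -> Kset B -> Kset B' ->
  kip A (t *: B + B') = t * kip A B + kip A B'.
Proof.
move=> KA KB KB'; have [a kA] := KA; have [b kB] := KB; have [b' kB'] := KB'.
apply/eqP; rewrite -subr_eq0; apply/eqP.
apply: (@eq_small1 _ ((`|t| * b + b') + `|t| * b + b')) => [|e /andP[e0 e1]].
  by rewrite !addr_ge0 ?mulr_ge0//; [exact: kB.1|exact: kB'.1|exact: kB.1|exact: kB'.1].
have [U kU] := kb_approx kA e0.
have h1 := kipP KA (Kset_lin t KB KB') kU (kb_lin t kB kB').
have h2 := kipP KA KB kU kB; have h3 := kipP KA KB' kU kB'.
rewrite ev_lin in h1.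
have -> : kip A (t *: B + B') - (t * kip A B + kip A B') = t * (ev B U - kip A B) + (ev B' U - kip A B')
   - (t * ev B U + ev B' U - kip A (t *: B + B')) by ring.
apply: le_trans (ler_normB _ _) _; apply: le_trans (lerD (ler_normD _ _) (lexx _)) _; rewrite normrM.
apply: le_trans (lerD (lerD (ler_wpM2l (normr_ge0 t) h2) h3) h1) _; apply: le_of_eq; ring.
Qed.

Lemma nn_approx A a U e : kb A a -> kb (A - rr U) e -> nn U <= a + e.
Proof.
move=> kA kU; apply: kb_rr_nn; have := kb_sub kA kU; congr kb.
by apply/funext => w; have alg (x y : H) : x - (x - y) = y by [vring R]; exact: alg.
Qed.

Lemma ev_approx B V U e : kb (B - rr V) e -> `|ev B U - bb V U| <= e * nn U.
Proof.
move=> [_ h]; have := h U; have -> : B - rr V = -1 *: rr V + B by rewrite scaleN1r addrC.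
by rewrite ev_lin mulN1r addrC.
Qed.

Lemma kipC A B : Kset A -> Kset B -> kip A B = kip B A.
Proof.
move=> KA KB; have [a kA] := KA; have [b kB] := KB.
have a0 := kA.1; have b0 := kB.1.
apply/eqP; rewrite -subr_eq0; apply/eqP.
apply: (@eq_small1 _ (b + a + (a + 1) + (b + 1))) => [|e /andP[e0 e1]]; first by rewrite !addr_ge0.
have [U kU] := kb_approx kA e0; have [V kV] := kb_approx kB e0.
have h1 := kipP KA KB kU kB; have h2 := kipP KB KA kV kA.
have h3 := ev_approx U kV; have h4 := ev_approx V kU; rewrite bbC in h4.
have n1 := nn_approx kA kU; have n2 := nn_approx kB kV.
have h3' : `|ev B U - bb V U| <= e * (a + 1).
  by apply: le_trans h3 _; apply: ler_wpM2l; [exact: ltW|lra].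
have h4' : `|ev A V - bb V U| <= e * (b + 1).
  by apply: le_trans h4 _; apply: ler_wpM2l; [exact: ltW|lra].
move: h1 h2 h3' h4'; move: (kip A B) (kip B A) (ev B U) (ev A V) (bb V U) => x1 x2 x3 x4 x5.
rewrite !ler_norml => /andP[? ?] /andP[? ?] /andP[? ?] /andP[? ?].
by apply/andP; split; rewrite !mulrDr mulr1 [e * b]mulrC [e * a]mulrC; lra.
Qed.

Lemma kip_ge0 A : Kset A -> 0 <= kip A A.
Proof.
move=> KA; have [a kA] := KA; have a0 := kA.1; rewrite -oppr_le0.
apply: (@le_small1 _ (a + (a + 1))) => [|e /andP[e0 e1]]; first by rewrite !addr_ge0.
have [U kU] := kb_approx kA e0; have h1 := kipP KA KA kU kA.
have h2 := ev_approx U kU; have n1 := nn_approx kA kU; have b0 := bb_ge0 U.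
have h2' : `|ev A U - bb U U| <= e * (a + 1).
  by apply: le_trans h2 _; apply: ler_wpM2l; [exact: ltW|lra].
move: h1 h2' b0; move: (kip A A) (ev A U) (bb U U) => x1 x2 x3.
rewrite !mulrDr mulr1 [e * a]mulrC !ler_norml => /andP[? ?] /andP[? ?] ?; lra.
Qed.

Lemma kip_le A c : kb A c -> kip A A <= c ^+ 2.
Proof.
move=> kA; have KA : Kset A by exists c.
have c0 := kA.1; rewrite -subr_le0; apply: (@le_small1 _ (2 * c)) => [|e /andP[e0 e1]]; first by rewrite mulr_ge0.
have [U kU] := kb_approx kA e0; have h1 := kipP KA KA kU kA.
have n1 := nn_approx kA kU; have [_ h] := kA; have h2 := h U.
have h3 : `|ev A U| <= c * (c + e) by apply: le_trans h2 _; exact: ler_wpM2l.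
move: h1 h3; move: (kip A A) (ev A U) => x1 x2.
rewrite !ler_norml expr2 mulrDr => /andP[? ?] /andP[? ?]; lra.
Qed.

Lemma ev1 A u v : ev A [:: (u, v)] = sg * gam (A u) v.
Proof. by rewrite ev_cons ev_nil addr0. Qed.
End CurvatureAlgebra.

(** * The Hilbert Lie algebra of operators and vectors *)

Section Completion.
Variables (R : realType).

Definition Kpred (D : curv_data R) : {pred (cv_space D -> cv_space D)} := fun A => `[< Kset A >].

Arguments Kpred D : clear implicits.

Lemma KpredP (D : curv_data R) (A : D -> D) : reflect (Kset A) (A \in Kpred D).
Proof. exact: asboolP. Qed.

Lemma Kpred_submod (D : curv_data R) : submod_closed (Kpred D).
Proof.
split=> [|t A B /KpredP KA /KpredP KB]; apply/KpredP; last exact: Kset_lin.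
by exists 0; exact: kb0.
Qed.
HB.instance Definition _ (D : curv_data R) :=
  GRing.isSubmodClosed.Build R (D -> D) (Kpred D) (Kpred_submod D).
End Completion.
Arguments Kpred {R} D.

Record Khat (R : realType) (D : curv_data R) := KHat { kval :> D -> D; kvalP : kval \in Kpred D }.
HB.instance Definition _ (R : realType) (D : curv_data R) := [isSub for @kval R D].
HB.instance Definition _ (R : realType) (D : curv_data R) := [Choice of Khat D by <:].
HB.instance Definition _ (R : realType) (D : curv_data R) := [SubChoice_isSubLmodule of Khat D by <:].

Section KhatForm.
Variables (R : realType) (D : curv_data R).
Let H : hilbertSpace R := D.
Let gam : H -> H -> R := @cv_form R D.
Let fg : psd_form gam := @cv_psd R D.

Lemma kvalL a (A B : Khat D) : kval (a *: A + B) = a *: kval A + kval B. Proof. by []. Qed.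
Lemma KsetV (A : Khat D) : Kset (kval A). Proof. by apply/KpredP; exact: kvalP. Qed.
Definition kmk (A : H -> H) (KA : Kset A) : Khat D := KHat (introT (KpredP A) KA).
Lemma kval_inj (A B : Khat D) : kval A = kval B -> A = B. Proof. exact: val_inj. Qed.

Definition kform (A B : Khat D) : R := kip (kval A) (kval B).

Lemma kform_psd : psd_form kform.
Proof.
split=> [a A B C|A B|A]; last exact: kip_ge0 (KsetV A).
  rewrite /kform kvalL (kipC (Kset_lin a (KsetV A) (KsetV B)) (KsetV C)).
  by rewrite (kip_linr a (KsetV C) (KsetV A) (KsetV B)) !(kipC (KsetV C)) //; exact: KsetV.
exact: kipC (KsetV A) (KsetV B).
Qed.

(** Evaluation on [U] is the inner product with [rr U], whose norm is [nn U], so this is the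
    Cauchy-Schwarz inequality. With [kip_le] it identifies the norm of [A] as the least constant [c]
    with [kb A c]. *)
Lemma kform_kb A c : 0 <= c -> kform A A <= c ^+ 2 -> kb (kval A) c.
Proof.
move=> c0 h; split=> // U; have e : ev (kval A) U = kform (kmk (Kset_rr U)) A by rewrite /kform kip_rr//; exact: KsetV.
rewrite -(@ler_pXn2r _ 2) ?nnegrE ?mulr_ge0 ?nn_ge0// -normrX ger0_norm ?sqr_ge0// e.
apply: le_trans (psd_cauchy kform_psd _ _) _; have -> : kform (kmk (Kset_rr U)) (kmk (Kset_rr U)) = nn U ^+ 2.
  by rewrite nnE /kform kip_rr//; exact: Kset_rr.
by rewrite mulrC [X in _ <= X]exprMn ler_wpM2r ?exprn_ge0 ?nn_ge0.
Qed.

Lemma ev_ext (A : H -> H) : (forall U, ev A U = 0) -> A = 0.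
Proof.
move=> h; apply/funext => u; apply: gam_eq0 => v; have := h [:: (u, v)].
by rewrite ev1 => /eqP; rewrite mulf_eq0 (negbTE (sg_neq0 D)) /= => /eqP.
Qed.

Lemma kform_definite A : kform A A = 0 -> A = 0.
Proof.
move=> h; apply: kval_inj; apply: ev_ext => U.
have [_ k] : kb (kval A) 0 by apply: kform_kb => //; rewrite h expr0n.
by apply/eqP; rewrite -normr_le0 -(mul0r (nn U)).
Qed.

Lemma kip_bound (A B : Khat D) a b : kb (kval A) a -> kb (kval B) b -> `|kform A B| <= a * b.
Proof.
move=> kA kB; have a0 := kA.1; have b0 := kB.1.
rewrite -(@ler_pXn2r _ 2) ?nnegrE ?mulr_ge0// -normrX ger0_norm ?sqr_ge0//.
apply: le_trans (psd_cauchy kform_psd _ _) _; rewrite [X in _ <= X]exprMn.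
by apply: ler_pM; [exact: kip_ge0 (KsetV A)|exact: kip_ge0 (KsetV B)|exact: kip_le|exact: kip_le].
Qed.

Lemma norm_gn : exists2 k : R, 0 < k & forall v : H, `|v| <= k * gn v /\ gn v <= k * `|v|.
Proof.
have [c [C [c0 cC]]] := cv_coercive D.
have cs : 0 < Num.sqrt c by rewrite sqrtr_gt0.
exists ((Num.sqrt c)^-1 + Num.sqrt `|C|); first by rewrite ltr_wpDr ?invr_gt0 ?sqrtr_ge0.
move=> v; have /andP[h1 h2] := cC v; have g0 := gn_ge0 v; have n0 := normr_ge0 v; split.
  apply: le_trans (_ : (Num.sqrt c)^-1 * gn v <= _); last by rewrite ler_wpM2r// lerDl sqrtr_ge0.
  rewrite ler_pdivlMl// -(@ler_pXn2r _ 2) ?nnegrE ?mulr_ge0 ?sqrtr_ge0//.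
  by rewrite exprMn sqr_sqrtr ?(ltW c0)// gnE.
apply: le_trans (_ : Num.sqrt `|C| * `|v| <= _); last by rewrite ler_wpM2r// lerDr invr_ge0 sqrtr_ge0.
rewrite -(@ler_pXn2r _ 2) ?nnegrE ?mulr_ge0 ?sqrtr_ge0// gnE [X in _ <= X]exprMn sqr_sqrtr//.
by apply: le_trans h2 _; rewrite ler_wpM2r ?exprn_ge0// ler_norm.
Qed.

(** The curvature norm controls the operator norm, so a pointwise limit exists. For a fixed list the
    evaluations converge, and the bound by [nn U] passes to the limit list by list, with a constant
    free of [U]. *)
Lemma khat_complete (A : nat -> Khat D) : (forall n, kb (kval (A n.+1) - kval (A n)) (2^-1 ^+ n)) ->
  exists l : Khat D, forall n, kb (kval (A n) - kval l) (2 * 2^-1 ^+ n).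
Proof.
move=> hA; have [k k0 kP] := norm_gn; have [kp0 _] := kappaP D.
have hn n : 0 < (2^-1 : R) ^+ n by rewrite exprn_gt0 ?invr_gt0.
have ex v : exists l : H, forall n, `|kval (A n) v - l| <= 2 * (k * (kappa D * gn v)) * 2^-1 ^+ n.
  apply: (@complete_geo _ H (fun n => kval (A n) v)) => n.
  apply: le_trans (kP _).1 _; rewrite -mulrA ler_wpM2l ?(ltW k0)//.
  apply: le_trans (kb_bound v (hA n)) _; apply: le_of_eq; ring.
have [l lP] := choice ex.
have evB (B C : H -> H) U : ev (B - C) U = ev B U - ev C U.
  have -> : B - C = -1 *: C + B by rewrite scaleN1r addrC.
  by rewrite ev_lin mulN1r addrC.
have lim U : exists2 K, 0 <= K & forall n, `|ev (kval (A n)) U - ev l U| <= K * 2^-1 ^+ n.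
  elim: U => [|a U [K K0 IH]]; first by exists 0 => // n; rewrite !ev_nil subrr normr0 mul0r.
  exists (k * (2 * (k * (kappa D * gn a.1))) * gn a.2 + K).
    by rewrite addr_ge0// !mulr_ge0 ?gn_ge0 ?(ltW k0).
  move=> n; rewrite -evB ev_cons evB; apply: le_trans (ler_normD _ _) _; rewrite mulrDl; apply: lerD => //.
  rewrite normrM sg_norm mul1r; apply: le_trans (gam_le _ _) _.
  have -> : k * (2 * (k * (kappa D * gn a.1))) * gn a.2 * 2^-1 ^+ n =
    k * (2 * (k * (kappa D * gn a.1)) * 2^-1 ^+ n) * gn a.2 by ring.
  rewrite ler_wpM2r ?gn_ge0//; apply: le_trans (kP _).2 _; rewrite ler_wpM2l ?(ltW k0)//; exact: lP.
have kl n : kb (kval (A n) - l) (2 * 2^-1 ^+ n).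
  split=> [|U]; first by rewrite mulr_ge0 ?ltW.
  have [K K0 KP] := lim U; rewrite evB; apply: (@le_geo _ _ _ K) => m.
  have hs i : `|(ev (kval (A i.+1)) U : R^o) - ev (kval (A i)) U| <= nn U * 2^-1 ^+ i.
    by have [_ h] := hA i; have := h U; rewrite evB mulrC.
  have h1 := geo_le hs n m; have h2 := KP (n + m)%N.
  have -> : ev (kval (A n)) U - ev l U = (ev (kval (A n)) U - ev (kval (A (n + m)%N)) U) +
    (ev (kval (A (n + m)%N)) U - ev l U) by ring.
  apply: le_trans (ler_normD _ _) _; apply: lerD.
    by apply: le_trans h1 _; apply: le_of_eq; ring.
  apply: le_trans h2 _; rewrite ler_wpM2l// exprD ler_piMl ?(ltW (hn _))//.
  by rewrite exprn_ile1 ?invr_ge0// invf_le1// ler1n.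
have Kl : Kset l.
  have [c kA] := KsetV (A 0%N); have := kb_sub kA (kl 0%N) => h.
  have e : kval (A 0%N) - (kval (A 0%N) - l) = l.
    by apply/funext => x; have alg (y z : H) : y - (y - z) = z by [vring R]; exact: alg.
  by rewrite e in h; exists (c + 2 * 2^-1 ^+ 0).
by exists (kmk Kl).
Qed.

Definition pspace : lmodType R := (Khat D * H)%type.
Definition pform (z w : pspace) : R := kform z.1 w.1 + gam z.2 w.2.

Lemma pform_psd : psd_form pform.
Proof.
have fk := kform_psd; split=> [a x y z|x y|x]; rewrite /pform.
- by rewrite /= !(psdDl fk, psdZl fk, psdDl fg, psdZl fg); ring.
- by rewrite (psdC fk) (psdC fg).
- by rewrite addr_ge0 ?(psd_ge0 fk) ?(psd_ge0 fg).
Qed.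

Lemma pform_definite x : pform x x = 0 -> x = 0.
Proof.
have fk := kform_psd; rewrite /pform => /eqP; rewrite paddr_eq0 ?(psd_ge0 fk) ?(psd_ge0 fg)//.
move=> /andP[/eqP h1 /eqP h2]; apply: injective_projections; first exact: kform_definite.
apply: gam_eq0 => w; apply/eqP; rewrite -sqrf_eq0 eq_le sqr_ge0 andbT.
by apply: le_trans (psd_cauchy fg _ _) _; rewrite h2 mul0r.
Qed.

Lemma pform_complete (u : nat -> pspace) :
  (forall n, pform (u n.+1 - u n) (u n.+1 - u n) <= (2^-1 ^+ n) ^+ 2) ->
  exists l, forall e, 0 < e -> exists N, forall n, (N <= n)%N -> pform (u n - l) (u n - l) <= e ^+ 2.
Proof.
move=> hu; have fk := kform_psd; have [k k0 kP] := norm_gn.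
have hn n : 0 < (2^-1 : R) ^+ n by rewrite exprn_gt0 ?invr_gt0.
have h1 n : kb (kval (u n.+1).1 - kval (u n).1) (2^-1 ^+ n).
  apply: (@kform_kb ((u n.+1 - u n).1)); first exact: ltW.
  by apply: le_trans (hu n); rewrite /pform lerDl; exact: (psd_ge0 fg).
have [l1 l1P] := khat_complete h1.
have [l2 l2P] : exists l : H, forall n, `|(u n).2 - l| <= 2 * k * 2^-1 ^+ n.
  apply: (@complete_geo _ H (fun n => (u n).2)) => n.
  apply: le_trans (kP _).1 _; rewrite ler_wpM2l ?(ltW k0)//.
  rewrite -(@ler_pXn2r _ 2) ?nnegrE ?gn_ge0 ?(ltW (hn n))// gnE.
  by apply: le_trans (hu n); rewrite /pform lerDr; exact: (psd_ge0 fk).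
exists (l1, l2) => e e0.
have [N NP] : exists N : nat, (2 + 2 * k ^+ 2) * 2^-1 ^+ N <= e.
  apply: contrapT => nm; have : e <= 0; last by rewrite leNgt e0.
  apply: (@le_geo _ _ _ (2 + 2 * k ^+ 2)) => n; rewrite add0r leNgt; apply/negP => h.
  by apply: nm; exists n; exact: ltW.
exists N => n Nn; pose a : R := 2^-1 ^+ n.
have aN : a <= 2^-1 ^+ N by rewrite ler_wiXn2l ?invr_ge0// invf_le1// ler1n.
have a0 : 0 <= a := ltW (hn n).
have f1 : kform ((u n).1 - l1) ((u n).1 - l1) <= (2 * a) ^+ 2 by exact: kip_le (l1P n).
have f2 : gam ((u n).2 - l2) ((u n).2 - l2) <= (2 * k ^+ 2 * a) ^+ 2.
  apply: (le_trans (le_of_eq (esym (gnE ((u n).2 - l2))))).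
  rewrite ler_pXn2r ?nnegrE ?gn_ge0 ?mulr_ge0 ?exprn_ge0 ?(ltW k0)//.
  apply: le_trans (kP _).2 _; apply: le_trans (ler_wpM2l (ltW k0) (l2P n)) _.
  by apply: le_of_eq; rewrite /a; ring.
have hk : 0 <= k ^+ 2 by rewrite exprn_ge0 ?ltW.
apply: le_trans (_ : ((2 + 2 * k ^+ 2) * a) ^+ 2 <= _); last first.
  have q0 : 0 <= 2 + 2 * k ^+ 2 by rewrite addr_ge0// mulr_ge0.
  rewrite ler_pXn2r ?nnegrE ?(ltW e0) ?(mulr_ge0 q0 a0)//.
  exact: le_trans (ler_wpM2l q0 aN) NP.
apply: le_trans (lerD f1 f2) _; rewrite -subr_ge0.
have -> : ((2 + 2 * k ^+ 2) * a) ^+ 2 - ((2 * a) ^+ 2 + (2 * k ^+ 2 * a) ^+ 2) = 8 * (k ^+ 2 * a ^+ 2) by ring.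
by rewrite mulr_ge0// mulr_ge0// exprn_ge0.
Qed.

Definition pre_L : pre_hilbert R := PreHilbert pform_psd pform_definite pform_complete.
Definition LH : hilbertSpace R := hilbert_of pre_L.

Lemma Kset_comm (A B : H -> H) : Kset A -> Kset B -> Kset (comm A B).
Proof. by move=> [a kA] [b kB]; exists (2 * (a * kappa D) * b); exact: kb_comm. Qed.

Definition kcomm (A B : Khat D) : Khat D := kmk (Kset_comm (KsetV A) (KsetV B)).
Definition kR (v w : H) : Khat D := kmk (Kset_rr [:: (v, w)]).

Definition Lbr (x y : pspace) : pspace :=
  (kcomm x.1 y.1 - kR x.2 y.2, kval x.1 y.2 - kval y.1 x.2).
(** On [p] the star is [1] for nonpositive curvature (noncompact type) and [-1] for nonnegative
    curvature (compact type); on [k], made of skew operators, it is always [-1]. *)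
Definition Lstar_op (x : pspace) : pspace := (- x.1, cv_sign D *: x.2).

Lemma klin (A : Khat D) a (u v : H) : kval A (a *: u + v) = a *: kval A u + kval A v.
Proof. by have [c kA] := KsetV A; exact: (kb_linear kA). Qed.

Lemma kB (A : Khat D) (u v : H) : kval A (u - v) = kval A u - kval A v.
Proof. by have := klin A (-1) v u; rewrite !scaleN1r addrC => ->; rewrite addrC. Qed.

Lemma Lbr1E x y t : kval (Lbr x y).1 t =
  kval x.1 (kval y.1 t) - kval y.1 (kval x.1 t) - @cv_curv R D x.2 y.2 t.
Proof. by rewrite -rr1. Qed.

Lemma Lbr_linl a x y z : Lbr (a *: x + y) z = a *: Lbr x z + Lbr y z.
Proof.
have p1 (u v : pspace) : (a *: u + v).1 = a *: u.1 + v.1 by [].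
have p2 (u v : pspace) : (a *: u + v).2 = a *: u.2 + v.2 by [].
have q (u v : pspace) : (Lbr u v).2 = kval u.1 v.2 - kval v.1 u.2 by [].
have e (u v : Khat D) s : kval (a *: u + v) s = a *: kval u s + kval v s by [].
apply: injective_projections.
  rewrite p1; apply: kval_inj; apply/funext => t.
  rewrite e !Lbr1E p1 p2 !e klin (cv_lin1 a x.2 y.2 z.2 t).
  set a1 := kval x.1 _; set a2 := kval y.1 _; set a3 := kval z.1 _; set a4 := kval z.1 _.
  set a5 := cv_curv _ _ _; set a6 := cv_curv _ _ _; vring R.
rewrite p2 !q p1 p2 e klin.
have alg (b c d f : H) : a *: b + c - (a *: d + f) = a *: (b - d) + (c - f) by vring R.
exact: alg.
Qed.

Lemma Lbr_anti x y : Lbr x y = - Lbr y x.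
Proof.
apply: injective_projections.
  apply: kval_inj; apply/funext => t.
  have -> : kval (- Lbr y x).1 t = - kval (Lbr y x).1 t by [].
  rewrite !Lbr1E [cv_curv x.2 y.2 t]cv_anti.
  set a1 := kval x.1 _; set a3 := kval y.1 _; set a5 := cv_curv _ _ _; vring R.
have -> : (- Lbr y x).2 = - (kval y.1 x.2 - kval x.1 y.2) by [].
by rewrite opprB.
Qed.

Lemma Lbr_linr a x y z : Lbr z (a *: x + y) = a *: Lbr z x + Lbr z y.
Proof. by rewrite Lbr_anti Lbr_linl opprD -scalerN -!Lbr_anti. Qed.

(** For three vectors of [p] the identity is the Bianchi identity. For an operator and two vectors
    it says that elements of [k] are derivations of the curvature, which is [kb_deriv]. *)
Lemma Lbr_jacobi x y z : Lbr x (Lbr y z) + Lbr y (Lbr z x) + Lbr z (Lbr x y) = 0.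
Proof.
apply: injective_projections.
  apply: kval_inj; apply/funext => t.
  have -> : kval (Lbr x (Lbr y z) + Lbr y (Lbr z x) + Lbr z (Lbr x y)).1 t =
    kval (Lbr x (Lbr y z)).1 t + kval (Lbr y (Lbr z x)).1 t + kval (Lbr z (Lbr x y)).1 t by [].
  have ex a b c : kval (Lbr a (Lbr b c)).1 t =
     kval a.1 (kval b.1 (kval c.1 t)) - kval a.1 (kval c.1 (kval b.1 t))
     - (kval b.1 (kval c.1 (kval a.1 t)) - kval c.1 (kval b.1 (kval a.1 t)))
     - (@cv_curv R D (kval a.1 b.2) c.2 t + @cv_curv R D b.2 (kval a.1 c.2) t)
     - (@cv_curv R D a.2 (kval b.1 c.2) t - @cv_curv R D a.2 (kval c.1 b.2) t).
    rewrite Lbr1E !Lbr1E !kB.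
    have [ca ka] := KsetV a.1; have <- := kb_deriv b.2 c.2 t ka.
    have -> : @cv_curv R D a.2 (Lbr b c).2 t =
        @cv_curv R D a.2 (kval b.1 c.2) t - @cv_curv R D a.2 (kval c.1 b.2) t.
      have e1 := RmDm a.2 (kval b.1 c.2) (- kval c.1 b.2) t.
      have e2 := RmZm (-1) a.2 (kval c.1 b.2) t; rewrite !scaleN1r in e2.
      exact: (etrans e1 (congr1 (+%R _) e2)).
    set a1 := kval a.1 _; set a2 := kval a.1 _; set a3 := kval a.1 _; set a4 := kval b.1 _; set a5 := kval c.1 _.
    set a6 := cv_curv _ _ _; set a7 := cv_curv _ _ _; set a8 := cv_curv _ _ _; vring R.
  rewrite !ex.
  have an u v : @cv_curv R D u v t = - @cv_curv R D v u t by exact: cv_anti.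
  rewrite (an z.2 (kval x.1 y.2)) (an x.2 (kval y.1 z.2)) (an y.2 (kval z.1 x.2)).
  rewrite (an z.2 (kval y.1 x.2)) (an x.2 (kval z.1 y.2)) (an y.2 (kval x.1 z.2)).
  move: (cv_curv _ _ _) (cv_curv _ _ _) (cv_curv _ _ _) (cv_curv _ _ _) (cv_curv _ _ _) (cv_curv _ _ _).
  have -> : kval (0 : pspace).1 t = 0 by [].
  move: (kval x.1 (kval y.1 (kval z.1 t))) (kval x.1 (kval z.1 (kval y.1 t))) => a1 a2.
  move: (kval y.1 (kval z.1 (kval x.1 t))) (kval z.1 (kval y.1 (kval x.1 t))) => a3 a4.
  by move: (kval y.1 (kval x.1 (kval z.1 t))) (kval z.1 (kval x.1 (kval y.1 t))) => a5 a6 *; vring R.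
have ex a b c : (Lbr a (Lbr b c)).2 = kval a.1 (kval b.1 c.2) - kval a.1 (kval c.1 b.2)
    - (kval b.1 (kval c.1 a.2) - kval c.1 (kval b.1 a.2) - @cv_curv R D b.2 c.2 a.2).
  exact: (congr2 (fun p q => p - q) (kB a.1 (kval b.1 c.2) (kval c.1 b.2)) (Lbr1E b c a.2)).
have -> : (Lbr x (Lbr y z) + Lbr y (Lbr z x) + Lbr z (Lbr x y)).2 =
  (Lbr x (Lbr y z)).2 + (Lbr y (Lbr z x)).2 + (Lbr z (Lbr x y)).2 by [].
rewrite !ex; have := cv_bianchi y.2 z.2 x.2.
move: (cv_curv _ _ _) (cv_curv _ _ _) (cv_curv _ _ _) => r1 r2 r3 bi.
have -> : r3 = - r1 - r2 by move: bi => /eqP; rewrite addr_eq0 => /eqP e; rewrite -[r3]opprK -e; vring R.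
have -> : (0 : pspace).2 = 0 by [].
move: (kval x.1 (kval y.1 z.2)) (kval x.1 (kval z.1 y.2)) (kval y.1 (kval z.1 x.2)) => a1 a2 a3.
by move: (kval z.1 (kval y.1 x.2)) (kval y.1 (kval x.1 z.2)) (kval z.1 (kval x.1 y.2)) => a4 a5 a6; vring R.
Qed.
End KhatForm.

(** * The L*-structure and the subalgebra generated by [p] *)

Section LstarModel.
Variables (R : realType) (D : curv_data R).
Let H : hilbertSpace R := D.
Let gam : H -> H -> R := @cv_form R D.
Let fg : psd_form gam := @cv_psd R D.
Let sg : R := cv_sign D.
Let fk : psd_form (@kform R D) := @kform_psd R D.

Lemma kcomm_linr (A : Khat D) t (B C : Khat D) : kcomm A (t *: B + C) = t *: kcomm A B + kcomm A C.
Proof.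
apply: kval_inj; apply/funext => x.
have alg (p q r s u v : H) : u = t *: p + q -> v = t *: r + s -> u - v = t *: (p - r) + (q - s).
  by move=> -> ->; vring R.
exact: (alg _ _ _ _ _ _ (klin A t (kval B x) (kval C x)) (erefl (t *: kval B (kval A x) + kval C (kval A x)))).
Qed.

Lemma kcomm_opp (A C : Khat D) : kcomm (- A) C = - kcomm A C.
Proof.
apply: kval_inj; apply/funext => x.
have alg (p q r : H) : r = - p -> - q - r = - (q - p) by move=> ->; vring R.
apply: (alg (kval C (kval A x)) (kval A (kval C x)) (kval C (- kval A x))).
have := kB C 0 (kval A x); rewrite !sub0r => ->.
have := klin C 1 0 0; rewrite scaler0 addr0 scale1r -{1}[kval C 0]addr0 => /addrI <-.
by rewrite sub0r.
Qed.

(** When [C] is some [rr U], commuting with [A] is the action on the list [U], and both sides are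
    evaluations of commutators on [U]. Both sides are bounded in [C], and such operators are
    dense. *)
Lemma kcomm_skew (A B C : Khat D) : kform (kcomm A B) C = - kform B (kcomm A C).
Proof.
have [a kA] := KsetV A; have [b kB'] := KsetV B; have [c kC] := KsetV C.
have a0 := kA.1; have b0 := kB'.1; have [k0 _] := kappaP D.
pose f (X : Khat D) := kform (kcomm A B) X + kform B (kcomm A X).
suff : f C = 0 by rewrite /f => /eqP; rewrite addr_eq0 => /eqP.
apply: (@eq_small _ _ (4 * (a * kappa D * b))) => [|e e0]; first by rewrite !mulr_ge0.
have [U kU] := kb_approx kC e0.
pose V := kmk (Kset_rr U); pose C' := C - V.
have fV : f V = 0.
  rewrite /f (psdC fk _ V) [kform B _](psdC fk).
  have -> : kcomm A V = kmk (Kset_rr (act (kval A) U)).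
    by apply: kval_inj; apply/funext => w; rewrite [RHS](rr_act _ _ kA).
  have e1 : kform V (kcomm A B) = ev (comm (kval A) (kval B)) U by apply: kip_rr; exact: KsetV.
  have e2 : kform (kmk (Kset_rr (act (kval A) U))) B = ev (kval B) (act (kval A) U) by apply: kip_rr; exact: KsetV.
  rewrite e1 e2 (ev_act _ _ kA) -[X in X + _]mul1r -ev_lin.
  have -> : 1 *: comm (kval A) (kval B) + comm (kval B) (kval A) = 0.
    apply/funext => x; have alg (p q : H) : 1 *: (p - q) + (q - p) = 0 by vring R.
    exact: alg.
  have [_ h0] := kb0 D; have := h0 U; rewrite mul0r normr_le0 => /eqP; exact.
have fD X Y : f (1 *: X + Y) = f X + f Y.
  by rewrite /f kcomm_linr !scale1r !(psdDr fk) addrACA.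
have fC : f C = f C'.
  have eC : C = 1 *: C' + V by rewrite scale1r subrK.
  by apply: (etrans (congr1 f eC)); rewrite fD fV addr0.
have kC' : kb (kval C') e by exact: kU.
rewrite fC /f; apply: le_trans (ler_normD _ _) _.
have h1 := kip_bound (A := kcomm A B) (B := C') (kb_comm kA kB') kC'.
have h2 := kip_bound (A := B) (B := kcomm A C') kB' (kb_comm kA kC').
apply: le_trans (lerD h1 h2) _; apply: le_of_eq; ring.
Qed.

Lemma kform_kR (u v : H) (C : Khat D) : kform (kR u v) C = sg * gam (kval C u) v.
Proof. by rewrite -ev1; apply: kip_rr; exact: KsetV. Qed.

Lemma Lbr_star (x y z : pspace D) : pform (Lbr x y) z = pform y (Lbr (Lstar_op x) z).
Proof.
have e0 : kform (kcomm x.1 y.1 - kR x.2 y.2) z.1 = - kform y.1 (kcomm x.1 z.1) - sg * gam (kval z.1 x.2) y.2.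
  by rewrite (psdDl fk) (psdNl fk) kcomm_skew kform_kR.
have e1 : kform y.1 (kcomm (- x.1) z.1 - kR (sg *: x.2) z.2) = - kform y.1 (kcomm x.1 z.1) - gam (kval y.1 x.2) z.2.
  rewrite (psdDr fk) (psdNr fk) kcomm_opp (psdNr fk) (psdC fk y.1 (kR _ _)) kform_kR.
  have := klin y.1 sg x.2 0; have := klin y.1 1 0 0.
  rewrite scaler0 addr0 scale1r -{1}[kval y.1 0]addr0 => /addrI <-; rewrite !addr0 => ->.
  by rewrite (psdZl fg) mulrA cv_sign2 mul1r.
have s1 : gam (kval x.1 y.2) z.2 = - gam y.2 (kval x.1 z.2).
  by have [c kA] := KsetV x.1; exact: kb_skew kA.
have s2 : kval z.1 (sg *: x.2) = sg *: kval z.1 x.2.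
  have := klin z.1 sg x.2 0; have := klin z.1 1 0 0.
  by rewrite scaler0 addr0 scale1r -{1}[kval z.1 0]addr0 => /addrI <-; rewrite !addr0 => ->.
have e2 : gam (kval x.1 y.2 - kval y.1 x.2) z.2 = - gam y.2 (kval x.1 z.2) - gam (kval y.1 x.2) z.2.
  by rewrite (psdDl fg) (psdNl fg) s1.
have e3 : gam y.2 (- kval x.1 z.2 - kval z.1 (sg *: x.2)) = - gam y.2 (kval x.1 z.2) - sg * gam (kval z.1 x.2) y.2.
  by rewrite s2 (psdDr fg) !(psdNr fg) (psdZr fg) (psdC fg y.2 (kval z.1 _)).
apply: (etrans (congr2 +%R e0 e2)); apply: (etrans _ (esym (congr2 +%R e1 e3))).
ring.
Qed.

Definition Lbracket (x y : hilb (pre_L D)) : hilb (pre_L D) := Lbr x y.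

Lemma Lbracket_morphl y : zmod_morphism (Lbracket^~ y).
Proof. by move=> x z; have := Lbr_linl (-1) z x y; rewrite !scaleN1r addrC [- _ + _]addrC. Qed.
Lemma Lbracket_morphr x : zmod_morphism (Lbracket x).
Proof. by move=> y z; have := Lbr_linr (-1) z y x; rewrite !scaleN1r addrC [- _ + _]addrC. Qed.
Lemma Lbr0l z : Lbr (0 : pspace D) z = 0.
Proof. by have := Lbr_linl (-1) 0 0 z; rewrite scaler0 addr0 scaleN1r addNr. Qed.
Lemma Lbr0r z : Lbr z (0 : pspace D) = 0.
Proof. by rewrite Lbr_anti Lbr0l oppr0. Qed.
Lemma Lbracket_scall y : scalable_for *:%R (Lbracket^~ y).
Proof. by move=> a x; have := Lbr_linl a x 0 y; rewrite Lbr0l !addr0. Qed.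
Lemma Lbracket_scalr x : scalable_for *:%R (Lbracket x).
Proof. by move=> a y; have := Lbr_linr a y 0 x; rewrite Lbr0r !addr0. Qed.

HB.instance Definition _ := @isBilinear.Build R (hilb (pre_L D)) (hilb (pre_L D)) (hilb (pre_L D))
  *:%R *:%R Lbracket Lbracket_morphl Lbracket_morphr Lbracket_scall Lbracket_scalr.

Lemma Lbracketxx (x : LH D) : Lbracket x x = 0.
Proof.
have h : Lbracket x x = - Lbracket x x by exact: Lbr_anti.
have : 2 *: Lbracket x x = 0 by rewrite scaler_nat mulr2n {1}h addNr.
by move/eqP; rewrite scaler_eq0 pnatr_eq0 /= => /eqP.
Qed.

Definition LS : LstarAlgebra R := @LstarAlgebraPack R (LH D) Lbracket Lbracketxx
  (@Lbr_jacobi R D) (@Lstar_op R D) Lbr_star.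

Definition L1 (z : LS) : D -> D := kval (z : pspace D).1.
Definition L2 (z : LS) : D := (z : pspace D).2.
Definition Lmk (A : Khat D) (v : D) : LS := (A, v) : pspace D.
Definition kk : set LS := [set z | L2 z = 0].
Definition pp : set LS := [set z | L1 z = 0].

Lemma L_ext (z w : LS) : L1 z = L1 w -> L2 z = L2 w -> z = w.
Proof. by move=> h1 h2; apply: injective_projections => //; exact: kval_inj. Qed.
Lemma L1_lin a (z w : LS) : L1 (a *: z + w) = a *: L1 z + L1 w. Proof. by []. Qed.
Lemma L2_lin a (z w : LS) : L2 (a *: z + w) = a *: L2 z + L2 w. Proof. by []. Qed.
Lemma L1_br (z w : LS) t : L1 (bracket LS z w) t =
  L1 z (L1 w t) - L1 w (L1 z t) - @cv_curv R D (L2 z) (L2 w) t.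
Proof. exact: Lbr1E. Qed.
Lemma L2_br (z w : LS) : L2 (bracket LS z w) = L1 z (L2 w) - L1 w (L2 z). Proof. by []. Qed.
Lemma L1_add (z : LS) u v : L1 z (u + v) = L1 z u + L1 z v.
Proof. by have := klin (z : pspace D).1 1 u v; rewrite !scale1r. Qed.
Lemma L1_zero (z : LS) : L1 z 0 = 0.
Proof. by have := L1_add z 0 0; rewrite addr0 -{1}[L1 z 0]addr0 => /addrI. Qed.

Lemma kip0l (B : H -> H) : Kset B -> kip (0 : H -> H) B = 0.
Proof.
move=> KB; have e : (0 : H -> H) = rr [::] by apply/funext => w; rewrite /rr big_nil.
by rewrite e kip_rr// ev_nil.
Qed.

Lemma L_ip (z w : LS) : L1 z = 0 -> ip LS z w = gam (L2 z) (L2 w).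
Proof.
move=> h; apply: (etrans (_ : _ = kip (L1 z) (L1 w) + gam (L2 z) (L2 w))) => //.
by rewrite h kip0l ?add0r//; exact: KsetV.
Qed.

(** Both summands are orthogonal complements, each of the other, which is how they are seen to be
    closed. *)
Lemma closed_orth (S : set LS) : closed [set z : LS | forall y, S y -> ip LS z y = 0].
Proof.
rewrite -[X in closed X]setCK; apply: open_closedC; apply/openP => x.
move=> /existsNP[y /not_implyP[Sy /eqP xy]].
have y1 : 0 < `|y| + 1 by rewrite ltr_wpDl.
exists (`|ip LS x y| / (`|y| + 1)) => [|h]; first by rewrite divr_gt0// normr_gt0.
rewrite ltr_pdivlMr// => hh /(_ y Sy); rewrite (psdDl (ip_psd LS)) => /eqP; rewrite addr_eq0 => /eqP e.
have e2 : `|ip LS x y| <= `|h| * `|y| by rewrite e normrN; exact: ip_le.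
have := lt_le_trans hh e2; rewrite ltNge => /negP; apply.
by rewrite ler_wpM2l// lerDl.
Qed.

Lemma gam_self v : gam v v = 0 -> v = 0.
Proof.
move=> h; apply: gam_eq0 => w; apply/eqP; rewrite -sqrf_eq0 eq_le sqr_ge0 andbT.
by apply: le_trans (psd_cauchy fg _ _) _; rewrite h mul0r.
Qed.

Lemma L_ipr (z w : LS) : L1 z = 0 -> ip LS w z = gam (L2 w) (L2 z).
Proof. by move=> h; apply: (etrans (psdC (ip_psd LS) w z)); rewrite L_ip// (psdC fg). Qed.

Lemma kkE : kk = [set z : LS | forall y, pp y -> ip LS z y = 0].
Proof.
apply/seteqP; split=> z.
  move=> z2 y y1; have e : L2 z = 0 := z2.
  by apply: (etrans (L_ipr z y1)); rewrite e (psd0l fg).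
move=> h; apply: gam_self; apply: etrans (h (Lmk 0 (L2 z)) (erefl _)).
by rewrite L_ipr.
Qed.

Lemma ppE : pp = [set z : LS | forall y, kk y -> ip LS z y = 0].
Proof.
apply/seteqP; split=> z.
  move=> z1 y y2; have e : L2 y = 0 := y2.
  by apply: (etrans (L_ip y z1)); rewrite e (psdC fg) (psd0l fg).
move=> h; have := h (Lmk (z : pspace D).1 0) (erefl _) => e.
have e' : kform (z : pspace D).1 (z : pspace D).1 + gam (L2 z) 0 = 0 by exact: e.
rewrite (psdC fg) (psd0l fg) addr0 in e'.
by rewrite /pp /= /L1 (kform_definite e').
Qed.

Lemma L_orthogonal : orthogonal_decomposition kk pp.
Proof.
split.
- split; last by rewrite kkE; exact: closed_orth.
  split=> // a x y hx hy; have alg (c d : H) : c = 0 -> d = 0 -> a *: c + d = 0.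
    by move=> -> ->; rewrite scaler0 addr0.
  exact: (etrans (L2_lin a x y) (alg _ _ hx hy)).
- split; last by rewrite ppE; exact: closed_orth.
  split=> // a x y hx hy; have alg (c d : H -> H) : c = 0 -> d = 0 -> a *: c + d = 0.
    by move=> -> ->; rewrite scaler0 addr0.
  exact: (etrans (L1_lin a x y) (alg _ _ hx hy)).
- by move=> x y; rewrite {1}kkE; apply.
- move=> z; exists (Lmk (z : pspace D).1 0), (Lmk 0 (L2 z)); split=> //.
  by apply: injective_projections; rewrite /= ?addr0 ?add0r.
Qed.

Lemma L_subalgebra : Lstar_subalgebra kk.
Proof.
have [[sk ck] _ _ _] := L_orthogonal; split=> //.
  split=> // x y hx hy; have alg (c d : H) : c = 0 -> d = 0 -> L1 x d - L1 y c = 0.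
    by move=> -> ->; rewrite !L1_zero subr0.
  exact: (etrans (L2_br x y) (alg _ _ hx hy)).
by move=> x hx; rewrite /kk /= ; apply: (etrans (congr1 (fun v => sg *: v) hx)); exact: scaler0.
Qed.

(** Together with [L_generated]: the algebra generated by [p] consists of the pairs whose operator
    is a finite sum of curvature operators. Only for these is a Killing field available, which is
    why the generated algebra and not [L] itself is mapped into Killing fields. *)
Lemma L_generated_rr (z : LS) : lie_generated pp z -> exists U, L1 z = rr U.
Proof.
move=> /(_ [set y | exists U, L1 y = rr U]).
apply; last by move=> y y1; exists [::]; rewrite (_ : L1 y = 0)//; apply/funext => w; rewrite /rr big_nil.
split; first split.
- by exists [::]; apply/funext => w; rewrite /rr big_nil.
- move=> a x y [U hU] [V hV]; exists (comb V a U); rewrite L1_lin hU hV.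
  apply/funext => w; rewrite rr_comb addrC.
  by [].
(* As [rr U] is a derivation of the curvature, its commutator with [rr V] is the curvature operator
   of the list [act (rr U) V]; the last pair accounts for the term [- R(u, v)] of the bracket. *)
move=> x y [U hU] [V hV]; exists (comb (act (rr U) V) (-1) [:: (L2 x, L2 y)]).
apply/funext => w; rewrite L1_br hU hV rr_comb rr1 scaleN1r (rr_act _ _ (kb_rr U)).
by [].
Qed.

Lemma L_generated U v : lie_generated pp (Lmk (kmk (Kset_rr U)) v).
Proof.
move=> A [[A0 Alin] Abr] ppA; have AD x y : A x -> A y -> A (x + y).
  by move=> hx hy; rewrite -[x]scale1r; exact: Alin.
have An x : A x -> A (- x) by move=> hx; rewrite -scaleN1r -[_ *: _]addr0; exact: Alin.
suff h : A (Lmk (kmk (Kset_rr U)) 0).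
  have -> : Lmk (kmk (Kset_rr U)) v = Lmk (kmk (Kset_rr U)) 0 + Lmk 0 v.
    by apply: injective_projections; rewrite /= ?addr0 ?add0r.
  by apply: AD => //; exact: ppA.
elim: U => [|a U IH].
  have -> // : Lmk (kmk (Kset_rr [::])) 0 = 0.
  by apply: L_ext => //; apply/funext => w; rewrite /L1 /= /rr big_nil.
have -> : Lmk (kmk (Kset_rr (a :: U))) 0 = - bracket LS (Lmk 0 a.1) (Lmk 0 a.2) + Lmk (kmk (Kset_rr U)) 0.
  apply: L_ext; last first.
    have -> : L2 (- bracket LS (Lmk 0 a.1) (Lmk 0 a.2) + Lmk (kmk (Kset_rr U)) 0) =
      - L2 (bracket LS (Lmk 0 a.1) (Lmk 0 a.2)) + 0 by [].
    rewrite L2_br; have alg (c d : H) : c = 0 -> d = 0 -> 0 = - (c - d) + 0 by move=> -> ->; vring R.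
    exact: alg.
  apply/funext => w.
  have -> : L1 (- bracket LS (Lmk 0 a.1) (Lmk 0 a.2) + Lmk (kmk (Kset_rr U)) 0) w =
    - L1 (bracket LS (Lmk 0 a.1) (Lmk 0 a.2)) w + rr U w by [].
  rewrite L1_br; have alg (c d e f k : H) : c = 0 -> d = 0 -> k = e + f -> k = - (c - d - e) + f.
    by move=> -> -> ->; vring R.
  by apply: alg => //; exact: big_cons.
by apply: AD => //; apply: An; apply: Abr; exact: ppA.
Qed.

Lemma L_dense : dense (lie_generated pp).
Proof.
move=> O [z Oz] /openP /(_ z Oz)[d d0 dO].
have [c kA] := KsetV (z : pspace D).1; have d2 : 0 < d / 2 by rewrite divr_gt0.
have [U kU] := kb_approx kA d2.
pose z' := Lmk (kmk (Kset_rr U)) (L2 z).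
exists z'; split; last exact: L_generated.
have -> : z' = z + (z' - z) by rewrite addrC subrK.
apply: dO; rewrite distrC; apply: (@le_lt_trans _ _ (d / 2)); last by lra.
have z1 : L1 (z - z') = kval (z : pspace D).1 - rr U by [].
have z2 : L2 (z - z') = 0 by apply: (subrr (L2 z)).
have e1 : ip LS (z - z') (z - z') = kip (L1 (z - z')) (L1 (z - z')) + gam (L2 (z - z')) (L2 (z - z')) by [].
have e2 : ip LS (z - z') (z - z') <= (d / 2) ^+ 2.
  by rewrite e1 z2 (psd0l fg) addr0 z1; exact: kip_le.
rewrite -(@ler_pXn2r _ 2) ?nnegrE ?(ltW d2)//.
exact: (le_trans (le_of_eq (esym (ip_norm (h := LS) (z - z')))) e2).
Qed.
End LstarModel.

(** * Finite rank traces and the sign of the curvature operator *)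

Section TraceUnique.
Variables (R : realType) (V : lmodType R) (b : V -> V -> R).
Hypotheses (fb : psd_form b) (b_definite : forall v, b v v = 0 -> v = 0).

Lemma psd_sumr I (s : seq I) x (F : I -> V) : b x (\sum_(i <- s) F i) = \sum_(i <- s) b x (F i).
Proof.
elim: s => [|i s IH]; first by rewrite !big_nil (psdC fb) (psd0l fb).
by rewrite !big_cons (psdDr fb) IH.
Qed.

Lemma psd_suml I (s : seq I) x (F : I -> V) : b (\sum_(i <- s) F i) x = \sum_(i <- s) b (F i) x.
Proof.
elim: s => [|i s IH]; first by rewrite !big_nil (psd0l fb).
by rewrite !big_cons (psdDl fb) IH.
Qed.

(* Induction on the number of terms: the value of the zero operator at the
   first vector [a] expresses the vector paired with it through the others. *)
Lemma trace_zero (s : seq (V * V)) :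
  (forall Z, \sum_(a <- s) b a.1 Z *: a.2 = 0) -> \sum_(a <- s) b a.1 a.2 = 0.
Proof.
have [n] := ubnP (size s); elim: n s => // n IH [|[a c] s] /=; first by rewrite big_nil.
rewrite ltnS => sn h; rewrite big_cons /=.
have hc Z : b a Z *: c + \sum_(i <- s) b i.1 Z *: i.2 = 0 by have := h Z; rewrite big_cons.
have [a0|a0] := eqVneq (b a a) 0.
  have za : a = 0 by exact: b_definite.
  rewrite za (psd0l fb) add0r; apply: IH => // Z.
  by have := hc Z; rewrite za (psd0l fb) scale0r add0r.
pose k (i : V * V) := b i.1 a / b a a.
have ec : c = - \sum_(i <- s) k i *: i.2.
  have e : \sum_(i <- s) k i *: i.2 = (b a a)^-1 *: \sum_(i <- s) b i.1 a *: i.2.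
    by rewrite scaler_sumr; apply: eq_bigr => i _; rewrite scalerA mulrC.
  have := hc a; move/eqP; rewrite addr_eq0 => /eqP ha.
  by rewrite e -[\sum_(i <- s) _]opprK -ha scalerN opprK scalerA mulVf// scale1r.
pose s' := [seq (i.1 - k i *: a, i.2) | i <- s].
have h0 : \sum_(i <- s') b i.1 i.2 = 0.
  apply: IH; first by rewrite size_map.
  move=> Z; rewrite big_map /= -[RHS](hc Z) ec scalerN scaler_sumr -sumrN -big_split /=.
  apply: eq_bigr => i _; rewrite (psdDl fb) (psdNl fb) (psdZl fb) scalerBl scalerA [b a Z * _]mulrC.
  by rewrite addrC.
rewrite -[RHS]h0 big_map ec (psdNr fb) psd_sumr -sumrN -big_split /=.
apply: eq_bigr => i _; rewrite (psdDl fb) (psdNl fb) (psdZl fb) (psdZr fb).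
by rewrite addrC.
Qed.

Lemma trace_unique (s t : seq (V * V)) :
  (forall Z, \sum_(a <- s) b a.1 Z *: a.2 = \sum_(a <- t) b a.1 Z *: a.2) ->
  \sum_(a <- s) b a.1 a.2 = \sum_(a <- t) b a.1 a.2.
Proof.
move=> h; apply/eqP; rewrite -subr_eq0; apply/eqP.
have := trace_zero (s := s ++ [seq (- a.1, a.2) | a <- t]).
rewrite big_cat big_map /= => hz; rewrite -[RHS]hz.
  by congr (_ + _); rewrite -sumrN; apply: eq_bigr => i _; rewrite (psdNl fb).
move=> Z; rewrite big_cat big_map /= h -big_split /= big1// => i _.
by rewrite (psdNl fb) scaleNr subrr.
Qed.
End TraceUnique.

Section CurvatureSign.
Variables (R : realType) (H : hilbertSpace R) (M : manifold H) (g : metric M) (q : M).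
Let fg : psd_form (g q) := metric_psd g q.

Lemma metric_definite (v : H) : g q v v = 0 -> v = 0.
Proof.
have [c [C [c0 cP]]] := metric_strong g q => e; have /andP[+ _] := cP v; rewrite e => h.
have := le_trans h (lexx 0); rewrite pmulr_rle0// => h2.
by apply/eqP; rewrite -normr_eq0 -sqrf_eq0 eq_le h2 sqr_ge0.
Qed.

Lemma metric_nondegenerate (u v : H) : (forall w, g q u w = g q v w) -> u = v.
Proof.
move=> h; apply/eqP; rewrite -subr_eq0; apply/eqP; apply: metric_definite.
by apply: (etrans (psdDl fg _ _ _)); rewrite h (psdNl fg) subrr.
Qed.

Lemma traceE (s : seq (H * H)) :
  trace g q (fun Z => \sum_(a <- s) g q a.1 Z *: a.2) = \sum_(a <- s) g q a.1 a.2.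
Proof.
set S := fun Z => _.
have : exists t : R, exists2 s' : seq (H * H), S = (fun Z => \sum_(a <- s') g q a.1 Z *: a.2) &
    t = \sum_(a <- s') g q a.1 a.2 by exists (\sum_(a <- s) g q a.1 a.2), s.
move=> /(@xgetPex _ 0)[s' es]; rewrite /trace => ->; apply: (trace_unique fg metric_definite) => Z.
by rewrite -/(S Z) es.
Qed.

Lemma transpose_skew (A : H -> H) : skew_symmetric g q A -> transpose g q A = (fun v => - A v).
Proof.
move=> sA.
have ex : exists B : H -> H, forall u v, g q (A u) v = g q u (B v).
  by exists (fun v => - A v) => u v; apply: (etrans (sA u v)); exact: (esym (psdNr fg _ _)).
have h := @xgetPex _ (fun=> 0) _ ex.
apply/funext => v; apply: metric_nondegenerate => u.
apply: (etrans (psdC fg _ _)); apply: (etrans (esym (h u v))); apply: (etrans (sA u v)).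
by apply: (etrans (esym (psdNr fg _ _))); exact: psdC.
Qed.

(** By skewness the two halves of a wedge contribute equally to the trace, hence the factor 2. *)
Lemma operator_pairing_wedge (A : H -> H) (U : seq (H * H)) : linear A -> skew_symmetric g q A ->
  operator_pairing g q A (\sum_(a <- U) wedge g q a.1 a.2) = 2 * \sum_(a <- U) g q (A a.1) a.2.
Proof.
move=> lA sA; rewrite /operator_pairing transpose_skew//.
have AD x y : A (x + y) = A x + A y by rewrite -[x]scale1r lA !scale1r.
have A0 : A 0 = 0 by have := lA (-1) 0 0; rewrite scaler0 addr0 scaleN1r addNr.
have AZ t x : A (t *: x) = t *: A x by have := lA t x 0; rewrite A0 !addr0.
have -> : (fun v => - A v) \o (\sum_(a <- U) wedge g q a.1 a.2) =
  fun Z => \sum_(a <- [seq (a.1, - A a.2) | a <- U] ++ [seq (a.2, A a.1) | a <- U]) g q a.1 Z *: a.2.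
  apply/funext => Z /=; rewrite big_cat !big_map /=.
  elim: U => [|a U IH]; first by rewrite !big_nil /= A0 oppr0 addr0.
  rewrite !big_cons /= fctE AD opprD IH /wedge AD -scaleNr !AZ.
  set x := \sum_(_ <- _) _; set y := \sum_(_ <- _) _; set z := A _; set t := A _.
  by vring R.
rewrite traceE big_cat !big_map /= -big_split mulr_sumr; apply: eq_bigr => a _ /=.
have e1 : g q a.1 (- A a.2) = g q (A a.1) a.2.
  by apply: (etrans (psdNr fg _ _)); rewrite sA.
by rewrite e1 (psdC fg a.2 (A a.1)) mulr_natl mulr2n.
Qed.

(** The factor 2 of the pairing occurs once in the identity that defines [C] on wedges and once in
    the pairing of [C U] with [U]; it cancels, so the quadratic form of [C] is exactly minus the
    double sum of the curvature tensor. *)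
Lemma curvature_operator_sum C (U : seq (H * H)) : curvature_operator g q C ->
  operator_pairing g q (C (\sum_(a <- U) wedge g q a.1 a.2)) (\sum_(a <- U) wedge g q a.1 a.2) =
  - \sum_(a <- U) \sum_(c <- U) g q (curvature g q a.1 a.2 c.1) c.2.
Proof.
move=> [Clin Cskew CR].
have ext V : exterior_square g q (\sum_(a <- V) wedge g q a.1 a.2) by exists V.
have [[lC _] sC] := Cskew _ (ext U).
rewrite (operator_pairing_wedge _ lC sC).
have C0 : C 0 = 0.
  have e0 : exterior_square g q 0 by exists [::]; rewrite big_nil.
  by have := Clin (-1) 0 0 e0 e0; rewrite scaler0 addr0 scaleN1r addNr.
have ew X Y : exterior_square g q (wedge g q X Y) by exists [:: (X, Y)]; rewrite big_seq1.
have CS V : C (\sum_(a <- V) wedge g q a.1 a.2) = \sum_(a <- V) C (wedge g q a.1 a.2).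
  elim: V => [|a V IH]; first by rewrite !big_nil C0.
  by rewrite !big_cons -IH -[wedge g q a.1 a.2 in LHS]scale1r Clin// scale1r.
have Cw X Y Z T : 2 * g q (C (wedge g q X Y) Z) T = - g q (curvature g q X Y Z) T.
  have [[lw _] sw] := Cskew _ (ew X Y).
  have := operator_pairing_wedge [:: (Z, T)] lw sw; rewrite !big_seq1 /= => <-; exact: CR.
rewrite CS exchange_big /= mulr_sumr -sumrN; apply: eq_bigr => c _.
have -> : (\sum_(a <- U) C (wedge g q a.1 a.2)) c.1 = \sum_(a <- U) C (wedge g q a.1 a.2) c.1.
  by elim: (U) => [|a V IH]; rewrite ?big_nil ?big_cons// fctE IH.
rewrite (psd_suml fg) mulr_sumr -sumrN; apply: eq_bigr => a _.
exact: Cw.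
Qed.

Lemma fixed_sign_curvature : fixed_sign_curvature_operator g q ->
  exists2 sg : R, sg * sg = 1 & forall U : seq (H * H),
    0 <= sg * \sum_(a <- U) \sum_(c <- U) g q (curvature g q a.1 a.2 c.1) c.2.
Proof.
move=> [[C cC CP]|[C cC CP]]; [exists 1; rewrite ?mulr1// => U|exists (-1); rewrite ?mulrNN ?mulr1// => U].
  have := CP _ (ex_intro _ U (erefl _)); rewrite (curvature_operator_sum _ cC) oppr_le0.
  by rewrite mul1r.
have := CP _ (ex_intro _ U (erefl _)); rewrite (curvature_operator_sum _ cC).
by rewrite mulN1r.
Qed.
End CurvatureSign.

(** * One-jets of Killing fields and the curvature identities *)

Lemma jet_bracket_alg (R : realType) (V : lmodType R) (Gm : V -> V -> V) (A1 A2 D1 D2 : V -> V)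
   (v1 v2 a c1 c2 d12 d21 r : V) :
  (forall t u u' w, Gm (t *: u + u') w = t *: Gm u w + Gm u' w) ->
  (forall u w, Gm u w = Gm w u) ->
  (forall t u w, D1 (t *: u + w) = t *: D1 u + D1 w) ->
  (forall t u w, D2 (t *: u + w) = t *: D2 u + D2 w) ->
  (forall u, D1 u = - A1 u - Gm u v1) -> (forall u, D2 u = - A2 u - Gm u v2) ->
  d21 + c2 + Gm (D2 a) v1 + Gm a (D2 v1) = D2 (Gm a v1) ->
  d12 + c1 + Gm (D1 a) v2 + Gm a (D1 v2) = D1 (Gm a v2) ->
  r = c1 - c2 + Gm v1 (Gm v2 a) - Gm v2 (Gm v1 a) ->
  (d21 + D2 (D1 a)) - (d12 + D1 (D2 a)) = - (A1 (A2 a) - A2 (A1 a) - r) - Gm a (A1 v2 - A2 v1).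
Proof.
move=> GL GC L1 L2 e1 e2 k2 k1 ->.
have GB u u' w : Gm (- u - u') w = - Gm u w - Gm u' w.
  have G0 : Gm 0 w = 0 by have := GL (-1) 0 0 w; rewrite scaler0 addr0 scaleN1r addNr.
  have GN z : Gm (- z) w = - Gm z w by have := GL (-1) z 0 w; rewrite addr0 G0 addr0 !scaleN1r.
  by have := GL (-1) u (- u') w; rewrite !scaleN1r GN.
have GS u u' w : Gm (u - u') w = Gm u w - Gm u' w.
  by have := GL (-1) u' u w; rewrite !scaleN1r addrC => ->; rewrite addrC.
have lin (D : V -> V) : (forall t u w, D (t *: u + w) = t *: D u + D w) -> forall u w, D (- u - w) = - D u - D w.
  move=> L u w; have D0 : D 0 = 0 by have := L (-1) 0 0; rewrite scaler0 addr0 scaleN1r addNr.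
  have DN z : D (- z) = - D z by have := L (-1) z 0; rewrite addr0 D0 addr0 !scaleN1r.
  by have := L (-1) u (- w); rewrite !scaleN1r DN.
have {k2} -> : d21 = D2 (Gm a v1) - c2 - Gm (D2 a) v1 - Gm a (D2 v1) by rewrite -k2; vring R.
have {k1} -> : d12 = D1 (Gm a v2) - c1 - Gm (D1 a) v2 - Gm a (D1 v2) by rewrite -k1; vring R.
rewrite [D1 a]e1 [D2 a]e2 (lin _ L1) (lin _ L2) [D1 v2]e1 [D2 v1]e2.
rewrite [D1 (A2 a)]e1 [D1 (Gm a v2)]e1 [D2 (A1 a)]e2 [D2 (Gm a v1)]e2.
rewrite !(GC a) !GB !GS (GC v2 v1) (GC v1 (Gm v2 a)) (GC v2 (Gm v1 a)).
vring R.
Qed.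

Section Jets.
Variables (R : realType) (H : hilbertSpace R) (M : manifold H) (g : metric M) (p : M).
Let form q := form_in_chart g q.
Let x0 := to_chart p p.
Let cx0 : codomain p x0. Proof. exact: to_chart_codomain (domain_self p). Qed.
Let mp : local_metric (codomain p) (form p) := form_metric g p.
Let Gam u v := chris (form p) x0 u v.

Lemma dchrisC u v w :
  'd (fun y => chris (form p) y u v) x0 w = 'd (fun y => chris (form p) y v u) x0 w.
Proof.
have ee y : codomain p y -> chris (form p) y v u = chris (form p) y u v.
  by move=> cy; exact: (chrisC mp v u cy).
have [_ de] := is_diff_open (@open_codomain _ _ _ p) cx0 ee (chris_slice_diff mp v u cx0).
exact: (congr1 (fun l : H -> H => l w) de).
Qed.

Lemma curvature_chris u v w : curvature g p u v w =
  'd (fun y => chris (form p) y v w) x0 u - 'd (fun y => chris (form p) y u w) x0 v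
  + Gam u (Gam v w) - Gam v (Gam u w).
Proof.
have e a b c : 'D_a (fun y => christoffel g p y b c) x0 = 'd (fun y => chris (form p) y b c) x0 a.
  by apply: deriveE; have [] := chris_slice_diff mp b c cx0.
by rewrite /curvature /= e e.
Qed.

(* The Killing field [Y] corresponds to the pair formed by the skew operator
   [A = - nabla Y] and the vector [v = Y p]. *)
Definition jet (Y : vector_field M) (A : H -> H) (v : H) : Prop :=
  [/\ inf_killing g Y, Y p = v & forall a, 'd (field_in_chart Y p) x0 a = - A a - Gam a v].

Lemma jet_op Y A v a : jet Y A v -> A a = - 'd (field_in_chart Y p) x0 a - Gam a v.
Proof. by move=> [_ _ ->]; rewrite opprB addrAC opprK subrr add0r. Qed.

Lemma jet_linear Y A v t a b : jet Y A v -> A (t *: a + b) = t *: A a + A b.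
Proof.
move=> jY; rewrite !(jet_op _ jY).
have alg (d d1 d2 c c1 c2 : H) : d = t *: d1 + d2 -> c = t *: c1 + c2 ->
   - d - c = t *: (- d1 - c1) + (- d2 - c2) by move=> -> ->; vring R.
apply: alg; last exact: (chris_lin1 mp t a b v cx0).
by rewrite dD dZ.
Qed.

Lemma jet_zero Y A v : jet Y A v -> A 0 = 0.
Proof. by move=> jY; have := jet_linear (-1) 0 0 jY; rewrite scaler0 addr0 scaleN1r addNr. Qed.
Lemma jet_neg Y A v a : jet Y A v -> A (- a) = - A a.
Proof. by move=> jY; have := jet_linear (-1) a 0 jY; rewrite addr0 (jet_zero jY) addr0 !scaleN1r. Qed.

Lemma jet_lin t Y Z A B v w : jet Y A v -> jet Z B w -> jet (t *: Y + Z) (t *: A + B) (t *: v + w).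
Proof.
move=> [kY vY dY] [kZ vZ dZ']; split; first exact: inf_killing_lin.
  by rewrite -vY -vZ.
move=> a.
have diffY X : inf_killing g X -> is_diff x0 (field_in_chart X p) ('d (field_in_chart X p) x0).
  by move=> [sX _]; apply: differentiableP; have [+ _] := class_CS (sX p 1%N); apply.
have e : field_in_chart (t *: Y + Z) p = t *: field_in_chart Y p + field_in_chart Z p.
  by apply/funext => x; exact: field_lin.
have [_ d] := is_diffD (is_diffZ t (diffY Y kY)) (diffY Z kZ).
have alg (d1 d2 d3 a1 a2 c c1 c2 : H) : d1 = t *: d2 + d3 -> d2 = - a1 - c1 -> d3 = - a2 - c2 ->
  c = t *: c1 + c2 -> d1 = - (t *: a1 + a2) - c by move=> -> -> -> ->; vring R.
apply: (alg _ _ _ _ _ _ _ _ _ (dY a) (dZ' a) (chris_lin2 mp t a v w cx0)).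
rewrite e.
exact: (congr1 (fun l : H -> H => l a) d).
Qed.

(** The difference of the two fields has zero 1-jet at [p]. Identities between Killing fields can
    thus be proved by comparing jets. *)
Lemma jet_eq Y Z A B v w : jet Y A v -> jet Z B w -> v = w -> (forall a, A a = B a) -> Y = Z.
Proof.
move=> jY jZ vw AB; have [kD vD dD'] := jet_lin (-1) jZ jY.
have h : forall a, (-1 *: Z + Y) a = 0.
  have w0 : -1 *: w + v = 0 by rewrite vw scaleN1r addNr.
  apply: (inf_killing_eq0 kD (etrans vD w0)) => a.
  have alg (b c e f : H) : b = c -> e = 0 -> f = - (-1 *: c + b) - e -> f = 0.
    by move=> -> -> ->; vring R.
  apply: (alg _ _ _ _ (AB a) _ (dD' a)).
  by rewrite w0; exact: (chris0r mp _ cx0).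
apply/funext => a; have alg (y z : H) : -1 *: z + y = 0 -> y = z.
  by rewrite scaleN1r addrC => /eqP; rewrite subr_eq0 => /eqP.
exact: alg (h a).
Qed.

Lemma jet_inj Y A B v w : jet Y A v -> jet Y B w -> v = w /\ A = B.
Proof.
move=> jY jZ; have [_ e1 _] := jY; have [_ e2 _] := jZ; have e : v = w by rewrite -e1 -e2.
split=> //; apply/funext => a; rewrite (jet_op a jY) (jet_op a jZ).
by rewrite e.
Qed.

(** The bracket of the model algebra, read on jets. The derivative of [[Y1, Y2]] at [p] contains
    second derivatives of both fields; [killing_chris] trades them for derivatives of the
    Christoffel symbols, and what remains of these is the curvature. *)
Lemma jet_bracket Y1 Y2 A1 A2 v1 v2 : jet Y1 A1 v1 -> jet Y2 A2 v2 ->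
  jet (field_bracket Y1 Y2) (fun a => A1 (A2 a) - A2 (A1 a) - curvature g p v1 v2 a) (A1 v2 - A2 v1).
Proof.
move=> [k1 e1 d1] [k2 e2 d2']; split; first exact: inf_killing_bracket.
  have alg (p1 p2 q1 q2 a1 a2 c c' : H) : p1 = - a2 - c -> p2 = - a1 - c' -> c = c' ->
    p1 - p2 = a1 - a2 by move=> -> -> ->; vring R.
  rewrite /field_bracket e1 e2.
  exact: (alg _ _ 0 0 _ _ _ _ (d2' v1) (d1 v2) (chrisC mp _ _ cx0)).
move=> a; have [s1 kk1] := k1; have [s2 kk2] := k2.
have oc : open (codomain p) := @open_codomain _ _ _ p.
have e y : codomain p y -> lie (field_in_chart Y1 p) (field_in_chart Y2 p) y = field_in_chart (field_bracket Y1 Y2) p y.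
  by move=> cy; rewrite field_bracketE.
have dL := lie_diff oc cx0 (s1 p 2%N) (s2 p 2%N).
have [_ d] := is_diff_open oc cx0 e dL.
have f1 : field_in_chart Y1 p x0 = v1 by rewrite -e1; exact: field_self.
have f2 : field_in_chart Y2 p x0 = v2 by rewrite -e2; exact: field_self.
have c1 := killing_chris mp (@subset_refl _ _) oc a v2 (s1 p 2%N) (kk1 p) cx0.
have c2 := killing_chris mp (@subset_refl _ _) oc a v1 (s2 p 2%N) (kk2 p) cx0.
apply: (etrans (congr1 (fun l : H -> H => l a) d)).
rewrite f1 f2 in c1 c2 *.
apply: (@jet_bracket_alg R H Gam A1 A2 _ _ v1 v2 a _ _ _ _ _ _ _ _ _ d1 d2' c2 c1).
- by move=> t u u' w; exact: (chris_lin1 mp t u u' w cx0).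
- by move=> u w; exact: (chrisC mp u w cx0).
- by move=> t u w; rewrite dD dZ.
- by move=> t u w; rewrite dD dZ.
have alg (a1 a2 b1 b2 g1 g2 : H) : a1 = b1 -> a2 = b2 -> a1 - a2 + g1 - g2 = b1 - b2 + g1 - g2.
  by move=> -> ->.
exact: (etrans (curvature_chris v1 v2 a) (alg _ _ _ _ _ _ (dchrisC v2 a v1) (dchrisC v1 a v2))).
Qed.

Lemma field_jacobi X Y Z : inf_killing g X -> inf_killing g Y -> inf_killing g Z ->
  field_bracket X (field_bracket Y Z) + field_bracket Y (field_bracket Z X)
  + field_bracket Z (field_bracket X Y) = 0.
Proof.
move=> kX kY kZ; apply/funext => q.
have oc : open (codomain q) := @open_codomain _ _ _ q.
have cq : codomain q (to_chart q q) by exact: to_chart_codomain (domain_self q).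
have key X1 Y1 Z1 : inf_killing g X1 -> inf_killing g Y1 -> inf_killing g Z1 ->
  field_bracket X1 (field_bracket Y1 Z1) q =
  lie (field_in_chart X1 q) (lie (field_in_chart Y1 q) (field_in_chart Z1 q)) (to_chart q q).
  move=> [s1 _] [s2 _] [s3 _].
  have e y : codomain q y -> field_in_chart (field_bracket Y1 Z1) q y = lie (field_in_chart Y1 q) (field_in_chart Z1 q) y.
    by move=> cy; rewrite field_bracketE.
  have dl := lie_smooth oc (s2 q) (s3 q) 1.
  have dL : is_diff (to_chart q q) (lie (field_in_chart Y1 q) (field_in_chart Z1 q)) ('d (lie (field_in_chart Y1 q) (field_in_chart Z1 q)) (to_chart q q)).
    by apply: differentiableP; have [+ _] := class_CS dl; apply.
  have [_ d] := is_diff_open oc cq (fun y cy => esym (e y cy)) dL.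
  have alg (f1 f2 h1 h2 : H -> H) (u1 u2 w1 w2 : H) : f1 = f2 -> u1 = u2 -> w1 = w2 -> f1 u1 - h1 w1 = f2 u2 - h1 w2.
    by move=> -> -> ->.
  apply: (alg _ _ _ id _ _ _ _ d (esym (field_self X1 q))).
  rewrite -(e _ cq); exact: esym (field_self _ q).
rewrite !fctE key// key// key//; have [s1 _] := kX; have [s2 _] := kY; have [s3 _] := kZ.
exact: (lie_jacobi oc cq (s1 q) (s2 q) (s3 q)).
Qed.

Lemma curvature_anti u v w : curvature g p u v w = - curvature g p v u w.
Proof.
rewrite !curvature_chris; have alg (a b c d : H) : a - b + c - d = - (b - a + d - c) by vring R.
exact: alg.
Qed.

Lemma curvature_bianchi u v w :
  curvature g p u v w + curvature g p v w u + curvature g p w u v = 0.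
Proof.
have gc a b c : Gam a (Gam b c) = Gam a (Gam c b) by exact: (congr1 (fun z => Gam a z) (chrisC mp b c cx0)).
have alg (a1 a2 a3 a4 a5 a6 b1 b2 b3 b4 b5 b6 : H) : a1 = a6 -> a2 = a3 -> a4 = a5 ->
  b1 = b6 -> b2 = b3 -> b4 = b5 ->
  (a1 - a2 + b1 - b2) + (a3 - a4 + b3 - b4) + (a5 - a6 + b5 - b6) = 0.
  by move=> -> -> -> -> -> ->; vring R.
apply: (etrans (congr2 +%R (congr2 +%R (curvature_chris u v w) (curvature_chris v w u)) (curvature_chris w u v))).
exact: (alg _ _ _ _ _ _ _ _ _ _ _ _ (dchrisC v w u) (dchrisC u w v) (dchrisC v u w)
  (gc u v w) (gc v u w) (gc w v u)).
Qed.

Lemma curvature0l v w : curvature g p 0 v w = 0.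
Proof.
have e : curvature g p 0 v w = 'd (fun y => chris (form p) y v w) x0 0 - 'd (fun y => chris (form p) y 0 w) x0 v
  + Gam 0 (Gam v w) - Gam v (Gam 0 w) := curvature_chris 0 v w.
have z1 : 'd (fun y => chris (form p) y 0 w) x0 v = 0.
  have ee y : codomain p y -> cst (0 : H) y = chris (form p) y 0 w by move=> cy; rewrite (chris0l mp _ cy).
  have [_ de] := is_diff_open (@open_codomain _ _ _ p) cx0 ee (is_diff_cst (0 : H) x0).
  exact: (congr1 (fun l : H -> H => l v) de).
have alg (a b c d f : H) : f = a - b + c - d -> a = 0 -> b = 0 -> c = 0 -> d = 0 -> f = 0.
  by move=> -> -> -> -> ->; vring R.
apply: (alg _ _ _ _ _ e (d0 _ _) z1); first exact: (chris0l mp _ cx0).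
by rewrite /Gam (chris0l mp w cx0); exact: (chris0r mp _ cx0).
Qed.

Lemma curvature0r u w : curvature g p u 0 w = 0.
Proof. by rewrite curvature_anti curvature0l oppr0. Qed.

Section Symmetric.
Hypothesis gS : symmetric_space g.
Let s : M -> M -> M := projT1 (cid (symmetry_choice gS)).
Let sP : forall a, symmetry_at g a (s a) := projT2 (cid (symmetry_choice gS)).

Lemma jet_transvection v : jet (transvection s p v) 0 v.
Proof.
split; [exact: transvection_killing|exact: transvection_at|].
move=> a; apply: (etrans (transvection_d p sP v a)).
have alg (b : H) : - b = - 0 - b by vring R.
exact: alg.
Qed.

Definition curvature_field (u v : H) : vector_field M :=
  field_bracket (transvection s p u) (transvection s p v).

Lemma jet_curvature u v : jet (curvature_field u v) (fun a => - curvature g p u v a) 0.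
Proof.
have := jet_bracket (jet_transvection u) (jet_transvection v).
have -> : (fun a : H => (0 : H -> H) ((0 : H -> H) a) - (0 : H -> H) ((0 : H -> H) a) - curvature g p u v a)
   = (fun a => - curvature g p u v a).
  by apply/funext => a; have alg (b : H) : 0 - 0 - b = - b by vring R; exact: alg.
by have -> : (0 : H -> H) v - (0 : H -> H) u = 0 :> H by exact: subrr.
Qed.

(** [R(u, v)] is, up to sign, the operator part of the jet of a bracket of transvections, and such
    operators are linear. *)
Lemma curvature_lin3 u v t a b :
  curvature g p u v (t *: a + b) = t *: curvature g p u v a + curvature g p u v b.
Proof.
have alg (x y z : H) : - x = t *: (- y) + (- z) -> x = t *: y + z.
  by move=> e; rewrite -[x]opprK e; vring R.
exact: (alg _ _ _ (jet_linear t a b (jet_curvature u v))).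
Qed.

(** The bracket of two transvections vanishes at [p] and has differential [R(u, v)] there, so that
    its Killing equation at [p] is the skewness of [R(u, v)]. *)
Lemma curvature_skew u v w z : g p (curvature g p u v w) z = - g p w (curvature g p u v z).
Proof.
have [[_ kk] e d] := jet_curvature u v; have := kk p x0 w z cx0.
have fx : field_in_chart (curvature_field u v) p x0 = 0 by rewrite -e; exact: field_self.
have dd a : 'd (field_in_chart (curvature_field u v) p) x0 a = curvature g p u v a.
  have alg (x y b : H) : x = - - y - b -> b = 0 -> x = y by move=> -> ->; vring R.
  exact: (alg _ _ _ (d a) (chris0r mp _ cx0)).
rewrite fx !dd /metric_d => h.
have h2 : 0 + form p x0 (curvature g p u v w) z + form p x0 w (curvature g p u v z) = 0.
  by rewrite -{}[RHS]h; congr (_ + _ + _); rewrite d0.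
move: h2; rewrite add0r => /eqP; rewrite addr_eq0 => /eqP h2.
by rewrite -!form_self.
Qed.

Lemma curvature_pair u v w z : g p (curvature g p u v w) z = g p (curvature g p w z u) v.
Proof.
have fg := metric_psd g p.
pose r a b c d := g p (curvature g p a b c) d.
have an a b c d : r a b c d = - r b a c d by exact: (etrans (congr1 (fun z => g p z d) (curvature_anti a b c)) (psdNl fg _ _)).
have sk a b c d : r a b c d = - r a b d c by exact: (etrans (curvature_skew a b c d) (congr1 -%R (psdC fg _ _))).
have bi a b c d : r a b c d + r b c a d + r c a b d = 0.
  apply: (etrans (congr1 (fun t => t + r c a b d) (esym (psdDl fg _ _ _)))).
  apply: (etrans (esym (psdDl fg _ _ _))).
  exact: (etrans (congr1 (fun z => g p z d) (curvature_bianchi a b c)) (psd0l fg _)).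
suff : r u v w z = r w z u v by [].
have e1 := sk v w z u; have e2 := sk w z v u; have e3 := an z v w u; have e4 := sk v z w u.
have e5 := sk z u w v; have e6 := an u w z v; have e7 := sk w u z v; have e8 := sk u v z w.
have b1 := bi u v w z; have b2 := bi v w z u; have b3 := bi w z u v; have b4 := bi z u v w.
move: e1 e2 e3 e4 e5 e6 e7 e8 b1 b2 b3 b4.
move: (r u v w z) (r w z u v) (r v w z u) (r v w u z) (r w z v u) (r z v w u) (r v z w u) (r v z u w).
move: (r z u w v) (r z u v w) (r u w z v) (r w u z v) (r w u v z) (r u v z w) => *.
lra.
Qed.

(** Pair symmetry exchanges the first and the third argument, and linearity in the third is
    known. *)
Lemma curvature_lin1 t a b v w :
  curvature g p (t *: a + b) v w = t *: curvature g p a v w + curvature g p b v w.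
Proof.
have fg := metric_psd g p; apply: (lm_inj mp cx0) => z.
have e x y : form p x0 x y = g p x y by exact: form_self.
rewrite !e; apply: (etrans (curvature_pair _ _ _ _)).
apply: (etrans (congr1 (fun x => g p x v) (curvature_lin3 w z t a b))).
have alg (x y x' y' : R) : x = x' -> y = y' -> t * x + y = t * x' + y' by move=> -> ->.
have [L _ _] := fg; apply: (etrans (L t _ _ _)); apply: (etrans _ (esym (L t _ _ _))).
exact: (alg _ _ _ _ (esym (curvature_pair a v w z)) (esym (curvature_pair b v w z))).
Qed.

(** The Jacobi identity of vector fields for the bracket of the transvections of [u] and [v] and the
    transvections of [w] and [z], read on the operator parts of jets at [p]. *)
Lemma curvature_deriv u v w z x :
  curvature g p u v (curvature g p w z x) - curvature g p w z (curvature g p u v x) =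
  curvature g p (curvature g p u v w) z x + curvature g p w (curvature g p u v z) x.
Proof.
have jh := jet_curvature u v; have jw := jet_transvection w; have jz := jet_transvection z.
have J1 := jet_bracket jh (jet_curvature w z).
have J2a := jet_bracket jz jh; have J2 := jet_bracket jw J2a.
have J3a := jet_bracket jh jw; have J3 := jet_bracket jz J3a.
(* A jet of the zero field, against which the jet of the Jacobi sum is compared. *)
have Z := jet_lin (-1) jh jh.
have S := jet_lin 1 (jet_lin 1 J1 J2) J3.
have [kh _ _] := jh; have [kw _ _] := jw; have [kz _ _] := jz.
have e0 : -1 *: curvature_field u v + curvature_field u v = 0 by rewrite scaleN1r addNr.
have eS : 1 *: (1 *: field_bracket (curvature_field u v) (curvature_field w z) +
    field_bracket (transvection s p w) (field_bracket (transvection s p z) (curvature_field u v))) +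
    field_bracket (transvection s p z) (field_bracket (curvature_field u v) (transvection s p w)) = 0.
  by rewrite !scale1r; exact: field_jacobi.
rewrite e0 in Z; rewrite eS in S.
have [_ eA] := jet_inj S Z; have {eA} := congr1 (fun l : H -> H => l x) eA.
have n3 a b c : curvature g p a b (- c) = - curvature g p a b c.
  by have := jet_neg c (jet_curvature a b) => /oppr_inj.
have n1 a b c : curvature g p (- a) b c = - curvature g p a b c.
  have := curvature_lin1 (-1) a 0 b c; rewrite curvature0l !addr0.
  by rewrite !scaleN1r.
have n2 a b c : curvature g p a (- b) c = - curvature g p a b c.
  by rewrite curvature_anti n1 opprK curvature_anti.
have z2 := jet_zero J2a; have z3 := jet_zero J3a.
have alg (a1 a2 b2 b3 q1 q2 r1 r2 r3 r4 h c : H) :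
  1 *: (1 *: (a1 - a2 - c) + (0 - b2 - r1)) + (0 - b3 - r2) = -1 *: h + h ->
  a1 = q1 -> a2 = q2 -> c = 0 -> b2 = 0 -> b3 = 0 -> r1 = r3 -> r2 = r4 -> q1 - q2 = r4 + r3.
  move=> + e1 e2 e3 e4 e5 e6 e7; rewrite e1 e2 e3 e4 e5 e6 e7 !scale1r scaleN1r addNr => e.
  apply/eqP; rewrite -subr_eq0; apply/eqP; rewrite -e; vring R.
move/alg; apply.
- exact: (etrans (congr1 -%R (n3 _ _ _)) (opprK _)).
- exact: (etrans (congr1 -%R (n3 _ _ _)) (opprK _)).
- exact: curvature0l.
- exact: z2.
- exact: z3.
- by apply: (congr1 (fun b => curvature g p w b x)); rewrite sub0r opprK.
- apply: (etrans (congr1 (fun b => curvature g p z b x) (subr0 _))).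
  by apply: (etrans (n2 _ _ _)); rewrite curvature_anti opprK.
Qed.

(** The components of the curvature are continuous in the vectors by smoothness of the Christoffel
    symbols. Together with homogeneity, this supplies the bound on sectional curvature, for which
    infinite dimension gives no compact unit sphere. *)
Lemma curvature_continuous : exists2 d : R, 0 < d & forall u v : H, `|u| < d -> `|v| < d ->
  `|curvature g p u v u| <= 1.
Proof.
pose chr3 (z : H * (H * H)) := chris (form p) z.1 z.2.1 z.2.2.
have oc : open (codomain p) := @open_codomain _ _ _ p.
have oT : open [set: H * H] by exact: openT.
have cx : class_C 0 setT (fun _ : H * H => x0) by exact: class_C_cst.
have c1 : class_C 0 setT (fst : H * H -> H) by exact: class_C_fst.
have c2 : class_C 0 setT (snd : H * H -> H) by exact: class_C_snd.
have cG (f h : H * H -> H) : class_C 0 setT f -> class_C 0 setT h ->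
  class_C 0 setT (fun q => Gam (f q) (h q)).
  move=> cf ch; have cL : class_C 0 setT (fun q : H * H => (x0, (f q, h q))).
    by do 2 apply: class_C_pair => //.
  have := @class_C_comp _ 0 _ _ _ _ _ _ _ oT (fun y _ => conj cx0 I) cL (chris_smooth mp 0%N).
  exact: class_C_ext.
have [_ cd] := class_CS (chris_smooth mp 1%N).
have cD (f h k : H * H -> H) : class_C 0 setT f -> class_C 0 setT h -> class_C 0 setT k ->
  class_C 0 setT (fun q => 'd (fun y => chris (form p) y (f q) (h q)) x0 (k q)).
  move=> cf ch ck.
  have cL : class_C 0 setT (fun q : H * H => ((x0, (f q, h q)), (k q, ((0 : H), (0 : H))))).
    do 2 apply: class_C_pair => //; first by apply: class_C_pair.
    by apply: class_C_cst.
  have := @class_C_comp _ 0 _ _ _ _ _ _ _ oT (fun y _ => conj (conj cx0 I) I) cL cd.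
  apply: class_C_ext => // q _ /=.
  rewrite (chris_diffE mp _ _ _ _ _ cx0) (chris0l mp _ cx0) (chris0r mp _ cx0) !addr0.
  by [].
pose F (q : H * H) := 'd (fun y => chris (form p) y q.2 q.1) x0 q.1 - 'd (fun y => chris (form p) y q.1 q.1) x0 q.2
  + Gam q.1 (Gam q.2 q.1) - Gam q.2 (Gam q.1 q.1).
have cF : class_C 0 setT F.
  apply: class_C_sub_ => //; last by apply: (cG) => //; exact: cG.
  apply: class_C_add => //; last by apply: (cG) => //; exact: cG.
  by apply: class_C_sub_ => //; exact: cD.
have F0 : F (0, 0) = 0 by exact: (etrans (esym (curvature_chris 0 0 0)) (curvature0l _ _)).
have := cF (0, 0) I; move/cvgrPdist_lt => /(_ 1 ltr01) /nbhs_ballP[d /= d0' dP].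
exists d => // u v ud vd.
have := dP (u, v); rewrite F0 sub0r normrN => h.
have e : curvature g p u v u = F (u, v) by exact: curvature_chris.
rewrite e; apply: ltW; apply: h; split; rewrite -ball_normE /= sub0r normrN; assumption.
Qed.
End Symmetric.
End Jets.

(** * Embedding the generated algebra into the Killing fields *)

Section KillingModel.
Variables (R : realType) (H : hilbertSpace R) (M : manifold H) (g : metric M) (p : M).
Hypothesis gS : symmetric_space g.

(** Both vectors are rescaled to length [e < d], where the curvature term is at most 1; it is
    quadratic in [u] and linear in [v], hence the constant [e^-3]. *)
Lemma curvature_sect_le : exists2 K : R, 0 <= K & forall u v : H,
  `|curvature g p u v u| <= K * (`|u| ^+ 2 * `|v|).
Proof.
have [d d0 dP] := curvature_continuous g p.
pose e := d / 2; have e0 : 0 < e by rewrite divr_gt0.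
exists ((e ^+ 3)^-1) => [|u v]; first by rewrite invr_ge0 exprn_ge0 ?ltW.
have ge0 : 0 <= (e ^+ 3)^-1 * (`|u| ^+ 2 * `|v|).
  by rewrite mulr_ge0 ?mulr_ge0 ?sqr_ge0 ?invr_ge0 ?exprn_ge0 ?(ltW e0).
have [u0|u0] := eqVneq u 0; first by rewrite {1}u0 curvature0l normr0.
have [v0|v0] := eqVneq v 0; first by rewrite {1}v0 curvature0r normr0.
have nu : 0 < `|u| by rewrite normr_gt0.
have nv : 0 < `|v| by rewrite normr_gt0.
have c1 t a b c : curvature g p (t *: a) b c = t *: curvature g p a b c.
  have := curvature_lin1 p gS t a 0 b c; rewrite curvature0l !addr0; exact.
have c2 t a b c : curvature g p a (t *: b) c = t *: curvature g p a b c.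
  by rewrite curvature_anti c1 -scalerN -curvature_anti.
have c3 t a b c : curvature g p a b (t *: c) = t *: curvature g p a b c.
  have := curvature_lin3 p gS a b t c 0; rewrite !addr0.
  have := curvature_lin3 p gS a b 1 0 0; rewrite scaler0 !addr0 scale1r -{1}[curvature g p a b 0]addr0.
  by move=> /addrI <-; rewrite addr0.
pose a := e / `|u|; pose b := e / `|v|.
have a0 : 0 < a by rewrite divr_gt0.
have b0 : 0 < b by rewrite divr_gt0.
have small (w : H) t : 0 < `|w| -> t = e / `|w| -> `|t *: w| < d.
  move=> w0 ->; rewrite normrZ gtr0_norm ?divr_gt0// mulfVK ?gt_eqF//.
  by rewrite /e ltr_pdivrMr// ltr_pMr// ltr1n.
have := dP (a *: u) (b *: v) (small u a nu (erefl _)) (small v b nv (erefl _)).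
have ab : 0 < a * b * a := mulr_gt0 (mulr_gt0 a0 b0) a0.
have -> : curvature g p (a *: u) (b *: v) (a *: u) = (a * b * a) *: curvature g p u v u.
  by rewrite c1 c2 c3 !scalerA.
rewrite normrZ gtr0_norm// => h; set r := `|_| in h *.
have h2 : r <= (a * b * a)^-1 by rewrite -[leRHS]mul1r ler_pdivlMr// mulrC.
apply: le_trans h2 _; apply: le_of_eq; rewrite /a /b.
by field; rewrite !gt_eqF.
Qed.

Lemma curvature_bound (sg : R) : sg * sg = 1 -> exists2 K : R, 0 < K & forall u v : H,
  sg * g p (curvature g p u v u) v <= K * (g p u u * g p v v).
Proof.
move=> sg2; have [K0 K00 KP] := curvature_sect_le; have fg := metric_psd g p.
have [c [C [c0 cC]]] := metric_strong g p.
pose Q := `|C| * K0 ^+ 2 / c ^+ 3.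
have Q0 : 0 <= Q by rewrite !mulr_ge0 ?sqr_ge0 ?invr_ge0 ?exprn_ge0 ?(ltW c0).
(* Squaring, the Cauchy-Schwarz inequality for [g] and the equivalence of norms give the bound
   [Q m^2]; as [Q <= (Q + 1)^2], the constant [Q + 1] does without a root. *)
exists (Q + 1) => [|u v]; first by rewrite ltr_wpDl.
set r := curvature g p u v u; set m := g p u u * g p v v.
have m0 : 0 <= m by rewrite mulr_ge0 ?(psd_ge0 fg).
have Qm : 0 <= (Q + 1) * m := mulr_ge0 (addr_ge0 Q0 ler01) m0.
apply: le_trans (ler_norm _) _; rewrite -(@ler_pXn2r _ 2) ?nnegrE//.
rewrite real_normK ?num_real// [X in X <= _]exprMn expr2 sg2 mul1r.
apply: le_trans (psd_cauchy fg r v) _.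
have /andP[cv _] := cC v.
have /andP[_ Cr] := cC r; have := KP u v; rewrite -/r => rK.
have rr1 : g p r r <= `|C| * (K0 * (`|u| ^+ 2 * `|v|)) ^+ 2.
  apply: le_trans Cr _; apply: (@le_trans _ _ (`|C| * `|r| ^+ 2)); first by rewrite ler_wpM2r ?sqr_ge0// ler_norm.
  by rewrite ler_wpM2l// lerXn2r ?nnegrE ?mulr_ge0 ?sqr_ge0.
have uu : `|u| ^+ 2 <= g p u u / c by rewrite ler_pdivlMr// mulrC; have /andP[] := cC u.
have vv : `|v| ^+ 2 <= g p v v / c by rewrite ler_pdivlMr// mulrC.
have gv0 : 0 <= g p v v by exact: (psd_ge0 fg).
apply: (@le_trans _ _ (Q * m ^+ 2)).
  apply: (@le_trans _ _ (`|C| * K0 ^+ 2 * ((g p u u / c) ^+ 2 * (g p v v / c)) * g p v v)); last first.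
    by apply: le_of_eq; rewrite /Q /m; field; rewrite gt_eqF.
  have key (k x y : R) : (k * (x ^+ 2 * y)) ^+ 2 = k ^+ 2 * ((x ^+ 2) ^+ 2 * y ^+ 2) by ring.
  have uc0 : 0 <= g p u u / c := le_trans (sqr_ge0 _) uu.
  have h4 : (`|u| ^+ 2) ^+ 2 <= (g p u u / c) ^+ 2 by rewrite lerXn2r ?nnegrE ?sqr_ge0.
  have h := ler_pM (sqr_ge0 _) (sqr_ge0 _) h4 vv.
  apply: (ler_wpM2r gv0); apply: (le_trans rr1); rewrite key -[leRHS]mulrA.
  exact: (ler_wpM2l (normr_ge0 C) (ler_wpM2l (sqr_ge0 K0) h)).
rewrite [leRHS]exprMn; apply: (ler_wpM2r (sqr_ge0 m)); rewrite sqrrD1.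
have := sqr_ge0 Q; lra.
Qed.

Section Model.
Variables (sg : R) (sg2 : sg * sg = 1) (sgP : forall U : seq (H * H),
    0 <= sg * \sum_(a <- U) \sum_(c <- U) g p (curvature g p a.1 a.2 c.1) c.2).

Definition curvature_data : curv_data R := @CurvData R H (fun u v => g p u v) (curvature g p) sg
  (metric_psd g p) (metric_strong g p) sg2 (curvature_lin1 p gS) (curvature_lin3 p gS)
  (@curvature_anti R H M g p) (curvature_skew p gS) (@curvature_bianchi R H M g p)
  (curvature_deriv p gS) (curvature_bound sg2) sgP.
Let D := curvature_data.

Lemma jet_ext Y A B v w : jet g p Y A v -> (forall a, A a = B a) -> v = w -> jet g p Y B w.
Proof. by move=> jY /funext <- <-. Qed.

Lemma jet_rr (U : seq (D * D)) : exists Y, jet g p Y (rr U) 0.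
Proof.
elim: U => [|a U [Y jY]].
  exists (-1 *: curvature_field p gS 0 0 + curvature_field p gS 0 0).
  apply: (jet_ext (jet_lin (-1) (jet_curvature p gS 0 0) (jet_curvature p gS 0 0))).
    move=> x; have alg (b c : H) : c = 0 -> -1 *: b + b = c by move=> ->; rewrite scaleN1r addNr.
    by apply: alg; rewrite /rr big_nil.
  by rewrite scaler0 addr0.
exists (-1 *: curvature_field p gS a.1 a.2 + Y).
apply: (jet_ext (jet_lin (-1) (jet_curvature p gS a.1 a.2) jY)).
  move=> x; have alg (b c d : H) : d = b + c -> -1 *: (- b) + c = d by move=> ->; rewrite scaleN1r opprK.
  by apply: alg; rewrite /rr big_cons.
by rewrite scaler0 addr0.
Qed.

(** [jet_eq] shows that at most one field has the prescribed jet. Existence is established on the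
    subalgebra generated by [p]; the default value 0 concerns jets without a field. *)
Definition killing_of (z : LS D) : vector_field M :=
  xget 0 [set Y : vector_field M | jet g p Y (L1 z) (L2 z)].

Lemma killing_of_jet (z : LS D) : lie_generated (@pp R D) z -> jet g p (killing_of z) (L1 z) (L2 z).
Proof.
move=> /L_generated_rr[U zU]; apply: (@xgetPex _ 0 [set Y : vector_field M | jet g p Y (L1 z) (L2 z)]).
have [Y jY] := jet_rr U.
exists (1 *: Y + transvection (projT1 (cid (symmetry_choice gS))) p (L2 z)).
apply: (jet_ext (jet_lin 1 jY (jet_transvection p gS (L2 z)))).
  move=> a; have alg (b c : H) : c = b -> 1 *: b + 0 = c by move=> ->; rewrite scale1r addr0.
  exact: alg (congr1 (fun f => f a) zU).
by rewrite scaler0 add0r.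
Qed.

Lemma lie_generated_subalgebra (L : LstarAlgebra R) (S : set L) : lie_subalgebra (lie_generated S).
Proof.
split; first split.
- by move=> A [[A0 _] _] _.
- by move=> a x y hx hy A sA SA; have [[_ h] _] := sA; apply: h; [exact: hx|exact: hy].
by move=> x y hx hy A sA SA; have [_ h] := sA; apply: h; [exact: hx|exact: hy].
Qed.

(** In each identity the two sides have the same jet, because combinations and brackets of jets
    follow the operations of the model; uniqueness concludes. Injectivity holds because a field
    determines its jet. *)
Lemma killing_of_morphism : isomorphic_to_killing_subalgebra g (lie_generated (@pp R D)).
Proof.
have [[_ Slin] Sbr] := lie_generated_subalgebra (@pp R D).
exists killing_of; split.
- move=> a x y hx hy.
  apply: (jet_eq (killing_of_jet (Slin a _ _ hx hy)) (jet_lin a (killing_of_jet hx) (killing_of_jet hy))) => //.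
- move=> x y hx hy.
  apply: (jet_eq (killing_of_jet (Sbr _ _ hx hy)) (jet_bracket (killing_of_jet hx) (killing_of_jet hy))) => //.
  by move=> a; exact: (L1_br x y a).
- move=> x y hx hy e; have jx := killing_of_jet hx; rewrite e in jx.
  by have [e2 e1] := jet_inj jx (killing_of_jet hy); exact: L_ext.
- by move=> x hx; have [kx _ _] := killing_of_jet hx; exact: inf_killing_field.
Qed.

Lemma pp_isometric : isometric_to_tangent g p (@pp R D).
Proof.
exists (@L2 R D); split=> //.
  by move=> x y hx hy; exact: esym (L_ip y hx).
by apply/seteqP; split=> // v _; exists (Lmk (D := D) 0 v).
Qed.
End Model.
End KillingModel.

Theorem theorem1p2 (R : realType) (H : hilbertSpace R) (M : manifold H)
    (g : metric M) (p : M) :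
  simply_connected R M ->
  symmetric_space g ->
  fixed_sign_curvature_operator g p ->
  exists (L : LstarAlgebra R) (kk pp : set L),
    [/\ orthogonal_decomposition kk pp,
        Lstar_subalgebra kk,
        isometric_to_tangent g p pp,
        dense (lie_generated pp) &
        isomorphic_to_killing_subalgebra g (lie_generated pp)].
Proof.
move=> _ gS /fixed_sign_curvature[sg sg2 sgP].
pose D := curvature_data gS sg2 sgP.
exists (LS D), (@kk R D), (@pp R D); split.
- exact: L_orthogonal.
- exact: L_subalgebra.
- exact: pp_isometric.
- exact: L_dense.
- exact: killing_of_morphism.
Qed.
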